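(* Let $J\in(0,2)$, $\delta=1-\frac J2$ and $\rho_\Pi=e^{-2J}$. There exists $C_J>0$, depending only on $J$, such that for all $N\ge1$, all solutions $(m^N_t)_{t\ge0}$ and $(m_t)_{t\ge0}$ of the $N$-particle and mean-field Fokker–Planck equations of the mean-field XY model with coupling $J$, all $\varepsilon\in(0,1)$ and all $t\ge0$, $$H(m^N_t|m_t^{\otimes N})\le C_J\,e^{-2(1-\varepsilon)\delta\rho_\Pi t}\,H(m^N_0|m_0^{\otimes N})+\frac{C_J}{(1-\varepsilon)\varepsilon}.$$
   Context: Mean-field XY model: state space $\mathbb T=\mathbb R/2\pi\mathbb Z$, no confinement, interaction $W(\theta,\theta')=-J\cos(\theta-\theta')$. The $N$-particle law $m^N_t$ (probability measure on $\mathbb T^N$) solves $\partial_tm^N_t=\sum_{i=1}^N\partial_{\theta^i}^2m^N_t+\partial_{\theta^i}\Bigl(\frac JN\sum_{j=1}^N\sin(\theta^i-\theta^j)\,m^N_t\Bigr),$ and the mean-field law $m_t$ (probability measure on $\mathbb T$) solves $\partial_tm_t=\partial_\theta^2m_t+\partial_\theta\Bigl(J\int_{\mathbb T}\sin(\theta-\theta')\,m_t(d\theta')\,m_t\Bigr).$ $H(\nu|m)=\int\log\frac{d\nu}{dm}\,d\nu$ is the relative entropy ($+\infty$ if $\nu\not\ll m$). *)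

(* Defs.v *)
From HB Require Import structures.
From mathcomp Require Import all_boot all_order all_algebra generic_quotient.
From mathcomp Require Import all_classical all_reals all_analysis.

Set Implicit Arguments.
Unset Strict Implicit.
Unset Printing Implicit Defensive.

Import Order.TTheory GRing.Theory Num.Theory.
Import numFieldNormedType.Exports.

Local Open Scope classical_set_scope.
Local Open Scope ring_scope.
Local Open Scope quotient_scope.

Section circle.
Variable R : realType.

Definition eq_mod2pi (x y : R) : bool :=
  `[< exists k : int, x - y = k%:~R * (2 * pi) >].

Lemma eq_mod2pi_refl : reflexive eq_mod2pi.
Proof. by move=> x; apply/asboolP; exists 0; rewrite subrr mul0r. Qed.

Lemma eq_mod2pi_sym : symmetric eq_mod2pi.
Proof.
by move=> x y; apply/asboolP/asboolP => -[k xy]; exists (- k);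
  rewrite -opprB xy mulrNz mulNr.
Qed.

Lemma eq_mod2pi_trans : transitive eq_mod2pi.
Proof.
move=> y x z /asboolP[k xy] /asboolP[l yz]; apply/asboolP; exists (k + l).
by rewrite mulrzDr mulrDl -xy -yz addrA subrK.
Qed.

Definition eq_mod2pi_rel :=
  EquivRel eq_mod2pi eq_mod2pi_refl eq_mod2pi_sym eq_mod2pi_trans.

Definition circle : Type := {eq_quot eq_mod2pi_rel}.

HB.instance Definition _ := Quotient.on circle.
HB.instance Definition _ :=
  Topological.copy circle (quotient_topology {eq_quot eq_mod2pi_rel}).
HB.instance Definition _ :=
  Pointed.copy circle (quotient_topology {eq_quot eq_mod2pi_rel}).

HB.instance Definition _ :=
  Measurable.copy circle (g_sigma_algebraType (@open circle)).

End circle.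

Section product.
Context d (T : measurableType d) (R : realType).

Definition cons_pair n (x : T * n.-tuple T) : n.+1.-tuple T :=
  [tuple of x.1 :: x.2].

Lemma measurable_cons_pair n :
  measurable_fun [set: T * n.-tuple T] (@cons_pair n).
Proof. exact: measurable_cons. Qed.

HB.instance Definition _ n :=
  isMeasurableFun.Build _ _ _ _ (@cons_pair n) (@measurable_cons_pair n).

Fixpoint tensor_power (P : probability T R) n : probability (n.-tuple T) R :=
  if n is n'.+1 then
    distribution (P \x tensor_power P n')%E (@cons_pair n')
  else dirac [tuple].

End product.

Section relative_entropy.
Context d (T : measurableType d) (R : realType).
Implicit Types nu mu : probability T R.
Local Open Scope charge_scope.

(* [lne] is -oo where the density vanishes, which is a [nu]-null set. *)
Definition relative_entropy nu mu : \bar R :=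
  if `[< nu `<< mu >] then
    (\int[nu]_x lne (('d (charge_of_finite_measure nu) '/d mu) x))%E
  else +oo%E.

End relative_entropy.

Section smooth.
Variable R : realType.

Definition partial N (i : 'I_N) (f : 'rV[R]_N -> R) : 'rV[R]_N -> R :=
  'D_(delta_mx 0 i) f.

Definition iter_partial N (s : seq 'I_N) (f : 'rV[R]_N -> R) :
  'rV[R]_N -> R := foldr (@partial N) f s.

Definition smooth N (f : 'rV[R]_N -> R) : Prop :=
  forall s : seq 'I_N, continuous (iter_partial s f) /\
    forall i x, derivable (iter_partial s f) x (delta_mx 0 i).

Definition smooth1 (f : R -> R) : Prop :=
  forall n x, derivable (derive1n n f) x 1.

End smooth.

(* Functions on the circle or the torus are differentiated through their
   2pi-periodic lifts to R or R^N; a lift, its derivatives and the sines below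
   are periodic, so their values at representatives do not depend on the
   choice made by [repr]. *)
Section lifts.
Variable R : realType.

Definition lift1 (phi : circle R -> R) : R -> R :=
  fun x => phi (\pi_(circle R) x).

Definition liftN N (phi : N.-tuple (circle R) -> R) : 'rV[R]_N -> R :=
  fun x => phi [tuple \pi_(circle R) (x 0 i) | i < N].

Definition repr_row N (theta : N.-tuple (circle R)) : 'rV[R]_N :=
  \row_i repr (tnth theta i).

Definition sin_diff (theta theta' : circle R) : R :=
  sin (repr theta - repr theta').

End lifts.

Section Fokker_Planck.
Variables (R : realType) (J : R).

(* The formal adjoints of the right-hand sides of
     d_t m = sum_i d_i^2 m + d_i ((J / N) sum_j sin (theta^i - theta^j) m) and
     d_t m = d^2 m + d (J (int sin (theta - theta') m(d theta')) m). *)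
Definition particle_generator N (phi : N.-tuple (circle R) -> R)
    (theta : N.-tuple (circle R)) : R :=
  \sum_(i < N)
    (partial i (partial i (liftN phi)) (repr_row theta)
     - J / N%:R * (\sum_(j < N) sin_diff (tnth theta i) (tnth theta j))
       * partial i (liftN phi) (repr_row theta)).

Definition mean_field_generator (m : probability (circle R) R)
    (phi : circle R -> R) (theta : circle R) : R :=
  derive1n 2 (lift1 phi) (repr theta)
  - J * (\int[m]_theta' sin_diff theta theta')
    * derive1 (lift1 phi) (repr theta).

(* Weak solutions: weakly continuous curves of probability measures on
   [0, +oo) which satisfy the equation when tested against smooth functions.
   The values at negative times are irrelevant. *)
Definition particle_Fokker_Planck N
    (m : R -> probability (N.-tuple (circle R)) R) : Prop :=
  forall phi, smooth (liftN phi) ->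
    {within `[0, +oo[, continuous (fun t => \int[m t]_theta phi theta)} /\
    forall t : R, 0 < t ->
      is_derive t 1 (fun s => \int[m s]_theta phi theta)
        (\int[m t]_theta particle_generator phi theta).

Definition mean_field_Fokker_Planck
    (m : R -> probability (circle R) R) : Prop :=
  forall phi, smooth1 (lift1 phi) ->
    {within `[0, +oo[, continuous (fun t => \int[m t]_theta phi theta)} /\
    forall t : R, 0 < t ->
      is_derive t 1 (fun s => \int[m s]_theta phi theta)
        (\int[m t]_theta mean_field_generator (m t) phi theta).

End Fokker_Planck.

(* Main.v *)
Require Import Defs.
From HB Require Import structures.
From mathcomp Require Import all_boot all_order all_algebra generic_quotient.
From mathcomp Require Import all_classical all_reals all_analysis.
From mathcomp Require Import measurable_realfun ring lra zify.

(* By the Donsker-Varadhan formula and a monotone class argument, the relative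
   entropy at time s1 is the supremum over trigonometric polynomials phi of
     int phi dm^N_s1 - log (int e^phi dmbar_s1),    mbar = m^{(x) N},
   so that no regularity of m^N is needed.  Let u solve the backward equation
   of the N-particle generator with final value phi and set v = alpha u with
   alpha(s) = e^{r (s1 - s)}.  Then
     int u dm^N_s - alpha^{-1} log (int e^v dmbar_s)
   is nearly nonincreasing, up to c, as soon as for nu = e^v mbar / Z
     r H(nu | mbar) <= int |grad v|^2 dnu + J int K . grad v dnu + c,
   where - J K is the difference of the two drifts.  In general this holds with
   r < 0, because K is of order N^{-1/2} and has Gaussian moments under mbar.
   When J < 2 the Lyapunov function sum_k |c_k|^2 / k of the Fourier modes of
   m_t decays at rate 2 - J, so that m_t is close to uniform after a time that
   depends on J only.  From then on an integration by parts turns the term in K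
   into J (N |w|^2 - 1) up to small errors, where w is the fluctuation of the
   order parameter; as the logarithmic Sobolev constant of the uniform measure
   and the sub-Gaussian constant of w are explicit, every r < 2 - J is
   admissible. *)

Set Implicit Arguments.
Unset Strict Implicit.
Unset Printing Implicit Defensive.

Import Order.TTheory GRing.Theory Num.Theory.
Import numFieldNormedType.Exports.

Local Open Scope classical_set_scope.
Local Open Scope ring_scope.
Local Open Scope quotient_scope.

(** * Calculus on the line *)

(** The target rate is [2 * delta * rho = (2 - J) * rho] with [rho = expR (- 2 * J) < 1], strictly
    below [2 - J]; this gap depends on J only and pays for every perturbation error, measured by
    [eta]. The number [2 - J] has two sources. The logarithmic Sobolev inequality of the uniform law
    yields a dissipation of twice the entropy H, and after the integration by parts the interaction
    costs J times the mean of N |w|^2 under nu. As [expR (a * cos x + b * sin x)] has uniform mean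
    at most [expR ((a ^+ 2 + b ^+ 2) / 4)], the exponential moments of lambda N |w|^2 are bounded in
    N for every lambda < 1, and the entropy inequality bounds the cost by J H up to small multiples
    of H and a constant. The main obstacle is that the equations may be tested against smooth
    functions only, while the particle law comes without a density. All test functions are therefore
    finite sums of waves, and both the backward solution and its exponential are replaced by
    truncations, whose error is sent to zero with N fixed. On the initial time interval the entropy
    may grow, but the length of this interval depends on J alone, so that the loss enters the
    constant. *)

Section drv.
Variable R : realType.
Implicit Types (f g : R -> R) (x a b c k : R).

Lemma drvD f g x a b : is_derive x 1 f a -> is_derive x 1 g b ->
  is_derive x 1 (fun y => f y + g y) (a + b).
Proof. by move=> df dg; exact: is_deriveD. Qed.

Lemma drvN f x a : is_derive x 1 f a -> is_derive x 1 (fun y => - f y) (- a).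
Proof. by move=> df; exact: is_deriveN. Qed.

Lemma drvB f g x a b : is_derive x 1 f a -> is_derive x 1 g b ->
  is_derive x 1 (fun y => f y - g y) (a - b).
Proof. by move=> df dg; exact: is_deriveB. Qed.

Lemma drvM f g x a b : is_derive x 1 f a -> is_derive x 1 g b ->
  is_derive x 1 (fun y => f y * g y) (a * g x + f x * b).
Proof.
move=> df dg; rewrite addrC [a * _]mulrC.
exact: (is_deriveM df dg).
Qed.

Lemma drv_cst c x : is_derive x 1 (fun=> c) 0.
Proof. exact: is_derive_cst. Qed.

Lemma drv_id x : is_derive x 1 (fun y => y) 1.
Proof. exact: is_derive_id. Qed.

Lemma drvZ c f x a : is_derive x 1 f a -> is_derive x 1 (fun y => c * f y) (c * a).
Proof.
move=> df; have := drvM (drv_cst c x) df; by rewrite mul0r add0r.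
Qed.

Lemma drvX n f x a : is_derive x 1 f a ->
  is_derive x 1 (fun y => f y ^+ n) (n%:R * f x ^+ n.-1 * a).
Proof.
move=> df; have := is_deriveX n df.
by have -> : f ^+ n = (fun y => f y ^+ n) by apply/funext => y; rewrite fctE.
Qed.

Lemma drv_comp (h g : R -> R) x a b : is_derive (g x) 1 h a -> is_derive x 1 g b ->
  is_derive x 1 (fun y => h (g y)) (a * b).
Proof. by move=> dh dg; exact: is_derive1_comp. Qed.

Lemma drv_exp f x a : is_derive x 1 f a ->
  is_derive x 1 (fun y => expR (f y)) (expR (f x) * a).
Proof. by move=> df; exact: drv_comp (is_derive_expR _) df. Qed.

Lemma drv_cos f x a : is_derive x 1 f a ->
  is_derive x 1 (fun y => cos (f y)) (- sin (f x) * a).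
Proof. by move=> df; exact: drv_comp (is_derive_cos _) df. Qed.

Lemma drv_sin f x a : is_derive x 1 f a ->
  is_derive x 1 (fun y => sin (f y)) (cos (f x) * a).
Proof. by move=> df; exact: drv_comp (is_derive_sin _) df. Qed.

Lemma drv_ln f x a : 0 < f x -> is_derive x 1 f a ->
  is_derive x 1 (fun y => ln (f y)) (a / f x).
Proof.
by move=> f0 df; rewrite mulrC; exact: drv_comp (is_derive1_ln f0) df.
Qed.

Lemma drv_inv f x a : f x != 0 -> is_derive x 1 f a ->
  is_derive x 1 (fun y => (f y)^-1) (- a / f x ^+ 2).
Proof.
move=> f0 df; have := is_deriveV f0 df.
by rewrite /GRing.scale/= mulNr [_ * a]mulrC mulNr.
Qed.

Lemma drv_sum (I : Type) (s : seq I) (F : I -> R -> R) (d : I -> R) x :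
  (forall i, is_derive x 1 (F i) (d i)) ->
  is_derive x 1 (fun y => \sum_(i <- s) F i y) (\sum_(i <- s) d i).
Proof.
move=> dF; elim: s => [|i s IH].
  have -> : (fun y => \sum_(i <- [::]) F i y) = (fun=> 0).
    by apply/funext => y; rewrite big_nil.
  by rewrite big_nil; exact: drv_cst.
have -> : (fun y => \sum_(j <- i :: s) F j y) = (fun y => F i y + \sum_(j <- s) F j y).
  by apply/funext => y; rewrite big_cons.
by rewrite big_cons; exact: drvD.
Qed.

Lemma drv_eq f x a b : is_derive x 1 f a -> a = b -> is_derive x 1 f b.
Proof. by move=> + <-. Qed.

Lemma drv_cos_affine k b x :
  is_derive x 1 (fun y => cos (k * y + b)) (k * cos (k * x + (b + pi / 2))).
Proof.
apply: (drv_eq (drv_cos (drvD (drvZ k (drv_id x)) (drv_cst b x)))).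
by rewrite addrA cosDpihalf; ring.
Qed.

Lemma drv_cont f x a : is_derive x 1 f a -> {for x, continuous f}.
Proof.
by move=> df; apply/differentiable_continuous/derivable1_diffP; exact: @ex_derive.
Qed.

End drv.

Lemma derive_nondecreasing (R : realType) (f df : R -> R) (a b : R) : a <= b ->
  (forall x, a < x < b -> is_derive x 1 f (df x)) ->
  {within `[a, b], continuous f} -> (forall x, a < x < b -> 0 <= df x) -> f a <= f b.
Proof.
rewrite le_eqVlt => /orP[/eqP->//|ab'] fdf cf df0.
have fdf' x : x \in `]a, b[ -> is_derive x 1 f (df x) by rewrite in_itv/=; exact: fdf.
have [c] := @MVT _ f df a b ab' fdf' cf.
rewrite in_itv/= => cab fE; rewrite -subr_ge0 fE mulr_ge0//; first exact: df0.
by rewrite subr_ge0 ltW.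
Qed.

Lemma is_derive_continuous (R : realType) (f df : R -> R) (a b : R) :
  (forall x : R, is_derive x 1 f (df x)) -> {within `[a, b], continuous f}.
Proof.
move=> fdf; apply: continuous_subspaceT => x.
by apply/differentiable_continuous/derivable1_diffP; exact: @ex_derive.
Qed.

Lemma derive_nondecreasingT (R : realType) (f df : R -> R) (a b : R) : a <= b ->
  (forall x : R, is_derive x 1 f (df x)) ->
  (forall x, a < x < b -> 0 <= df x) -> f a <= f b.
Proof.
move=> ab fdf; apply: derive_nondecreasing => //; exact: is_derive_continuous fdf.
Qed.

(** The derivative of [expR (- x) * (1 + x + x ^+ 2)] is [expR (- x) * (x * (1 - x))], so that on
    []-oo, 1]] this product is smallest at 0, where it equals 1. *)
Lemma expR_le_quadratic (R : realType) (y : R) : y <= 1 -> expR y <= 1 + y + y ^+ 2.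
Proof.
move=> y1; pose f (x : R) := expR (- x) * (1 + x + x ^+ 2).
pose df (x : R) := expR (- x) * (x * (1 - x)).
have fdf (x : R) : is_derive x 1 f (df x).
  apply: (drv_eq (drvM (drv_exp (drvN (drv_id x)))
    (drvD (drvD (drv_cst 1 x) (drv_id x)) (drvX 2 (drv_id x))))).
  by rewrite /df /= expr1; ring.
suff f1 : 1 <= f y.
  have := f1; rewrite /f expRN mulrC -ler_pdivrMr ?invr_gt0 ?expR_gt0// mul1r.
  by rewrite invrK.
have f0 : f 0 = 1 by rewrite /f oppr0 expR0 mul1r addr0 expr0n addr0.
rewrite -f0; have [y0|y0] := leP 0 y.
  apply: (derive_nondecreasingT y0 fdf) => x /andP[x0 xy].
  by rewrite mulr_ge0 ?expR_ge0// mulr_ge0//; lra.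
rewrite -lerN2; apply: (derive_nondecreasingT (f := fun x => - f x) (ltW y0) (fun x => is_deriveN (fdf x))).
move=> x /andP[x0 xy]; rewrite oppr_ge0 pmulr_rle0 ?expR_gt0//.
by rewrite nmulr_rle0//; lra.
Qed.

(** For a centred variable the term [y] disappears under expectation, which leaves a sub-Gaussian
    bound. *)
Lemma expR_le_sqr (R : realType) (y : R) : expR y <= y + expR (y ^+ 2).
Proof.
have h := expR_ge1Dx (y ^+ 2).
have [y1|y1] := leP y 1.
  by have := expR_le_quadratic y1; lra.
have : expR y <= expR (y ^+ 2) by rewrite ler_expR expr2 ler_peMl//; lra.
lra.
Qed.

(** * Expectations of bounded measurable functions *)

Section bm.
Context d (T : measurableType d) (R : realType).
Implicit Types f g : T -> R.

(** Apart from the densities in the Donsker-Varadhan formula, expectations are taken in this class,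
    where integrability is automatic and which is stable under the operations of the proof. *)
Definition bm f := measurable_fun [set: T] f /\ exists M, forall x, `|f x| <= M.

Lemma bm_cst c : bm (fun=> c).
Proof. by split; [exact: measurable_cst|exists `|c|]. Qed.

Lemma bmD f g : bm f -> bm g -> bm (fun x => f x + g x).
Proof.
move=> [mf [M fM]] [mg [K gK]]; split; first exact: measurable_funD.
by exists (M + K) => x; rewrite (le_trans (ler_normD _ _))// lerD.
Qed.

Lemma bmM f g : bm f -> bm g -> bm (fun x => f x * g x).
Proof.
move=> [mf [M fM]] [mg [K gK]]; split; first exact: measurable_funM.
by exists (M * K) => x; rewrite normrM ler_pM.
Qed.

Lemma bmZ c f : bm f -> bm (fun x => c * f x).
Proof. by move=> bf; apply: bmM => //; exact: bm_cst. Qed.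

Lemma bmN f : bm f -> bm (fun x => - f x).
Proof. move=> bf; have -> : (fun x => - f x) = (fun x => -1 * f x); last exact: bmZ.
by apply/funext => x; rewrite mulN1r. Qed.

Lemma bmB f g : bm f -> bm g -> bm (fun x => f x - g x).
Proof. by move=> bf bg; apply: bmD => //; exact: bmN. Qed.

Lemma bm_sum (I : Type) (s : seq I) (P : pred I) (F : I -> T -> R) :
  (forall i, bm (F i)) -> bm (fun x => \sum_(i <- s | P i) F i x).
Proof.
move=> bF; elim: s => [|i s IH].
  by under eq_fun do rewrite big_nil; exact: bm_cst.
under eq_fun do rewrite big_cons.
by case: (P i) => //; exact: bmD.
Qed.

Lemma bmX n f : bm f -> bm (fun x => f x ^+ n).
Proof.
move=> bf; elim: n => [|n IH]; first exact: bm_cst.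
by under eq_fun do rewrite exprS; exact: bmM.
Qed.

Lemma bm_exp f : bm f -> bm (fun x => expR (f x)).
Proof.
move=> [mf [M fM]]; split; first exact: measurableT_comp.
exists (expR M) => x; rewrite ger0_norm ?expR_ge0// ler_expR.
exact: le_trans (ler_norm _) (fM x).
Qed.

Lemma bm_inv f c : 0 < c -> (forall x, c <= f x) -> bm f -> bm (fun x => (f x)^-1).
Proof.
move=> c0 cf [mf [M fM]]; split.
  have -> : (fun x => (f x)^-1) = (fun x => expR (- ln (f x))).
    by apply/funext => x; rewrite expRN lnK// posrE (lt_le_trans c0).
  apply: measurableT_comp => //; apply: measurable_funN.
  by apply: (measurableT_comp (@measurable_ln R)).
exists c^-1 => x; have fx0 : 0 < f x by rewrite (lt_le_trans c0).
rewrite ger0_norm; last by rewrite invr_ge0 ltW.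
by rewrite lef_pV2 ?posrE.
Qed.

Lemma bm_ln f c : 0 < c -> (forall x, c <= f x) -> bm f -> bm (fun x => ln (f x)).
Proof.
move=> c0 cf [mf [M fM]]; split; first by apply: (measurableT_comp (@measurable_ln R)).
exists (`|ln c| + `|ln M|) => x; have fx0 : 0 < f x by rewrite (lt_le_trans c0).
have l1 : ln c <= ln (f x) by rewrite ler_ln ?posrE.
have fM' : f x <= M by rewrite (le_trans (ler_norm _)).
have l2 : ln (f x) <= ln M by rewrite ler_ln ?posrE// (lt_le_trans fx0).
have := ler_norm (ln M); have := lerNnormlW (lexx `|ln c|).
have := normr_ge0 (ln c); have := normr_ge0 (ln M).
by move=> *; rewrite ler_norml; lra.
Qed.

Lemma bm_lim (F : nat -> T -> R) f M : (forall n, measurable_fun setT (F n)) ->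
  (forall n x, `|F n x| <= M) -> (forall x, F n x @[n --> \oo] --> f x) -> bm f.
Proof.
move=> mF FM cF; split.
  by apply: (measurable_fun_cvg (h := F)) => // x _; exact: cF.
exists M => x; have /cvg_norm cx := cF x.
rewrite -(cvg_lim _ cx)//; apply: limr_le; first by apply/cvg_ex; exists `|f x|.
by apply: nearW => n; exact: FM.
Qed.

End bm.

Section esp.
Context d (T : measurableType d) (R : realType) (P : probability T R).
Implicit Types f g : T -> R.

Definition esp f := \int[P]_x f x.

Lemma bm_int f : bm f -> P.-integrable setT (EFin \o f).
Proof.
move=> [mf [M fM]]; apply: measurable_bounded_integrable => //.
  by rewrite (le_lt_trans (@probability_le1 _ _ _ P setT measurableT))// ltry.
exists M; split; first exact: num_real.
by move=> y My x _ /=; rewrite (le_trans (fM x))// ltW.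
Qed.

Lemma EFin_esp f : bm f -> ((esp f)%:E = \int[P]_x (f x)%:E)%E.
Proof.
by move=> bf; rewrite /esp /Rintegral fineK//; apply: integrable_fin_num => //; exact: bm_int.
Qed.

Lemma esp_cst c : esp (fun=> c) = c.
Proof.
rewrite /esp Rintegral_cst//; transitivity (c * fine (1%E : \bar R)).
  by congr (_ * fine _); exact: probability_setT.
by rewrite mulr1.
Qed.

Lemma espD f g : bm f -> bm g -> esp (fun x => f x + g x) = esp f + esp g.
Proof. by move=> bf bg; rewrite /esp RintegralD//; exact: bm_int. Qed.

Lemma espB f g : bm f -> bm g -> esp (fun x => f x - g x) = esp f - esp g.
Proof. by move=> bf bg; rewrite /esp RintegralB//; exact: bm_int. Qed.

Lemma espZ c f : bm f -> esp (fun x => c * f x) = c * esp f.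
Proof. by move=> bf; rewrite /esp RintegralZl//; exact: bm_int. Qed.

Lemma espZr c f : bm f -> esp (fun x => f x * c) = esp f * c.
Proof. by move=> bf; rewrite /esp RintegralZr//; exact: bm_int. Qed.

Lemma espN f : bm f -> esp (fun x => - f x) = - esp f.
Proof. move=> bf; have -> : (fun x => - f x) = (fun x => -1 * f x) by apply/funext => x; rewrite mulN1r.
by rewrite espZ// mulN1r. Qed.

Lemma esp_sum (I : Type) (s : seq I) (F : I -> T -> R) : (forall i, bm (F i)) ->
  esp (fun x => \sum_(i <- s) F i x) = \sum_(i <- s) esp (F i).
Proof.
move=> bF; elim: s => [|i s IH].
  by under eq_fun do rewrite big_nil; rewrite esp_cst big_nil.
under eq_fun do rewrite big_cons.
by rewrite espD ?IH ?big_cons//; exact: bm_sum.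
Qed.

Lemma le_esp f g : bm f -> bm g -> (forall x, f x <= g x) -> esp f <= esp g.
Proof. by move=> bf bg fg; apply: le_Rintegral => //; exact: bm_int. Qed.

Lemma esp_ge0 f : (forall x, 0 <= f x) -> 0 <= esp f.
Proof. by move=> f0; apply: Rintegral_ge0. Qed.

Lemma esp_ge f c : bm f -> (forall x, c <= f x) -> c <= esp f.
Proof. by move=> bf cf; rewrite -(esp_cst c) le_esp//; exact: bm_cst. Qed.

Lemma esp_le f c : bm f -> (forall x, f x <= c) -> esp f <= c.
Proof. by move=> bf cf; rewrite -(esp_cst c) le_esp//; exact: bm_cst. Qed.

Lemma esp_norm f c : bm f -> (forall x, `|f x| <= c) -> `|esp f| <= c.
Proof.
move=> bf cf; rewrite ler_norml esp_le ?andbT//; last first.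
  by move=> x; exact: le_trans (ler_norm _) (cf x).
by rewrite esp_ge// => x; have := cf x; rewrite ler_norml => /andP[].
Qed.

Lemma esp_cvg (F : nat -> T -> R) f M : (forall n, measurable_fun setT (F n)) ->
  (forall n x, `|F n x| <= M) -> (forall x, F n x @[n --> \oo] --> f x) ->
  esp (F n) @[n --> \oo] --> esp f.
Proof.
move=> mF FM cF; have [mf _] := bm_lim mF FM cF.
have M0 : P.-integrable setT (EFin \o (fun=> M)) by apply/bm_int/bm_cst.
have [//| | | |_ _] := @dominated_convergence _ _ _ P setT measurableT
  (fun n => EFin \o F n) (EFin \o f) (EFin \o (fun=> M)) _ _ _ M0.
- by move=> n; apply/measurable_EFinP; exact: mF.
- exact/measurable_EFinP.
- by apply: aeW => x _; apply: cvg_EFin; [exact: nearW|exact: cF].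
- by apply: aeW => x n _ /=; rewrite lee_fin.
- by move=> h; apply: fine_cvg; rewrite fineK// integrable_fin_num//; apply: bm_int;
    exact: bm_lim FM cF.
Qed.

End esp.

Lemma eq_esp d (T : measurableType d) (R : realType) (P : probability T R) (f g : T -> R) :
  f =1 g -> esp P f = esp P g.
Proof. by move=> /funext ->. Qed.

Lemma bm_comp d1 d2 (T1 : measurableType d1) (T2 : measurableType d2) (R : realType)
    (f : T2 -> R) (h : T1 -> T2) : measurable_fun setT h -> bm f -> bm (f \o h).
Proof.
by move=> mh [mf [M fM]]; split; [exact: measurableT_comp|exists M => x; exact: fM].
Qed.

(** * Fubini's theorem and expectations under tensor powers *)

Section fubini.
Context d1 d2 (T1 : measurableType d1) (T2 : measurableType d2) (R : realType).

Lemma bm_slice1 (f : T1 * T2 -> R) x : bm f -> bm (fun y => f (x, y)).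
Proof. by move=> bf; apply: (@bm_comp _ _ _ _ _ f (pair x)) bf; exact: pair1_measurable. Qed.

Variables (P : probability T1 R) (Q : probability T2 R).

Lemma fubini_F_esp (f : T1 * T2 -> R) : bm f ->
  fubini_F Q (EFin \o f) = EFin \o (fun x => esp Q (fun y => f (x, y))).
Proof.
move=> bf; apply/funext => x; rewrite /fubini_F /esp /Rintegral/= fineK//.
by apply: integrable_fin_num => //; apply: (bm_int Q (bm_slice1 x bf)).
Qed.

Lemma bm_esp (f : T1 * T2 -> R) : bm f -> bm (fun x => esp Q (fun y => f (x, y))).
Proof.
move=> bf; split; last first.
  have [_ [M fM]] := bf; exists M => x.
  by apply: esp_norm => [|y]; [exact: bm_slice1|exact: fM].
apply/measurable_EFinP; rewrite -fubini_F_esp//.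
apply: (measurable_fubini_F (m1 := P)).
exact: bm_int.
Qed.

Lemma esp_prod (f : T1 * T2 -> R) : bm f ->
  esp (P \x Q)%E f = esp P (fun x => esp Q (fun y => f (x, y))).
Proof.
move=> bf; rewrite {1}/esp /Rintegral.
have := integral12_prod_meas1 (m1 := P) (m2 := Q) (f := EFin \o f).
rewrite fubini_F_esp// => <- //.
exact: bm_int.
Qed.

Lemma esp_prod_swap (f : T1 * T2 -> R) : bm f ->
  esp P (fun x => esp Q (fun y => f (x, y))) =
  esp Q (fun y => esp P (fun x => f (x, y))).
Proof.
move=> bf; rewrite -esp_prod//.
have bs y : bm (fun x => f (x, y)).
  by apply: (@bm_comp _ _ _ _ _ f (pair^~ y)) bf; exact: pair2_measurable.
have := integral21_prod_meas1 (m1 := P) (m2 := Q) (f := EFin \o f).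
rewrite {1 2}/esp /Rintegral => <-; last exact: bm_int.
congr fine; apply: eq_integral => y _.
rewrite /fubini_G /esp /Rintegral/= fineK//.
by apply: integrable_fin_num => //; apply: (bm_int P (bs y)).
Qed.

End fubini.

Lemma bm_esp2 d1 d2 (T1 : measurableType d1) (T2 : measurableType d2) (R : realType)
  (Q : probability T2 R) (f : T1 -> T2 -> R) : bm (fun z : T1 * T2 => f z.1 z.2) ->
  bm (fun x => esp Q (f x)).
Proof.
(* Measurability in the parameter comes from Fubini's theorem, which involves a probability on [T1]:
   any Dirac mass serves, and an empty [T1] is treated apart. *)
move=> bf; have [[x0]|ne] := pselect (inhabited T1).
  exact: (bm_esp (dirac x0) Q bf).
split.
  move=> _ Y mY; have -> : [set: T1] `&` (fun x : T1 => esp Q (f x)) @^-1` Y = set0.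
    by rewrite -subset0 => x; exfalso; apply: ne; exists.
  exact: measurable0.
by exists 0 => x; exfalso; apply: ne; exists.
Qed.

Section tensor.
Context d (T : measurableType d) (R : realType) (P : probability T R).

Lemma esp_tensor0 (f : 0.-tuple T -> R) : bm f -> esp (tensor_power P 0) f = f [tuple].
Proof.
move=> [mf _]; rewrite /esp /Rintegral/= integral_dirac//; last exact/measurable_EFinP.
by rewrite diracT mul1e.
Qed.

Lemma bm_cons n (f : n.+1.-tuple T -> R) : bm f ->
  bm (fun z : T * n.-tuple T => f (cons_pair z)).
Proof. by move=> bf; apply: (bm_comp _ bf); exact: measurable_cons_pair. Qed.

Lemma esp_tensorS n (f : n.+1.-tuple T -> R) : bm f ->
  esp (tensor_power P n.+1) f =
  esp P (fun x => esp (tensor_power P n) (fun t => f (cons_pair (x, t)))).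
Proof.
move=> bf; rewrite -(esp_prod _ _ (bm_cons bf)).
rewrite /esp /Rintegral/= integral_distribution//.
- by case: bf => mf _; exact/measurable_EFinP.
- exact: (bm_int (P \x tensor_power P n)%E (bm_cons bf)).
Qed.

End tensor.

(** * The Donsker-Varadhan formula *)

Section relative_entropy_lemmas.
Context d (T : measurableType d) (R : realType).

(** Meant for [f = ln k] with [k] a density, whose integral may be [+oo]: comparing positive and
    negative parts separately only asks the lower function to be integrable. *)
Lemma ae_le_integral_lower (mu : {measure set T -> \bar R}) (f g : T -> \bar R) :
  measurable_fun setT f -> mu.-integrable setT g ->
  {ae mu, forall x, (g x <= f x)%E} -> (\int[mu]_x g x <= \int[mu]_x f x)%E.
Proof.
move=> mf ig gf; have mg := measurable_int mu ig.
rewrite integralE [leRHS]integralE; apply: leeB.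
  apply: ae_ge0_le_integral => //; [exact: measurable_funepos|exact: measurable_funepos|].
  apply: filterS gf => x gfx _; rewrite !funeposE.
  by rewrite ge_max !le_max lexx gfx orbT.
apply: ae_ge0_le_integral => //; [exact: measurable_funeneg|exact: measurable_funeneg|].
apply: filterS gf => x gfx _; rewrite !funenegE.
by rewrite ge_max !le_max lexx leeN2 gfx orbT.
Qed.

Variables nu mu : probability T R.

(** Provides an everywhere finite and nonnegative version [k] of the density, so that the formulas
    below can be written with real numbers; the set where [k] vanishes is null for [nu]. *)
Lemma relative_entropy_density : nu `<< mu -> exists k : T -> R,
  [/\ measurable_fun setT k, forall x, 0 <= k x,
   forall g : T -> \bar R, (forall x, 0 <= g x)%E -> measurable_fun setT g ->
     (\int[mu]_x (g x * (k x)%:E) = \int[nu]_x g x)%E,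
   {ae nu, forall x, 0 < k x} &
   relative_entropy nu mu = (\int[nu]_x (ln (k x))%:E)%E].
Proof.
move=> numu; pose f0 := Radon_Nikodym_SigmaFinite.f nu mu.
have f00 := Radon_Nikodym_SigmaFinite.f_ge0 numu.
have f0f := Radon_Nikodym_SigmaFinite.f_fin_num numu.
have if0 := Radon_Nikodym_SigmaFinite.f_integrable numu.
have f0i := Radon_Nikodym_SigmaFinite.f_integral numu.
pose k x := fine (f0 x).
have kE x : (k x)%:E = f0 x by rewrite /k fineK.
have mk : measurable_fun setT k.
  by apply: measurableT_comp => //; exact: measurable_int if0.
have k0 x : 0 <= k x by rewrite -lee_fin kE.
have mN : measurable [set x | k x <= 0].
  have -> : [set x | k x <= 0] = setT `&` (k @^-1` `]-oo, 0]).
    by rewrite setTI; apply/seteqP; split => x /=; rewrite in_itv.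
  exact: mk.
have nuN : nu [set x | k x <= 0] = 0%E.
  rewrite f0i//; apply: integral0_eq => x /= kx0.
  by rewrite -[LHS]/(f0 x) -kE; congr EFin; apply/eqP; rewrite eq_le kx0 k0.
have kae : {ae nu, forall x, 0 < k x}.
  exists [set x | k x <= 0]; split => // x /= /negP.
  by rewrite -leNgt.
exists k; split => //.
  move=> g g0 mg; under eq_integral do rewrite kE.
  exact: Radon_Nikodym_SigmaFinite.change_of_variables.
rewrite /relative_entropy asboolT//.
have ae1 : ae_eq nu setT (fun x => lne (Radon_Nikodym (charge_of_finite_measure nu) mu x))
    (fun x => (ln (k x))%:E).
  have /= [N [mN' N0 sN]] := ae_eq_Radon_Nikodym_SigmaFinite numu measurableT.
  have nuN0 : nu N = 0%E by move/null_content_dominatesP : numu; exact.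
  exists (N `|` [set x | k x <= 0]); split; first exact: measurableU.
    by rewrite null_set_setU.
  move=> x nx; apply: contrapT => /not_orP[Nx kx]; apply: nx => _.
  have e : f0 x = Radon_Nikodym (charge_of_finite_measure nu) mu x.
    by apply: contrapT => h; apply: Nx; apply: sN => hh; apply: h; exact: hh.
  have {}kx : ~~ (k x <= 0) by apply/negP.
  by rewrite -e// -kE lne_EFin// ltNge.
have mlnk : measurable_fun setT (fun x => (ln (k x))%:E).
  by apply/measurable_EFinP; apply: (measurableT_comp (@measurable_ln R)).
apply: ae_eq_integral => //.
pose k2 x := fine (Radon_Nikodym (charge_of_finite_measure nu) mu x).
have mk2 : measurable_fun setT k2.
  by apply: measurableT_comp => //; exact: (measurable_int mu).
have -> : (fun x => lne (Radon_Nikodym (charge_of_finite_measure nu) mu x)) =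
    (fun x => if k2 x <= 0 then -oo%E else (ln (k2 x))%:E).
  apply/funext => x; rewrite -[X in lne X]fineK//.
  exact: Radon_Nikodym_fin_num.
apply: measurable_fun_ifT => //; first exact: measurable_fun_ler.
by apply/measurable_EFinP; apply: (measurableT_comp (@measurable_ln R)).
Qed.

(** Only an inequality, since integration against [nu] misses the part of [mu] carried by the set
    where [k] vanishes. *)
Lemma int_inv_density (k : T -> R) (psi : T -> R) : measurable_fun setT k ->
  (forall x, 0 <= k x) ->
  (forall g : T -> \bar R, (forall x, 0 <= g x)%E -> measurable_fun setT g ->
     (\int[mu]_x (g x * (k x)%:E) = \int[nu]_x g x)%E) ->
  bm psi -> (forall x, 0 <= psi x) ->
  (\int[nu]_x (psi x / k x)%:E <= (esp mu psi)%:E)%E.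
Proof.
move=> mk k0 kE bpsi psi0; have [mpsi _] := bpsi.
have minv : measurable_fun setT (fun x => (k x)^-1).
  have -> : (fun x => (k x)^-1) = (fun x => if k x <= 0 then 0 else expR (- ln (k x))).
    apply/funext => x; case: ifPn => [kx|]; last first.
      by rewrite -ltNge => kx; rewrite expRN lnK.
    have -> : k x = 0 by apply/eqP; rewrite eq_le kx k0.
    by rewrite invr0.
  apply: measurable_fun_ifT => //; first exact: measurable_fun_ler.
  apply: measurableT_comp => //; apply: measurable_funN.
  exact: (measurableT_comp (@measurable_ln R)).
have mpk : measurable_fun setT (fun x => (psi x / k x)%:E).
  by apply/measurable_EFinP; exact: measurable_funM.
rewrite -kE//; last by move=> x; rewrite lee_fin divr_ge0.
rewrite /esp /Rintegral fineK; last first.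
  by apply: integrable_fin_num => //; exact: (bm_int mu bpsi).
apply: ge0_le_integral => //.
- by move=> x _; rewrite -EFinM lee_fin mulr_ge0// divr_ge0.
- by apply/measurable_EFinP; apply: measurable_funM => //; exact: measurable_funM.
- exact/measurable_EFinP.
move=> x _; rewrite -EFinM lee_fin.
have [->|kx] := eqVneq (k x) 0; first by rewrite mulr0.
by rewrite divfK.
Qed.

(** With [psi] the function [expR phi] normalised to have mean one under [mu], the inequality
    [ln y <= y - 1] at [y = psi / k] bounds [ln k] from below by [phi - c + 1 - psi / k]; the last
    two terms have a nonnegative integral against [nu]. *)
Lemma relative_entropy_ge (phi : T -> R) : bm phi ->
  ((esp nu phi - ln (esp mu (fun x => expR (phi x))))%:E <= relative_entropy nu mu)%E.
Proof.
move=> bphi; have [numu|nnumu] := pselect (nu `<< mu); last first.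
  by rewrite /relative_entropy asboolF// leey.
have [k [mk k0 kE kae ->]] := relative_entropy_density numu.
set Z := esp mu _; set c := ln Z.
have bephi := bm_exp bphi.
have Z0 : 0 < Z.
  have [_ [M M1]] := bphi; apply: (@lt_le_trans _ _ (expR (- M))); first exact: expR_gt0.
  by apply: esp_ge => // x; rewrite ler_expR; have := M1 x; rewrite ler_norml => /andP[].
have ecZ : expR (- c) * Z = 1 by rewrite expRN lnK// mulVf// gt_eqF.
pose psi x := expR (- c) * expR (phi x).
have bpsi : bm psi by exact: bmZ.
have psi0 x : 0 <= psi x by rewrite mulr_ge0// expR_ge0.
have epsi : esp mu psi = 1 by rewrite espZ.
have inv := int_inv_density mk k0 kE bpsi psi0.
have minv : measurable_fun setT (fun x => (psi x / k x)%:E).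
  apply/measurable_EFinP.
  have -> : (fun x => psi x / k x) =
      (fun x => if k x <= 0 then 0 else psi x * expR (- ln (k x))).
    apply/funext => x; case: ifPn => [kx|]; last first.
      by rewrite -ltNge => kx; rewrite expRN lnK.
    have -> : k x = 0 by apply/eqP; rewrite eq_le kx k0.
    by rewrite invr0 mulr0.
  apply: measurable_fun_ifT => //; first exact: measurable_fun_ler.
  apply: measurable_funM; first by case: bpsi.
  apply: measurableT_comp => //; apply: measurable_funN.
  exact: (measurableT_comp (@measurable_ln R)).
have iinv : nu.-integrable setT (fun x => (psi x / k x)%:E).
  apply/integrableP; split => //.
  under eq_integral do rewrite gee0_abs ?lee_fin ?divr_ge0//.
  by apply: (le_lt_trans inv); rewrite ltry.
have b2 : bm (fun x => phi x - c + 1).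
  by apply: bmD; [apply: bmB => //; exact: bm_cst|exact: bm_cst].
have i2 := bm_int nu b2.
have ig : nu.-integrable setT (fun x => (phi x - c + 1 - psi x / k x)%:E).
  by under eq_fun do rewrite EFinB; exact: integrableB.
have mlnk : measurable_fun setT (fun x => (ln (k x))%:E).
  by apply/measurable_EFinP; apply: (measurableT_comp (@measurable_ln R)).
apply: (@le_trans _ _ (\int[nu]_x (phi x - c + 1 - psi x / k x)%:E)%E).
  under eq_integral do rewrite EFinB.
  rewrite integralB// -[X in (X - _)%E]fineK; last exact: integrable_fin_num.
  rewrite -[X in (_ - X)%E]fineK; last exact: integrable_fin_num.
  rewrite -EFinB lee_fin.
  have -> : fine (\int[nu]_x (phi x - c + 1)%:E) = esp nu phi - c + 1.
    rewrite -[LHS]/(esp nu (fun x => phi x - c + 1)).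
    by rewrite espD ?espB ?esp_cst//; try exact: bm_cst; apply: bmB => //; exact: bm_cst.
  have : fine (\int[nu]_x (psi x / k x)%:E) <= 1.
    rewrite -lee_fin fineK; last exact: integrable_fin_num.
    by rewrite (le_trans inv)// epsi.
  by move=> ?; rewrite -addrA lerDl subr_ge0.
apply: ae_le_integral_lower => //.
apply: filterS kae => x kx; rewrite lee_fin.
have p0 : 0 < psi x / k x by rewrite divr_gt0// mulr_gt0// expR_gt0.
have := le_ln1Dx (x := psi x / k x - 1).
rewrite addrCA subrr addr0 => /(_ _) le1.
have {le1} : ln (psi x / k x) <= psi x / k x - 1 by apply: le1; rewrite ltrBrDl subrr.
rewrite ln_div ?posrE//; last by rewrite mulr_gt0// expR_gt0.
rewrite /psi lnM ?posrE ?expR_gt0// !expRK; lra.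
Qed.

End relative_entropy_lemmas.

Lemma esp_indic d (T : measurableType d) (R : realType) (P : probability T R)
  (A : set T) : measurable A -> esp P (\1_A : T -> R) = fine (P A).
Proof. by move=> mA; rewrite /esp /Rintegral integral_indic// setIT. Qed.

Lemma bm_indic d (T : measurableType d) (R : realType) (A : set T) :
  measurable A -> bm (\1_A : T -> R).
Proof.
move=> mA; split; first exact: measurable_indic.
by exists 1 => x; rewrite indicE; case: (_ \in _); rewrite ?normr1 ?normr0.
Qed.

Section variational_bound.
Context d (T : measurableType d) (R : realType) (nu mu : probability T R) (B : R).
Hypothesis nuB : forall phi : T -> R, bm phi ->
  esp nu phi - ln (esp mu (fun x => expR (phi x))) <= B.

(** If [mu A = 0], testing with [n] times the indicator of [A] gives [n * nu A <= B] for every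
    [n]. *)
Lemma variational_dominates : nu `<< mu.
Proof.
apply/null_content_dominatesP => A mA muA0.
have bA := bm_indic R mA.
have le n : n%:R * fine (nu A) <= B.
  have := nuB (bmZ n%:R bA); rewrite espZ// esp_indic//.
  have -> : (fun x => expR (n%:R * \1_A x)) = (fun x => 1 + (expR n%:R - 1) * \1_A x :> R).
    apply/funext => x; rewrite indicE; case: (_ \in _).
      by rewrite !mulr1 addrCA subrr addr0.
    by rewrite !mulr0 expR0 addr0.
  by rewrite espD ?esp_cst ?espZ ?esp_indic//;
    [rewrite muA0 mulr0 addr0 ln1 subr0|exact: bm_cst|exact: bmZ].
have fA : nu A \is a fin_num by exact: fin_num_measure.
rewrite -(fineK fA); congr EFin; apply/eqP; rewrite eq_le; apply/andP; split; last first.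
  by apply: fine_ge0; exact: measure_ge0.
rewrite leNgt; apply/negP => a0.
have := le (Num.truncn (B / fine (nu A))).+1.
by rewrite leNgt -ltr_pdivrMr// truncnS_gt.
Qed.

(** The optimal test function in the variational formula is [ln k]; it is approached by bounded
    truncations, whose exponential means under [mu] tend to one. *)
Lemma relative_entropy_le : (relative_entropy nu mu <= B%:E)%E.
Proof.
have [k [mk k0 kE kae ->]] := relative_entropy_density variational_dominates.
have mlnk : measurable_fun setT (fun x => ln (k x)).
  exact: (measurableT_comp (@measurable_ln R)).
(* [p n - q n] is [ln k] with [k] cut off at [n.+1] and at its inverse, split into positive and
   negative parts. *)
pose p n x := ln (Num.max 1 (Num.min (k x) n.+1%:R)).
pose q n x := - ln (Num.min 1 (Num.max (k x) n.+1%:R^-1)).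
have n1 n : 1 <= n.+1%:R :> R by rewrite ler1n.
have ni1 n : n.+1%:R^-1 <= 1 :> R by rewrite invf_le1.
have ni0 n : 0 < n.+1%:R^-1 :> R by rewrite invr_gt0.
have bp n : bm (p n).
  apply: (bm_ln (c := 1)) => //; first by move=> x; rewrite le_max lexx.
  split; first by apply: measurable_maxr => //; exact: measurable_minr.
  exists n.+1%:R => x; rewrite ger0_norm; last by rewrite le_max ler01.
  by rewrite ge_max n1 ge_min lexx orbT.
have bq n : bm (q n).
  apply: bmN; apply: (bm_ln (c := n.+1%:R^-1)) => //.
    by move=> x; rewrite le_min ni1 le_max lexx orbT.
  split; first by apply: measurable_minr => //; exact: measurable_maxr.
  exists 1 => x; rewrite ger0_norm; first by rewrite ge_min lexx.
  by rewrite le_min ler01 le_max k0.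
have p0 n x : 0 <= p n x by rewrite ln_ge0// le_max lexx.
have q0 n x : 0 <= q n x by rewrite oppr_ge0 ln_le0// ge_min lexx.
pose D := (\int[nu]_x (funeneg (fun x => (ln (k x))%:E)) x)%E.
have mneg : measurable_fun setT (funeneg (fun x => (ln (k x))%:E)).
  by apply: measurable_funeneg; exact/measurable_EFinP.
(* The negative part of [ln k] is at most [1 / k], whose integral against [nu] is at most one. *)
have D1 : (D <= 1%:E)%E.
  have := int_inv_density mk k0 kE (bm_cst T 1) (fun=> ler01).
  rewrite esp_cst; apply: le_trans.
  have minv : measurable_fun setT (fun x => (1 / k x)).
    have -> : (fun x => 1 / k x) = (fun x => if k x <= 0 then 0 else expR (- ln (k x))).
      apply/funext => x; case: ifPn => [kx|]; last first.
        by rewrite -ltNge => kx; rewrite expRN lnK// mul1r.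
      have -> : k x = 0 by apply/eqP; rewrite eq_le kx k0.
      by rewrite invr0 mulr0.
    apply: measurable_fun_ifT => //; first exact: measurable_fun_ler.
    by apply: measurableT_comp => //; exact: measurable_funN.
  apply: ae_ge0_le_integral => //.
  - by move=> x _; rewrite lee_fin mul1r invr_ge0.
  - exact/measurable_EFinP.
  apply: filterS kae => x kx _; rewrite funenegE ge_max mul1r.
  apply/andP; split; last by rewrite lee_fin invr_ge0 ltW.
  rewrite -EFinN lee_fin.
  have := le_ln1Dx (x := (k x)^-1 - 1); rewrite addrCA subrr addr0 lnV ?posrE//.
  by move=> h; have := h _; rewrite ltrBrDl subrr invr_gt0 => /(_ kx); lra.
have D0 : (0 <= D)%E by apply: integral_ge0.
have Dfin : D \is a fin_num by rewrite ge0_fin_numE// (le_lt_trans D1)// ltry.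
have ekint : (\int[mu]_x (k x)%:E = 1)%E.
  have := kE (cst 1%E) (fun=> lee01) (measurable_cst _).
  under eq_integral do rewrite mul1e.
  by move=> ->; rewrite integral_cst// mul1e; exact: probability_setT.
(* Two truncation levels: [n] stays fixed while [m] grows to remove the error [m.+1%:R^-1];
   afterwards [n] grows by monotone convergence. *)
have pB n m : (n <= m)%N -> esp nu (p n) <= B + m.+1%:R^-1 + fine D.
  move=> nm; have b2 : bm (fun x => p m x - q m x) by exact: bmB.
  have := nuB b2; rewrite espB// => Hm.
  have q_le : esp nu (q m) <= fine D.
    rewrite -lee_fin (fineK Dfin) EFin_esp//.
    apply: ae_ge0_le_integral => //; first by move=> x _; rewrite lee_fin.
      by apply/measurable_EFinP; case: (bq m).
    apply: filterS kae => x kx _; rewrite funenegE le_max !lee_fin /q.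
    have [k1|k1] := leP 1 (k x).
      by rewrite min_l ?ln1 ?oppr0 ?lexx ?orbT// le_max k1.
    apply/orP; left; rewrite lerN2 ler_ln ?posrE//.
      by rewrite le_min (ltW k1) le_max lexx.
    by rewrite lt_min ltr01 lt_max kx.
  have p_le : esp nu (p n) <= esp nu (p m).
    apply: le_esp => // x; rewrite ler_ln ?posrE ?lt_max ?ltr01//.
    rewrite ge_max !le_max lexx/=; apply/orP; right.
    by rewrite le_min ge_min lexx ge_min ler_nat ltnS nm orbT.
  suff le_e : ln (esp mu (fun x => expR (p m x - q m x))) <= m.+1%:R^-1.
    have gen (a b c e f g : R) : a <= b -> c <= e -> b - c - f <= B -> f <= g ->
      a <= B + g + e by lra.
    exact: gen p_le q_le Hm le_e.
  (* The exponential of the truncated logarithm is at most [k + m.+1%:R^-1], the second term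
     accounting for the points where [k] is small. *)
  have e_le : esp mu (fun x => expR (p m x - q m x)) <= 1 + m.+1%:R^-1.
    have be := bm_exp b2.
    rewrite -lee_fin EFin_esp//.
    have -> : ((1 + m.+1%:R^-1)%:E = \int[mu]_x ((k x)%:E + (m.+1%:R^-1)%:E) :> \bar R)%E.
      rewrite ge0_integralD//; first last.
      all: try by move=> x _; rewrite lee_fin ltW.
      all: try by apply/measurable_EFinP.
        by move=> x _; rewrite lee_fin.
      rewrite ekint integral_cst// EFinD; congr (_ + _)%E.
      by rewrite -[LHS]mule1; congr (_ * _)%E; apply/esym; exact: probability_setT.
    have [mbe _] := be.
    apply: ge0_le_integral => //.
    all: try by move=> x _; rewrite lee_fin expR_ge0.
    all: try by apply/measurable_EFinP.
    all: try by move=> x _; rewrite -EFinD lee_fin addr_ge0// ltW.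
    all: try by apply/measurable_EFinP; apply: measurable_funD.
    move=> x _; rewrite -EFinD lee_fin /p /q opprK expRD !lnK ?posrE ?lt_max ?ltr01//; last first.
      by rewrite lt_min ltr01 lt_max ni0 orbT.
    have [k1|k1] := leP 1 (k x).
      rewrite (@min_l _ _ 1) ?le_max ?k1// mulr1 ge_max ge_min.
      move: (m.+1%:R^-1) (ni0 m) => i i0.
      by apply/andP; split; [lra|apply/orP; left; lra].
    rewrite (@max_l _ _ 1) ?ge_min ?(ltW k1)// mul1r ge_min ge_max.
    move: (m.+1%:R^-1) (ni0 m) (k0 x) => i i0 kx0.
    by apply/orP; right; apply/andP; split; lra.
  have e0 : 0 < esp mu (fun x => expR (p m x - q m x)).
    have [_ [M M1]] := b2; apply: (@lt_le_trans _ _ (expR (- M))); first exact: expR_gt0.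
    apply: esp_ge => [|x]; first exact: bm_exp.
    by rewrite ler_expR; have := M1 x; rewrite ler_norml => /andP[].
  apply: (@le_trans _ _ (ln (1 + m.+1%:R^-1))); first by rewrite ler_ln ?posrE// addr_gt0.
  by apply: le_ln1Dx; rewrite (lt_trans _ (ni0 m))// ltrN10.
have {}pB n : esp nu (p n) <= B + fine D.
  apply/ler_addgt0Pr => e e0; pose m := maxn n (Num.truncn e^-1).
  apply: (le_trans (pB n m (leq_maxl _ _))); rewrite addrAC lerD2l.
  rewrite -[leRHS]invrK lef_pV2 ?posrE ?invr_gt0//.
  apply: ltW; apply: (lt_le_trans (truncnS_gt _)).
  by rewrite ler_nat ltnS leq_maxr.
rewrite integralE -/D -(fineK Dfin) leeBlDr// -EFinD.
have cvgp : (\int[nu]_x (p n x)%:E @[n --> \oo] -->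
    \int[nu]_x (funepos (fun x => (ln (k x))%:E)) x)%E.
  have -> : (\int[nu]_x (funepos (fun x => (ln (k x))%:E)) x)%E =
      (\int[nu]_x limn (fun n => (p n x)%:E))%E.
    apply: ae_eq_integral => //.
    - by apply: measurable_funepos; exact/measurable_EFinP.
    - apply: (emeasurable_fun_cvg (fun n x => (p n x)%:E)).
        by move=> n; apply/measurable_EFinP; case: (bp n).
      move=> x _; apply: ereal_nondecreasing_is_cvgn => a b ab.
      rewrite lee_fin ler_ln ?posrE ?lt_max ?ltr01//.
      rewrite ge_max !le_max lexx/=; apply/orP; right.
      by rewrite le_min ge_min lexx ge_min ler_nat ltnS ab orbT.
    apply: filterS kae => x kx _; apply/esym/cvg_lim => //.
    apply: cvg_near_cst; exists (Num.truncn (k x)) => // n /= nk.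
    rewrite funeposE -EFin_max; congr EFin; rewrite /p min_l; last first.
      by apply: ltW; apply: (lt_le_trans (truncnS_gt _)); rewrite ler_nat ltnS.
    have [k1|k1] := leP 1 (k x); first by rewrite max_l// ln_ge0.
    by rewrite max_r ?ln1// ln_le0// ltW.
  apply: cvg_monotone_convergence => //.
  - by move=> n; apply/measurable_EFinP; case: (bp n).
  - by move=> n x _; rewrite lee_fin.
  move=> x _ a b ab; rewrite lee_fin ler_ln ?posrE ?lt_max ?ltr01//.
  rewrite ge_max !le_max lexx/=; apply/orP; right.
  by rewrite le_min ge_min lexx ge_min ler_nat ltnS ab orbT.
rewrite -(cvg_lim _ cvgp)//; apply: lime_le; first by apply/cvg_ex; eexists; exact: cvgp.
apply: nearW => n; have := pB n; rewrite -lee_fin EFin_esp//.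
Qed.

End variational_bound.

(** * Trigonometric polynomials on the torus *)

Section bounded_closure.
Context d (T : measurableType d) (R : realType).
Implicit Types (f g : T -> R) (D : (T -> R) -> Prop).

Definition bounded_closed D := forall (F : nat -> T -> R) f M,
  (forall n, D (F n)) -> (forall n x, `|F n x| <= M) ->
  (forall x, F n x @[n --> \oo] --> f x) -> D f.

Variable A : (T -> R) -> Prop.
Hypothesis A_bm : forall f, A f -> bm f.
Hypothesis A_cst : forall c, A (fun=> c).
Hypothesis AD : forall f g, A f -> A g -> A (fun x => f x + g x).
Hypothesis AM : forall f g, A f -> A g -> A (fun x => f x * g x).
Hypothesis A_gen : forall S : set (set T), sigma_algebra setT S ->
  (forall f, A f -> S [set x | 0 < f x]) -> forall E, measurable E -> S E.

(** The intersection of all stable classes that contain [A]. Properties of its members follow by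
    choosing [D], which replaces a transfinite induction over limits. *)
Let cl f := forall D, (forall g, A g -> D g) -> bounded_closed D -> D f.

Let cl_bm f : cl f -> bm f.
Proof.
apply => // F h M bF FM Fh; apply: bm_lim FM Fh => n.
by have [] := bF n.
Qed.

Let cl_A f : A f -> cl f. Proof. by move=> Af D + _; apply. Qed.

Let cl_lim : bounded_closed cl.
Proof.
move=> F f M cF FM Ff D DA bD; apply: (bD _ _ _ _ FM Ff) => n; exact: cF.
Qed.

(** Stability is shown in one argument at a time, the other being first in [A] and then in [cl]. *)
Let clD f g : cl f -> cl g -> cl (fun x => f x + g x).
Proof.
have step1 f1 g1 : A f1 -> cl g1 -> cl (fun x => f1 x + g1 x).
  move=> Af cg; apply: (cg (fun h => cl (fun x => f1 x + h x))).
    by move=> h Ah; apply: cl_A; exact: AD.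
  move=> F h M cF FM Fh; have [_ [K fK]] := A_bm Af.
  apply: (cl_lim cF (M := K + M)) => [n x|x]; last by apply: cvgD => //; exact: cvg_cst.
  by rewrite (le_trans (ler_normD _ _))// lerD.
move=> cf cg; apply: (cf (fun h => cl (fun x => h x + g x))).
  by move=> h Ah; exact: step1.
move=> F h M cF FM Fh; have [_ [K fK]] := cl_bm cg.
apply: (cl_lim cF (M := M + K)) => [n x|x]; last by apply: cvgD => //; exact: cvg_cst.
by rewrite (le_trans (ler_normD _ _))// lerD.
Qed.

Let clM f g : cl f -> cl g -> cl (fun x => f x * g x).
Proof.
have step1 f1 g1 : A f1 -> cl g1 -> cl (fun x => f1 x * g1 x).
  move=> Af cg; apply: (cg (fun h => cl (fun x => f1 x * h x))).
    by move=> h Ah; apply: cl_A; exact: AM.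
  move=> F h M cF FM Fh; have [_ [K fK]] := A_bm Af.
  apply: (cl_lim cF (M := K * M)) => [n x|x]; last by apply: cvgM => //; exact: cvg_cst.
  by rewrite normrM ler_pM.
move=> cf cg; apply: (cf (fun h => cl (fun x => h x * g x))).
  by move=> h Ah; exact: step1.
move=> F h M cF FM Fh; have [_ [K fK]] := cl_bm cg.
apply: (cl_lim cF (M := M * K)) => [n x|x]; last by apply: cvgM => //; exact: cvg_cst.
by rewrite normrM ler_pM.
Qed.

Let cl_cst c : cl (fun=> c). Proof. by move=> D DA _; apply: DA. Qed.

Let clZ c f : cl f -> cl (fun x => c * f x).
Proof. by move=> cf; exact: (clM (cl_cst c) cf). Qed.

Let clX f n : cl f -> cl (fun x => f x ^+ n).
Proof.
move=> cf; elim: n => [|n IH]; first exact: cl_cst.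
have -> : (fun x => f x ^+ n.+1) = (fun x => f x * f x ^+ n).
  by apply/funext => x; rewrite exprS.
exact: clM.
Qed.

Let cl_sum (I : Type) (s : seq I) (F : I -> T -> R) :
  (forall i, cl (F i)) -> cl (fun x => \sum_(i <- s) F i x).
Proof.
move=> cF; elim: s => [|i s IH].
  by under eq_fun do rewrite big_nil; exact: cl_cst.
by under eq_fun do rewrite big_cons; exact: clD.
Qed.

Let cl_exp f : cl f -> cl (fun x => expR (f x)).
Proof.
move=> cf; have [_ [M fM]] := cl_bm cf.
apply: (@cl_lim (fun n x => series (exp_coeff (f x)) n) _ (expR M)).
- by move=> n; rewrite /series/=; apply: cl_sum => i; apply: clM; [exact: clX|exact: cl_cst].
- move=> n x; apply: (@le_trans _ _ (expR `|f x|)); last by rewrite ler_expR.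
  apply: (@le_trans _ _ (series (exp_coeff `|f x|) n)).
    rewrite /series/= (le_trans (ler_norm_sum _ _ _))// ler_sum// => i _.
    by rewrite /exp_coeff/= normrM normrX [X in _ * X]ger0_norm// invr_ge0 ler0n.
  apply: nondecreasing_cvgn_le; last exact: is_cvg_series_exp_coeff.
  by apply: nondecreasing_series => i _ _; rewrite exp_coeff_ge0.
by move=> x; exact: is_cvg_series_exp_coeff.
Qed.

(** Exponentials produce indicators: [expR (- (n%:R * f x ^+ 2))] tends to the indicator of [f = 0],
    and [expR (- expR (- (n%:R * f x)))] to the indicator of [0 < f] plus [expR (-1)] times that of
    [f = 0]. *)
Let cl_pos f : cl f -> cl (\1_[set x | 0 < f x]).
Proof.
move=> cf.
have cvg0 c : 0 < c -> expR (- (n%:R * c)) @[n --> \oo] --> (0 : R).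
  move=> c0; have -> : (fun n => expR (- (n%:R * c))) = (fun n => (expR (- c)) ^+ n).
    by apply/funext => n; rewrite -expRM_natl mulrN.
  by apply: cvg_expr; rewrite ger0_norm ?expR_ge0// expR_lt1 oppr_lt0.
have c0 : cl (fun x => \1_[set x | f x = 0] x).
  apply: (@cl_lim (fun n x => expR (- (n%:R * f x ^+ 2))) _ 1).
  - move=> n; apply: (cl_exp (f := fun x => - (n%:R * f x ^+ 2))).
    have -> : (fun x => - (n%:R * f x ^+ 2)) = (fun x => (- n%:R) * f x ^+ 2).
      by apply/funext => x; rewrite mulNr.
    by apply: clZ; exact: clX.
  - by move=> n x; rewrite ger0_norm ?expR_ge0// expR_le1 oppr_le0 mulr_ge0// sqr_ge0.
  move=> x; rewrite indicE; have [fx|fx] := eqVneq (f x) 0.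
    rewrite mem_set//; under eq_fun do rewrite fx expr0n/= mulr0 oppr0 expR0.
    exact: cvg_cst.
  rewrite memNset; last by move=> /= h; rewrite h eqxx in fx.
  by apply: cvg0; rewrite exprn_even_gt0.
have c1 : cl (fun x => \1_[set x | 0 < f x] x + expR (-1) * \1_[set x | f x = 0] x).
  apply: (@cl_lim (fun n x => expR (- expR (- (n%:R * f x)))) _ 1).
  - move=> n; apply: (cl_exp (f := fun x => - expR (- (n%:R * f x)))).
    have -> : (fun x => - expR (- (n%:R * f x))) = (fun x => (- 1) * expR ((- n%:R) * f x)).
      by apply/funext => x; rewrite mulN1r mulNr.
    by apply: clZ; apply: cl_exp; exact: clZ.
  - by move=> n x; rewrite ger0_norm ?expR_ge0// expR_le1 oppr_le0 expR_ge0.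
  move=> x; rewrite !indicE; have [fx|fx|fx] := ltgtP (f x) 0.
  - rewrite memNset ?memNset/=; last 2 first.
      by move=> h; rewrite h ltxx in fx.
      by apply/negP; rewrite -leNgt ltW.
    rewrite mulr0 addr0.
    apply: (@squeeze_cvgr _ _ _ _ (fun=> 0) (fun n => expR (- (n%:R * - f x)))).
    + apply: nearW => n; rewrite expR_ge0/= ler_expR lerN2 mulrN -mulNr.
      by have := expR_ge1Dx (- n%:R * f x); rewrite mulNr; lra.
    + exact: cvg_cst.
    + by apply: cvg0; rewrite oppr_gt0.
  - rewrite mem_set// memNset/=; last by move=> h; rewrite h ltxx in fx.
    rewrite mulr0 addr0 -[X in _ --> X](@expR0 R) -[X in expR X]oppr0.
    apply: continuous_cvg; first exact: continuous_expR.
    by apply: cvgN; exact: cvg0.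
  - rewrite memNset/= ?fx ?ltxx// mem_set//.
    rewrite add0r mulr1; under eq_fun do rewrite mulr0 oppr0 expR0.
    exact: cvg_cst.
have -> : \1_[set x | 0 < f x] = (fun x =>
    (\1_[set x | 0 < f x] x + expR (-1) * \1_[set x | f x = 0] x)
     + (- expR (-1)) * \1_[set x | f x = 0] x) :> (T -> R).
  by apply/funext => x; rewrite mulNr addrK.
by apply: clD => //; exact: clZ.
Qed.

Let cl_indic E : measurable E -> cl (\1_E).
Proof.
move=> mE; apply: (A_gen (S := [set E | cl (\1_E)])) => //; last first.
  by move=> f Af; apply: cl_pos; exact: cl_A.
have indC B : cl (\1_B) -> cl (\1_(~` B)).
  move=> cB; have -> : \1_(~` B) = (fun x => 1 + (-1) * \1_B x) :> (T -> R).
    by apply/funext => x; rewrite !indicE in_setC; case: (x \in B); rewrite /=; lra.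
  by apply: clD; [exact: cl_cst|exact: clZ].
split => /=.
- by rewrite indic0; exact: cl_cst.
- by move=> B cB; rewrite setTD; exact: indC.
move=> B cB.
have cU n : cl (\1_(\big[setU/set0]_(i < n) B i)).
  elim: n => [|n IH]; first by rewrite big_ord0 indic0; exact: cl_cst.
  rewrite big_ord_recr/= -[X in \1_X]setCK setCU; apply: (indC).
  rewrite indicI; apply: clM; exact: indC.
apply: (cl_lim cU (M := 1)) => [n x|x].
  by rewrite indicE; case: (_ \in _); rewrite ?normr1 ?normr0.
rewrite indicE; have [/set_mem[k _ Bk]|/negP nx] := boolP (x \in \bigcup_k B k).
  apply: cvg_near_cst; exists k.+1 => // n /= kn; rewrite indicE mem_set//.
  by rewrite -bigcup_mkord; exists k.
apply: cvg_near_cst; exists 0%N => // n _; rewrite indicE memNset//.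
by rewrite -bigcup_mkord => -[k _ Bk]; apply: nx; apply: mem_set; exists k.
Qed.

(** A layer-cake formula: a function with values in [[0, n]] is within 1 of a sum of indicators of
    its superlevel sets. After rescaling, bounded functions become uniform limits of combinations of
    indicators. *)
Let count_approx n (y : R) : 0 <= y <= n%:R ->
  `|\sum_(1 <= j < n.+1) (j%:R < y)%R%:R - y| <= 1.
Proof.
elim: n y => [|n IH] y /andP[y0 yn].
  have -> : y = 0 by apply/eqP; rewrite eq_le y0 yn.
  by rewrite big_nil subrr normr0.
rewrite big_nat_recr//=; have [yn'|yn'] := leP y n%:R.
  have -> : (n.+1%:R < y) = false by apply/negbTE; rewrite -leNgt (le_trans yn')// ler_nat.
  rewrite addr0.
  by apply: IH; rewrite y0.
have -> : \sum_(1 <= j < n.+1) (j%:R < y)%R%:R = n%:R :> R.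
  rewrite (eq_big_nat _ _ (F2 := fun=> 1)); last first.
    move=> j /andP[_ jn]; rewrite (le_lt_trans _ yn')// ler_nat.
    by rewrite -ltnS.
  by rewrite big_const_nat subn1/= iter_addr_0.
have -> : (n.+1%:R < y) = false by apply/negbTE; rewrite -leNgt.
rewrite addr0 ler_norml.
move: yn; rewrite -natr1 => yn; move: (n%:R) yn yn' => z; lra.
Qed.

Theorem bounded_closed_bm D : (forall g, A g -> D g) -> bounded_closed D ->
  forall f, bm f -> D f.
Proof.
move=> DA bD f [mf [M0 fM0]]; suff : cl f by exact.
pose M := `|M0| + 1; have M1 : 0 < M by rewrite ltr_wpDl.
have fM x : `|f x| <= M.
  by rewrite (le_trans (fM0 x))// (le_trans (ler_norm _))// lerDl.
pose y n x : R := n.+1%:R * (f x + M) / (2 * M).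
have y01 n x : 0 <= y n x <= n.+1%:R.
  have := fM x; rewrite ler_norml => /andP[f1 f2].
  rewrite divr_ge0 ?mulr_ge0//=; [|lra|lra].
  rewrite ler_pdivrMr; last lra.
  by rewrite ler_wpM2l//; lra.
pose F n x := - M + 2 * M / n.+1%:R * \sum_(1 <= j < n.+2) \1_[set x | j%:R < y n x] x.
have FE n x : `|F n x - f x| <= 2 * M / n.+1%:R.
  have -> : F n x - f x = 2 * M / n.+1%:R *
      (\sum_(1 <= j < n.+2) (j%:R < y n x)%R%:R - y n x).
    have <- : \sum_(1 <= j < n.+2) \1_[set x | j%:R < y n x] x =
        \sum_(1 <= j < n.+2) (j%:R < y n x)%R%:R :> R.
      apply: eq_bigr => j _; rewrite indicE; congr ((nat_of_bool _)%:R).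
      by apply/idP/idP => [/set_mem|h]//; rewrite mem_set.
    rewrite /F mulrBr; have -> : 2 * M / n.+1%:R * y n x = f x + M.
      by rewrite /y; field; rewrite gt_eqF//= addrC natr1 pnatr_eq0.
    ring.
  have p0 : 0 <= 2 * M / n.+1%:R by rewrite divr_ge0// mulr_ge0// ltW.
  rewrite normrM (ger0_norm p0) -[leRHS]mulr1 ler_wpM2l//.
  exact: count_approx.
apply: (@cl_lim F _ (3 * M)).
- move=> n; apply: clD; first exact: cl_cst.
  apply: clZ; apply: cl_sum => j; apply: cl_indic.
  have mE : measurable_fun setT (fun x => j%:R < y n x).
    apply: measurable_fun_ltr => //; apply: measurable_funM => //.
    by apply: measurable_funM => //; exact: measurable_funD.
  by rewrite -[X in measurable X]setTI; exact: (mE measurableT [set true]).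
- move=> n x; rewrite -(subrK (f x) (F n x)) (le_trans (ler_normD _ _))//.
  have : `|F n x - f x| <= 2 * M.
    rewrite (le_trans (FE n x))// ler_pdivrMr// ler_peMr// ?ler1n//.
    by rewrite mulr_ge0// ltW.
  by have := fM x; lra.
move=> x; apply: cvg_zero; apply: norm_cvg0.
apply: (@squeeze_cvgr _ _ _ _ (fun=> 0) (fun n => 2 * M * n.+1%:R^-1)).
- by apply: nearW => n; rewrite normr_ge0/=; exact: FE.
- exact: cvg_cst.
rewrite -(mulr0 (2 * M)); apply: cvgM; first exact: cvg_cst.
exact: cvg_harmonic.
Qed.

End bounded_closure.

(** * Waves on the circle and on the torus *)

Section cos_periodic.
Variable R : realType.

Lemma cos_shift (x : R) (k : int) : cos (x + k%:~R * (2 * pi)) = cos x.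
Proof.
have pos (n : nat) y : cos (y + n%:R * (2 * pi)) = cos y :> R.
  rewrite [2 * pi]mulr_natl mulr_natl.
  exact: (periodicn (@cosD2pi R)).
case: k => n; first exact: pos.
by rewrite NegzE mulrNz mulNr -[in RHS](subrK (n.+1%:R * (2 * pi)) x) pos.
Qed.

(** After reduction to [[-pi, pi[] the cosine decreases with the distance to 0, so that a superlevel
    set of the cosine is a short arc modulo [2 * pi]. *)
Lemma cos_near (y delta : R) : 0 < delta -> delta < pi -> cos delta < cos y ->
  exists m : int, `|y - m%:~R * (2 * pi)| < delta.
Proof.
move=> d0 dpi cy; have p0 := pi_gt0 R.
pose m : int := Num.floor ((y + pi) / (2 * pi)); exists m.
set z := y - _.
have [z1 z2] : - pi <= z /\ z < pi.
  have := floor_itv ((y + pi) / (2 * pi)); rewrite -/m => /andP[].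
  rewrite ler_pdivlMr ?ltr_pdivrMr ?mulr_gt0// intrD /z; lra.
have zpi : `|z| <= pi by rewrite ler_norml z1 ltW.
rewrite ltNge; apply/negP => dz.
have : cos `|z| <= cos delta.
  move: dz; rewrite le_eqVlt => /orP[/eqP->//|dz].
  apply: ltW; rewrite ltr_cos// in_itv/= ?zpi ?normr_ge0// (ltW d0) ltW//.
  rewrite -/z.
rewrite cos_norm /z -[y - _]/(y - m%:~R * (2 * pi)) -mulNr -mulrNz cos_shift.
by rewrite leNgt cy.
Qed.

End cos_periodic.

Section circle.
Variable R : realType.
Local Notation C := (circle R).

Lemma pi_circle_eq (x y : R) : \pi_C x = \pi_C y <-> exists k : int, x - y = k%:~R * (2 * pi).
Proof.
split=> [/eqquotP/asboolP//|h]; apply/eqquotP; exact/asboolP.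
Qed.

Lemma repr_pi_circle (x : R) : exists k : int, repr (\pi_C x) = x + k%:~R * (2 * pi).
Proof.
have /pi_circle_eq[k e] : \pi_C (repr (\pi_C x)) = \pi_C x by rewrite reprK.
by exists k; rewrite -e addrC subrK.
Qed.

(** A real phase takes the place of complex exponentials: differentiation in [x] shifts the phase by
    [pi / 2], and products of waves are again sums of waves. *)
Definition wave1 (k : int) (b : R) (x : C) : R := cos (k%:~R * repr x + b).

Lemma cos_pi_circle (k : int) (b x : R) :
  cos (k%:~R * repr (\pi_C x) + b) = cos (k%:~R * x + b).
Proof.
have [l ->] := repr_pi_circle x.
by rewrite mulrDr addrAC mulrA -intrM cos_shift.
Qed.

Lemma wave1_pi k b x : wave1 k b (\pi_C x) = cos (k%:~R * x + b).
Proof. exact: cos_pi_circle. Qed.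

Lemma open_measurable_circle (U : set C) : open U -> measurable U.
Proof. by move=> oU; exact: sub_sigma_algebra. Qed.

Lemma measurable_circle (f : C -> R) (g : R -> R) : continuous g ->
  (forall x, f (\pi_C x) = g x) -> measurable_fun setT f.
Proof.
move=> cg fg; apply: (measurability _ (RGenOInfty.measurableE R)) => //.
move=> _ [_ [a ->] <-]; rewrite setTI; apply: open_measurable_circle.
rewrite /open/= /quotient_open -comp_preimage.
have -> : f \o \pi_C = g by apply/funext.
by move/continuousP : cg; apply; exact: interval_open.
Qed.

Lemma continuous_cos_affine (k : int) (b : R) : continuous (fun x : R => cos (k%:~R * x + b)).
Proof.
by move=> x; exact: (drv_cont (drv_cos (drvD (drvZ _ (drv_id x)) (drv_cst b x)))).
Qed.

Lemma bm_wave1 k b : bm (wave1 k b).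
Proof.
split; last by exists 1 => x; exact: cos_max.
exact: (measurable_circle (@continuous_cos_affine k b) (wave1_pi k b)).
Qed.

(** Arcs with rational centre and rational threshold form a countable base of the topology, so that
    superlevel sets of waves generate the Borel sets. *)
Lemma open_circle_arcs (U : set C) : open U ->
  U = \bigcup_n (if unpickle n is Some (q, c) then
     if `[< [set x | ratr c < wave1 1 (- ratr q) x] `<=` U >] then
       [set x | ratr c < wave1 1 (- ratr q) x] else set0 else set0).
Proof.
move=> oU; apply/seteqP; split=> [x Ux|x [n _]]; last first.
  case: (unpickle n) => [[q c]|//]; case: asboolP => // sU; exact: sU.
have : nbhs (repr x) (\pi_C @^-1` U).
  by apply: open_nbhs_nbhs; split; [exact: oU|rewrite /preimage/= reprK].
move=> /nbhs_ballP[e /= e0 eU].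
pose d : R := Num.min e 1 / 2.
have m0 : 0 < Num.min e 1 by rewrite lt_min e0 ltr01.
have d0 : 0 < d by rewrite divr_gt0.
have d1 : d < 1 by rewrite ltr_pdivrMr// mul1r; have : Num.min e 1 <= 1 by [rewrite ge_min lexx orbT|]; lra.
have de : d + d <= e by rewrite -splitr ge_min lexx.
have dpi : d < pi by have := pi_ge2 R; lra.
have [q] := @rat_in_itvoo R (repr x - d) (repr x + d) ltac:(lra).
rewrite in_itv/= => /andP[q1 q2].
have qd : `|repr x - ratr q| < d by rewrite ltr_norml; apply/andP; split; lra.
have cd : cos d < cos (repr x - ratr q).
  rewrite -[ltRHS]cos_norm ltr_cos// in_itv/= ?normr_ge0 ?(ltW d0) ?(ltW dpi)//.
  by rewrite ltW// (lt_trans qd).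
have [c] := rat_in_itvoo cd; rewrite in_itv/= => /andP[c1 c2].
apply: (ex_intro2 _ _ (pickle (q, c)) I); rewrite pickleK asboolT; first by rewrite /= /wave1 mul1r.
move=> y /=; rewrite /wave1 mul1r => cy.
have [m ym] := cos_near d0 dpi (lt_trans c1 cy).
have -> : y = \pi_C (repr y - m%:~R * (2 * pi)).
  rewrite -[LHS]reprK; apply/pi_circle_eq; exists m; ring.
apply: eU; rewrite /ball/=.
have -> : repr x - (repr y - m%:~R * (2 * pi)) =
  (repr x - ratr q) - (repr y - ratr q - m%:~R * (2 * pi)) by ring.
rewrite (le_lt_trans (ler_normB _ _))// (lt_le_trans _ de)//.
by rewrite ltrD// -(_ : repr y - ratr q = repr y - ratr q).
Qed.

Section waves.
Variable N : nat.
Implicit Types (k l : {ffun 'I_N -> int}) (b c : R) (t : N.-tuple C).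

Definition angle k t : R := \sum_i (k i)%:~R * repr (tnth t i).
Definition wave k b t : R := cos (angle k t + b).

Lemma wave_pi k b (x : 'I_N -> R) :
  wave k b [tuple \pi_C (x i) | i < N] = cos (\sum_i (k i)%:~R * x i + b).
Proof.
rewrite /wave /angle.
have [m mE] : exists m : int, \sum_i (k i)%:~R * repr (tnth [tuple \pi_C (x i) | i < N] i) =
    \sum_i (k i)%:~R * x i + m%:~R * (2 * pi).
  elim/big_ind2 : _ => [|u v u' v' [m1 ->] [m2 ->]|i _].
  - by exists 0; rewrite mul0r addr0.
  - by exists (m1 + m2); rewrite intrD; ring.
  have [m e] := repr_pi_circle (x i); rewrite tnth_mktuple e.
  by exists (k i * m); rewrite intrM; ring.
by rewrite mE addrAC cos_shift.
Qed.

Lemma bm_wave k b : bm (wave k b).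
Proof.
have gen (s : seq 'I_N) c : bm (fun t => cos (\sum_(i <- s) (k i)%:~R * repr (tnth t i) + c)).
  elim: s c => [|i s IH] c.
    under eq_fun do rewrite big_nil add0r; exact: bm_cst.
  have -> : (fun t => cos (\sum_(j <- i :: s) (k j)%:~R * repr (tnth t j) + c)) =
      (fun t => wave1 (k i) 0 (tnth t i) * cos (\sum_(j <- s) (k j)%:~R * repr (tnth t j) + c)
       + wave1 (k i) (pi / 2) (tnth t i) *
         cos (\sum_(j <- s) (k j)%:~R * repr (tnth t j) + (c - pi / 2))).
    apply/funext => t; rewrite big_cons -addrA cosD /wave1 addr0 cosDpihalf.
    by rewrite [_ + (c - _)]addrA cosBpihalf; ring.
  have bt (b0 : R) : bm (fun t : N.-tuple C => wave1 (k i) b0 (tnth t i)).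
    by apply: (@bm_comp _ _ _ _ _ (wave1 (k i) b0)); [exact: measurable_tnth|exact: bm_wave1].
  by apply: bmD; apply: bmM.
exact: gen.
Qed.

Lemma angleD k l t : angle (k + l) t = angle k t + angle l t.
Proof.
by rewrite /angle -big_split/=; apply: eq_bigr => i _; rewrite ffunE intrD mulrDl.
Qed.

Lemma angleB k l t : angle (k - l) t = angle k t - angle l t.
Proof.
rewrite /angle -sumrB; apply: eq_bigr => i _.
by rewrite !ffunE intrD mulrDl mulrNz mulNr.
Qed.

Lemma waveM k l b c t : wave k b t * wave l c t =
  2^-1 * wave (k + l) (b + c) t + 2^-1 * wave (k - l) (b - c) t.
Proof.
rewrite /wave angleD angleB [_ + (b + c)]addrACA.
have -> : angle k t - angle l t + (b - c) = (angle k t + b) - (angle l t + c) by ring.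
move: (angle k t + b) (angle l t + c) => u v.
by rewrite (cosD u v) (cosB u v); field.
Qed.

Lemma wave0 b t : wave 0 b t = cos b.
Proof.
by rewrite /wave /angle big1 ?add0r// => i _; rewrite ffunE mul0r.
Qed.

(* The term [(a, k, b)] stands for [a * cos (k . theta + b)]. *)
Definition tpoly := seq (R * {ffun 'I_N -> int} * R).
Implicit Types p q : tpoly.

Definition teval p t : R := \sum_(w <- p) w.1.1 * wave w.1.2 w.2 t.

Lemma bm_teval p : bm (teval p).
Proof. by apply: bm_sum => w; apply: bmZ; exact: bm_wave. Qed.

Definition tmul p q : tpoly := [seq (w.1.1 * v.1.1 / 2, w.1.2 + v.1.2, w.2 + v.2) | w <- p, v <- q]
  ++ [seq (w.1.1 * v.1.1 / 2, w.1.2 - v.1.2, w.2 - v.2) | w <- p, v <- q].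

Lemma teval_cat p q t : teval (p ++ q) t = teval p t + teval q t.
Proof. exact: big_cat. Qed.

Lemma tevalM p q t : teval (tmul p q) t = teval p t * teval q t.
Proof.
rewrite teval_cat /teval !big_allpairs_dep -big_split/= mulr_suml.
apply: eq_bigr => w _; rewrite -big_split/= mulr_sumr; apply: eq_bigr => v _ /=.
by rewrite [RHS]mulrACA waveM; field.
Qed.

Definition single (i : 'I_N) (m : int) : {ffun 'I_N -> int} := [ffun j => if j == i then m else 0].

Lemma wave_single i (m : int) b t : wave (single i m) b t = wave1 m b (tnth t i).
Proof.
rewrite /wave /angle (bigD1 i)//= ffunE eqxx big1 ?addr0// => j /negbTE ji.
by rewrite ffunE ji mul0r.
Qed.

(** Trigonometric polynomials form an algebra, and the sets where they are positive include the arcs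
    in each coordinate, which generate the product sigma-algebra. *)
Theorem tpoly_bounded_closed (D : (N.-tuple C -> R) -> Prop) :
  (forall p, D (teval p)) -> bounded_closed D -> forall f, bm f -> D f.
Proof.
move=> Dp bD; apply: (@bounded_closed_bm _ _ _ (fun f => exists p, f = teval p)) bD.
- by move=> _ [p ->]; exact: bm_teval.
- move=> c; exists [:: (c, 0, 0)]; apply/funext => t.
  by rewrite /teval big_seq1/= wave0 cos0 mulr1.
- by move=> _ _ [p ->] [q ->]; exists (p ++ q); apply/funext => t; rewrite teval_cat.
- by move=> _ _ [p ->] [q ->]; exists (tmul p q); apply/funext => t; rewrite tevalM.
- move=> S sS Spos E mE.
  suff : @measurable _ (N.-tuple C) `<=` S by exact.
  apply: smallest_sub => // {E mE} E.
  have ex F : (\big[setU/set0]_(i < N) F i) E -> exists i : 'I_N, F i E.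
    by elim/big_ind : _ => [//|X Y HX HY [/HX|/HY]//|i _ h]; exists i.
  move=> /ex[i [B mB <-]]; rewrite setTI => {ex E}.
  case: sS => S0 SC SU.
  suff : @measurable _ C `<=` [set B | S ((fun t : N.-tuple C => tnth t i) @^-1` B)] by exact.
  apply: smallest_sub => {B mB}.
    split => /=; first by rewrite preimage_set0.
      by move=> B SB; exact: (SC _ SB).
    by move=> B SB; rewrite preimage_bigcup; exact: SU.
  move=> U oU; rewrite /= (open_circle_arcs oU) preimage_bigcup; apply: SU => n.
  case: (unpickle n) => [[q c]|]; last by rewrite preimage_set0.
  case: ifPn => _; last by rewrite preimage_set0.
  have := Spos _ (ex_intro _ [:: (1, single i 1, - ratr q); (- ratr c, 0, 0)] erefl).
  congr S; apply/seteqP; split=> t /=; rewrite /teval big_cons big_seq1/= wave0 cos0 mulr1;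
    by rewrite mul1r wave_single subr_gt0.
- by move=> _ [p ->].
Qed.

End waves.

Theorem tpoly1_bounded_closed (D : (C -> R) -> Prop) :
  (forall s : seq (R * int * R), D (fun x => \sum_(w <- s) w.1.1 * wave1 w.1.2 w.2 x)) ->
  bounded_closed D -> forall f, bm f -> D f.
Proof.
move=> Ds bD f bf; pose i0 : 'I_1 := ord0.
have -> : f = (fun x => (f \o (fun t : 1.-tuple C => tnth t i0)) [tuple x]) by [].
apply: (@tpoly_bounded_closed 1 (fun g => D (fun x => g [tuple x]))).
- move=> p; have := Ds [seq (w.1.1, (w.1.2 : {ffun 'I_1 -> int}) i0, w.2) | w <- (p : seq (R * {ffun 'I_1 -> int} * R))].
  congr D; apply/funext => x; rewrite big_map; apply: eq_bigr => w _ /=.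
  by rewrite /wave /angle big_ord1 /wave1.
- by move=> F g M DF FM Fg; apply: (bD _ _ M DF) => [n x|x]; [exact: FM|exact: Fg].
- by apply: (@bm_comp _ _ _ _ _ f) bf; exact: measurable_tnth.
Qed.

(** The addition formula splits off the first coordinate at the price of two products; expectations
    of waves under tensor powers can then be treated by induction on the dimension. *)
Lemma wave_cons n (k : {ffun 'I_n.+1 -> int}) b x (t : n.-tuple C) :
  wave k b (cons_pair (x, t)) =
  wave1 (k ord0) b x * wave [ffun i => k (lift ord0 i)] 0 t
  + wave1 (k ord0) (b + pi / 2) x * wave [ffun i => k (lift ord0 i)] (- (pi / 2)) t.
Proof.
rewrite /wave /angle big_ord_recl/= /wave1 addrA cosDpihalf cosBpihalf addr0.
have -> : \sum_(i < n) (k (lift ord0 i))%:~R * repr (tnth [tuple of x :: t] (lift ord0 i)) =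
    \sum_i ([ffun i => k (lift ord0 i)] i)%:~R * repr (tnth t i).
  by apply: eq_bigr => i _; rewrite ffunE; congr (_ * repr _); rewrite !(tnth_nth x).
by rewrite addrAC cosD mulNr.
Qed.

End circle.

(** * Quadratic exponential moments *)

Section exponential_moment.
Context d (T : measurableType d) (R : realType) (P : probability T R).
Variables (g1 g2 : T -> R) (kappa : R).
Hypotheses (bg1 : bm g1) (bg2 : bm g2).
Hypothesis (kappa0 : 0 <= kappa).
Hypothesis g4 : forall x, g1 x ^+ 2 + g2 x ^+ 2 <= 4.
Hypothesis subg : forall a1 a2 : R,
  esp P (fun x => expR (a1 * g1 x + a2 * g2 x)) <= expR (kappa * (a1 ^+ 2 + a2 ^+ 2) / 4).

Definition tsum (g : T -> R) n (t : n.-tuple T) : R := \sum_(i < n) g (tnth t i).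

Lemma tsum_cons g n x (t : n.-tuple T) : tsum g (cons_pair (x, t)) = g x + tsum g t.
Proof.
rewrite /tsum big_ord_recl/=; congr (_ + _); apply: eq_bigr => i _.
by congr g; rewrite !(tnth_nth x).
Qed.

Lemma bm_tnth (g : T -> R) n (i : 'I_n) : bm g -> bm (fun t : n.-tuple T => g (tnth t i)).
Proof. by move=> bg; apply: (@bm_comp _ _ _ _ _ g) bg; exact: measurable_tnth. Qed.

Lemma bm_tsum (g : T -> R) n : bm g -> bm (fun t : n.-tuple T => tsum g t).
Proof. by move=> bg; apply: bm_sum => i; exact: bm_tnth. Qed.

(** The shift [(x1, x2)] lets the induction absorb one coordinate at a time. Integrating the other
    [n] coordinates turns [q] into [q / (1 - kappa * q * n%:R)]; the absorbed coordinate then enters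
    through a linear term, controlled by [subg], and a square, controlled by [g4]. *)
Lemma exp_moment n (q x1 x2 : R) : 0 <= q -> kappa * q * n%:R < 1 ->
  esp (tensor_power P n)
    (fun t => expR (q * ((x1 + tsum g1 t) ^+ 2 + (x2 + tsum g2 t) ^+ 2))) <=
  expR (q * (x1 ^+ 2 + x2 ^+ 2 + 4 * n%:R) / (1 - kappa * q * n%:R)).
Proof.
move=> q0; elim: n x1 x2 => [|n IH] x1 x2 qn.
  rewrite esp_tensor0; last first.
    by apply: bm_exp; apply: bmZ; apply: bmD; apply: bmX; apply: bmD;
      [exact: bm_cst|exact: bm_tsum|exact: bm_cst|exact: bm_tsum].
  by rewrite /tsum !big_ord0 !addr0 !mulr0 subr0 divr1 addr0.
have bq m y1 y2 : bm (fun t : m.-tuple T =>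
    expR (q * ((y1 + tsum g1 t) ^+ 2 + (y2 + tsum g2 t) ^+ 2))).
  by apply: bm_exp; apply: bmZ; apply: bmD; apply: bmX; apply: bmD;
      [exact: bm_cst|exact: bm_tsum|exact: bm_cst|exact: bm_tsum].
have kq0 : 0 <= kappa * q by rewrite mulr_ge0.
have qn' : kappa * q * n%:R < 1.
  by apply: le_lt_trans qn; rewrite ler_wpM2l// ler_nat.
rewrite esp_tensorS//.
set d' := 1 - kappa * q * n%:R; set e := 1 - kappa * q * n.+1%:R.
have eE : e = d' - kappa * q by rewrite /e /d' -natr1 mulrDr mulr1; ring.
have e0 : 0 < e by rewrite subr_gt0.
have d0 : 0 < d' by rewrite subr_gt0.
pose q' := q / d'.
have q'0 : 0 <= q' by rewrite divr_ge0// ltW.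
set X := x1 ^+ 2 + x2 ^+ 2.
have X0 : 0 <= X by rewrite addr_ge0// sqr_ge0.
have be : bm (fun x => expR (2 * q' * x1 * g1 x + 2 * q' * x2 * g2 x)).
  by apply: bm_exp; apply: bmD; exact: bmZ.
apply: (@le_trans _ _ (esp P (fun x => expR (q' * (X + 4 * n.+1%:R)) *
    expR (2 * q' * x1 * g1 x + 2 * q' * x2 * g2 x)))).
  apply: le_esp; [|exact: bmZ|move=> x].
    exact: (bm_esp2 (tensor_power P n) (f := fun x t => _) (bm_cons (bq n.+1 x1 x2))).
  have -> : (fun t : n.-tuple T => expR (q * ((x1 + tsum g1 (cons_pair (x, t))) ^+ 2 +
      (x2 + tsum g2 (cons_pair (x, t))) ^+ 2))) = (fun t : n.-tuple T =>
      expR (q * ((x1 + g1 x + tsum g1 t) ^+ 2 + (x2 + g2 x + tsum g2 t) ^+ 2))).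
    by apply/funext => t; rewrite !tsum_cons !addrA.
  apply: (le_trans (IH _ _ qn')); rewrite -expRD ler_expR.
  rewrite -/d' mulrAC -/(q') -natr1 /X.
  have := g4 x; move: (g1 x) (g2 x) => u v uv.
  rewrite -subr_ge0 [leRHS](_ : _ = q' * (4 - (u ^+ 2 + v ^+ 2))); last by ring.
  by rewrite mulr_ge0// subr_ge0.
rewrite espZ//; apply: (le_trans (ler_wpM2l (expR_ge0 _) (subg _ _))).
rewrite -expRD ler_expR.
have -> : kappa * ((2 * q' * x1) ^+ 2 + (2 * q' * x2) ^+ 2) / 4 = kappa * q' ^+ 2 * X.
  by rewrite /X; field.
(* The function [s |-> q / (1 - kappa * q * s)] solves [u' = kappa * u ^+ 2] and is convex, so that
   one explicit Euler step of length 1 stays below it. *)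
have qe : q' + kappa * q' ^+ 2 <= q / e.
  rewrite -subr_ge0.
  have -> : q / e - (q' + kappa * q' ^+ 2) = (kappa * q ^+ 2) * (kappa * q) / (d' ^+ 2 * e).
    rewrite /q' eE; field; rewrite -eE !gt_eqF//.
  apply: divr_ge0; last by rewrite ltW// mulr_gt0// exprn_gt0.
  by apply: mulr_ge0 => //; apply: mulr_ge0 => //; exact: sqr_ge0.
have q'e : q' <= q / e by rewrite (le_trans _ qe)// lerDl mulr_ge0// sqr_ge0.
rewrite -subr_ge0 [leRHS](_ : _ =
  (q / e - (q' + kappa * q' ^+ 2)) * X + (q / e - q') * (4 * n.+1%:R)); last by ring.
by rewrite addr_ge0// mulr_ge0// subr_ge0.
Qed.

End exponential_moment.

(** * Entropy and its tensorization *)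

Lemma eq_ler (R : numDomainType) (x y : R) : x = y -> x <= y.
Proof. by move=> ->. Qed.

Section entropy.
Context d (T : measurableType d) (R : realType) (P : probability T R).
Implicit Types F G : T -> R.

Definition ent F := esp P (fun x => F x * ln (F x)) - esp P F * ln (esp P F).

Lemma esp_gt0 F c : 0 < c -> (forall x, c <= F x) -> bm F -> 0 < esp P F.
Proof. by move=> c0 cF bF; apply: lt_le_trans c0 _; exact: esp_ge. Qed.

Lemma bm_xlnx F c : 0 < c -> (forall x, c <= F x) -> bm F -> bm (fun x => F x * ln (F x)).
Proof. by move=> c0 cF bF; apply: bmM => //; exact: bm_ln cF bF. Qed.

(** Integrate [F] times the inequality [1 + y <= expR y] at [y = (G - ln B) - (ln F - ln A)]. This
    is how entropy controls expectations under the measure with density proportional to [F]. *)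
Lemma gibbs_variational F G c : 0 < c -> (forall x, c <= F x) -> bm F -> bm G ->
  esp P (fun x => F x * G x) <= ent F + esp P F * ln (esp P (fun x => expR (G x))).
Proof.
move=> c0 cF bF bG; set A := esp P F; set B := esp P (fun x => expR (G x)).
have A0 : 0 < A by exact: esp_gt0 cF bF.
have beG := bm_exp bG.
have B0 : 0 < B.
  have [_ [M GM]] := bG; apply: (@esp_gt0 _ (expR (- M))) => //; first exact: expR_gt0.
  by move=> x; rewrite ler_expR; have := GM x; rewrite ler_norml => /andP[].
have bxl := bm_xlnx c0 cF bF.
have bFG := bmM bF bG.
have pt x : F x * G x <= F x * ln (F x) + (ln B - ln A - 1) * F x + A / B * expR (G x).
  have F0 : 0 < F x by exact: lt_le_trans (cF x).
  have h := ler_wpM2l (ltW F0) (expR_ge1Dx (G x - ln B - (ln (F x) - ln A))).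
  have e : F x * expR (G x - ln B - (ln (F x) - ln A)) = A / B * expR (G x).
    by rewrite !expRB !lnK ?posrE//; field; rewrite !gt_eqF.
  by rewrite e in h; lra.
have h := le_esp P bFG (bmD (bmD bxl (bmZ _ bF)) (bmZ (A / B) beG)) pt.
apply: (le_trans h); rewrite espD ?espD ?espZ//.
all: try by do ?[assumption|apply: bmD|apply: bmZ].
rewrite -/A -/B divfK ?gt_eqF// /ent -/A.
by apply: eq_ler; ring.
Qed.

Lemma ent_ge0 F c : 0 < c -> (forall x, c <= F x) -> bm F -> 0 <= ent F.
Proof.
move=> c0 cF bF; have := gibbs_variational c0 cF bF (bm_cst T 0).
by rewrite expR0 !esp_cst ln1 mulr0 addr0; under eq_fun do rewrite mulr0; rewrite esp_cst.
Qed.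

End entropy.

Section entropy_convexity.
Context d1 d2 (T1 : measurableType d1) (T2 : measurableType d2) (R : realType).
Variables (P : probability T1 R) (Q : probability T2 R) (F : T1 * T2 -> R) (c : R).
Hypotheses (c0 : 0 < c) (cF : forall z, c <= F z) (bF : bm F).

Let slice2 y : bm (fun x => F (x, y)).
Proof. by apply: (@bm_comp _ _ _ _ _ F (pair^~ y)) bF; exact: pair2_measurable. Qed.

Let bswap : bm (fun z : T2 * T1 => F (z.2, z.1)).
Proof.
apply: (@bm_comp _ _ _ _ _ F (fun z : T2 * T1 => (z.2, z.1))) bF.
by apply/measurable_fun_pairP; split; [exact: measurable_snd|exact: measurable_fst].
Qed.

Lemma bm_ent : bm (fun x => ent Q (fun y => F (x, y))).
Proof.
have b1 := bm_xlnx c0 cF bF.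
have e : bm (fun x => esp Q (fun y => F (x, y))).
  by apply: (bm_esp2 Q (f := fun x y => F (x, y))); under eq_fun do rewrite -surjective_pairing.
apply: bmB.
  apply: (bm_esp2 Q (f := fun x y => F (x, y) * ln (F (x, y)))).
  by under eq_fun do rewrite -surjective_pairing.
apply: bmM => //; apply: (bm_ln c0) => // x.
by apply: esp_ge => //; exact: bm_slice1.
Qed.

(* Test the variational formula for each slice with the maximiser for the average. *)
Lemma ent_esp_le : ent P (fun x => esp Q (fun y => F (x, y))) <=
  esp Q (fun y => ent P (fun x => F (x, y))).
Proof.
set Fb := fun x => esp Q (fun y => F (x, y)).
have bFb : bm Fb by exact: bm_esp.
have cFb x : c <= Fb x by apply: esp_ge => //; exact: bm_slice1.
have lFb : bm (fun x => ln (Fb x)) by exact: bm_ln cFb bFb.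
set A := esp P Fb; have A0 : 0 < A by exact: esp_gt0 cFb bFb.
pose G x := ln (Fb x) - ln A.
have bG : bm G by apply: bmB => //; exact: bm_cst.
have eG : esp P (fun x => expR (G x)) = 1.
  have -> : (fun x => expR (G x)) = (fun x => A^-1 * Fb x).
    apply/funext => x; rewrite expRB !lnK ?posrE//; first by rewrite mulrC.
    exact: lt_le_trans (cFb x).
  by rewrite espZ// mulVf// gt_eqF.
have bFG : bm (fun z => F z * G z.1).
  apply: bmM => //; apply: (@bm_comp _ _ _ _ _ G fst) bG; exact: measurable_fst.
have -> : ent P Fb = esp Q (fun y => esp P (fun x => F (x, y) * G x)).
  rewrite -(esp_prod_swap P Q bFG) /= /ent -/A.
  have -> : (fun x => esp Q (fun y => F (x, y) * G x)) = (fun x => Fb x * ln (Fb x) - Fb x * ln A).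
    apply/funext => x; rewrite espZr; last exact: bm_slice1.
    by rewrite -/(Fb x) /G mulrBr.
  rewrite espB; [by rewrite espZr|by apply: bmM|by apply: bmM => //; exact: bm_cst].
apply: le_esp.
- apply: (bm_esp Q P (f := fun z : T2 * T1 => F (z.2, z.1) * G z.2)).
  by apply: bmM => //; apply: (@bm_comp _ _ _ _ _ G snd) bG; exact: measurable_snd.
- have b1 : bm (fun z : T2 * T1 => F (z.2, z.1) * ln (F (z.2, z.1))).
    exact: (bm_xlnx c0 (fun z => cF _) bswap).
  have be := bm_esp Q P bswap.
  apply: bmB; first exact: (bm_esp Q P b1).
  apply: bmM => //; apply: (bm_ln c0) => // y.
  by apply: esp_ge => //; exact: slice2.
move=> y; have := gibbs_variational P c0 (fun x => cF (x, y)) (slice2 y) bG.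
by rewrite eG ln1 mulr0 addr0.
Qed.

End entropy_convexity.

Section tensorization.
Context d (T : measurableType d) (R : realType) (P : probability T R).

(** Resampling one coordinate expresses conditional entropies given all the others without splitting
    the tuple at [i]. *)
Definition upd n (i : 'I_n) (y : T) (t : n.-tuple T) : n.-tuple T :=
  [tuple if j == i then y else tnth t j | j < n].

Lemma measurable_upd n (i : 'I_n) :
  measurable_fun setT (fun z : n.-tuple T * T => upd i z.2 z.1).
Proof.
apply/measurable_fun_tnthP => j.
have -> : (tnth (T:=T))^~ j \o (fun z : n.-tuple T * T => upd i z.2 z.1) =
    (fun z => if j == i then z.2 else tnth z.1 j).
  by apply/funext => z; rewrite /= tnth_mktuple.
case: eqP => _; first exact: measurable_snd.
by apply: (measurableT_comp (measurable_tnth j)); exact: measurable_fst.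
Qed.

Lemma bm_upd n (i : 'I_n) (F : n.-tuple T -> R) : bm F ->
  bm (fun z : n.-tuple T * T => F (upd i z.2 z.1)).
Proof. by move=> bF; apply: (@bm_comp _ _ _ _ _ F) bF; exact: measurable_upd. Qed.

Lemma upd0_cons n (x y : T) (t : n.-tuple T) :
  upd ord0 y (cons_pair (x, t)) = cons_pair (y, t).
Proof.
apply: eq_from_tnth => j; rewrite tnth_mktuple.
case: (unliftP ord0 j) => [k|] ->; last by rewrite eqxx.
by rewrite eq_sym (negbTE (neq_lift _ _)) !(tnth_nth x).
Qed.

Lemma updS_cons n (i : 'I_n) (x y : T) (t : n.-tuple T) :
  upd (lift ord0 i) y (cons_pair (x, t)) = cons_pair (x, upd i y t).
Proof.
apply: eq_from_tnth => j; rewrite tnth_mktuple.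
case: (unliftP ord0 j) => [k|] ->; last by rewrite (negbTE (neq_lift _ _)).
have tS (u : n.-tuple T) : tnth (cons_pair (x, u)) (lift ord0 k) = tnth u k.
  by rewrite !(tnth_nth x).
by rewrite (inj_eq lift_inj) !tS tnth_mktuple.
Qed.

Lemma esp_upd n (i : 'I_n) (F : n.-tuple T -> R) : bm F ->
  esp (tensor_power P n) (fun t => esp P (fun y => F (upd i y t))) = esp (tensor_power P n) F.
Proof.
elim: n i F => [|n IH] i F bF; first by case: i.
have bFc := bm_cons bF.
have bu := bm_esp (tensor_power P n.+1) P (bm_upd i bF).
rewrite esp_tensorS// esp_tensorS//.
case: (unliftP ord0 i) bu => [j|] -> bu.
  apply: eq_esp => x; rewrite -(IH j (fun t => F (cons_pair (x, t)))); last first.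
    exact: (bm_slice1 x bFc).
  by apply: eq_esp => t; apply: eq_esp => y; rewrite updS_cons.
have -> : (fun x => esp (tensor_power P n) (fun t => esp P (fun y => F (upd ord0 y (cons_pair (x, t)))))) =
    (fun=> esp (tensor_power P n) (fun t => esp P (fun y => F (cons_pair (y, t))))).
  by apply/funext => x; apply: eq_esp => t; apply: eq_esp => y; rewrite upd0_cons.
by rewrite esp_cst -(esp_prod_swap P (tensor_power P n) bFc).
Qed.

(** Induction on the dimension, from the chain rule for entropy and the convexity of entropy in
    [ent_esp_le]. *)
Theorem ent_tensor n (F : n.-tuple T -> R) c : 0 < c -> (forall t, c <= F t) -> bm F ->
  ent (tensor_power P n) F <=
  \sum_(i < n) esp (tensor_power P n) (fun t => ent P (fun y => F (upd i y t))).
Proof.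
move=> c0; elim: n F => [|n IH] F cF bF.
  rewrite big_ord0 /ent !esp_tensor0//; last exact: bm_xlnx cF bF.
  by rewrite subrr.
have bFc := bm_cons bF; have cFc z : c <= F (@cons_pair _ T n z) by exact: cF.
have bswap : bm (fun z : n.-tuple T * T => F (cons_pair (z.2, z.1))).
  apply: (@bm_comp _ _ _ _ _ (fun z => F (cons_pair z)) (fun z : n.-tuple T * T => (z.2, z.1))) bFc.
  by apply/measurable_fun_pairP; split; [exact: measurable_snd|exact: measurable_fst].
set Q := tensor_power P n.
pose Fb t := esp P (fun x => F (cons_pair (x, t))).
have bFb : bm Fb by exact: (bm_esp Q P bswap).
have sl t : bm (fun x => F (cons_pair (x, t))) by exact: (bm_slice1 t bswap).
have cFb t : c <= Fb t by apply: esp_ge => // x; exact: cF.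
have bx := bm_xlnx c0 cF bF; have bxb := bm_xlnx c0 cFb bFb.
have bent : bm (fun t => ent P (fun x => F (cons_pair (x, t)))).
  by apply: (bm_ent P c0 (F := fun z : n.-tuple T * T => F (cons_pair (z.2, z.1)))).
(* The chain rule: mean conditional entropy of the first coordinate plus entropy of the average
   [Fb], exact because the means of [Fb * ln Fb] cancel. *)
have -> : ent (tensor_power P n.+1) F =
    esp Q (fun t => ent P (fun x => F (cons_pair (x, t)))) + ent Q Fb.
  rewrite /ent !esp_tensorS// (esp_prod_swap P Q bFc) (esp_prod_swap P Q (bm_cons bx)).
  have bxs : bm (fun z : n.-tuple T * T => F (cons_pair (z.2, z.1)) * ln (F (cons_pair (z.2, z.1)))).
    exact: (bm_xlnx c0 (fun z => cF _) bswap).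
  rewrite espB//; last exact: (bm_esp Q P bxs).
  by rewrite -/Q /Fb; ring.
rewrite big_ord_recl; apply: lerD.
  rewrite esp_tensorS; last exact: (bm_ent P c0 (fun z => cF _) (bm_upd ord0 bF)).
  apply: eq_ler.
  have -> : (fun x => esp Q (fun t => ent P (fun y => F (upd ord0 y (cons_pair (x, t)))))) =
      (fun=> esp Q (fun t => ent P (fun y => F (cons_pair (y, t))))).
    apply/funext => x; apply: eq_esp => t; congr (ent P _).
    by apply/funext => y; rewrite upd0_cons.
  by rewrite esp_cst.
(* The induction hypothesis concerns [Fb]; in each summand convexity moves the average over the
   first coordinate out of the entropy. *)
apply: (le_trans (IH Fb cFb bFb)); apply: ler_sum => i _.
rewrite esp_tensorS; last exact: (bm_ent P c0 (fun z => cF _) (bm_upd (lift ord0 i) bF)).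
have mu2 : measurable_fun setT (fun w : (T * n.-tuple T) * T => upd i w.2 w.1.2).
  have -> : (fun w : (T * n.-tuple T) * T => upd i w.2 w.1.2) =
    (fun z : n.-tuple T * T => upd i z.2 z.1) \o (fun w => (w.1.2, w.2)) by [].
  apply: (measurableT_comp (measurable_upd i)); apply/measurable_fun_pairP.
  by split; [exact: (measurableT_comp measurable_snd measurable_fst)|exact: measurable_snd].
have mc : measurable_fun setT (fun w : (T * n.-tuple T) * T => (w.1.1, upd i w.2 w.1.2)).
  by apply/measurable_fun_pairP; split; [exact: (measurableT_comp measurable_fst measurable_fst)|exact: mu2].
have b2 : bm (fun w : (T * n.-tuple T) * T => F (cons_pair (w.1.1, upd i w.2 w.1.2))).
  exact: (bm_comp mc bFc).
have b3 : bm (fun z : T * n.-tuple T => ent P (fun y => F (cons_pair (z.1, upd i y z.2)))).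
  exact: (bm_ent P c0 (F := fun w : (T * n.-tuple T) * T => F (cons_pair (w.1.1, upd i w.2 w.1.2)))).
have -> : esp P (fun x => esp Q (fun t => ent P (fun y => F (upd (lift ord0 i) y (cons_pair (x, t)))))) =
    esp Q (fun t => esp P (fun x => ent P (fun y => F (cons_pair (x, upd i y t))))).
  rewrite -(esp_prod_swap P Q b3); apply: eq_esp => x; apply: eq_esp => t /=.
  by congr (ent P _); apply/funext => y; rewrite updS_cons.
have b3s : bm (fun z : n.-tuple T * T => ent P (fun y => F (cons_pair (z.2, upd i y z.1)))).
  apply: (@bm_comp _ _ _ _ _ _ (fun z : n.-tuple T * T => (z.2, z.1)) _ b3).
  by apply/measurable_fun_pairP; split; [exact: measurable_snd|exact: measurable_fst].
apply: le_esp.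
- apply: (bm_ent P c0 (F := fun z : n.-tuple T * T => Fb (upd i z.2 z.1))) => //.
  exact: bm_upd.
- exact: (bm_esp Q P b3s).
move=> t.
have b4 : bm (fun z : T * T => F (cons_pair (z.2, upd i z.1 t))).
  apply: (@bm_comp _ _ _ _ _ (fun z => F (cons_pair z)) (fun z : T * T => (z.2, upd i z.1 t))) bFc.
  have mu3 : measurable_fun setT (fun z : T * T => upd i z.1 t).
    have -> : (fun z : T * T => upd i z.1 t) =
      (fun z : n.-tuple T * T => upd i z.2 z.1) \o (fun z => (t, z.1)) by [].
    apply: (measurableT_comp (measurable_upd i)); apply/measurable_fun_pairP.
    by split; [exact: measurable_cst|exact: measurable_fst].
  by apply/measurable_fun_pairP; split; [exact: measurable_snd|exact: mu3].
exact: (ent_esp_le P P c0 (F := fun z : T * T => F (cons_pair (z.2, upd i z.1 t)))).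
Qed.

End tensorization.

(** * The logarithmic Sobolev inequality on the circle *)

Section uniform_circle.
Variable R : realType.
Implicit Types (f g F : R -> R).
Local Notation leb := (@lebesgue_measure R).

Lemma continuous_integrable f (a b : R) : continuous f ->
  leb.-integrable `[a, b] (EFin \o f).
Proof.
move=> cf; apply: continuous_compact_integrable; first exact: segment_compact.
exact: continuous_subspaceT.
Qed.

Lemma FTC f F (a b : R) : a < b -> (forall x, a <= x <= b -> {for x, continuous f}) ->
  (forall x, a <= x <= b -> is_derive x 1 F (f x)) ->
  \int[leb]_(x in `[a, b]) f x = F b - F a.
Proof.
move=> ab cf dF.
have cF x : a <= x <= b -> {for x, continuous F} by move=> h; exact: drv_cont (dF x h).
rewrite /Rintegral (@continuous_FTC2 _ f F)//.
- apply: continuous_in_subspaceT => x; rewrite inE/= in_itv/=; exact: cf.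
- split.
  + move=> x; rewrite in_itv/= => /andP[ax xb].
    by apply: (@ex_derive _ _ _ _ _ _ _ (dF x _)); rewrite !ltW.
  + apply: cvg_at_right_filter; apply: cF; rewrite lexx ltW//.
  + apply: cvg_at_left_filter; apply: cF; rewrite lexx ltW//.
move=> x; rewrite in_itv/= => /andP[ax xb].
rewrite derive1E; apply: (@derive_val _ _ _ _ _ _ _ (dF x _)).
by rewrite !ltW.
Qed.

Lemma twopi_gt0 : 0 < 2 * pi :> R.
Proof. by rewrite mulr_gt0// pi_gt0. Qed.

(** The uniform law is placed on the line rather than on the circle, so that one-variable calculus
    applies directly to periodic lifts. *)
Definition unif := uniform_prob twopi_gt0.

Lemma esp_unif f : bm f ->
  esp unif f = (2 * pi)^-1 * \int[leb]_(x in `[0, 2 * pi]) f x.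
Proof.
have p0 := twopi_gt0.
have bint g : bm g -> leb.-integrable `[0, 2 * pi] (EFin \o g).
  move=> [mg [M gM]]; apply: measurable_bounded_integrable => //.
  - suff : (leb `[0%R, (2 * pi)%R]%classic < +oo)%E by exact.
    by rewrite lebesgue_measure_itv/= lte_fin p0 -EFinB ltry.
  - exact: measurable_funTS.
  - exists M; split; first exact: num_real.
    by move=> y My x _ /=; rewrite (le_trans (gM x))// ltW.
(* Nonnegative integrands are treated first; a general one is shifted by its bound [M]. *)
have pos g : bm g -> (forall x, 0 <= g x) ->
    esp unif g = (2 * pi)^-1 * \int[leb]_(x in `[0, 2 * pi]) g x.
  move=> bg g0; have [mg _] := bg; rewrite /esp /Rintegral /unif integral_uniform//.
  - rewrite fineM ?subr0//; apply: integrable_fin_num => //.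
    exact: bint.
  - by apply/measurable_EFinP.
move=> bf; have [mf [M fM]] := bf.
have M0 : 0 <= M by rewrite (le_trans _ (fM 0)).
have bfM : bm (fun x => f x + M) by apply: bmD => //; exact: bm_cst.
have := pos _ bfM (fun x => _); rewrite espD ?esp_cst//; last exact: bm_cst.
move=> /(_ _) e.
have {}e : esp unif f + M = (2 * pi)^-1 * \int[leb]_(x in `[0, 2 * pi]) (f x + M).
  by apply: e => x; have := fM x; rewrite ler_norml => /andP[]; lra.
apply: (addIr M); rewrite e RintegralD//; [|exact: bint|apply: bint; exact: bm_cst].
rewrite mulrDr; congr (_ + _).
have -> : \int[leb]_(x in `[0, 2 * pi]) M = M * (2 * pi).
  rewrite Rintegral_cst//; congr (_ * _); rewrite -[RHS]/(fine (2 * pi)%:E); congr fine.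
  transitivity (leb `[0%R, (2 * pi)%R]%classic) => //.
  by rewrite lebesgue_measure_itv/= lte_fin p0 -EFinB subr0.
by rewrite mulrCA mulVf ?mulr1// gt_eqF.
Qed.

Lemma esp_unif_FTC f F : bm f -> continuous f ->
  (forall x : R, is_derive x 1 F (f x)) -> F (2 * pi) = F 0 -> esp unif f = 0.
Proof.
move=> bf cf dF F0; rewrite esp_unif// (FTC twopi_gt0 (fun x _ => cf x) (fun x _ => dF x)).
by rewrite F0 subrr mulr0.
Qed.

Lemma esp_unif_wave (k : int) b :
  esp unif (fun x => cos (k%:~R * x + b)) = if k == 0 then cos b else 0.
Proof.
case: eqP => [->|/eqP k0].
  by under eq_fun do rewrite mul0r add0r; rewrite esp_cst.
have bc : bm (fun x : R => cos (k%:~R * x + b)).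
  split; last by exists 1 => x; exact: cos_max.
  by apply: continuous_measurable_fun; exact: continuous_cos_affine.
have k0' : k%:~R != 0 :> R by rewrite intr_eq0.
apply: (@esp_unif_FTC _ (fun x => k%:~R^-1 * cos (k%:~R * x + (b - pi / 2)))) => //.
- exact: continuous_cos_affine.
- move=> x; apply: (drv_eq (drvZ _ (drv_cos_affine _ _ x))).
  by rewrite mulrA mulVf// mul1r subrK.
by rewrite mulr0 addrC cos_shift add0r.
Qed.

(* Both sides only see the values of [g] on the circle, so that it suffices to
   compare them on waves. *)
Lemma esp_unif_shift g c : continuous g -> (exists M, forall x, `|g x| <= M) ->
  (forall x, g (x + 2 * pi) = g x) -> esp unif (fun x => g (x + c)) = esp unif g.
Proof.
move=> cg [M gM] gper.
have gz (x : R) (k : int) : g (x + k%:~R * (2 * pi)) = g x.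
  have pos (n : nat) y : g (y + n%:R * (2 * pi)) = g y.
    elim: n y => [|n IH] y; first by rewrite mul0r addr0.
    by rewrite -natr1 mulrDl mul1r addrA gper IH.
  case: k => n; first exact: pos.
  by rewrite NegzE mulrNz mulNr -[in RHS](subrK (n.+1%:R * (2 * pi)) x) pos.
pose phi (x : circle R) := g (repr x).
have phiE x : phi (\pi_(circle R) x) = g x.
  by rewrite /phi; have [k ->] := repr_pi_circle x.
have bphi : bm phi.
  split; last by exists M => x; exact: gM.
  exact: (measurable_circle cg phiE).
pose D (h : circle R -> R) := bm h /\
  esp unif (fun x => h (\pi_(circle R) (x + c))) = esp unif (fun x => h (\pi_(circle R) x)).
have mpi (c0 : R) : measurable_fun setT (fun x : R => \pi_(circle R) (x + c0)).
  move=> _ Y mY; rewrite setTI.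
  suff : @measurable _ (circle R) `<=`
      [set B | measurable ((fun x : R => \pi_(circle R) (x + c0)) @^-1` B)] by exact.
  apply: smallest_sub; first split => /=.
  - by rewrite preimage_set0.
  - by move=> B mB; exact: (measurableD measurableT mB).
  - by move=> B mB; rewrite preimage_bigcup; exact: bigcup_measurable.
  move=> U oU /=; apply: open_measurable.
  have : continuous (fun x : R => x + c0).
    by move=> x; apply: (drv_cont (drvD (drv_id x) (drv_cst c0 x))).
  by move=> /continuousP/(_ _ oU).
suff : D phi.
  move=> [_]; have -> : (fun x => phi (\pi_(circle R) (x + c))) = (fun x => g (x + c)).
    by apply/funext => x; rewrite phiE.
  by have -> : (fun x => phi (\pi_(circle R) x)) = g by apply/funext => x; rewrite phiE.
apply: (tpoly1_bounded_closed (D := D)) => //.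
- move=> s; split; first by apply: bm_sum => w; apply: bmZ; exact: bm_wave1.
  have E c0 : esp unif (fun x => \sum_(w <- s) w.1.1 * wave1 w.1.2 w.2 (\pi_(circle R) (x + c0)))
      = \sum_(w <- s) w.1.1 * (if w.1.2 == 0 then cos w.2 else 0).
    rewrite esp_sum; last first.
      move=> w; apply: bmZ.
      by apply: (@bm_comp _ _ _ _ _ (wave1 w.1.2 w.2)); [exact: mpi|exact: bm_wave1].
    apply: eq_bigr => w _; rewrite espZ; last first.
      by apply: (@bm_comp _ _ _ _ _ (wave1 w.1.2 w.2)); [exact: mpi|exact: bm_wave1].
    congr (_ * _); have -> : (fun x => wave1 w.1.2 w.2 (\pi_(circle R) (x + c0))) =
        (fun x => cos (w.1.2%:~R * x + (w.1.2%:~R * c0 + w.2))).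
      by apply/funext => x; rewrite wave1_pi mulrDr addrA.
    rewrite esp_unif_wave; case: eqP => // ->.
    by rewrite mul0r add0r.
  by rewrite E -(E 0); congr esp; apply/funext => x; rewrite addr0.
- move=> F h K DF FK Fh; split.
    by apply: (bm_lim _ FK Fh) => n; have [[]] := DF n.
  have H (c0 : R) : esp unif (fun x => F n (\pi_(circle R) (x + c0))) @[n --> \oo] -->
      esp unif (fun x => h (\pi_(circle R) (x + c0))).
    have := (@esp_cvg _ _ _ unif (fun n x => F n (\pi_(circle R) (x + c0))) (fun x => h (\pi_(circle R) (x + c0))) K). apply.
    + move=> n; have [[mF _] _] := DF n.
      by apply: (measurableT_comp mF); exact: mpi.
    + by move=> n x; exact: FK.
    + by move=> x; exact: Fh.
  have /funext H0 x : x + 0 = x :> R by rewrite addr0.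
  have HC := H c; have := H 0.
  have -> : (fun x => h (\pi_(circle R) (x + 0))) = (fun x => h (\pi_(circle R) x)).
    by apply/funext => x; rewrite addr0.
  have -> : (fun n => esp unif (fun x => F n (\pi_(circle R) (x + 0)))) =
      (fun n => esp unif (fun x => F n (\pi_(circle R) (x + c)))).
    apply/funext => n; have [_ ->] := DF n.
    by congr esp; apply/funext => x; rewrite addr0.
  by move=> H1; rewrite -(cvg_lim _ HC)// -(cvg_lim _ H1).
Qed.

(* Calibration: [g'^2 - beta^2 g^2 = (g' + T g)^2 - (T g^2)'] with
   [T x = beta tan (beta (x - a - pi/2))], which is smooth on [[a, a + pi]] as [beta < 1]. *)
Lemma wirtinger_dirichlet (g g' : R -> R) (a beta : R) : 0 < beta < 1 ->
  (forall x : R, is_derive x 1 g (g' x)) -> continuous g' -> g a = 0 -> g (a + pi) = 0 ->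
  beta ^+ 2 * \int[leb]_(x in `[a, (a + pi)]) (g x ^+ 2) <=
  \int[leb]_(x in `[a, (a + pi)]) (g' x ^+ 2).
Proof.
move=> /andP[b0 b1] dg cg' ga gb; have p0 := pi_gt0 R.
have cg : continuous g by move=> x; exact: drv_cont (dg x).
pose c := a + pi / 2; pose th x := beta * (x - c).
have dth (x : R) : is_derive x 1 th beta.
  by apply: (drv_eq (drvZ beta (drvB (drv_id x) (drv_cst c x)))); rewrite subr0 mulr1.
have cpos x : a <= x <= a + pi -> 0 < cos (th x).
  move=> /andP[ax xb]; apply: cos_gt0_pihalf.
  have h : `|x - c| <= pi / 2 by rewrite /c ler_norml; lra.
  have : `|th x| < pi / 2.
    rewrite /th normrM (ger0_norm (ltW b0)).
    have [->|xc] := eqVneq (x - c) 0; first by rewrite normr0 mulr0 divr_gt0.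
    by apply: lt_le_trans h; rewrite gtr_pMl// normr_gt0.
  by rewrite ltr_norml.
pose F x := beta * tan (th x) * g x ^+ 2.
pose F' x := beta ^+ 2 * (1 + tan (th x) ^+ 2) * g x ^+ 2 + beta * tan (th x) * (2 * g x * g' x).
have dtan (x : R) : a <= x <= a + pi -> is_derive x 1 (fun y => tan (th y)) (beta * (1 + tan (th x) ^+ 2)).
  move=> xab; have c0 : cos (th x) != 0 by rewrite gt_eqF// cpos.
  apply: (drv_eq (drv_comp (is_derive_tan c0) (dth x))).
  by rewrite cos2_tan2// mulrC.
have dF (x : R) : a <= x <= a + pi -> is_derive x 1 F (F' x).
  move=> xab; apply: (drv_eq (drvM (drvZ beta (dtan x xab)) (drvX 2 (dg x)))).
  by rewrite /F' /= expr1; ring.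
have cF' x : a <= x <= a + pi -> {for x, continuous F'}.
  move=> xab; have ct := drv_cont (dtan x xab).
  apply: cvgD; apply: cvgM.
  - apply: cvgM; first exact: cvg_cst.
    by apply: cvgD; [exact: cvg_cst|apply: cvgM; exact: ct].
  - by apply: cvgM; exact: cg.
  - by apply: cvgM; [exact: cvg_cst|exact: ct].
  - by apply: cvgM; [apply: cvgM; [exact: cvg_cst|exact: cg]|exact: cg'].
have aapi : a < a + pi by rewrite ltrDl.
have F0 : \int[leb]_(x in `[a, (a + pi)]) F' x = 0.
  by rewrite (FTC aapi cF' dF) /F ga gb expr0n/= !mulr0 subrr.
have ig2 : leb.-integrable `[a, (a + pi)] (EFin \o (fun x => g x ^+ 2)).
  by apply: continuous_integrable => x; apply: cvgM; exact: cg.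
have ig'2 : leb.-integrable `[a, (a + pi)] (EFin \o (fun x => g' x ^+ 2)).
  by apply: continuous_integrable => x; apply: cvgM; exact: cg'.
have iF' : leb.-integrable `[a, (a + pi)] (EFin \o F').
  apply: continuous_compact_integrable; first exact: segment_compact.
  by apply: continuous_in_subspaceT => x; rewrite inE/= in_itv/=; exact: cF'.
have ibg2 : leb.-integrable `[a, (a + pi)] (EFin \o (fun x => beta ^+ 2 * g x ^+ 2)).
  by apply: continuous_integrable => x; apply: cvgM; [exact: cvg_cst|apply: cvgM; exact: cg].
rewrite -RintegralZl// -[leLHS]subr0 -F0 -RintegralB//.
apply: le_Rintegral => //.
  exact: (integrableB _ ibg2 iF').
move=> x _; rewrite -subr_ge0.
rewrite [leRHS](_ : _ = (g' x + beta * tan (th x) * g x) ^+ 2); last by rewrite /F'; ring.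
exact: sqr_ge0.
Qed.

(** The Dirichlet inequality is applied on each half period and [beta] is sent to 1; at [beta = 1]
    the calibrating tangent would be singular at the end points. *)
Lemma wirtinger_zero (g g' : R -> R) : (forall x : R, is_derive x 1 g (g' x)) ->
  continuous g' -> g 0 = 0 -> g pi = 0 -> g (2 * pi) = 0 -> bm g -> bm g' ->
  esp unif (fun x => g x ^+ 2) <= esp unif (fun x => g' x ^+ 2).
Proof.
move=> dg cg' g0 g1 g2 bg bg'; have p0 := pi_gt0 R.
have cg : continuous g by move=> x; exact: drv_cont (dg x).
have split f : continuous f -> \int[leb]_(x in `[0, 2 * pi]) f x =
    \int[leb]_(x in `[0, (0 + pi)]) f x + \int[leb]_(x in `[pi, (pi + pi)]) f x.
  move=> cf; rewrite add0r -[pi + pi]mulr2n -[pi *+ 2]mulr_natl.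
  have := @Rintegral_itvB R f (BLeft 0) (BRight (2 * pi)) pi (continuous_integrable _ _ cf).
  rewrite !bnd_simp => /(_ (ltW p0)) e.
  have {}e := e (_ : pi <= 2 * pi).
  have e2 := @Rintegral_itv_obnd_cbnd R pi (BRight (2 * pi)) f.
  rewrite -e2; last first.
    by apply: integrableS (continuous_integrable pi (2 * pi) cf) => //; exact: subset_itv_oc_cc.
  by rewrite -e; [rewrite addrC subrK|lra].
rewrite !esp_unif; [|exact: bmX|exact: bmX].
apply: ler_wpM2l; first by rewrite invr_ge0 mulr_ge0// ltW.
rewrite !split; [|by move=> x; apply: cvgM; exact: cg'|by move=> x; apply: cvgM; exact: cg].
have key a : g a = 0 -> g (a + pi) = 0 ->
  \int[leb]_(x in `[a, (a + pi)]) (g x ^+ 2) <= \int[leb]_(x in `[a, (a + pi)]) (g' x ^+ 2).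
  move=> ga gb; set A := (X in X <= _); set B := (X in _ <= X).
  have A0 : 0 <= A by apply: Rintegral_ge0 => x _; exact: sqr_ge0.
  (* With [mm = 1 - beta], the loss is [(1 - beta ^+ 2) * A <= 2 * mm * A], which is at most [e]. *)
  apply/ler_addgt0Pr => e e0; pose beta := 1 - Num.min (1 / 2) (e / (2 * (A + 1))).
  have m0 : 0 < Num.min (1 / 2) (e / (2 * (A + 1))).
    by rewrite lt_min; apply/andP; split; [lra|rewrite divr_gt0//; lra].
  have m1 : Num.min (1 / 2) (e / (2 * (A + 1))) <= 1 / 2 by rewrite ge_min lexx.
  have m2 : Num.min (1 / 2) (e / (2 * (A + 1))) <= e / (2 * (A + 1)) by rewrite ge_min lexx orbT.
  have b01 : 0 < beta < 1 by rewrite /beta; lra.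
  have := wirtinger_dirichlet b01 dg cg' ga gb; rewrite -/A -/B.
  have : A - e <= beta ^+ 2 * A.
    move: m2; rewrite /beta; set mm := Num.min _ _ => m2.
    have : mm * (2 * (A + 1)) <= e by rewrite -ler_pdivlMr//; lra.
    nra.
  lra.
apply: lerD; apply: key => //; rewrite ?add0r//.
by rewrite -[pi + pi]mulr2n -[pi *+ 2]mulr_natl.
Qed.

(* The parts of [k = h'] which are even and odd under the shift by [pi] both
   vanish at some point, hence also half a period later. *)
Lemma wirtinger (h k k' : R -> R) : (forall x : R, is_derive x 1 h (k x)) ->
  (forall x : R, is_derive x 1 k (k' x)) -> continuous k' ->
  (forall x, h (x + 2 * pi) = h x) -> (forall x, k (x + 2 * pi) = k x) ->
  (forall x, k' (x + 2 * pi) = k' x) -> bm k -> bm k' ->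
  esp unif (fun x => k x ^+ 2) <= esp unif (fun x => k' x ^+ 2).
Proof.
move=> dh dk ck' hper kper k'per bk bk'; have p0 := pi_gt0 R.
have ck : continuous k by move=> x; exact: drv_cont (dk x).
have ch : continuous h by move=> x; exact: drv_cont (dh x).
have dsh (f f' : R -> R) (c : R) : (forall x : R, is_derive x 1 f (f' x)) ->
    forall x : R, is_derive x 1 (fun y => f (y + c)) (f' (x + c)).
  move=> df x; apply: (drv_eq (@drv_comp _ f (fun y => y + c) x _ _ (df (x + c)) (drvD (drv_id x) (drv_cst c x)))).
  by rewrite addr0 mulr1.
have csh (f : R -> R) (c : R) : continuous f -> continuous (fun y => f (y + c)).
  move=> cf x; have ca : continuous (fun y : R => y + c).
    by move=> y; exact: (drv_cont (drvD (drv_id y) (drv_cst c y))).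
  exact: (continuous_comp (ca x) (cf _)).
have bsh (f : R -> R) (c : R) : bm f -> bm (fun y : R => f (y + c)).
  move=> bf; apply: (@bm_comp _ _ _ _ _ f) bf.
  by apply: (measurable_funD (f := fun y : R => y) (g := fun=> c)).
have addpp x : x + pi + pi = x + 2 * pi :> R by ring.
pose ke x := 2^-1 * (k x + k (x + pi)); pose ko x := 2^-1 * (k x - k (x + pi)).
pose ke' x := 2^-1 * (k' x + k' (x + pi)); pose ko' x := 2^-1 * (k' x - k' (x + pi)).
have dke (x : R) : is_derive x 1 ke (ke' x).
  exact: drvZ (drvD (dk x) (dsh _ _ pi dk x)).
have dko (x : R) : is_derive x 1 ko (ko' x).
  exact: drvZ (drvB (dk x) (dsh _ _ pi dk x)).
have keper x : ke (x + pi) = ke x by rewrite /ke addpp kper; ring.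
have koper x : ko (x + pi) = - ko x by rewrite /ko addpp kper; ring.
have bke : bm ke by apply: bmZ; apply: bmD => //; exact: bsh.
have bko : bm ko by apply: bmZ; apply: bmB => //; exact: bsh.
have bke' : bm ke' by apply: bmZ; apply: bmD => //; exact: bsh.
have bko' : bm ko' by apply: bmZ; apply: bmB => //; exact: bsh.
have cke' : continuous ke'.
  by move=> x; apply: cvgM; [exact: cvg_cst|apply: cvgD; [exact: ck'|exact: (csh _ pi ck')]].
have cko' : continuous ko'.
  by move=> x; apply: cvgM; [exact: cvg_cst|apply: cvgB; [exact: ck'|exact: (csh _ pi ck')]].
have cke : continuous ke by move=> x; exact: drv_cont (dke x).
have cko : continuous ko by move=> x; exact: drv_cont (dko x).
(* Rolle's theorem applies because [ke] is the derivative of a function with period [pi]. The odd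
   part [ko] takes opposite values at 0 and [pi], and vanishes by the intermediate value theorem. *)
have [x0 kex0] : exists x0, ke x0 = 0.
  have dhe (x : R) : is_derive x 1 (fun x => 2^-1 * (h x + h (x + pi))) (ke x).
    exact: drvZ (drvD (dh x) (dsh _ _ pi dh x)).
  pose he x := 2^-1 * (h x + h (x + pi)).
  have R1 x : x \in `]0, (pi : R)[ -> derivable he x 1.
    by move=> _; exact: (@ex_derive _ _ _ _ _ _ _ (dhe x)).
  have R2 : {within `[0, (pi : R)], continuous he}.
    by apply: continuous_subspaceT => x; exact: drv_cont (dhe x).
  have R3 : he 0 = he pi.
    by rewrite /he add0r -[pi + pi]add0r addrA addpp hper addrC.
  have [c _ dc] := Rolle p0 R1 R2 R3.
  exists c; have := @derive_val _ _ _ _ _ _ _ dc.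
  by rewrite (@derive_val _ _ _ _ _ _ _ (dhe c)).
have [x1 kox1] : exists x1, ko x1 = 0.
  have kop : ko pi = - ko 0 by rewrite -koper add0r.
  have I1 : {within `[0, (pi : R)], continuous ko} by exact: continuous_subspaceT.
  have I2 : Num.min (ko 0) (ko pi) <= 0 <= Num.max (ko 0) (ko pi).
    rewrite kop ge_min le_max oppr_le0 oppr_ge0.
    by rewrite !le_total.
  by have [c _ kc] := IVT (ltW p0) I1 I2; exists c.
have bdd (f : R -> R) : bm f -> exists M, forall x, `|f x| <= M by case.
have step (f f' : R -> R) z : (forall x : R, is_derive x 1 f (f' x)) -> continuous f' ->
    bm f -> bm f' -> (forall x, f (x + 2 * pi) = f x) -> (forall x, f' (x + 2 * pi) = f' x) ->
    f z = 0 -> f (z + pi) = 0 ->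
    esp unif (fun x => f x ^+ 2) <= esp unif (fun x => f' x ^+ 2).
  move=> df cf' bf bf' fper f'per fz fzpi.
  have cf : continuous f by move=> x; exact: drv_cont (df x).
  have c2 (g : R -> R) : continuous g -> continuous (fun x => g x ^+ 2).
    by move=> cg x; apply: cvgM; exact: cg.
  rewrite -(@esp_unif_shift (fun x => f x ^+ 2) z); first last.
  - by move=> x; rewrite fper.
  - exact/bdd/bmX.
  - exact: c2.
  rewrite -(@esp_unif_shift (fun x => f' x ^+ 2) z); first last.
  - by move=> x; rewrite f'per.
  - exact/bdd/bmX.
  - exact: c2.
  have e0 : f (0 + z) = 0 by rewrite add0r.
  have e1 : f (pi + z) = 0 by rewrite addrC.
  have e2 : f (2 * pi + z) = 0 by rewrite addrC fper.
  exact: (wirtinger_zero (dsh f f' z df) (csh f' z cf') e0 e1 e2 (bsh f z bf) (bsh f' z bf')).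
have shc x : x + 2 * pi + pi = x + pi + 2 * pi :> R by ring.
have keper2 x : ke (x + 2 * pi) = ke x by rewrite -addpp !keper.
have koper2 x : ko (x + 2 * pi) = ko x by rewrite -addpp !koper opprK.
have ke'per x : ke' (x + 2 * pi) = ke' x by rewrite /ke' k'per shc k'per.
have ko'per x : ko' (x + 2 * pi) = ko' x by rewrite /ko' k'per shc k'per.
have kex0' : ke (x0 + pi) = 0 by rewrite keper.
have kox1' : ko (x1 + pi) = 0 by rewrite koper kox1 oppr0.
have le_e := step ke ke' x0 dke cke' bke bke' keper2 ke'per kex0 kex0'.
have le_o := step ko ko' x1 dko cko' bko bko' koper2 ko'per kox1 kox1'.
(* The even and odd parts are orthogonal, by the parallelogram identity and the invariance of [unif]
   under the shift by [pi]. *)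
have decomp (f : R -> R) : continuous f -> bm f -> (forall x, f (x + 2 * pi) = f x) ->
    esp unif (fun x => f x ^+ 2) =
    esp unif (fun x => (2^-1 * (f x + f (x + pi))) ^+ 2) +
    esp unif (fun x => (2^-1 * (f x - f (x + pi))) ^+ 2).
  move=> cf bf fper; have bfs := bsh _ pi bf.
  rewrite -espD; [|by apply/bmX/bmZ/bmD|by apply/bmX/bmZ/bmB].
  have -> : (fun x => (2^-1 * (f x + f (x + pi))) ^+ 2 + (2^-1 * (f x - f (x + pi))) ^+ 2) =
      (fun x => 2^-1 * f x ^+ 2 + 2^-1 * f (x + pi) ^+ 2).
    by apply/funext => x; field.
  rewrite espD; [|by apply/bmZ/bmX|by apply/bmZ/bmX].
  rewrite !espZ; [|by apply/bmX|by apply/bmX].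
  rewrite (@esp_unif_shift (fun x => f x ^+ 2) pi).
  - by field.
  - by move=> x; apply: cvgM; exact: cf.
  - exact/bdd/bmX.
  - by move=> x; rewrite fper.
rewrite (decomp k)// (decomp k')//; exact: lerD.
Qed.

End uniform_circle.

Section continuity.
Variable R : realType.
Implicit Types f g : R -> R.

Lemma contD f g : continuous f -> continuous g -> continuous (fun x => f x + g x).
Proof. by move=> cf cg x; apply: cvgD; [exact: cf|exact: cg]. Qed.
Lemma contB f g : continuous f -> continuous g -> continuous (fun x => f x - g x).
Proof. by move=> cf cg x; apply: cvgB; [exact: cf|exact: cg]. Qed.
Lemma contM f g : continuous f -> continuous g -> continuous (fun x => f x * g x).
Proof. by move=> cf cg x; apply: cvgM; [exact: cf|exact: cg]. Qed.
Lemma contX n f : continuous f -> continuous (fun x => f x ^+ n).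
Proof.
move=> cf; elim: n => [|n IH]; first by move=> x; exact: cvg_cst.
have -> : (fun x => f x ^+ n.+1) = (fun x => f x * f x ^+ n).
  by apply/funext => x; rewrite exprS.
exact: contM.
Qed.
Lemma cont_cst (c : R) : continuous (fun _ : R => c).
Proof. by move=> x; exact: cvg_cst. Qed.
Lemma contV f : (forall x, f x != 0) -> continuous f -> continuous (fun x => (f x)^-1).
Proof. by move=> f0 cf x; apply: cvgV; [exact: f0|exact: cf]. Qed.
End continuity.

Section sqrt_trick.
Variables (R : realType) (f f1 f2 f3 f4 : R -> R) (c : R).
Hypotheses (df : forall x : R, is_derive x 1 f (f1 x)) (df1 : forall x : R, is_derive x 1 f1 (f2 x))
  (df2 : forall x : R, is_derive x 1 f2 (f3 x)) (df3 : forall x : R, is_derive x 1 f3 (f4 x)).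
Hypotheses (pf : forall x, f (x + 2 * pi) = f x) (pf1 : forall x, f1 (x + 2 * pi) = f1 x)
  (pf2 : forall x, f2 (x + 2 * pi) = f2 x).
Hypotheses (bf : bm f) (bf1 : bm f1) (bf2 : bm f2) (bf3 : bm f3).
Hypotheses (c0 : 0 < c) (cf : forall x, c <= f x).

(* With [h = sqrt f], the integrand is [4 (h''^2 - h'^2) + f1^4 / (12 f^3)] up to
   the derivative of [f1 (ln f + 1) - f1 f2 / f + f1^3 / (6 f^2)]. *)
Lemma fisher_dissipation :
  0 <= esp (@unif R) (fun x => f2 x * (ln (f x) + 1) - f1 x * f3 x / f x
    + 2^-1 * (f1 x ^+ 2 * f2 x / f x ^+ 2)).
Proof.
have f0 x : 0 < f x by exact: lt_le_trans (cf x).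
have f0' x : f x != 0 by rewrite gt_eqF.
(* [E] is the inverse square root of [f], so that [h = f * E] is the square root of [f], with
   [k = h'] and [k' = h'']. Wirtinger's inequality is applied to [k]. *)
pose E x := expR (- (2^-1 * ln (f x))).
have E2 x : E x ^+ 2 = (f x)^-1.
  by rewrite -expRM_natl mulrN mulrA divff// mul1r expRN lnK// posrE.
have dln (x : R) := drv_ln (f0 x) (df x).
have dE (x : R) : is_derive x 1 E (E x * - (2^-1 * (f1 x / f x))).
  exact: drv_exp (drvN (drvZ 2^-1 (dln x))).
pose k x := 2^-1 * f1 x * E x.
pose k' x := 2^-1 * f2 x * E x - 4^-1 * (f1 x ^+ 2 / f x) * E x.
have dk (x : R) : is_derive x 1 k (k' x).
  apply: (drv_eq (drvM (drvZ 2^-1 (df1 x)) (dE x))).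
  by rewrite /k'; field; exact: f0'.
pose h x := f x * E x.
have dh (x : R) : is_derive x 1 h (k x).
  apply: (drv_eq (drvM (df x) (dE x))).
  by rewrite /k; field; exact: f0'.
have cont_f : continuous f by move=> x; exact: drv_cont (df x).
have cont_f1 : continuous f1 by move=> x; exact: drv_cont (df1 x).
have cont_f2 : continuous f2 by move=> x; exact: drv_cont (df2 x).
have cont_f3 : continuous f3 by move=> x; exact: drv_cont (df3 x).
have cont_E : continuous E by move=> x; exact: drv_cont (dE x).
have cont_ln : continuous (fun x => ln (f x)) by move=> x; exact: drv_cont (dln x).
have cont_V : continuous (fun x => (f x)^-1) by exact: contV.
have cont_V2 : continuous (fun x => (f x ^+ 2)^-1).
  by apply: contV; [move=> x; rewrite expf_neq0|exact: contX].
have cont_V3 : continuous (fun x => (f x ^+ 3)^-1).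
  by apply: contV; [move=> x; rewrite expf_neq0|exact: contX].
have bV : bm (fun x => (f x)^-1) by exact: bm_inv c0 cf bf.
have bln : bm (fun x => ln (f x)) by exact: bm_ln c0 cf bf.
have bE : bm E by apply: bm_exp; apply: bmN; exact: bmZ.
have bV2 : bm (fun x => (f x ^+ 2)^-1).
  by under eq_fun do rewrite -exprVn; exact: bmX.
have bV3 : bm (fun x => (f x ^+ 3)^-1).
  by under eq_fun do rewrite -exprVn; exact: bmX.
have ck' : continuous k'.
  by apply: contB; apply: contM => //; apply: contM => //; try exact: cont_cst;
    apply: contM => //; exact: contX.
have bk : bm k by apply: bmM => //; exact: bmZ.
have bk' : bm k'.
  by apply: bmB; apply: bmM => //; apply: bmZ => //; apply: bmM => //; exact: bmX.
have pE x : E (x + 2 * pi) = E x by rewrite /E pf.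
have W : esp (@unif R) (fun x => k x ^+ 2) <= esp (@unif R) (fun x => k' x ^+ 2).
  apply: (wirtinger dh dk ck') => // x.
  - by rewrite /h pf pE.
  - by rewrite /k pf1 pE.
  - by rewrite /k' pf pf1 pf2 pE.
pose G x := f1 x * (ln (f x) + 1) - f1 x * f2 x * (f x)^-1 + 6^-1 * (f1 x ^+ 3 * (f x ^+ 2)^-1).
pose G' x := f2 x * (ln (f x) + 1) + f1 x ^+ 2 * (f x)^-1
   - (f2 x ^+ 2 + f1 x * f3 x) * (f x)^-1 + f1 x ^+ 2 * f2 x * (f x ^+ 2)^-1
   + (2^-1 * (f1 x ^+ 2 * f2 x * (f x ^+ 2)^-1) - 3^-1 * (f1 x ^+ 4 * (f x ^+ 3)^-1)).
have dG (x : R) : is_derive x 1 G (G' x).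
  have f2x : f x ^+ 2 != 0 by rewrite expf_neq0.
  have d1 := drvM (df1 x) (drvD (dln x) (drv_cst 1 x)).
  have d2 := drvM (drvM (df1 x) (df2 x)) (drv_inv (f0' x) (df x)).
  have d3 := drvZ 6^-1 (drvM (drvX 3 (df1 x)) (@drv_inv _ (fun y => f y ^+ 2) x _ f2x (drvX 2 (df x)))).
  apply: (drv_eq (drvD (drvB d1 d2) d3)).
  rewrite /G' /= expr1; field; exact: f0'.
have cG' : continuous G'.
  have c12 := @contX R 2 f1 cont_f1; have cm2 := contM (contM c12 cont_f2) cont_V2.
  exact: (contD (contD (contB (contD (contM cont_f2 (contD cont_ln (@cont_cst R 1))) (contM c12 cont_V))
    (contM (contD (@contX R 2 f2 cont_f2) (contM cont_f1 cont_f3)) cont_V)) cm2)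
    (contB (contM (@cont_cst R 2^-1) cm2) (contM (@cont_cst R 3^-1) (contM (@contX R 4 f1 cont_f1) cont_V3)))).
have bG' : bm G'.
  rewrite /G'; do !(first [apply: bmB|apply: bmD|apply: bmX|apply: bmM|assumption|exact: bm_cst]).
have pG x : G (x + 2 * pi) = G x by rewrite /G pf pf1 pf2.
have EG : esp (@unif R) G' = 0.
  by apply: (esp_unif_FTC bG' cG' dG); rewrite -[2 * pi]add0r pG.
have bk2 : bm (fun x => k x ^+ 2) by exact: bmX.
have bk'2 : bm (fun x => k' x ^+ 2) by exact: bmX.
have -> : (fun x => f2 x * (ln (f x) + 1) - f1 x * f3 x / f x
    + 2^-1 * (f1 x ^+ 2 * f2 x / f x ^+ 2)) =
  (fun x => G' x + 4 * (k' x ^+ 2 - k x ^+ 2) + 12^-1 * (f1 x ^+ 4 * (f x ^+ 3)^-1)).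
  apply/funext => x; rewrite /G' /k /k'.
  have -> : (2^-1 * f2 x * E x - 4^-1 * (f1 x ^+ 2 / f x) * E x) ^+ 2 =
    (2^-1 * f2 x - 4^-1 * (f1 x ^+ 2 / f x)) ^+ 2 * E x ^+ 2 by ring.
  rewrite [(_ * E x) ^+ 2]exprMn E2; field; exact: f0'.
have b4 : bm (fun x => 12^-1 * (f1 x ^+ 4 * (f x ^+ 3)^-1)).
  by apply: bmZ; apply: bmM => //; exact: bmX.
have bkk : bm (fun x => 4 * (k' x ^+ 2 - k x ^+ 2)) by apply: bmZ; exact: bmB.
rewrite espD//; last exact: bmD.
rewrite espD// EG add0r espZ; last exact: bmB.
rewrite espB// addr_ge0//; first by rewrite mulr_ge0// subr_ge0.
apply: esp_ge0 => x; apply: mulr_ge0; first by rewrite invr_ge0.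
apply: mulr_ge0; first exact: exprn_even_ge0.
by rewrite invr_ge0 exprn_ge0// ltW.
Qed.

End sqrt_trick.

(** * The heat flow on trigonometric polynomials *)

Section trig_lists.
Variable R : realType.
Implicit Types (s : seq (R * int * R)) (x t c : R).

Definition ev s x : R := \sum_(w <- s) w.1.1 * cos (w.1.2%:~R * x + w.2).
Definition dl s := [seq (w.1.1 * w.1.2%:~R, w.1.2, w.2 + pi / 2) | w <- s].
Definition heat t s := [seq (w.1.1 * expR (- (w.1.2%:~R ^+ 2 * t)), w.1.2, w.2) | w <- s].
Definition nrm s : R := \sum_(w <- s) `|w.1.1|.

Lemma drv_ev s x : is_derive x 1 (ev s) (ev (dl s) x).
Proof.
rewrite /ev big_map; apply: drv_sum => w /=.
by apply: (drv_eq (drvZ _ (drv_cos_affine _ _ x))); rewrite mulrA.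
Qed.

Lemma continuous_ev s : continuous (ev s).
Proof. by move=> x; exact: drv_cont (drv_ev s x). Qed.

Lemma ev_per s x : ev s (x + 2 * pi) = ev s x.
Proof.
apply: eq_bigr => w _; congr (_ * _); rewrite mulrDr addrAC.
exact: cos_shift.
Qed.

Lemma ev_bound s x : `|ev s x| <= nrm s.
Proof.
rewrite (le_trans (ler_norm_sum _ _ _))// ler_sum// => w _.
by rewrite normrM ler_piMr// cos_max.
Qed.

Lemma bm_ev s : bm (ev s).
Proof.
split; first by apply: continuous_measurable_fun; exact: continuous_ev.
by exists (nrm s) => x; exact: ev_bound.
Qed.

Lemma heat_bound s x t : 0 <= t -> `|ev (heat t s) x| <= nrm s.
Proof.
move=> t0; rewrite (le_trans (ev_bound _ _))// /nrm big_map ler_sum// => w _ /=.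
by rewrite normrM ler_piMr// ger0_norm ?expR_ge0// expR_le1 oppr_le0 mulr_ge0// sqr_ge0.
Qed.

Lemma ev_heat_dl s x t : ev (dl (heat t s)) x = ev (heat t (dl s)) x.
Proof. by rewrite /ev !big_map; apply: eq_bigr => w _ /=; congr (_ * _); ring. Qed.

Lemma drv_ev_heat s x t : is_derive x 1 (ev (heat t s)) (ev (heat t (dl s)) x).
Proof. by apply: (drv_eq (drv_ev _ x)); exact: ev_heat_dl. Qed.

Lemma drv_heat s x t : is_derive t 1 (fun r => ev (heat r s) x) (ev (heat t (dl (dl s))) x).
Proof.
have -> : (fun r => ev (heat r s) x) = (fun r => \sum_(w <- s)
    (w.1.1 * cos (w.1.2%:~R * x + w.2)) * expR (- (w.1.2%:~R ^+ 2 * r))).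
  by apply/funext => r; rewrite /ev big_map; apply: eq_bigr => w _ /=; ring.
rewrite /ev !big_map; apply: drv_sum => w /=.
apply: (drv_eq (drvZ _ (drv_exp (drvN (drvZ (w.1.2%:~R ^+ 2) (drv_id t)))))).
rewrite !addrA !cosDpihalf sinDpihalf; ring.
Qed.

Lemma heat0 s x : ev (heat 0 s) x = ev s x.
Proof.
by rewrite /ev big_map; apply: eq_bigr => w _ /=; rewrite mulr0 oppr0 expR0 mulr1.
Qed.

Lemma derive_ge0 (f f' : R -> R) (z : R) : (forall u : R, is_derive u 1 f (f' u)) ->
  f 0 = 0 -> 0 <= z -> (forall u, 0 < u < z -> 0 <= f' u) -> 0 <= f z.
Proof. by move=> df f0 z0 f'0; rewrite -[leLHS]f0; exact: derive_nondecreasingT df f'0. Qed.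

Lemma cos_ge_quadratic (y : R) : 1 - y ^+ 2 / 2 <= cos y.
Proof.
have sin_le (z : R) : 0 <= z -> sin z <= z.
  move=> z0; rewrite -subr_ge0.
  have h (u : R) : is_derive u 1 (fun u => u - sin u) (1 - cos u).
    by apply: (drv_eq (drvB (drv_id u) (drv_sin (drv_id u)))); rewrite mulr1.
  apply: (derive_ge0 h _ z0); first by rewrite sin0 subrr.
  by move=> u _; rewrite subr_ge0 cos_le1.
have key (z : R) : 0 <= z -> 1 - z ^+ 2 / 2 <= cos z.
  move=> z0; rewrite -subr_ge0.
  have h (u : R) : is_derive u 1 (fun u => cos u - (1 - u ^+ 2 / 2)) (u - sin u).
    have := drvB (drv_cos (drv_id u)) (drvB (drv_cst 1 u) (drvM (drvX 2 (drv_id u)) (drv_cst 2^-1 u))).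
    by move=> e; apply: (drv_eq e); rewrite /= expr1; field.
  apply: (derive_ge0 h _ z0); first by rewrite cos0 expr0n/= mul0r subr0 subrr.
  by move=> u /andP[u0 _]; rewrite subr_ge0 sin_le// ltW.
by have := key `|y| (normr_ge0 y); rewrite cos_norm real_normK// num_real.
Qed.

Lemma cos_le_quartic (y : R) : cos y <= 1 - y ^+ 2 / 2 + y ^+ 4 / 24.
Proof.
have sin_ge (z : R) : 0 <= z -> z - z ^+ 3 / 6 <= sin z.
  move=> z0; rewrite -subr_ge0.
  have h (u : R) : is_derive u 1 (fun u => sin u - (u - u ^+ 3 / 6)) (cos u - (1 - u ^+ 2 / 2)).
    have := drvB (drv_sin (drv_id u)) (drvB (drv_id u) (drvM (drvX 3 (drv_id u)) (drv_cst 6^-1 u))).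
    by move=> e; apply: (drv_eq e); rewrite /=; field.
  apply: (derive_ge0 h _ z0); first by rewrite sin0 expr0n/= mul0r !subr0.
  by move=> u _; rewrite subr_ge0 cos_ge_quadratic.
have key (z : R) : 0 <= z -> cos z <= 1 - z ^+ 2 / 2 + z ^+ 4 / 24.
  move=> z0; rewrite -subr_ge0.
  have h (u : R) : is_derive u 1 (fun u => 1 - u ^+ 2 / 2 + u ^+ 4 / 24 - cos u)
      (sin u - (u - u ^+ 3 / 6)).
    have := drvB (drvD (drvB (drv_cst 1 u) (drvM (drvX 2 (drv_id u)) (drv_cst 2^-1 u)))
       (drvM (drvX 4 (drv_id u)) (drv_cst 24^-1 u))) (drv_cos (drv_id u)).
    by move=> e; apply: (drv_eq e); rewrite /= expr1; field.
  apply: (derive_ge0 h _ z0); first by rewrite cos0 !expr0n/= !mul0r subr0 addr0 subrr.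
  by move=> u /andP[u0 _]; rewrite subr_ge0 sin_ge// ltW.
have := key `|y| (normr_ge0 y); rewrite cos_norm.
by rewrite -[4%N]/(2 * 2)%N exprM real_normK ?num_real// -exprM.
Qed.

(** The local estimate behind the central limit theorem for the symmetric walk: with steps of order
    [n ^ (-1/2)] the error per step is of order [n ^ (-2)]. *)
Lemma cos_gauss (y : R) : `|cos y - expR (- (y ^+ 2 / 2))| <= y ^+ 4.
Proof.
set z := y ^+ 2 / 2; have z0 : 0 <= z by rewrite divr_ge0// sqr_ge0.
have z4 : y ^+ 4 = 4 * z ^+ 2 by rewrite /z; field.
have e1 := expR_ge1Dx (- z).
have e2 : expR (- z) <= 1 + - z + (- z) ^+ 2 by apply: expR_le_quadratic; lra.
have c1 := cos_ge_quadratic y; have := cos_le_quartic y; rewrite -/z in c1 *.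
rewrite z4 sqrrN in e2 * => c2.
have z20 : 0 <= z ^+ 2 by exact: sqr_ge0.
by rewrite ler_norml; apply/andP; split; lra.
Qed.

Lemma norm_exprB (a b : R) n : `|a| <= 1 -> `|b| <= 1 -> `|a ^+ n - b ^+ n| <= n%:R * `|a - b|.
Proof.
move=> a1 b1; elim: n => [|n IH]; first by rewrite subrr normr0 mul0r.
have -> : a ^+ n.+1 - b ^+ n.+1 = a * (a ^+ n - b ^+ n) + (a - b) * b ^+ n.
  by rewrite !exprS; ring.
rewrite -natr1 [leRHS]mulrDl mul1r (le_trans (ler_normD _ _))// lerD//.
  by rewrite normrM (le_trans _ IH)// ler_piMl.
by rewrite normrM normrX ler_piMr// exprn_ile1.
Qed.

Let walk (e : R) s := [seq (w.1.1 * cos (w.1.2%:~R * e), w.1.2, w.2) | w <- s].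

(* The heat flow is a limit of averages over symmetric random walks, because
   [cos (k sqrt (2t/n)) ^ n] tends to [exp (- k^2 t)]; hence it is positive. *)
Lemma heat_ge s c t : (forall x, c <= ev s x) -> 0 <= t -> forall x, c <= ev (heat t s) x.
Proof.
move=> cs t0 x.
have walkE e s' y : ev (walk e s') y = 2^-1 * (ev s' (y + e) + ev s' (y - e)).
  rewrite /ev big_map -big_split/= mulr_sumr; apply: eq_bigr => w _ /=.
  have -> : w.1.2%:~R * (y + e) + w.2 = (w.1.2%:~R * y + w.2) + w.1.2%:~R * e by ring.
  have -> : w.1.2%:~R * (y - e) + w.2 = (w.1.2%:~R * y + w.2) - w.1.2%:~R * e by ring.
  move: (w.1.2%:~R * y + w.2) (w.1.2%:~R * e) => u v.
  by rewrite (cosD u v) (cosB u v); field.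
have iter_ge e n y : c <= ev (iter n (walk e) s) y.
  elim: n y => [|n IH] y; first exact: cs.
  by rewrite iterS walkE; have := IH (y + e); have := IH (y - e); lra.
have iterE e n y : ev (iter n (walk e) s) y =
    \sum_(w <- s) w.1.1 * cos (w.1.2%:~R * e) ^+ n * cos (w.1.2%:~R * y + w.2).
  elim: n y => [|n IH] y.
    by apply: eq_bigr => w _; rewrite expr0 mulr1.
  rewrite iterS walkE !IH -big_split/= mulr_sumr; apply: eq_bigr => w _ /=.
  have -> : w.1.2%:~R * (y + e) + w.2 = (w.1.2%:~R * y + w.2) + w.1.2%:~R * e by ring.
  have -> : w.1.2%:~R * (y - e) + w.2 = (w.1.2%:~R * y + w.2) - w.1.2%:~R * e by ring.
  move: (w.1.2%:~R * y + w.2) (w.1.2%:~R * e) => u v.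
  by rewrite (cosD u v) (cosB u v) exprS; field.
pose K := \sum_(w <- s) `|w.1.1| * (4 * t ^+ 2 * w.1.2%:~R ^+ 4).
have K0 : 0 <= K.
  apply: sumr_ge0 => w _; apply: mulr_ge0 => //; apply: mulr_ge0; last exact: exprn_even_ge0.
  by apply: mulr_ge0 => //; exact: sqr_ge0.
have close n : `|ev (iter n.+1 (walk (Num.sqrt (2 * t / n.+1%:R))) s) x - ev (heat t s) x|
    <= K / n.+1%:R.
  rewrite iterE /ev big_map -sumrB mulr_suml (le_trans (ler_norm_sum _ _ _))//.
  rewrite ler_sum// => w _ /=; set e := Num.sqrt _; set k : R := w.1.2%:~R.
  have e2 : e ^+ 2 = 2 * t / n.+1%:R by rewrite sqr_sqrtr// divr_ge0// mulr_ge0.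
  have -> : w.1.1 * cos (k * e) ^+ n.+1 * cos (k * x + w.2) -
      w.1.1 * expR (- (k ^+ 2 * t)) * cos (k * x + w.2) =
      w.1.1 * (cos (k * e) ^+ n.+1 - expR (- (k ^+ 2 * t))) * cos (k * x + w.2) by ring.
  rewrite normrM normrM -mulrA -mulrA ler_wpM2l//.
  rewrite -[leRHS]mulr1; apply: ler_pM => //; last exact: cos_max.
  have -> : expR (- (k ^+ 2 * t)) = expR (- ((k * e) ^+ 2 / 2)) ^+ n.+1.
    rewrite -expRM_natl exprMn e2; congr expR; field.
    by rewrite addrC natr1 pnatr_eq0.
  apply: (le_trans (norm_exprB _ (cos_max _) _)).
    by rewrite ger0_norm ?expR_ge0// expR_le1 oppr_le0 divr_ge0// sqr_ge0.
  rewrite (le_trans (ler_wpM2l _ (cos_gauss _)))//.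
  have -> : (k * e) ^+ 4 = k ^+ 4 * (e ^+ 2) ^+ 2 by ring.
  rewrite e2 le_eqVlt; apply/orP; left; apply/eqP; field.
  by rewrite addrC natr1 pnatr_eq0.
apply/ler_addgt0Pr => r r0; pose n := Num.truncn (K / r).
have Kn : K / n.+1%:R <= r.
  by rewrite ler_pdivrMr// mulrC -ler_pdivrMr// ltW// truncnS_gt.
have gen (a b k : R) : k <= r -> c <= a -> - k <= a - b <= k -> c <= b + r by lra.
by apply: (gen _ _ _ Kn (iter_ge _ n.+1 x)); rewrite -ler_norml; exact: close.
Qed.

End trig_lists.

Section log_sobolev.
Variables (R : realType) (s : seq (R * int * R)) (c : R).
Hypotheses (c0 : 0 < c) (cs : forall x, c <= ev s x).
Local Notation U := (@unif R).
Local Notation f t x := (ev (heat t s) x).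
Local Notation f1 t x := (ev (heat t (dl s)) x).
Local Notation f2 t x := (ev (heat t (dl (dl s))) x).
Local Notation f3 t x := (ev (heat t (dl (dl (dl s)))) x).

Let fc (t x : R) : 0 <= t -> c <= f t x. Proof. by move=> t0; exact: heat_ge. Qed.
Let f0 (t x : R) : 0 <= t -> 0 < f t x. Proof. by move=> t0; exact: lt_le_trans (fc x t0). Qed.

(** The integrand of the entropy minus half the Fisher information along the heat flow. Its time
    derivative [dTh] is the integrand of [fisher_dissipation]. *)
Let Th (t x : R) := f t x * ln (f t x) - 2^-1 * (f1 t x ^+ 2 / f t x).
Let dTh (t x : R) := f2 t x * (ln (f t x) + 1) - f1 t x * f3 t x / f t x
    + 2^-1 * (f1 t x ^+ 2 * f2 t x / f t x ^+ 2).

Let drvTh (t x : R) : 0 <= t -> is_derive t 1 (Th ^~ x) (dTh t x).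
Proof.
move=> t0; have fx0 : f t x != 0 by rewrite gt_eqF// f0.
have d := drv_heat s x t; have d1 := drv_heat (dl s) x t.
have h := drvB (drvM d (@drv_ln R (fun r => f r x) t _ (f0 x t0) d))
  (drvZ 2^-1 (drvM (drvX 2 d1) (@drv_inv R (fun r => f r x) t _ fx0 d))).
by apply: (drv_eq h); rewrite /dTh /= expr1; field.
Qed.

Let bln (t : R) : 0 <= t -> bm (fun x => ln (f t x)).
Proof. by move=> t0; apply: (bm_ln c0) => [x|]; [exact: fc|exact: bm_ev]. Qed.

Let binv (t : R) : 0 <= t -> bm (fun x => (f t x)^-1).
Proof. by move=> t0; apply: (bm_inv c0) => [x|]; [exact: fc|exact: bm_ev]. Qed.

Let bTh (t : R) : 0 <= t -> bm (Th t).
Proof.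
move=> t0; have bl := bln t0; have bi := binv t0; rewrite /Th.
by do !(first [assumption|apply: bm_ev|apply: bm_cst|apply: bmB|apply: bmX|apply: bmM]).
Qed.

Let M0 := nrm s. Let M1 := nrm (dl s). Let M2 := nrm (dl (dl s)).
Let M3 := nrm (dl (dl (dl s))). Let L := `|ln c| + `|ln M0|.

Let ln_bound (t x : R) : 0 <= t -> `|ln (f t x)| <= L.
Proof.
move=> t0; have fx0 := f0 x t0.
have l1 : ln c <= ln (f t x) by rewrite ler_ln ?posrE// fc.
have fM : f t x <= M0 by rewrite (le_trans (ler_norm _))// heat_bound.
have l2 : ln (f t x) <= ln M0 by rewrite ler_ln ?posrE// (lt_le_trans fx0).
have := ler_norm (ln M0); have := lerNnormlW (lexx `|ln c|).
have := normr_ge0 (ln c); have := normr_ge0 (ln M0).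
by rewrite /L => *; rewrite ler_norml; lra.
Qed.

Let inv_bound (t x : R) : 0 <= t -> `|(f t x)^-1| <= c^-1.
Proof.
move=> t0; have fx0 := f0 x t0; rewrite ger0_norm; last by rewrite invr_ge0 ltW.
by rewrite lef_pV2 ?posrE// fc.
Qed.

Let Th_bound (t x : R) : 0 <= t -> `|Th t x| <= M0 * L + 2^-1 * (M1 ^+ 2 * c^-1).
Proof.
move=> t0; rewrite (le_trans (ler_normB _ _))// lerD//.
  by rewrite normrM ler_pM// ?heat_bound// ln_bound.
rewrite normrM (ger0_norm (_ : 0 <= 2^-1))// ler_wpM2l// normrM ler_pM//.
  by rewrite normrX lerXn2r// ?nnegrE ?heat_bound// (le_trans (normr_ge0 _) (heat_bound (dl s) 0 t0)).
exact: inv_bound.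
Qed.

Let K := M2 * (L + 1) + M1 * M3 * c^-1 + 2^-1 * (M1 ^+ 2 * M2 * c^-1 ^+ 2).

Let dTh_bound (t x : R) : 0 <= t -> `|dTh t x| <= K.
Proof.
move=> t0; rewrite /dTh /K (le_trans (ler_normD _ _))// lerD//.
  rewrite (le_trans (ler_normB _ _))// lerD//.
    rewrite normrM ler_pM ?heat_bound// (le_trans (ler_normD _ _))// normr1 lerD2r.
    exact: ln_bound.
  by rewrite normrM ler_pM ?inv_bound// normrM ler_pM ?heat_bound.
rewrite normrM (ger0_norm (_ : 0 <= 2^-1))// ler_wpM2l// normrM -exprVn ler_pM//.
  rewrite normrM ler_pM ?heat_bound//.
  by rewrite normrX lerXn2r// ?nnegrE ?heat_bound// (le_trans (normr_ge0 _) (heat_bound (dl s) 0 t0)).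
by rewrite normrX lerXn2r// ?nnegrE ?inv_bound// invr_ge0 ltW.
Qed.

Let y t := esp U (Th t).

Let dTh_ge0 (t : R) : 0 <= t -> 0 <= esp U (dTh t).
Proof.
move=> t0.
have pev s' x : ev (heat t s') (x + 2 * pi) = ev (heat t s') x by exact: ev_per.
exact: (@fisher_dissipation R (ev (heat t s)) (ev (heat t (dl s)))
  (ev (heat t (dl (dl s)))) (ev (heat t (dl (dl (dl s)))))
  (ev (heat t (dl (dl (dl (dl s)))))) c
  (fun x => drv_ev_heat _ x t) (fun x => drv_ev_heat _ x t) (fun x => drv_ev_heat _ x t)
  (fun x => drv_ev_heat _ x t) (pev _) (pev _) (pev _)
  (bm_ev _) (bm_ev _) (bm_ev _) (bm_ev _) c0 (fun x => fc x t0)).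
Qed.

Let drvy (t : R) : 0 < t -> is_derive t 1 y (esp U (dTh t)).
Proof.
move=> t0.
have Ia : `]0, (t + 1)[%classic t by rewrite /= in_itv/= t0/= ltrDl.
have itf x : `]0, (t + 1)[%classic x -> U.-integrable setT (EFin \o Th x).
  by rewrite /= in_itv/= => /andP[x0 _]; apply: bm_int; apply: bTh; exact: ltW.
have der x z : `]0, (t + 1)[%classic x -> setT z -> derivable (Th ^~ z) x 1.
  rewrite /= in_itv/= => /andP[x0 _] _.
  exact: (@ex_derive _ _ _ _ _ _ _ (drvTh z (ltW x0))).
have dE x z : 0 < x -> derive1 (Th ^~ z) x = dTh x z.
  by move=> x0; rewrite derive1E; apply: (@derive_val _ _ _ _ _ _ _ (drvTh z (ltW x0))).
have bd x z : `]0, (t + 1)[%classic x -> setT z -> `|derive1 (Th ^~ z) x| <= K.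
  rewrite /= in_itv/= => /andP[x0 _] _; rewrite dE//; apply: dTh_bound; exact: ltW.
have K0 : 0 <= K by exact: le_trans (dTh_bound 0 (ltW t0)).
have iK : U.-integrable setT (EFin \o (fun=> K)) by apply: bm_int; exact: bm_cst.
have D1 := derivable_under_integral measurableT Ia itf der (fun=> K0) iK bd.
have D2 := differentiation_under_integral measurableT Ia itf der (fun=> K0) iK bd.
apply: DeriveDef => //; rewrite -derive1E D2.
transitivity (esp U (fun z => derive1 (Th ^~ z) t)); first by [].
by apply: eq_esp => z; exact: dE.
Qed.

Let y_mono (t1 t2 : R) : 0 < t1 -> t1 <= t2 -> y t1 <= y t2.
Proof.
move=> t10 t12; apply: (derive_nondecreasing t12 (df := fun t => esp U (dTh t))).
- by move=> x /andP[x1 _]; apply: drvy; exact: lt_trans x1.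
- apply: continuous_in_subspaceT => x; rewrite inE/= in_itv/= => /andP[x1 _].
  by apply: drv_cont; apply: drvy; exact: lt_le_trans x1.
- by move=> x /andP[x1 _]; apply: dTh_ge0; apply: ltW; exact: lt_trans x1.
Qed.

Let a0 := esp U (ev s).

Let a0E s' : esp U (ev s') = \sum_(w <- s') w.1.1 * (if w.1.2 == 0 then cos w.2 else 0).
Proof.
have bw (w : R * int * R) : bm (fun x : R => cos (w.1.2%:~R * x + w.2)).
  split; last by exists 1 => x; exact: cos_max.
  by apply: continuous_measurable_fun; exact: continuous_cos_affine.
rewrite esp_sum; last by move=> w; apply: bmZ; exact: bw.
by apply: eq_bigr => w _; rewrite espZ; [congr (_ * _); exact: esp_unif_wave|exact: bw].
Qed.

Let heat_lim s' x : ev (heat n.+1%:R s') x @[n --> \oo] --> esp U (ev s').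
Proof.
rewrite a0E.
have -> : (fun n => ev (heat n.+1%:R s') x) = (fun n => \sum_(w <- s')
    w.1.1 * (expR (- w.1.2%:~R ^+ 2) ^+ n.+1 * cos (w.1.2%:~R * x + w.2))).
  apply/funext => n; rewrite /ev big_map; apply: eq_bigr => w _ /=.
  by rewrite -mulrA -expRM_natl mulrN [_ * n.+1%:R]mulrC.
elim: s' => [|w s' IH].
  rewrite big_nil; have -> : (fun n : nat => \sum_(w <- [::]) w.1.1 * (expR (- w.1.2%:~R ^+ 2) ^+ n.+1 *
      cos (w.1.2%:~R * x + w.2))) = (fun=> 0) by apply/funext => n; rewrite big_nil.
  exact: cvg_cst.
have -> : (fun n : nat => \sum_(w <- w :: s') w.1.1 * (expR (- w.1.2%:~R ^+ 2) ^+ n.+1 *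
      cos (w.1.2%:~R * x + w.2))) = (fun n => w.1.1 * (expR (- w.1.2%:~R ^+ 2) ^+ n.+1 *
      cos (w.1.2%:~R * x + w.2)) + \sum_(w <- s') w.1.1 * (expR (- w.1.2%:~R ^+ 2) ^+ n.+1 *
      cos (w.1.2%:~R * x + w.2))) by apply/funext => n; rewrite big_cons.
rewrite big_cons; apply: cvgD; last exact: IH.
apply: cvgM; first exact: cvg_cst.
case: eqP => [->|/eqP w0].
  have -> : (fun n : nat => expR (- 0%:~R ^+ 2) ^+ n.+1 * cos (0%:~R * x + w.2)) = (fun=> cos w.2).
    by apply/funext => n; rewrite expr0n/= oppr0 expR0 expr1n mul1r mul0r add0r.
  exact: cvg_cst.
rewrite -(mul0r (cos (w.1.2%:~R * x + w.2))); apply: cvgM; last exact: cvg_cst.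
have h : `|expR (- w.1.2%:~R ^+ 2) : R| < 1.
  by rewrite ger0_norm ?expR_ge0// expR_lt1 oppr_lt0 exprn_even_gt0/= ?intr_eq0//.
have := cvg_expr h; by rewrite -cvg_shiftS.
Qed.

Let mean_dl : esp U (ev (dl s)) = 0.
Proof.
rewrite a0E big_map big1// => w _ /=.
by case: eqP => [->|_]; rewrite ?mulr0 ?mul0r//.
Qed.

Let a0_gt0 : 0 < a0.
Proof. by apply: lt_le_trans c0 _; apply: esp_ge => //; exact: bm_ev. Qed.

Let y_lim0 : y n.+1%:R^-1 @[n --> \oo] --> y 0.
Proof.
have p n : 0 <= n.+1%:R^-1 :> R by rewrite invr_ge0.
apply: (@esp_cvg _ _ _ U (fun n => Th n.+1%:R^-1) (Th 0)
  (M0 * L + 2^-1 * (M1 ^+ 2 * c^-1))) => [n|n x|x].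
- by case: (bTh (p n)).
- exact: Th_bound.
- have h := drv_cont (drvTh x (lexx 0)).
  exact: (@continuous_cvg _ _ _ _ _ (@harmonic R) (Th ^~ x) 0 h (@cvg_harmonic R)).
Qed.

Let y_lim : y n.+1%:R @[n --> \oo] --> a0 * ln a0.
Proof.
rewrite -[X in _ --> X](esp_cst U).
have p n : 0 <= n.+1%:R :> R by [].
apply: (@esp_cvg _ _ _ U (fun n => Th n.+1%:R) (fun=> a0 * ln a0)
  (M0 * L + 2^-1 * (M1 ^+ 2 * c^-1))) => [n|n x|x].
- by case: (bTh (p n)).
- exact: Th_bound.
- have l0 := @heat_lim s x; have l1 := @heat_lim (dl s) x; rewrite mean_dl in l1.
  have -> : a0 * ln a0 = a0 * ln a0 - 2^-1 * (0 * 0 / a0) by rewrite !mul0r mulr0 subr0.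
  rewrite /Th; apply: cvgB.
    by apply: cvgM => //; apply: (cvg_comp _ _ l0); exact: continuous_ln.
  apply: cvgM; first exact: cvg_cst.
  apply: cvgM; last by apply: cvgV => //; rewrite gt_eqF.
  by under eq_fun do rewrite expr2; apply: cvgM.
Qed.

(** The mean [y] of [Th] is nondecreasing in time and tends to [a0 * ln a0], because the flow
    converges to the constant [a0] and its derivative to 0; hence [y 0 <= a0 * ln a0], which is the
    inequality. *)
Theorem circle_log_sobolev :
  ent U (ev s) <= 2^-1 * esp U (fun x => ev (dl s) x ^+ 2 / ev s x).
Proof.
have le01 : y 0 <= a0 * ln a0.
  (* Differentiation under the integral is done at positive times; time 0 is reached along
     [n.+1%:R^-1] and infinity along [n.+1%:R]. *)
  apply: (ler_cvg_to y_lim0 y_lim); apply: nearW => n; apply: y_mono.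
    by rewrite invr_gt0.
  by rewrite (@le_trans _ _ 1)// ?invf_le1 ?ler1n.
have bl := bln (lexx 0); have bi := binv (lexx 0).
have y0E : y 0 = esp U (fun x => ev s x * ln (ev s x)) -
    2^-1 * esp U (fun x => ev (dl s) x ^+ 2 / ev s x).
  have e x : f 0 x = ev s x := heat0 s x.
  have e1 x : f1 0 x = ev (dl s) x := heat0 (dl s) x.
  have bl' : bm (fun x => ln (ev s x)) by apply: (bm_ln c0) => //; exact: bm_ev.
  have bi' : bm (fun x => (ev s x)^-1) by apply: (bm_inv c0) => //; exact: bm_ev.
  rewrite -espZ; last first.
    by do !(first [assumption|apply: bm_ev|apply: bm_cst|apply: bmB|apply: bmX|apply: bmM]).
  rewrite -espB; [by apply: eq_esp => x; rewrite /Th e e1| |];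
    by do !(first [assumption|apply: bm_ev|apply: bm_cst|apply: bmB|apply: bmX|apply: bmM]).
by rewrite y0E in le01; rewrite /ent -/a0; lra.
Qed.

End log_sobolev.

Section taylor.
Variable R : realType.
Implicit Types y M : R.

(** The exponential of a trigonometric polynomial is not one, but its truncated series is. The sum
    has [n] terms, hence degree [n - 1], and differentiation lowers the index by one. *)
Definition texp n y : R := \sum_(j < n) y ^+ j / j`!%:R.

Lemma texpS n y : texp n.+1 y = texp n y + y ^+ n / n`!%:R.
Proof. by rewrite /texp big_ord_recr. Qed.

Lemma drv_texp n y : is_derive y 1 (texp n.+1) (texp n y).
Proof.
elim: n => [|n IH].
  have -> : texp 1 = (fun=> 1).
    by apply/funext => z; rewrite /texp big_ord_recr big_ord0/= add0r expr0 fact0 divr1.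
  by rewrite /texp big_ord0; exact: drv_cst.
have -> : texp n.+2 = (fun z => texp n.+1 z + z ^+ n.+1 / n.+1`!%:R) by apply/funext => z; rewrite texpS.
apply: (drv_eq (drvD IH (drvM (drvX n.+1 (drv_id y)) (drv_cst n.+1`!%:R^-1 y)))).
have f0 : n`!%:R != 0 :> R by rewrite pnatr_eq0 -lt0n fact_gt0.
have n0 : n.+1%:R != 0 :> R by [].
rewrite texpS /= factS natrM; move: (n.+1%:R) (n`!%:R) f0 n0 => a b b0 a0.
by field; rewrite a0 b0.
Qed.

Lemma texp_cvg y : texp n y @[n --> \oo] --> expR y.
Proof.
have -> : texp ^~ y = series (exp_coeff y).
  by apply/funext => n; rewrite /series/= big_mkord.
exact: is_cvg_series_exp_coeff.
Qed.

Lemma texp_dist n y M : `|y| <= M -> `|texp n y - expR y| <= expR M - texp n M.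
Proof.
move=> yM; have M0 : 0 <= M by exact: le_trans yM.
have h m : `|texp n y - texp (n + m) y| <= texp (n + m) M - texp n M.
  elim: m => [|m IH]; first by rewrite addn0 !subrr normr0.
  rewrite addnS !texpS opprD addrA (le_trans (ler_normB _ _))// addrAC lerD//.
  rewrite normrM normrX (ger0_norm (_ : 0 <= _^-1)) ?invr_ge0//.
  by rewrite ler_wpM2r ?invr_ge0// lerXn2r ?nnegrE.
have s z : texp (n + m) z @[m --> \oo] --> expR z.
  have := @texp_cvg z; rewrite -(cvg_shiftn n) => h'; suff -> : (fun m => texp (n + m) z) = (fun m => texp (m + n) z) by [].
  by apply/funext => m; rewrite addnC.
have l1 : `|texp n y - texp (n + m) y| @[m --> \oo] --> `|texp n y - expR y|.
  by apply: cvg_norm; apply: cvgB; [exact: cvg_cst|exact: s].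
have l2 : texp (n + m) M - texp n M @[m --> \oo] --> expR M - texp n M.
  by apply: cvgB; [exact: s|exact: cvg_cst].
exact: ler_cvg_to l1 l2 (nearW _ h).
Qed.

Lemma texp_uniform M e : 0 < e -> exists n0, forall n y, (n0 <= n)%N -> `|y| <= M ->
  `|texp n y - expR y| <= e.
Proof.
move=> e0; have /cvgrPdist_le/(_ e e0) [n0 _ h] := @texp_cvg M.
exists n0 => n y n0n yM; apply: (le_trans (texp_dist n yM)).
by apply: (le_trans (ler_norm _)); exact: h.
Qed.

Lemma texp_bound n y M : `|y| <= M -> `|texp n y| <= expR M.
Proof.
move=> yM; have M0 : 0 <= M by exact: le_trans yM.
have mono : {homo texp ^~ M : m k / (m <= k)%N >-> m <= k}.
  apply/nondecreasing_seqP => k; rewrite texpS lerDl.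
  by rewrite mulr_ge0 ?exprn_ge0// invr_ge0.
apply: (@le_trans _ _ (texp n M)).
  rewrite /texp (le_trans (ler_norm_sum _ _ _))// ler_sum// => i _.
  rewrite normrM normrX (ger0_norm (_ : 0 <= _^-1)) ?invr_ge0//.
  by rewrite ler_wpM2r ?invr_ge0// lerXn2r ?nnegrE.
have cM := @texp_cvg M; rewrite -(cvg_lim _ cM)//.
have cc : cvgn (texp ^~ M) by apply/cvg_ex; exists (expR M).
exact: (nondecreasing_cvgn_le mono cc n).
Qed.

Lemma bm_texp d (T : measurableType d) (f : T -> R) n : bm f -> bm (fun x => texp n (f x)).
Proof.
move=> bf; rewrite /texp; apply: bm_sum => j.
have -> : (fun x => f x ^+ j / j`!%:R) = (fun x => j`!%:R^-1 * f x ^+ j) by apply/funext => x; rewrite mulrC.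
by apply: bmZ; exact: bmX.
Qed.

End taylor.

Section exponential_lists.
Variable R : realType.
Implicit Types s t : seq (R * int * R).

Definition lmul s t : seq (R * int * R) :=
  [seq (w.1.1 * v.1.1 / 2, w.1.2 + v.1.2, w.2 + v.2) | w <- s, v <- t] ++
  [seq (w.1.1 * v.1.1 / 2, w.1.2 - v.1.2, w.2 - v.2) | w <- s, v <- t].

Lemma ev_lmul s t x : ev (lmul s t) x = ev s x * ev t x.
Proof.
rewrite /ev big_cat/= !big_allpairs_dep -big_split/= mulr_suml; apply: eq_bigr => w _.
rewrite -big_split/= mulr_sumr; apply: eq_bigr => v _.
rewrite intrD intrB !mulrDl mulNr.
set y := w.1.2%:~R * x; set z := v.1.2%:~R * x.
have -> : y + z + (w.2 + v.2) = (y + w.2) + (z + v.2) by ring.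
have -> : y - z + (w.2 - v.2) = (y + w.2) - (z + v.2) by ring.
by rewrite (cosD (y + w.2) (z + v.2)) (cosB (y + w.2) (z + v.2)); field.
Qed.

Fixpoint lpow s j := if j is j'.+1 then lmul s (lpow s j') else [:: (1, 0, 0)].

Lemma ev_lpow s j x : ev (lpow s j) x = ev s x ^+ j.
Proof.
elim: j => [|j IH] /=; last by rewrite ev_lmul IH exprS.
by rewrite /ev big_seq1/= mul0r add0r cos0 mulr1.
Qed.

Fixpoint ltexp s n : seq (R * int * R) :=
  if n is n'.+1 then ltexp s n' ++ [seq (w.1.1 / n'`!%:R, w.1.2, w.2) | w <- lpow s n'] else [::].

Lemma ev_ltexp s n x : ev (ltexp s n) x = texp n (ev s x).
Proof.
elim: n => [|n IH] /=; first by rewrite /ev big_nil /texp big_ord0.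
rewrite texpS -IH -ev_lpow /ev big_cat big_map/= mulr_suml; congr (_ + _).
by apply: eq_bigr => w _; rewrite mulrAC.
Qed.

Lemma ev_dl_ltexp s n x : ev (dl (ltexp s n.+1)) x = texp n (ev s x) * ev (dl s) x.
Proof.
have h1 := drv_ev (ltexp s n.+1) x.
have h2 := @drv_comp R (texp n.+1) (ev s) x _ _ (drv_texp n (ev s x)) (drv_ev s x).
have e : ev (ltexp s n.+1) = (fun y => texp n.+1 (ev s y)).
  by apply/funext => y; exact: ev_ltexp.
by rewrite e in h1; rewrite -(@derive_val _ _ _ _ _ _ _ h1) (@derive_val _ _ _ _ _ _ _ h2).
Qed.

(** Passes from polynomials to their exponentials through the truncations [f k], whose derivative is
    [g k] times [ev (dl s)]; both converge boundedly. *)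
Lemma circle_log_sobolev_exp s : ent (@unif R) (fun x => expR (ev s x)) <=
  2^-1 * esp (@unif R) (fun x => expR (ev s x) * ev (dl s) x ^+ 2).
Proof.
set U := @unif R; set M := nrm s; set M1 := nrm (dl s).
have vM x : `|ev s x| <= M by exact: ev_bound.
have e0 : 0 < expR (- M) / 2 by rewrite divr_gt0// expR_gt0.
have [n0 hn0] := texp_uniform M e0.
have eM x : expR (- M) <= expR (ev s x).
  by rewrite ler_expR; have := vM x; rewrite ler_norml => /andP[].
have low n x : (n0 <= n)%N -> expR (- M) / 2 <= texp n (ev s x).
  by move=> n0n; have := hn0 n (ev s x) n0n (vM x); have := eM x; rewrite ler_norml; lra.
set f := fun k x => texp (n0 + k).+1 (ev s x); set g := fun k x => texp (n0 + k) (ev s x).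
have fl k x : expR (- M) / 2 <= f k x by apply: low; rewrite -addnS leq_addr.
have f_gt k x : 0 < f k x by exact: lt_le_trans e0 (fl k x).
have bs := @bm_ev R s; have bds := @bm_ev R (dl s).
have bf k : bm (f k) by exact: bm_texp.
have bg k : bm (g k) by exact: bm_texp.
have fM k x : `|f k x| <= expR M by exact: texp_bound.
have gM k x : `|g k x| <= expR M by exact: texp_bound.
have cg x : g k x @[k --> \oo] --> expR (ev s x).
  have := @texp_cvg R (ev s x); rewrite -(cvg_shiftn n0) => h'.
  by suff -> : g ^~ x = (fun m => texp (m + n0) (ev s x)) by []; apply/funext => m; rewrite /g addnC.
have cf x : f k x @[k --> \oo] --> expR (ev s x).
  have := @texp_cvg R (ev s x); rewrite -(cvg_shiftn n0.+1) => h'.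
  by suff -> : f ^~ x = (fun m => texp (m + n0.+1) (ev s x)) by []; apply/funext => m; rewrite /f addnC addnS.
set q := fun k x => g k x ^+ 2 * ev (dl s) x ^+ 2 / f k x.
have bq k : bm (q k).
  by apply: bmM; [apply: bmM; apply: bmX|apply: (bm_inv e0)].
set l := ln (esp U (fun x => expR (ev s x))).
(* The entropy of [f k] is bounded below by testing it against [ev s], so that the limit is taken in
   expressions that are linear in [f k] instead of [f k * ln (f k)]. *)
have ineq k : esp U (fun x => f k x * ev s x) - esp U (f k) * l <= 2^-1 * esp U (q k).
  have fE : f k = ev (ltexp s (n0 + k).+1) by apply/funext => x; rewrite ev_ltexp.
  have h := @circle_log_sobolev R (ltexp s (n0 + k).+1) _ e0 (fun x => _).
  have {}h : ent U (f k) <= 2^-1 * esp U (q k).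
    rewrite fE; apply: (le_trans (h _)) => [x|]; first by rewrite ev_ltexp; exact: fl.
    rewrite ler_pM2l// le_eqVlt; apply/orP; left; apply/eqP; apply: eq_esp => x.
    by rewrite ev_dl_ltexp ev_ltexp /q /f /g exprMn.
  have gib := gibbs_variational U e0 (fl k) (bf k) bs.
  by rewrite lerBlDr (le_trans gib)// lerD2r.
have M0 : 0 <= M by exact: le_trans (vM 0).
have c1 : esp U (fun x => f k x * ev s x) @[k --> \oo] --> esp U (fun x => expR (ev s x) * ev s x).
  apply: (@esp_cvg _ _ _ U (fun k x => f k x * ev s x) _ (expR M * M)) => [k|k x|x].
  - by have [] := bmM (bf k) bs.
  - by rewrite normrM ler_pM.
  - by apply: cvgM; [exact: cf|exact: cvg_cst].
have c2 : esp U (f k) @[k --> \oo] --> esp U (fun x => expR (ev s x)).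
  by apply: (@esp_cvg _ _ _ U f _ (expR M)) => [k|k x|x]; [have [] := bf k|exact: fM|exact: cf].
have c3 : esp U (q k) @[k --> \oo] --> esp U (fun x => expR (ev s x) * ev (dl s) x ^+ 2).
  apply: (@esp_cvg _ _ _ U q _ (expR M ^+ 2 * M1 ^+ 2 * (expR (- M) / 2)^-1)) => [k|k x|x].
  - by have [] := bq k.
  - rewrite /q normrM; apply: ler_pM => //; last first.
      have fkx := f_gt k x; rewrite ger0_norm; last by rewrite invr_ge0 ltW.
      by rewrite lef_pV2.
    rewrite normrM; apply: ler_pM => //; rewrite normrX lerXn2r ?nnegrE ?expR_ge0 ?ev_bound//.
    exact: (le_trans (normr_ge0 _) (ev_bound (dl s) 0)).
  - have -> : expR (ev s x) * ev (dl s) x ^+ 2 =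
      expR (ev s x) * expR (ev s x) * ev (dl s) x ^+ 2 / expR (ev s x).
      by field; rewrite gt_eqF// expR_gt0.
    rewrite /q; apply: cvgM.
      apply: cvgM; last exact: cvg_cst.
      by under eq_fun do rewrite expr2; apply: cvgM; exact: cg.
    by apply: cvgV; [rewrite gt_eqF// expR_gt0|exact: cf].
have cl : esp U (fun x => f k x * ev s x) - esp U (f k) * l @[k --> \oo] -->
    esp U (fun x => expR (ev s x) * ev s x) - esp U (fun x => expR (ev s x)) * l.
  by apply: cvgB => //; apply: cvgM => //; exact: cvg_cst.
have cr : 2^-1 * esp U (q k) @[k --> \oo] --> 2^-1 * esp U (fun x => expR (ev s x) * ev (dl s) x ^+ 2).
  by apply: cvgM => //; exact: cvg_cst.
apply: le_trans (ler_cvg_to cl cr (nearW _ ineq)).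
rewrite /ent -/l lerD2r le_eqVlt; apply/orP; left; apply/eqP.
by apply: eq_esp => x; rewrite expRK.
Qed.

End exponential_lists.

(** * Decay of the Fourier modes of the mean-field law *)

Section mean_field_waves.
Variable R : realType.
Local Notation C := (circle R).

Lemma derive1n_cos (k b : R) n : derive1n n (fun y => cos (k * y + b)) =
  (fun x => k ^+ n * cos (k * x + (b + n%:R * (pi / 2)))).
Proof.
elim: n => [|n IH]; first by apply/funext => x /=; rewrite mul0r addr0 expr0 mul1r.
apply/funext => x; rewrite derive1nS IH derive1E.
have := drvZ (k ^+ n) (drv_cos_affine k (b + n%:R * (pi / 2)) x).
move=> /@derive_val ->; rewrite mulrA -exprSr; congr (_ * cos _); rewrite -natr1; ring.
Qed.

Lemma smooth1_wave (k : int) b : smooth1 (lift1 (@wave1 R k b)).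
Proof.
have -> : lift1 (@wave1 R k b) = (fun x => cos (k%:~R * x + b)).
  by apply/funext => x; rewrite /lift1 wave1_pi.
move=> n x; rewrite derive1n_cos.
exact: (@ex_derive _ _ _ _ _ _ _ (drvZ _ (drv_cos_affine _ _ x))).
Qed.

Variables (J : R) (m : R -> probability C R).
Hypothesis mFP : mean_field_Fokker_Planck J m.

Definition mean t (k : int) b := esp (m t) (wave1 k b).

Lemma mean_cont k b : {within `[0, +oo[, continuous (fun t => mean t k b)}.
Proof. by have [] := mFP (@smooth1_wave k b). Qed.

Definition drift t (x : C) : R :=
  mean t 1 0 * wave1 1 (- (pi / 2)) x - mean t 1 (- (pi / 2)) * wave1 1 0 x.

Lemma drift_int t x : \int[m t]_theta' sin_diff x theta' = drift t x.
Proof.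
rewrite -[LHS]/(esp (m t) (fun y => sin_diff x y)).
have -> : (fun y => sin_diff x y) = (fun y => wave1 1 (- (pi / 2)) x * wave1 1 0 y
    - wave1 1 0 x * wave1 1 (- (pi / 2)) y).
  by apply/funext => y; rewrite /sin_diff /wave1 !mul1r !addr0 !cosBpihalf sinB.
have b1 := bm_wave1; rewrite espB ?espZ//; try exact: bmZ.
by rewrite /drift /mean; ring.
Qed.

Lemma mean_derive k b (t : R) : 0 < t -> is_derive t 1 (fun s => mean s k b)
  (esp (m t) (fun x => - k%:~R ^+ 2 * wave1 k b x
      - J * drift t x * (k%:~R * wave1 k (b + pi / 2) x))).
Proof.
move=> t0; have [_ /(_ t t0) h] := mFP (@smooth1_wave k b).
apply: (drv_eq h); apply: eq_esp => x.
rewrite /mean_field_generator drift_int.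
have -> : lift1 (@wave1 R k b) = (fun x => cos (k%:~R * x + b)).
  by apply/funext => y; rewrite /lift1 wave1_pi.
rewrite derive1n_cos -[derive1 _]/(derive1n 1 _) derive1n_cos /wave1 expr1 mul1r.
congr (_ - _); have -> : 2%:R * (pi / 2) = pi :> R by field.
by rewrite addrA cosDpi mulrN mulNr.
Qed.

(** The interaction is a first harmonic, so that mode [k] is coupled to the modes [k + 1] and
    [k - 1] only. *)
Lemma mean_ode (k : int) b (t : R) : 0 < t -> is_derive t 1 (fun s => mean s k b)
  (- k%:~R ^+ 2 * mean t k b - J * k%:~R / 2 *
    (mean t 1 0 * (mean t (k + 1) b - mean t (k - 1) b)
     - mean t 1 (- (pi / 2)) * (mean t (k + 1) (b + pi / 2) + mean t (k - 1) (b + pi / 2)))).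
Proof.
move=> t0; apply: (drv_eq (mean_derive k b t0)).
set a1 := mean t 1 0; set b1 := mean t 1 (- (pi / 2)).
have -> : (fun x => - k%:~R ^+ 2 * wave1 k b x
      - J * drift t x * (k%:~R * wave1 k (b + pi / 2) x)) = (fun x : C =>
    (- k%:~R ^+ 2 * wave1 k b x - (J * k%:~R / 2 * a1) * (wave1 (k + 1) b x - wave1 (k - 1) b x))
     + (J * k%:~R / 2 * b1) * (wave1 (k + 1) (b + pi / 2) x + wave1 (k - 1) (b + pi / 2) x)).
  apply/funext => x; rewrite /drift -/a1 -/b1 /wave1.
  set y := repr x; rewrite !mul1r !addr0 cosBpihalf !addrA !cosDpihalf.
  rewrite !intrD mulrNz !mulr1z !mulrDl mulNr !mul1r.
  have -> : k%:~R * y + y + b = (k%:~R * y + b) + y by ring.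
  have -> : k%:~R * y + -1 * y + b = (k%:~R * y + b) - y by ring.
  move: (k%:~R) => v; move: (v * y + b) => u.
  by rewrite (cosD u y) (cosB u y) (sinD u y) (sinB u y); field.
have bw := @bm_wave1 R.
rewrite espD ?espB ?espZ ?espB ?espD//.
all: try by do ?[exact: bw|apply: bmB|apply: bmD|apply: bmZ].
by rewrite /mean; ring.
Qed.

Lemma mean_bound t k b : `|mean t k b| <= 1.
Proof. by apply: esp_norm => [|x]; [exact: bm_wave1|exact: cos_max]. Qed.

End mean_field_waves.

Section particle_waves.
Variables (R : realType) (N : nat).
Local Notation C := (circle R).
Implicit Types (k : {ffun 'I_N -> int}) (b c : R).

Let lw k c b : 'rV[R]_N -> R := fun x => c * cos (\sum_i (k i)%:~R * x 0 i + b).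

Lemma liftN_wave k b : liftN (@wave R N k b) = lw k 1 b.
Proof. by apply/funext => x; rewrite /liftN wave_pi /lw mul1r. Qed.

Let lw_partial k c b i x : is_derive x (delta_mx 0 i) (lw k c b)
  (c * (k i)%:~R * cos (\sum_i (k i)%:~R * x 0 i + (b + pi / 2))).
Proof.
set s := \sum_i _.
have h := drvZ c (drv_cos_affine (k i)%:~R (s + b) 0).
have e (y : R) : c * cos ((k i)%:~R * y + (s + b)) = lw k c b (y *: delta_mx 0 i + x).
  rewrite /lw; congr (_ * cos _); rewrite addrA; congr (_ + _).
  rewrite /s (bigD1 i)//= [in RHS](bigD1 i)//= !mxE !eqxx mulr1 mulrDr addrA [RHS]addrC.
  rewrite [in RHS]addrC; congr (_ + _); apply: eq_bigr => j ji.
  by rewrite !mxE (negbTE ji) andbF mulr0 add0r.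
have lim : h0^-1 *: (lw k c b (h0 *: delta_mx 0 i + x) - lw k c b x) @[h0 --> 0^'] -->
    (c * (k i)%:~R * cos (s + (b + pi / 2))).
  have [hd hv] := h.
  move: hd => /cvg_ex[l hl].
  have lE : l = c * (k i)%:~R * cos (s + (b + pi / 2)).
    have <- := cvg_lim _ hl; last by [].
    by move: hv; rewrite /derive => ->; rewrite mulr0 add0r mulrA addrA.
  rewrite -lE; move: hl; apply: cvg_trans; apply: near_eq_cvg; apply: nearW => y /=.
  rewrite -e; have := e 0; rewrite scale0r add0r => <-.
  by rewrite scaler1 addr0 mulr0.
apply: DeriveDef; first by apply/cvg_ex; eexists; exact: lim.
exact: cvg_lim lim.
Qed.

Lemma partial_lw k c b i : partial i (lw k c b) = lw k (c * (k i)%:~R) (b + pi / 2).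
Proof. by apply/funext => x; rewrite /partial; case: (lw_partial k c b i x). Qed.

Lemma smooth_wave k b : smooth (liftN (@wave R N k b)).
Proof.
rewrite liftN_wave => s.
have [c [b' ->]] : exists c b', iter_partial s (lw k 1 b) = lw k c b'.
  elim: s => [|i s [c [b' IH]]]; first by exists 1, b.
  by exists (c * (k i)%:~R), (b' + pi / 2); rewrite /= IH partial_lw.
split; last by move=> i x; exact: (@ex_derive _ _ _ _ _ _ _ (lw_partial _ _ _ _ x)).
have cs : continuous (fun y : 'rV[R]_N => \sum_i (k i)%:~R * y 0 i + b').
  have ci (l : seq 'I_N) : continuous (fun y : 'rV[R]_N => \sum_(i <- l) (k i)%:~R * y 0 i).
    elim: l => [|i l IH].
      have -> : (fun y : 'rV[R]_N => \sum_(i <- [::]) (k i)%:~R * y 0 i) = (fun=> 0).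
        by apply/funext => y; rewrite big_nil.
      exact: cst_continuous.
    have -> : (fun y : 'rV[R]_N => \sum_(j <- i :: l) (k j)%:~R * y 0 j) =
        (fun y => (k i)%:~R * y 0 i + \sum_(j <- l) (k j)%:~R * y 0 j).
      by apply/funext => y; rewrite big_cons.
    move=> y; apply: (@cvgD _ _ _ _ (nbhs_filter y)); last exact: IH.
    have cm : continuous (fun z : R => (k i)%:~R * z).
      by move=> z; exact: (drv_cont (drvZ _ (drv_id z))).
    exact: (@continuous_comp _ _ _ (fun z : 'rV[R]_N => z 0 i) (fun z => (k i)%:~R * z) y
      (@coord_continuous R 1 N 0 i y) (cm _)).
  move=> y; apply: (@cvgD _ _ _ _ (nbhs_filter y)); first exact: ci.
  exact: cst_continuous.
move=> x; apply: (@cvgM _ _ _ (nbhs_filter x)); first exact: cst_continuous.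
exact: (continuous_comp (cs x) (@continuous_cos R _)).
Qed.

Variables (J : R) (mN : R -> probability (N.-tuple C) R).
Hypothesis mFP : particle_Fokker_Planck J mN.

Lemma sum_repr_row k (t : N.-tuple C) :
  \sum_i (k i)%:~R * (repr_row t) 0 i = angle k t.
Proof. by apply: eq_bigr => i _; rewrite mxE. Qed.

Definition Lwave k b (t : N.-tuple C) : R := \sum_(i < N)
  (- (k i)%:~R ^+ 2 * wave k b t
   - J / N%:R * (\sum_(j < N) sin_diff (tnth t i) (tnth t j)) * ((k i)%:~R * wave k (b + pi / 2) t)).

Lemma particle_wave_cont k b : {within `[0, +oo[, continuous (fun t => esp (mN t) (wave k b))}.
Proof. by have [] := mFP (@smooth_wave k b). Qed.

Lemma particle_wave_derive k b (t : R) : 0 < t ->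
  is_derive t 1 (fun s => esp (mN s) (wave k b)) (esp (mN t) (Lwave k b)).
Proof.
move=> t0; have [_ /(_ t t0) h] := mFP (@smooth_wave k b).
apply: (drv_eq h); apply: eq_esp => x.
rewrite /particle_generator /Lwave; apply: eq_bigr => i _.
rewrite liftN_wave !partial_lw /lw sum_repr_row mul1r; congr (_ - _).
by rewrite !addrA !cosDpihalf sinDpihalf /wave; ring.
Qed.

End particle_waves.

Lemma derive_nondecreasing_closed (R : realType) (f df : R -> R) (a b : R) : a <= b ->
  (forall x : R, a <= x <= b -> is_derive x 1 f (df x)) ->
  (forall x : R, a <= x <= b -> 0 <= df x) -> f a <= f b.
Proof.
move=> ab fdf df0.
have wI x : a < x < b -> a <= x <= b by move=> /andP[/ltW -> /ltW ->].
apply: (derive_nondecreasing ab (df := df)) => [x /wI/fdf//||x /wI/df0//].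
apply: continuous_in_subspaceT => x; rewrite inE/= in_itv/= => /fdf d.
exact: drv_cont d.
Qed.

Lemma gronwall (R : realType) (f df : R -> R) (a G s t : R) : 0 < a -> 0 <= G -> s <= t ->
  (forall x : R, s <= x <= t -> is_derive x 1 f (df x)) ->
  (forall x : R, s <= x <= t -> df x <= - a * f x + G) ->
  f t <= expR (- a * (t - s)) * f s + G / a.
Proof.
move=> a0 G0 st df_f fG.
have dg (x : R) : s <= x <= t -> is_derive x 1 (fun y => expR (a * (y - t)) * (G / a - f y))
    (expR (a * (x - t)) * (G - a * f x - df x)).
  move=> /df_f d.
  have := drvM (drv_exp (drvZ a (drvB (drv_id x) (drv_cst t x)))) (drvB (drv_cst (G / a) x) d).
  by move/drv_eq; apply; field; rewrite gt_eqF.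
have h := derive_nondecreasing_closed st dg.
have {h} : expR (a * (s - t)) * (G / a - f s) <= expR (a * (t - t)) * (G / a - f t).
  apply: h => x xs; rewrite mulr_ge0 ?expR_ge0//.
  by have := fG x xs; lra.
rewrite subrr mulr0 expR0 mul1r.
have -> : a * (s - t) = - a * (t - s) by ring.
have : 0 <= expR (- a * (t - s)) * (G / a) by rewrite mulr_ge0 ?expR_ge0// divr_ge0// ltW.
by rewrite mulrBr; lra.
Qed.

Lemma gronwall_norm (R : realType) (f g : R -> R) (a G s t : R) : 0 < a -> s <= t ->
  (forall x : R, s <= x <= t -> is_derive x 1 f (- a * f x + g x)) ->
  (forall x : R, s <= x <= t -> `|g x| <= G) ->
  `|f t| <= expR (- a * (t - s)) * `|f s| + G / a.
Proof.
move=> a0 st dff gG.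
have G0 : 0 <= G by apply: le_trans (gG s _) => //; rewrite lexx.
have gG' x : s <= x <= t -> - G <= g x <= G by move=> /gG; rewrite ler_norml.
have e0 := expR_ge0 (- a * (t - s)).
rewrite ler_norml; apply/andP; split.
  have dN x : s <= x <= t -> is_derive x 1 (fun y => - f y) (- (- a * f x + g x)).
    by move=> /dff; exact: drvN.
  have : - f t <= expR (- a * (t - s)) * - f s + G / a.
    by apply: (gronwall a0 G0 st dN) => x /gG'; lra.
  have : expR (- a * (t - s)) * - f s <= expR (- a * (t - s)) * `|f s|.
    by rewrite ler_wpM2l// -normrN ler_norm.
  lra.
have : f t <= expR (- a * (t - s)) * f s + G / a.
  by apply: (gronwall a0 G0 st dff) => x /gG'; lra.
have : expR (- a * (t - s)) * f s <= expR (- a * (t - s)) * `|f s|.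
  by rewrite ler_wpM2l// ler_norm.
lra.
Qed.

(** * Smoothing and exponential decay of the Fourier modes *)

Section fourier_decay.
Variables (R : realType) (J : R) (m : R -> probability (circle R) R).
Hypotheses (J0 : 0 < J) (J2 : J < 2) (mFP : mean_field_Fokker_Planck J m).

Lemma mean_odeS n b (t : R) : 0 < t -> is_derive t 1 (fun s => mean m s n.+1%:Z b)
  (- n.+1%:R ^+ 2 * mean m t n.+1%:Z b - J * n.+1%:R / 2 *
    (mean m t 1 0 * (mean m t n.+2%:Z b - mean m t n%:Z b)
     - mean m t 1 (- (pi / 2)) * (mean m t n.+2%:Z (b + pi / 2) + mean m t n%:Z (b + pi / 2)))).
Proof.
move=> t0; apply: (drv_eq (mean_ode mFP n.+1%:Z b t0)).
have -> : n.+1%:Z + 1 = n.+2%:Z by rewrite -PoszD addn1.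
have -> : n.+1%:Z - 1 = n%:Z by rewrite -addn1 PoszD addrK.
by rewrite -pmulrn.
Qed.

(** Parabolic smoothing gains one power of the frequency per unit of time: mode [k] is damped at
    rate [k ^+ 2], while its forcing is of order [k] times the size of the neighbouring modes. The
    value one unit of time earlier is damped by [expR (- k ^+ 2) <= k^-1]. *)
Lemma bootstrap p M T : 0 < T -> 1 <= M ->
  (forall t n b, T <= t -> `|mean m t n.+1%:Z b| <= M / n.+1%:R ^+ p) ->
  forall t n b, T + 1 <= t -> `|mean m t n.+1%:Z b| <= (1 + 4 * 2 ^+ p) * M / n.+1%:R ^+ p.+1.
Proof.
move=> T0 M1 hM t [|n] b Tt.
  rewrite expr1n divr1 (le_trans (mean_bound _ _ _ _))//.
  have : 0 <= 2 ^+ p :> R by rewrite exprn_ge0.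
  by nra.
set k : R := n.+2%:R; have k0 : 0 < k by [].
have k1 : 1 <= k by rewrite ler1n.
(* The neighbouring modes have frequency at least [k / 2], which costs the factor [2 ^+ p]. *)
set B := 2 ^+ p * M / k ^+ p.
have kp : 0 < k ^+ p by exact: exprn_gt0.
have near s j c : T <= s -> (n.+2 <= 2 * j.+1)%N -> `|mean m s j.+1%:Z c| <= B.
  move=> Ts nj; apply: (le_trans (hM s j c Ts)); rewrite /B.
  have kj : k ^+ p <= 2 ^+ p * j.+1%:R ^+ p.
    by rewrite -exprMn lerXn2r ?nnegrE// -natrM ler_nat.
  have jp : 0 < j.+1%:R ^+ p :> R by exact: exprn_gt0.
  rewrite ler_pdivrMr// mulrAC ler_pdivlMr// [leRHS]mulrAC [leRHS]mulrC ler_wpM2l//.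
  lra.
have h := @gronwall_norm R (fun s => mean m s n.+2%:Z b) (fun s => - (J * k / 2 *
    (mean m s 1 0 * (mean m s n.+3%:Z b - mean m s n.+1%:Z b)
     - mean m s 1 (- (pi / 2)) * (mean m s n.+3%:Z (b + pi / 2) + mean m s n.+1%:Z (b + pi / 2)))))
  (k ^+ 2) (4 * k * B) (t - 1) t (exprn_gt0 2 k0).
have B0 : 0 <= B by apply: divr_ge0; [apply: mulr_ge0; [exact: exprn_ge0|lra]|exact: ltW].
have {}h : `|mean m t n.+2%:Z b| <= expR (- k ^+ 2 * (t - (t - 1))) * `|mean m (t - 1) n.+2%:Z b|
    + 4 * k * B / k ^+ 2.
  apply: h => [|x /andP[x1 x2]|x /andP[x1 x2]]; first lra.
    by apply: mean_odeS; lra.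
  have Tx : T <= x by lra.
  have a3 c := near x n.+2 c Tx (leq_trans (leqnSn _) (leq_pmull n.+3 (isT : 0 < 2)%N)).
  have nn : (n.+2 <= 2 * n.+1)%N by rewrite mul2n -addnn addSn ltnS addnS ltnS leq_addr.
  have a1 c := near x n c Tx nn.
  rewrite normrN normrM ger0_norm; last by rewrite !mulr_ge0// ltW.
  have -> : 4 * k * B = 2 * k / 2 * (1 * (B + B) + 1 * (B + B)) by field.
  rewrite ler_pM//.
  - by rewrite !mulr_ge0// ltW.
  - by rewrite !ler_pM2r// ltW.
  rewrite (le_trans (ler_normB _ _))// lerD//.
    by rewrite normrM ler_pM ?mean_bound// (le_trans (ler_normB _ _))// lerD.
  by rewrite normrM ler_pM ?mean_bound// (le_trans (ler_normD _ _))// lerD.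
apply: (le_trans h).
have -> : - k ^+ 2 * (t - (t - 1)) = - k ^+ 2 by ring.
have -> : (1 + 4 * 2 ^+ p) * M / k ^+ p.+1 = k^-1 * (M / k ^+ p) + 4 * k * B / k ^+ 2.
  by rewrite /B exprS; field; rewrite !gt_eqF.
rewrite lerD2r ler_pM ?expR_ge0//.
  rewrite expRN lef_pV2 ?posrE ?expR_gt0//.
  by rewrite (le_trans _ (expR_ge1Dx _))//; nra.
by apply: hM; lra.
Qed.

(** Three rounds of smoothing from the trivial bound 1 at time 1, with [765 = 5 * 9 * 17]. The cubic
    decay makes the series of frequency times modulus summable, with a constant that is the same for
    all solutions. *)
Lemma mean_decay3 t n b : 4 <= t -> `|mean m t n.+1%:Z b| <= 765 / n.+1%:R ^+ 3.
Proof.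
have h0 (s : R) n' c : 1 <= s -> `|mean m s n'.+1%:Z c| <= 1 / n'.+1%:R ^+ 0.
  by move=> _; rewrite expr0 divr1 mean_bound.
have h1 := bootstrap ltr01 (lexx 1) h0.
have a2 : (0 : R) < 1 + 1 by lra.
have a3 : (0 : R) < 1 + 1 + 1 by lra.
have m1 : (1 : R) <= (1 + 4 * 2 ^+ 0) * 1 by lra.
have h2 := bootstrap a2 m1 h1.
have m2 : (1 : R) <= (1 + 4 * 2 ^+ 1) * ((1 + 4 * 2 ^+ 0) * 1) by rewrite expr1 expr0; lra.
have h3 := bootstrap a3 m2 h2.
move=> t4; have := h3 t n b; have -> : (1 + 4 * 2 ^+ 2) * ((1 + 4 * 2 ^+ 1) * ((1 + 4 * 2 ^+ 0) * 1)) = 765 :> R by ring.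
by apply; lra.
Qed.

Variable M : R.
Hypotheses (M1 : 1 <= M) (hM : forall t n b, 4 <= t -> `|mean m t n.+1%:Z b| <= M / n.+1%:R ^+ 3).
Let M_gt0 : 0 < M. Proof. by rewrite (lt_le_trans _ M1). Qed.
Let M2_gt0 : 0 < M ^+ 2. Proof. by rewrite exprn_gt0. Qed.

Local Notation A k t := (mean m t k%:Z 0).
Local Notation B k t := (mean m t k%:Z (- (pi / 2))).

Lemma mean_pi2 t k : mean m t k (pi / 2) = - mean m t k (- (pi / 2)).
Proof.
rewrite /mean -espN; last exact: bm_wave1.
by apply: eq_esp => x; rewrite /wave1 cosBpihalf cosDpihalf.
Qed.

(** The flux between the modes [k] and [k + 1]. Dividing the squared modulus of mode [k] by [k]
    removes the factor [k] from the interaction term, which then telescopes; this is the origin of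
    the Lyapunov function. *)
Let D k t := A 1 t * (A k t * A k.+1 t + B k t * B k.+1 t)
  + B 1 t * (A k t * B k.+1 t - B k t * A k.+1 t).
Let c2 k t := A k t ^+ 2 + B k t ^+ 2.

Let dc2 n (t : R) : 0 < t -> is_derive t 1 (fun s => c2 n.+1 s / n.+1%:R)
  (- 2 * n.+1%:R * c2 n.+1 t - J * (D n.+1 t - D n t)).
Proof.
move=> t0; have dA := mean_odeS n 0 t0; have dB := mean_odeS n (- (pi / 2)) t0.
rewrite addNr add0r !mean_pi2 in dA dB.
have k0 : n.+1%:R != 0 :> R by [].
have := drvD (drvX 2 dA) (drvX 2 dB).
move=> /(fun h => drvM h (drv_cst n.+1%:R^-1 t)) /drv_eq; apply.
by rewrite /c2 /D /= expr1; move: k0; move: (n.+1%:R) => k k0; field.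
Qed.

Definition lyapunov K t := \sum_(n < K) c2 n.+1 t / n.+1%:R.

Lemma drv_lyapunov K (t : R) : 0 < t -> is_derive t 1 (lyapunov K)
  (\sum_(n < K) (- 2 * n.+1%:R * c2 n.+1 t) - J * (D K t - D 0 t)).
Proof.
move=> t0; have -> : lyapunov K = (fun s => \sum_(n < K) c2 n.+1 s / n.+1%:R) by [].
have h := @drv_sum R _ (index_enum 'I_K) (fun n s => c2 n.+1 s / n.+1%:R) _ t (fun n => dc2 n t0).
apply: (drv_eq h).
rewrite (eq_bigr _ (fun i _ => erefl)) sumrB -mulr_sumr; congr (_ - _ * _).
by elim: K {h} => [|K IH]; rewrite ?big_ord0 ?subrr// big_ord_recr/= IH; ring.
Qed.

Let D0 t : D 0 t = c2 1 t.
Proof.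
have -> : D 0 t = A 1 t * (A 0 t * A 1 t + B 0 t * B 1 t)
  + B 1 t * (A 0 t * B 1 t - B 0 t * A 1 t) by [].
have -> : A 0 t = 1.
  transitivity (esp (m t) (fun=> 1)); last exact: esp_cst.
  by apply: eq_esp => x; rewrite /wave1 mul0r addr0 cos0.
have -> : B 0 t = 0.
  transitivity (esp (m t) (fun=> 0)); last exact: esp_cst.
  by apply: eq_esp => x; rewrite /wave1 mul0r add0r cosN cos_pihalf.
by rewrite /c2; ring.
Qed.

Let bA n t : 4 <= t -> `|A n.+1 t| <= M / n.+1%:R ^+ 3 /\ `|B n.+1 t| <= M / n.+1%:R ^+ 3.
Proof. by move=> t4; split; exact: hM. Qed.

Let D_bound K t : 4 <= t -> `|D K.+1 t| <= 4 * M ^+ 2 / K.+1%:R.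
Proof.
move=> t4; have [a1 b1] := bA K t4; have [a2 b2] := bA K.+1 t4.
set x := M / K.+1%:R ^+ 3 in a1 b1; set y := M / K.+2%:R ^+ 3 in a2 b2.
have aa u v x' y' : `|u| <= x' -> `|v| <= y' -> `|u * v| <= x' * y' :> R.
  by move=> *; rewrite normrM ler_pM.
have xy : x * y <= M ^+ 2 / K.+1%:R.
  rewrite expr2 /x /y mulrACA -mulrA -mulrA ler_pM2l// ler_pM2l// -invfM lef_pV2 ?posrE ?mulr_gt0 ?exprn_gt0//.
  rewrite -natrX -natrX -natrM ler_nat expnS -mulnA leq_pmulr// muln_gt0 !expn_gt0.
have s2 u v : `|u| <= x * y -> `|v| <= x * y -> `|u + v| <= 2 * (M ^+ 2 / K.+1%:R).
  by move=> hu hv; rewrite (le_trans (ler_normD _ _))// mulr_natl mulr2n lerD// ?(le_trans hu) ?(le_trans hv).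
rewrite /D (le_trans (ler_normD _ _))//.
have -> : 4 * M ^+ 2 / K.+1%:R = 2 * (M ^+ 2 / K.+1%:R) + 2 * (M ^+ 2 / K.+1%:R) by ring.
rewrite lerD// -[leRHS]mul1r normrM ler_pM ?mean_bound//; apply: s2; rewrite ?normrN; exact: aa.
Qed.

Let c2_ge0 n t : 0 <= c2 n t. Proof. by rewrite addr_ge0// sqr_ge0. Qed.

(** After telescoping, two boundary terms remain: [D 0 = c2 1], whose contribution [J * c2 1] is
    absorbed by the damping [2 * c2 1] of the first mode, and the flux through the truncation level,
    of order [1 / K]. *)
Lemma lyapunov_decay K (t : R) : 4 <= t ->
  lyapunov K.+1 t <= expR (- (2 - J) * (t - 4)) * lyapunov K.+1 4 + 8 * M ^+ 2 / K.+1%:R / (2 - J).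
Proof.
move=> t4.
have e0 : 0 <= 8 * M ^+ 2 / K.+1%:R :> R by rewrite divr_ge0// mulr_ge0// ltW.
have j0 : 0 < 2 - J by rewrite subr_gt0.
apply: (gronwall j0 e0 t4 (df := fun t => \sum_(n < K.+1) (- 2 * n.+1%:R * c2 n.+1 t) - J * (D K.+1 t - D 0 t))).
  by move=> x /andP[x4 _]; apply: drv_lyapunov; lra.
move=> x /andP[x4 _]; have := D_bound K x4.
rewrite ler_norml => /andP[Dl Du]; rewrite D0.
have h : \sum_(n < K.+1) (- 2 * n.+1%:R * c2 n.+1 x) + J * c2 1 x <= - (2 - J) * lyapunov K.+1 x.
  rewrite /lyapunov !big_ord_recl/= [leRHS]mulrDr mulr_sumr.
  rewrite addrAC lerD//; first by rewrite divr1; lra.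
  apply: ler_sum => i _; rewrite /bump/= add1n.
  have := c2_ge0 i.+2 x; move: (c2 _ _) => c c0.
  have k1 : 1 <= i.+2%:R :> R by rewrite ler1n.
  have k0 : 0 < i.+2%:R :> R by [].
  move: (i.+2%:R) k1 k0 => k k1 k0.
  have : c / k <= k * c by rewrite ler_pdivrMr// mulrAC ler_peMl// -expr2 exprn_ege1.
  have : 0 <= c / k by rewrite divr_ge0// ltW.
  move: (c / k) => d d0 dk; have := mulr_ge0 (ltW J0) d0.
  have -> : - (2 - J) * d = J * d - 2 * d by ring. lra.
have JD : J * (- (4 * M ^+ 2 / K.+1%:R)) <= J * D K.+1 x by rewrite ler_pM2l.
have e8 : J * (4 * M ^+ 2 / K.+1%:R) <= 8 * M ^+ 2 / K.+1%:R.
  have -> : 8 * M ^+ 2 / K.+1%:R = 2 * (4 * M ^+ 2 / K.+1%:R) by ring.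
  by rewrite ler_wpM2r ?(ltW J2)// divr_ge0// mulr_ge0// ltW.
rewrite mulrBr; rewrite mulrN in JD; move: h JD e8.
move: (\sum_(n < K.+1) _) (lyapunov K.+1 x) (D K.+1 x) (c2 1 x) => s L d c.
rewrite mulNr mulrBl; move: (J * L) (J * d) (J * c) (4 * M ^+ 2 / K.+1%:R) (8 * M ^+ 2 / K.+1%:R).
by move=> u1 u2 u3 u4 u5; move: (J * u4) => u6; lra.
Qed.

Lemma lyapunov_bound K t : 4 <= t -> lyapunov K t <= 4 * M ^+ 2.
Proof.
move=> t4; have -> : (4 : R) * M ^+ 2 = 2 * M ^+ 2 * 2 by ring.
have h : lyapunov K t <= \sum_(n < K) 2 * M ^+ 2 * (n.+1%:R ^- 2).
  apply: ler_sum => n _; have [a1 b1] := bA n t4.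
  have k0 : 0 < n.+1%:R :> R by [].
  have k1 : 1 <= n.+1%:R :> R by rewrite ler1n.
  move: (n.+1%:R) k0 k1 a1 b1 => k k0 k1 a1 b1.
  have le a : `|a| <= M / k ^+ 3 -> a ^+ 2 <= M ^+ 2 / k.
    move=> ha; rewrite -real_normK ?num_real//.
    apply: (@le_trans _ _ ((M / k ^+ 3) ^+ 2)).
      by rewrite lerXn2r ?nnegrE// divr_ge0 ?exprn_ge0// ltW.
    rewrite expr_div_n ler_pM2l// lef_pV2 ?posrE ?exprn_gt0//.
    by rewrite -exprM -[leLHS]expr1; apply: ler_weXn2l.
  have := le _ a1; have := le _ b1; rewrite -/(c2 n.+1 t).
  rewrite ler_pdivrMr// /c2.
  have -> : 2 * M ^+ 2 / k ^+ 2 * k = M ^+ 2 / k + M ^+ 2 / k :> R by field; rewrite gt_eqF.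
  lra.
apply: (le_trans h); rewrite -mulr_sumr ler_pM2l ?mulr_gt0 ?exprn_gt0//.
have : \sum_(n < K.+1) (n.+1%:R ^- 2 : R) <= 2 - K.+1%:R^-1.
  elim: K {h} => [|K IH]; first by rewrite big_ord_recr big_ord0/= add0r expr1n invr1; lra.
  rewrite big_ord_recr/=.
  have k0 : 0 < K.+1%:R :> R by [].
  have e : K.+2%:R ^- 2 <= K.+1%:R^-1 - K.+2%:R^-1 :> R.
    rewrite -[K.+2%:R]natr1; move: (K.+1%:R) k0 => k k0.
    rewrite -subr_ge0 [leRHS](_ : _ = (k * (k + 1) ^+ 2)^-1).
      by rewrite invr_ge0 mulr_ge0 ?sqr_ge0// ltW.
    by field; rewrite !gt_eqF//; lra.
  have -> : 2 - K.+2%:R^-1 = (2 - K.+1%:R^-1) + (K.+1%:R^-1 - K.+2%:R^-1) :> R by ring.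
  exact: lerD.
move=> h2; suff : \sum_(n < K) (n.+1%:R ^- 2 : R) <= \sum_(n < K.+1) (n.+1%:R ^- 2 : R).
  by move=> h1; rewrite (le_trans h1)// (le_trans h2)// gerBl invr_ge0.
by rewrite [leRHS]big_ord_recr/= lerDl invr_ge0 exprn_ge0.
Qed.

(* The truncation level K may be sent to infinity since the Lyapunov bound is uniform in K. *)
Lemma mean_exp_decay n (t : R) : 4 <= t ->
  c2 n.+1 t <= n.+1%:R * (expR (- (2 - J) * (t - 4)) * (4 * M ^+ 2)).
Proof.
move=> t4; set S := expR _ * _.
have k0 : 0 < n.+1%:R :> R by [].
have h K : (n <= K)%N -> c2 n.+1 t / n.+1%:R <= S + 8 * M ^+ 2 / (2 - J) * K.+1%:R^-1.
  move=> nK; have := lyapunov_decay K t4.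
  have nK1 : (n < K.+1)%N by [].
  have l1 : c2 n.+1 t / n.+1%:R <= lyapunov K.+1 t.
    rewrite /lyapunov (bigD1 (Ordinal nK1))//= lerDl sumr_ge0// => i _.
    by rewrite divr_ge0// c2_ge0.
  have : expR (- (2 - J) * (t - 4)) * lyapunov K.+1 4 <= S.
    by rewrite ler_wpM2l ?expR_ge0// lyapunov_bound.
  move=> h1 h2; rewrite (le_trans l1)// (le_trans h2)//.
  by rewrite [8 * M ^+ 2 / (2 - J) * _]mulrAC lerD2r.
rewrite mulrC -ler_pdivrMr//.
have cv : S + 8 * M ^+ 2 / (2 - J) * K.+1%:R^-1 @[K --> \oo] --> S + 8 * M ^+ 2 / (2 - J) * 0.
  by apply: cvgD; [exact: cvg_cst|apply: cvgM; [exact: cvg_cst|exact: cvg_harmonic]].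
rewrite mulr0 addr0 in cv.
apply: (ler_cvg_to (@cvg_cst _ (c2 n.+1 t / n.+1%:R) _ _ _) cv).
by exists n => // K /= nK; exact: h.
Qed.

End fourier_decay.

(** High modes are controlled by the cubic decay, low modes by the exponential decay. Both constants
    are uniform over the solutions, which is why [T] depends on [J] and [eta] only. *)
Lemma mean_small (R : realType) (J eta : R) : 0 < J -> J < 2 -> 0 < eta -> exists T : R, 4 <= T /\
  forall m : R -> probability (circle R) R, mean_field_Fokker_Planck J m ->
  forall t, T <= t -> forall K,
  \sum_(n < K) n.+1%:R * (`|mean m t n.+1%:Z 0| + `|mean m t n.+1%:Z (- (pi / 2))|) <= eta.
Proof.
move=> J0 J2 eta0.
have [M [M1 hM]] : exists M : R, 1 <= M /\ forall m : R -> probability (circle R) R,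
    mean_field_Fokker_Planck J m ->
    forall t n b, 4 <= t -> `|mean m t n.+1%:Z b| <= M / n.+1%:R ^+ 3.
  by exists 765; split; [rewrite ler1n|move=> *; exact: mean_decay3 J0 J2 _ _ _ _ _].
have M0 : 0 < M by exact: lt_le_trans M1.
have j0 : 0 < 2 - J by rewrite subr_gt0.
(* Beyond [K0] the series is dominated by [2 * M] times a telescoping sum, so that this tail is at
   most [eta / 2]. *)
have [K0 hK0] : exists K0, 2 * M / K0.+1%:R <= eta / 2.
  exists (Num.truncn (4 * M / eta)); rewrite ler_pdivrMr//.
  have /ltW := truncnS_gt (4 * M / eta); move: ((Num.truncn _).+1%:R) => x; rewrite ler_pdivrMr//.
  move=> h; have -> : eta / 2 * x = x * eta / 2 by ring. lra.
set k0 : R := K0.+1%:R in hK0; have k00 : 0 < k0 by [].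
(* Target size of each low mode: [k0] terms with weight at most [k0] and two components each
   contribute [2 * k0 ^+ 2 * z = eta / 2]. *)
set z := eta / (4 * k0 ^+ 2).
have z0 : 0 < z by rewrite divr_gt0// mulr_gt0 ?exprn_gt0.
set Q := 4 * M ^+ 2 * k0 / z ^+ 2.
have Q0 : 0 < Q.
  apply: divr_gt0; last exact: exprn_gt0.
  by apply: mulr_gt0 => //; apply: mulr_gt0 => //; exact: exprn_gt0.
(* At this time the exponential factor is at most [Q^-1], by [x <= expR x], and [Q] is chosen so
   that the decay estimate then gives modes of size at most [z]. *)
exists (4 + Q / (2 - J)); split; first by rewrite lerDl divr_ge0// ltW.
move=> m mFP t Tt K.
have t4 : 4 <= t by rewrite (le_trans _ Tt)// lerDl divr_ge0// ltW.
set x := fun n => n.+1%:R * (`|mean m t n.+1%:Z 0| + `|mean m t n.+1%:Z (- (pi / 2))|).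
have x0 n : 0 <= x n by rewrite mulr_ge0// addr_ge0.
have E : expR (- (2 - J) * (t - 4)) * (4 * M ^+ 2) <= z ^+ 2 / k0.
  have QT : Q <= (2 - J) * (t - 4) by rewrite mulrC -ler_pdivrMr//; lra.
  have e1 : expR (- (2 - J) * (t - 4)) <= Q^-1.
    rewrite mulNr expRN lef_pV2 ?posrE ?expR_gt0// (le_trans _ (expR_ge1Dx _))//.
    by rewrite (le_trans QT)// lerDr.
  apply: (le_trans (ler_wpM2r _ e1)); first by rewrite mulr_ge0// sqr_ge0.
  rewrite /Q invf_div.
  have -> : z ^+ 2 / (4 * M ^+ 2 * k0) * (4 * M ^+ 2) = z ^+ 2 / k0 by field; rewrite !gt_eqF.
  by [].
have xn n : (n <= K0)%N -> x n <= eta / 2 / k0.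
  move=> nK; have nk : n.+1%:R <= k0 by rewrite ler_nat.
  have := mean_exp_decay J0 J2 mFP M1 (hM m mFP) n t4.
  set S := expR _ * _; move=> h.
  have {}h : mean m t n.+1%:Z 0 ^+ 2 + mean m t n.+1%:Z (- (pi / 2)) ^+ 2 <= z ^+ 2.
    apply: (le_trans h); apply: (@le_trans _ _ (k0 * (z ^+ 2 / k0))).
      by rewrite ler_pM// /S mulr_ge0 ?expR_ge0// mulr_ge0// sqr_ge0.
    by rewrite mulrCA divff ?mulr1// gt_eqF.
  have le a : a ^+ 2 <= z ^+ 2 -> `|a| <= z.
    by rewrite -(@real_normK _ a) ?num_real// ler_sqr ?nnegrE// ltW.
  have hA : `|mean m t n.+1%:Z 0| <= z by apply: le; rewrite (le_trans _ h)// lerDl sqr_ge0.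
  have hB : `|mean m t n.+1%:Z (- (pi / 2))| <= z by apply: le; rewrite (le_trans _ h)// lerDr sqr_ge0.
  have -> : eta / 2 / k0 = k0 * (z + z) by rewrite /z; field; rewrite gt_eqF.
  by rewrite ler_pM// ?addr_ge0// lerD.
have base : \sum_(n < K0.+1) x n <= eta / 2.
  apply: (@le_trans _ _ (\sum_(n < K0.+1) eta / 2 / k0)).
    by apply: ler_sum => n _; apply: xn; rewrite -ltnS.
  by rewrite sumr_const card_ord -[_ *+ _]mulr_natr divfK// gt_eqF.
have step j : \sum_(n < K0.+1 + j) x n <= eta / 2 + 2 * M * (k0^-1 - (K0.+1 + j)%:R^-1).
  elim: j => [|j IH]; first by rewrite addn0 subrr mulr0 addr0.
  rewrite addnS big_ord_recr/=; set p := (K0.+1 + j)%N in IH *.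
  have p0 : 0 < p%:R :> R by rewrite ltr0n.
  have -> : eta / 2 + 2 * M * (k0^-1 - p.+1%:R^-1) =
    eta / 2 + 2 * M * (k0^-1 - p%:R^-1) + 2 * M * (p%:R^-1 - p.+1%:R^-1) by ring.
  rewrite lerD// /x/=.
  have := hM m mFP t p 0 t4; have := hM m mFP t p (- (pi / 2)) t4.
  rewrite -[p.+1%:R]natr1; move: (p%:R) p0 => q q0 h1 h2.
  have q1 : 0 < q + 1 by lra.
  apply: (@le_trans _ _ ((q + 1) * (M / (q + 1) ^+ 3 + M / (q + 1) ^+ 3))).
    apply: ler_wpM2l; [exact: ltW|exact: lerD].
  rewrite -subr_ge0 [leRHS](_ : _ = 2 * M / (q * (q + 1) ^+ 2)).
    by rewrite divr_ge0 ?mulr_ge0 ?sqr_ge0// ltW.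
  by field; rewrite !gt_eqF.
have mono : \sum_(n < K) x n <= \sum_(n < K0.+1 + K) x n.
  elim: (K0.+1) => [|j IH]; first by rewrite add0n.
  by rewrite addSn big_ord_recr/= (le_trans IH)// lerDl.
apply: (le_trans mono); apply: (le_trans (step K)).
rewrite [leRHS](_ : eta = eta / 2 + eta / 2); last by field.
rewrite lerD2l (le_trans _ hK0)// ler_pM2l ?mulr_gt0// gerBl.
by rewrite invr_ge0.
Qed.

(** * Densities with small Fourier coefficients *)

Section density.
Variables (R : realType) (mu : probability (circle R) R) (eta : R).
Local Notation C := (circle R).
Local Notation U := (@unif R).
Local Notation co n b x := (cos (n.+1%:Z%:~R * x + b)).
Local Notation pi2 := (pi / 2).
Let a n := esp mu (wave1 n.+1%:Z 0).
Let b n := esp mu (wave1 n.+1%:Z (- pi2)).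
Hypothesis small : forall K, \sum_(n < K) n.+1%:R * (`|a n| + `|b n|) <= eta / 2.

Let v (n : nat) (x : R) := a n * co n 0 x + b n * co n (- pi2) x.
Let dv (n : nat) (x : R) := n.+1%:R * (a n * co n pi2 x + b n * co n 0 x).
Let pK K (x : R) := 1 + 2 * \sum_(n < K) v n x.
Let dK K (x : R) := 2 * \sum_(n < K) dv n x.

Let cos1 (y : R) : `|cos y| <= 1. Proof. exact: cos_max. Qed.

Let lin_bound (u w y z : R) : `|u * cos y + w * cos z| <= `|u| + `|w|.
Proof.
by rewrite (le_trans (ler_normD _ _))// !normrM lerD// ler_piMr.
Qed.

Let v_bound n x : `|v n x| <= n.+1%:R * (`|a n| + `|b n|).
Proof.
by rewrite (le_trans (lin_bound _ _ _ _))// ler_peMl ?addr_ge0// ler1n.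
Qed.

Let dv_bound n x : `|dv n x| <= n.+1%:R * (`|a n| + `|b n|).
Proof. by rewrite /dv normrM ger0_norm// ler_wpM2l// lin_bound. Qed.

Let sum_bound (u : nat -> R) K : (forall n, `|u n| <= n.+1%:R * (`|a n| + `|b n|)) ->
  `|2 * \sum_(n < K) u n| <= eta.
Proof.
move=> hu; rewrite normrM ger0_norm// mulrC -ler_pdivlMr//.
by rewrite (le_trans (ler_norm_sum _ _ _))// (le_trans _ (small K))// ler_sum.
Qed.

Let sum_cvg (u : nat -> R) : (forall n, `|u n| <= n.+1%:R * (`|a n| + `|b n|)) ->
  cvgn (fun K => \sum_(n < K) u n).
Proof.
move=> hu; have -> : (fun K => \sum_(n < K) u n) = series u.
  by apply/funext => K; rewrite /series/= big_mkord.
apply: normed_cvg; apply: nondecreasing_is_cvgn.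
  by apply: nondecreasing_series => n _ _; exact: normr_ge0.
exists (eta / 2) => _ [K _ <-]; rewrite [leLHS](_ : _ = \sum_(0 <= n < K) `|u n|)// big_mkord.
by apply: le_trans (small K); apply: ler_sum => n _.
Qed.

(** The density with respect to [unif] is constructed as the sum of the Fourier series of [mu];
    [small] makes this series and its termwise derivative [ddens] converge absolutely. That it is
    the density is the content of [esp_dens]. *)
Definition dens (x : R) : R := limn (fun K => pK K x).
Definition ddens (x : R) : R := limn (fun K => dK K x).

Let dens_cvg x : pK K x @[K --> \oo] --> dens x.
Proof.
have /cvg_ex[l hl] := @sum_cvg (v ^~ x) (fun n => v_bound n x).
have h : pK K x @[K --> \oo] --> 1 + 2 * l.
  by apply: cvgD; [exact: cvg_cst|apply: cvgM; [exact: cvg_cst|exact: hl]].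
by rewrite /dens (cvg_lim _ h).
Qed.

Let ddens_cvg x : dK K x @[K --> \oo] --> ddens x.
Proof.
have /cvg_ex[l hl] := @sum_cvg (dv ^~ x) (fun n => dv_bound n x).
have h : dK K x @[K --> \oo] --> 2 * l by apply: cvgM; [exact: cvg_cst|exact: hl].
by rewrite /ddens (cvg_lim _ h).
Qed.

Let norm_lim (u : nat -> R) l M : u n @[n --> \oo] --> l -> (forall n, `|u n| <= M) -> `|l| <= M.
Proof.
move=> /cvg_norm ul uM; rewrite -(cvg_lim _ ul)//; apply: limr_le; first by apply/cvg_ex; exists `|l|.
exact: nearW.
Qed.

Lemma dens_near1 x : `|dens x - 1| <= eta.
Proof.
apply: (@norm_lim (fun K => pK K x - 1)); first by apply: cvgB; [exact: dens_cvg|exact: cvg_cst].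
by move=> K; rewrite /pK addrAC subrr add0r; apply: (@sum_bound (v ^~ x)) => n; exact: v_bound.
Qed.

Lemma ddens_small x : `|ddens x| <= eta.
Proof.
apply: (@norm_lim (fun K => dK K x)); first exact: ddens_cvg.
by move=> K; apply: (@sum_bound (dv ^~ x)) => n; exact: dv_bound.
Qed.

Lemma dens_pi x : dens (repr (\pi_C x)) = dens x.
Proof.
rewrite /dens; suff -> : pK ^~ (repr (\pi_C x)) = pK ^~ x by [].
apply/funext => K; congr (1 + 2 * _); apply: eq_bigr => n _.
by rewrite /v -[co n (- pi2) (repr _)]/(wave1 n.+1%:Z (- pi2) (\pi_C x)) -[co n 0 (repr _)]/(wave1 n.+1%:Z 0 (\pi_C x)) !wave1_pi.
Qed.

Lemma ddens_pi x : ddens (repr (\pi_C x)) = ddens x.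
Proof.
rewrite /ddens; suff -> : dK ^~ (repr (\pi_C x)) = dK ^~ x by [].
apply/funext => K; congr (2 * _); apply: eq_bigr => n _.
by rewrite /dv -[co n pi2 (repr _)]/(wave1 n.+1%:Z pi2 (\pi_C x)) -[co n 0 (repr _)]/(wave1 n.+1%:Z 0 (\pi_C x)) !wave1_pi.
Qed.

Let bmc n c : bm (fun x : R => co n c x).
Proof.
split; last by exists 1 => x; exact: cos_max.
by apply: continuous_measurable_fun; exact: continuous_cos_affine.
Qed.

Let pK_bound K x : `|pK K x| <= 1 + eta.
Proof.
rewrite (le_trans (ler_normD _ _))// normr1 lerD2l; apply: (@sum_bound (v ^~ x)) => n; exact: v_bound.
Qed.

Let dK_bound K x : `|dK K x| <= eta.
Proof. by apply: (@sum_bound (dv ^~ x)) => n; exact: dv_bound. Qed.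

Let bm_pK K : bm (pK K).
Proof.
apply: bmD; first exact: bm_cst.
by apply: bmZ; apply: bm_sum => n; apply: bmD; apply: bmZ; exact: bmc.
Qed.

Let bm_dK K : bm (dK K).
Proof.
by apply: bmZ; apply: bm_sum => n; apply: bmZ; apply: bmD; apply: bmZ; exact: bmc.
Qed.

Lemma bm_dens : bm dens.
Proof. by apply: (@bm_lim _ _ _ pK dens (1 + eta)) => // n; have [] := bm_pK n. Qed.

Lemma bm_dens_repr : bm (fun x : C => dens (repr x)).
Proof.
apply: (@bm_lim _ C R (fun K x => pK K (repr x)) (fun x => dens (repr x)) (1 + eta)) => [n|n x|x]; [|exact: pK_bound|exact: dens_cvg].
suff [] : bm (fun x : C => pK n (repr x)) by [].
apply: bmD; first exact: bm_cst.
by apply: bmZ; apply: bm_sum => k; apply: bmD; apply: bmZ; exact: bm_wave1.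
Qed.

Lemma bm_ddens_repr : bm (fun x : C => ddens (repr x)).
Proof.
apply: (@bm_lim _ C R (fun K x => dK K (repr x)) (fun x => ddens (repr x)) eta) => [n|n x|x]; [|exact: dK_bound|exact: ddens_cvg].
suff [] : bm (fun x : C => dK n (repr x)) by [].
by apply: bmZ; apply: bm_sum => k; apply: bmZ; apply: bmD; apply: bmZ; exact: bm_wave1.
Qed.

Let d_pK K (x : R) : is_derive x 1 (pK K) (dK K x).
Proof.
have h := drvD (drv_cst (1 : R) x) (drvZ 2 (@drv_sum R _ (index_enum 'I_K) v _ x (fun n =>
  drvD (drvZ (a n) (drv_cos_affine n.+1%:Z%:~R 0 x)) (drvZ (b n) (drv_cos_affine n.+1%:Z%:~R (- pi2) x))))).
apply: (drv_eq h); rewrite add0r; congr (_ * _); apply: eq_bigr => n _.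
by rewrite add0r addNr /dv -pmulrn; ring.
Qed.

(** States that [ddens] is the weak derivative of [dens]; the partial sums satisfy the identity by
    the fundamental theorem of calculus, and it passes to the limit. *)
Lemma dens_ibp (h h' : R -> R) : bm h -> bm h' -> continuous h' ->
  (forall x : R, is_derive x 1 h (h' x)) -> h (2 * pi) = h 0 ->
  esp U (fun x => h' x * dens x + h x * ddens x) = 0.
Proof.
move=> bh bh' ch' dh hper; have [mh [M1 hM1]] := bh; have [mh' [M2 hM2]] := bh'.
pose G K x := h' x * pK K x + h x * dK K x.
have bG K : bm (G K) by apply: bmD; apply: bmM.
have G0 K : esp U (G K) = 0.
  apply: (@esp_unif_FTC R (G K) (fun x => h x * pK K x)) => //.
  - have cos_c n c : continuous (fun x : R => co n c x) by exact: continuous_cos_affine.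
    apply: contD; apply: contM => //; first by move=> x; exact: drv_cont (d_pK K x).
    + by move=> x; exact: drv_cont (dh x).
    + have csum (u : nat -> R -> R) (k : seq 'I_K) : (forall n, continuous (u n)) ->
        continuous (fun x => \sum_(n <- k) u n x).
        move=> cu; elim: k => [|n k IH].
          by under eq_fun do rewrite big_nil; exact: cont_cst.
        by under eq_fun do rewrite big_cons; exact: contD.
      apply: contM; first exact: cont_cst.
      apply: csum => n; apply: contM; first exact: cont_cst.
      by apply: contD; apply: contM => //; exact: cont_cst.
  - by move=> x; apply: (drv_eq (drvM (dh x) (d_pK K x))); rewrite /G; ring.
  - congr (_ * _) => //; congr (1 + 2 * _); apply: eq_bigr => n _; congr (_ * _ + _ * _);
      by rewrite mulr0 addrC cos_shift add0r.
have cG : esp U (G K) @[K --> \oo] --> esp U (fun x => h' x * dens x + h x * ddens x).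
  apply: (@esp_cvg _ _ _ U G _ (M2 * (1 + eta) + M1 * eta)) => [K|K x|x].
  - by have [] := bG K.
  - by rewrite (le_trans (ler_normD _ _))// lerD// normrM ler_pM.
  - have l1 : h' x * pK K x @[K --> \oo] --> h' x * dens x.
      by apply: cvgM; [exact: cvg_cst|exact: dens_cvg].
    have l2 : h x * dK K x @[K --> \oo] --> h x * ddens x.
      by apply: cvgM; [exact: cvg_cst|exact: ddens_cvg].
    have l3 : h' x * pK K x + h x * dK K x @[K --> \oo] --> h' x * dens x + h x * ddens x.
      by apply: cvgD.
    exact: l3.
transitivity (limn (fun K => esp U (G K))); first by rewrite (cvg_lim _ cG).
have -> : (fun K => esp U (G K)) = (fun=> 0) by apply/funext.
by rewrite lim_cst.
Qed.


Ltac bmt := do !(first [exact: bmc|exact: bm_wave1|apply: bmZ|apply: bmM|apply: bmD|apply: bm_cst|assumption|match goal with h : forall _ _, bm _ |- _ => apply: (h) end|apply: bm_sum => ?]).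

Let esp_coco n k c c' : esp U (fun x => co n c x * co k c' x) =
  if k == n then cos (c - c') / 2 else 0.
Proof.
have e x : co n c x * co k c' x = 2^-1 * cos ((n.+1%:Z + k.+1%:Z)%:~R * x + (c + c')) +
    2^-1 * cos ((n.+1%:Z - k.+1%:Z)%:~R * x + (c - c')).
  rewrite intrD intrB !mulrDl mulNr.
  move: (n.+1%:Z%:~R * x) (k.+1%:Z%:~R * x) => y z.
  have -> : y + z + (c + c') = (y + c) + (z + c') by ring.
  have -> : y - z + (c - c') = (y + c) - (z + c') by ring.
  by rewrite (cosD (y + c) (z + c')) (cosB (y + c) (z + c')); field.
have bc j d : bm (fun x : R => cos (j%:~R * x + d)).
  split; last by exists 1 => x; exact: cos_max.
  by apply: continuous_measurable_fun; exact: continuous_cos_affine.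
transitivity (esp U (fun x => 2^-1 * cos ((n.+1%:Z + k.+1%:Z)%:~R * x + (c + c')) +
    2^-1 * cos ((n.+1%:Z - k.+1%:Z)%:~R * x + (c - c')))).
  by apply: eq_esp => x; exact: e.
rewrite espD ?espZ; try by bmt.
rewrite !esp_unif_wave -PoszD/= mulr0 add0r subr_eq0 eqz_nat eqSS eq_sym.
by case: eqP => _; rewrite ?mulr0// mulrC.
Qed.

Let esp_copK n c K : (n < K)%N -> esp U (fun x => co n c x * pK K x) =
  a n * cos c - b n * sin c.
Proof.
move=> nK.
transitivity (esp U (fun x => co n c x + \sum_(k < K) (2 * a k * (co n c x * co k 0 x) +
    2 * b k * (co n c x * co k (- pi2) x)))).
  apply: eq_esp => x; rewrite /pK mulrDr mulr1 mulrCA mulr_sumr mulr_sumr; congr (_ + _).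
  by apply: eq_bigr => k _; rewrite /v; ring.
have bs k : bm (fun x : R => 2 * a k * (co n c x * co k 0 x) + 2 * b k * (co n c x * co k (- pi2) x)).
  by bmt.
rewrite espD; [|exact: bmc|by apply: bm_sum => k; exact: bs].
rewrite esp_unif_wave/= add0r esp_sum; last by move=> k; exact: bs.
rewrite (bigD1 (Ordinal nK))//= big1.
  rewrite addr0 espD ?espZ ?esp_coco ?eqxx; try by bmt.
  by rewrite subr0 opprK cosDpihalf; field.
move=> k kn; rewrite espD ?espZ ?esp_coco; try by bmt.
have /negbTE -> : (k : nat) != n by apply: contra kn => /eqP e; apply/eqP/val_inj.
by rewrite !mulr0 addr0.
Qed.

Let esp_wave_dens (j : int) c :
  esp mu (wave1 j c) = esp U (fun x => cos (j%:~R * x + c) * dens x).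
Proof.
wlog j0 : j c / 0 <= j.
  move=> H; have [j0|j0] := leP 0 j; first exact: H.
  have -> : wave1 j c = wave1 (- j) (- c) :> (C -> R).
    by apply/funext => x; rewrite /wave1 -cosN mulrNz mulNr opprD.
  rewrite H ?oppr_ge0 1?ltW//; apply: eq_esp => x; congr (_ * _).
  by rewrite mulrNz mulNr -opprD cosN.
have bc : bm (fun x : R => cos (j%:~R * x + c)).
  split; last by exists 1 => x; exact: cos_max.
  by apply: continuous_measurable_fun; exact: continuous_cos_affine.
have cv : esp U (fun x => cos (j%:~R * x + c) * pK K x) @[K --> \oo] -->
    esp U (fun x => cos (j%:~R * x + c) * dens x).
  apply: (@esp_cvg _ _ _ U (fun K x => cos (j%:~R * x + c) * pK K x) _ (1 * (1 + eta))) => [K|K x|x].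
  - by have [] := bmM bc (bm_pK K).
  - by rewrite normrM ler_pM.
  - by apply: cvgM; [exact: cvg_cst|exact: dens_cvg].
(* By orthogonality the sequence is constant as soon as the partial sum contains the frequency
   [j]. *)
have ev : \forall K \near \oo, esp U (fun x => cos (j%:~R * x + c) * pK K x) = esp mu (wave1 j c).
  case: j j0 bc {cv} => // -[|n] _ bc.
    apply: nearW => K; have -> : wave1 0 c = (fun=> cos c) :> (C -> R).
      by apply/funext => x; rewrite /wave1 mul0r add0r.
    rewrite esp_cst; transitivity (esp U (fun x => cos c * pK K x)).
      by apply: eq_esp => x; rewrite mul0r add0r.
    rewrite espZ; last exact: bm_pK.
    rewrite -[esp U (pK K)]/(esp U (fun x => 1 + 2 * \sum_(n < K) v n x)) espD; [|exact: bm_cst|by bmt].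
    rewrite esp_cst espZ; last by bmt.
    rewrite esp_sum; last by move=> n; bmt.
    rewrite big1 ?mulr0 ?addr0 ?mulr1// => n _.
    by rewrite espD ?espZ ?esp_unif_wave/= ?mulr0 ?addr0//; bmt.
  exists n.+1 => // K /= nK; rewrite esp_copK//.
  transitivity (esp mu (fun x => cos c * wave1 n.+1%:Z 0 x - sin c * wave1 n.+1%:Z (- pi2) x)).
    rewrite espB ?espZ; try by bmt.
    by rewrite /a /b; ring.
  by apply: eq_esp => x; rewrite /wave1 addr0 cosBpihalf cosD; ring.
by rewrite -(cvg_lim _ cv)//; apply/esym/cvg_lim => //; apply: cvg_near_cst.
Qed.

(** Holds for waves because all Fourier coefficients agree, and extends to bounded measurable
    functions by the monotone class theorem. *)
Theorem esp_dens g : bm g -> bm (fun x : R => g (\pi_C x)) /\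
  esp mu g = esp U (fun x => g (\pi_C x) * dens x).
Proof.
have bd := bm_dens; move=> bg; suff [] : bm g /\ (bm (fun x : R => g (\pi_C x)) /\
  esp mu g = esp U (fun x => g (\pi_C x) * dens x)) by [].
apply: (tpoly1_bounded_closed (D := fun g => bm g /\ (bm (fun x : R => g (\pi_C x)) /\
  esp mu g = esp U (fun x => g (\pi_C x) * dens x)))) bg => {g} [s|F f M DF FM Ff].
  have bc j d : bm (fun x : R => cos (j%:~R * x + d)).
    split; last by exists 1 => x; exact: cos_max.
    by apply: continuous_measurable_fun; exact: continuous_cos_affine.
  split; first by apply: bm_sum => w; apply: bmZ; exact: bm_wave1.
  have e x : \sum_(w <- s) w.1.1 * wave1 w.1.2 w.2 (\pi_C x) =
      \sum_(w <- s) w.1.1 * cos (w.1.2%:~R * x + w.2).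
    by apply: eq_bigr => w _; rewrite wave1_pi.
  have -> : (fun x => \sum_(w <- s) w.1.1 * wave1 w.1.2 w.2 (\pi_C x)) =
      (fun x => \sum_(w <- s) w.1.1 * cos (w.1.2%:~R * x + w.2)) by apply/funext.
  split; first by apply: bm_sum => w; apply: bmZ; exact: bc.
  transitivity (esp U (fun x => \sum_(w <- s) w.1.1 * (cos (w.1.2%:~R * x + w.2) * dens x))).
    rewrite !esp_sum; [|by move=> w; bmt|by move=> w; apply: bmZ; exact: bm_wave1].
    apply: eq_bigr => w _; rewrite !espZ; [by rewrite esp_wave_dens|by bmt|exact: bm_wave1].
  by apply: eq_esp => x; rewrite e mulr_suml; apply: eq_bigr => w _; rewrite mulrA.
have bf : bm f by apply: (bm_lim _ FM Ff) => n; have [[]] := DF n.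
have bfp : bm (fun x : R => f (\pi_C x)).
  apply: (@bm_lim _ _ R (fun n x => F n (\pi_C x)) _ M) => [n|n x|x//].
  - by have [_ [[]]] := DF n.
  - exact: FM.
split=> //; split=> //.
have c1 : esp mu (F n) @[n --> \oo] --> esp mu f.
  by apply: (esp_cvg _ FM Ff) => n; have [[]] := DF n.
have c2 : esp U (fun x => F n (\pi_C x) * dens x) @[n --> \oo] --> esp U (fun x => f (\pi_C x) * dens x).
  apply: (@esp_cvg _ _ _ U (fun n x => F n (\pi_C x) * dens x) _ (M * (1 + eta))) => [n|n x|x].
  - by have [_ [h _]] := DF n; have [] := bmM h bd.
  - rewrite normrM ler_pM//.
    have -> : dens x = 1 + (dens x - 1) by ring.
    by rewrite (le_trans (ler_normD _ _))// normr1 lerD2l dens_near1.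
  - by apply: cvgM; [exact: Ff|exact: cvg_cst].
rewrite -(cvg_lim _ c1)// -(cvg_lim _ c2)//.
suff -> : (fun n => esp mu (F n)) = (fun n => esp U (fun x => F n (\pi_C x) * dens x)) by [].
by apply/funext => n; have [_ [_]] := DF n.
Qed.

End density.

Lemma drv_esp d (T : measurableType d) (R : realType) (P : probability T R)
    (F dF : R -> T -> R) (a b K t : R) : a < t < b ->
  (forall s, a < s < b -> bm (F s)) ->
  (forall (s : R) x, a < s < b -> is_derive s 1 (F ^~ x) (dF s x)) ->
  (forall (s : R) x, a < s < b -> `|dF s x| <= K) ->
  is_derive t 1 (fun s => esp P (F s)) (esp P (dF t)).
Proof.
move=> tab bF dFF dFK.
have Ia : `]a, b[%classic t by rewrite /= in_itv.
have itf x : `]a, b[%classic x -> P.-integrable setT (EFin \o F x).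
  by rewrite /= in_itv/= => xab; apply: bm_int; exact: bF.
have der x z : `]a, b[%classic x -> setT z -> derivable (F ^~ z) x 1.
  by rewrite /= in_itv/= => xab _; exact: (@ex_derive _ _ _ _ _ _ _ (dFF _ z xab)).
have dE x z : a < x < b -> derive1 (F ^~ z) x = dF x z.
  by move=> xab; rewrite derive1E; apply: (@derive_val _ _ _ _ _ _ _ (dFF _ z xab)).
have bd x z : `]a, b[%classic x -> setT z -> `|derive1 (F ^~ z) x| <= Num.max 0 K.
  by rewrite /= in_itv/= => xab _; rewrite dE// le_max dFK// orbT.
have K0 (x : T) : 0 <= Num.max 0 K by rewrite le_max lexx.
have iK : P.-integrable setT (EFin \o (fun=> Num.max 0 K)) by apply: bm_int; exact: bm_cst.
have D1 := derivable_under_integral measurableT Ia itf der K0 iK bd.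
have D2 := differentiation_under_integral measurableT Ia itf der K0 iK bd.
apply: DeriveDef => //; rewrite -derive1E D2.
transitivity (esp P (fun z => derive1 (F ^~ z) t)); first by [].
by apply: eq_esp => z; exact: dE.
Qed.

(** In [expR_le_sqr] the linear term vanishes by centring, and by the Cauchy-Schwarz inequality the
    square is at most [4 * (a1 ^+ 2 + a2 ^+ 2)]; this is the constant [kappa = 16]. *)
Lemma subgaussian_crude d (T : measurableType d) (R : realType) (P : probability T R)
    (g1 g2 : T -> R) (a1 a2 : R) : bm g1 -> bm g2 -> esp P g1 = 0 -> esp P g2 = 0 ->
  (forall x, g1 x ^+ 2 + g2 x ^+ 2 <= 4) ->
  esp P (fun x => expR (a1 * g1 x + a2 * g2 x)) <= expR (16 * (a1 ^+ 2 + a2 ^+ 2) / 4).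
Proof.
move=> b1 b2 z1 z2 g4; set e := expR _.
have by_ : bm (fun x => a1 * g1 x + a2 * g2 x) by apply: bmD; exact: bmZ.
have pt x : expR (a1 * g1 x + a2 * g2 x) <= a1 * g1 x + a2 * g2 x + e.
  rewrite (le_trans (expR_le_sqr _))// lerD2l ler_expR.
  have := g4 x; move: (g1 x) (g2 x) => u v uv.
  apply: (@le_trans _ _ ((a1 ^+ 2 + a2 ^+ 2) * (u ^+ 2 + v ^+ 2))).
    rewrite -subr_ge0 [leRHS](_ : _ = (a1 * v - a2 * u) ^+ 2); last by ring.
    exact: sqr_ge0.
  have -> : 16 * (a1 ^+ 2 + a2 ^+ 2) / 4 = (a1 ^+ 2 + a2 ^+ 2) * 4 by field.
  by rewrite ler_wpM2l// addr_ge0// sqr_ge0.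
apply: (le_trans (le_esp P (bm_exp by_) (bmD by_ (bm_cst _ e)) pt)).
rewrite espD//; last exact: bm_cst.
by rewrite esp_cst espD ?espZ ?z1 ?z2 ?mulr0 ?addr0 ?add0r//; exact: bmZ.
Qed.

Lemma expR_sym_le (R : realType) (y z : R) : y ^+ 2 <= z ^+ 2 ->
  expR y + expR (- y) <= expR z + expR (- z).
Proof.
have abs (u : R) : expR u + expR (- u) = expR `|u| + expR (- `|u|).
  have [u0|u0] := leP 0 u; first by rewrite ger0_norm.
  by rewrite ltr0_norm// opprK addrC.
rewrite -(@real_normK _ y) ?num_real// -(@real_normK _ z) ?num_real// ler_sqr ?nnegrE//.
rewrite (abs y) (abs z); move: `|y| `|z| (normr_ge0 y) => {y z abs} y z y0 yz.
rewrite -subr_ge0 [leRHS](_ : _ = (expR z - expR y) * (1 - expR (- y - z))).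
  rewrite mulr_ge0// subr_ge0 ?ler_expR// expR_le1; lra.
have := @expR_gt0 R y; have := @expR_gt0 R z; rewrite expRB !expRN.
by move: (expR z) (expR y) => a b a0 b0; field; rewrite !gt_eqF.
Qed.

Section uniform_exp_moment.
Variables (R : realType) (a b : R).
Local Notation U := (@unif R).
Let g (x : R) := a * cos x + b * sin x.
Let g' (x : R) := b * cos x - a * sin x.
Let rho := a ^+ 2 + b ^+ 2.

Let dg (x : R) : is_derive x 1 g (g' x).
Proof.
apply: (drv_eq (drvD (drvZ a (drv_cos (drv_id x))) (drvZ b (drv_sin (drv_id x))))).
by rewrite /g'; ring.
Qed.

Let dg' (x : R) : is_derive x 1 g' (- g x).
Proof.
apply: (drv_eq (drvB (drvZ b (drv_cos (drv_id x))) (drvZ a (drv_sin (drv_id x))))).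
by rewrite /g; ring.
Qed.

Let cg : continuous g. Proof. by move=> x; exact: drv_cont (dg x). Qed.
Let cg' : continuous g'. Proof. by move=> x; exact: drv_cont (dg' x). Qed.

Let gb (x : R) : `|g x| <= `|a| + `|b| /\ `|g' x| <= `|a| + `|b|.
Proof.
split; [rewrite (le_trans (ler_normD _ _))//|rewrite (le_trans (ler_normB _ _))// addrC];
  by rewrite !normrM lerD// ler_piMr// ?cos_max ?sin_max.
Qed.

Let bmg : bm g.
Proof. by split; [exact: continuous_measurable_fun|exists (`|a| + `|b|) => x; case: (gb x)]. Qed.
Let bmg' : bm g'.
Proof. by split; [exact: continuous_measurable_fun|exists (`|a| + `|b|) => x; case: (gb x)]. Qed.

Let gp x : g (x + pi / 2) = g' x.
Proof. by rewrite /g /g' cosDpihalf sinDpihalf; ring. Qed.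
Let g'p x : g' (x + pi / 2) = - g x.
Proof. by rewrite /g /g' cosDpihalf sinDpihalf; ring. Qed.

Let pythagoras x : g x ^+ 2 + g' x ^+ 2 = rho.
Proof.
rewrite /g /g' /rho; have := cos2Dsin2 x; move: (cos x) (sin x) => c s cs.
have -> : (a * c + b * s) ^+ 2 + (b * c - a * s) ^+ 2 = (a ^+ 2 + b ^+ 2) * (c ^+ 2 + s ^+ 2) by ring.
by rewrite cs mulr1.
Qed.

Let f t := esp U (fun x => expR (t * g x)).

Let drvf (t : R) : is_derive t 1 f (esp U (fun x => g x * expR (t * g x))).
Proof.
have bt (s : R) : bm (fun x => expR (s * g x)) by apply: bm_exp; exact: bmZ.
set M := `|a| + `|b|.
have M0 : 0 <= M by rewrite addr_ge0.
apply: (@drv_esp _ _ _ U (fun s x => expR (s * g x)) (fun s x => g x * expR (s * g x)) (t - 1) (t + 1)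
   (M * expR ((`|t| + 1) * M))) => [|s _|s x _|s x st].
- by apply/andP; split; lra.
- exact: bt.
- by apply: (drv_eq (drv_exp (drvM (drv_id s) (drv_cst (g x) s)))); ring.
- have [gx _] := gb x; rewrite normrM ler_pM// ger0_norm ?expR_ge0// ler_expR.
  rewrite (le_trans (ler_norm _))// normrM ler_pM//.
  by have := ler_norm t; have := lerNnormlW (lexx `|t|); rewrite ler_norml; lra.
Qed.

(** A rotation by [pi / 2] maps the pair [(g, g')] to [(g', - g)]. Summing the integrand over the
    four rotations gives [y ^+ 2 - z ^+ 2] times twice the difference of the hyperbolic cosines of
    [t * y] and [t * z], which is nonnegative. *)
Let sym (t : R) : 0 <= esp U (fun x => (g x ^+ 2 - g' x ^+ 2) * expR (t * g x)).
Proof.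
pose G (y z : R) := (y ^+ 2 - z ^+ 2) * expR (t * y).
have cG (u w : R -> R) : continuous u -> continuous w -> continuous (fun x => G (u x) (w x)).
  move=> cu cw; apply: contM; first by apply: contB; apply: contX.
  move=> x; apply: (@continuous_comp _ _ _ (fun z => t * u z) expR x); last exact: continuous_expR.
  by apply: contM => //; exact: cont_cst.
have bG (u w : R -> R) : bm u -> bm w -> bm (fun x => G (u x) (w x)).
  move=> bu bw; apply: bmM; first by apply: bmB; apply: bmX.
  by apply: bm_exp; exact: bmZ.
have cN (u : R -> R) : continuous u -> continuous (fun x => - u x).
  move=> cu; have -> : (fun x => - u x) = (fun x => 0 - u x) by apply/funext => x; rewrite sub0r.
  by apply: contB => //; exact: cont_cst.
have p2 (u : R -> R) : (forall x : R, u (x + pi / 2 + pi / 2 + pi / 2 + pi / 2) = u x) ->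
    forall x : R, u (x + 2 * pi) = u x.
  by move=> hu x; rewrite -[RHS]hu; congr u; field.
have shift (u w : R -> R) : continuous u -> continuous w -> bm u -> bm w ->
    (forall x, u (x + 2 * pi) = u x) -> (forall x, w (x + 2 * pi) = w x) ->
    esp U (fun x => G (u (x + pi / 2)) (w (x + pi / 2))) = esp U (fun x => G (u x) (w x)).
  move=> cu cw bu bw pu pw.
  apply: (@esp_unif_shift R (fun x => G (u x) (w x)) (pi / 2)) => [||x]; first exact: cG.
    by have [_] := bG u w bu bw.
  by rewrite pu pw.
have pg : forall x : R, g (x + 2 * pi) = g x.
  by apply: (p2 g) => x; rewrite gp g'p gp g'p opprK.
have pg' : forall x : R, g' (x + 2 * pi) = g' x.
  by apply: (p2 g') => x; rewrite g'p gp g'p gp opprK.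
have e1 : esp U (fun x => G (g' x) (- g x)) = esp U (fun x => G (g x) (g' x)).
  by rewrite -(shift g g' cg cg' bmg bmg' pg pg'); apply: eq_esp => x; rewrite gp g'p.
have e2 : esp U (fun x => G (- g x) (- g' x)) = esp U (fun x => G (g' x) (- g x)).
  have pN (x : R) : - g (x + 2 * pi) = - g x by rewrite pg.
  rewrite -(shift g' (fun x => - g x) cg' (cN _ cg) bmg' (bmN bmg) pg' pN).
  by apply: eq_esp => x; rewrite gp g'p.
have e3 : esp U (fun x => G (- g' x) (g x)) = esp U (fun x => G (- g x) (- g' x)).
  rewrite -[RHS](shift (fun x => - g x) (fun x => - g' x)).
    by apply: eq_esp => x; rewrite gp g'p opprK.
  all: try exact: cN; try exact: bmN; try by move=> x; rewrite ?pg ?pg'.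
rewrite -/(esp U (fun x => G (g x) (g' x))).
have bN : bm (fun x => - g x) by exact: bmN.
have bN' : bm (fun x => - g' x) by exact: bmN.
suff : 0 <= 4 * esp U (fun x => G (g x) (g' x)) by rewrite pmulr_rge0.
have -> : 4 * esp U (fun x => G (g x) (g' x)) = esp U (fun x => (G (g x) (g' x) + G (g' x) (- g x)) +
    (G (- g x) (- g' x) + G (- g' x) (g x))).
  rewrite espD; [|by apply: bmD; exact: bG|by apply: bmD; exact: bG].
  rewrite espD; [|exact: bG|exact: bG].
  rewrite espD; [|exact: bG|exact: bG].
  by rewrite e3 e2 e1; ring.
apply: esp_ge0 => x; rewrite /G !sqrrN.
move: (g x) (g' x) => y z.
have -> : (y ^+ 2 - z ^+ 2) * expR (t * y) + (z ^+ 2 - y ^+ 2) * expR (t * z) +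
  ((y ^+ 2 - z ^+ 2) * expR (t * - y) + (z ^+ 2 - y ^+ 2) * expR (t * - z)) =
  (y ^+ 2 - z ^+ 2) * ((expR (t * y) + expR (- (t * y))) - (expR (t * z) + expR (- (t * z)))).
  by rewrite !mulrN; ring.
have sq (u w : R) : u ^+ 2 <= w ^+ 2 -> expR (t * u) + expR (- (t * u)) <= expR (t * w) + expR (- (t * w)).
  by move=> uw; apply: expR_sym_le; rewrite !exprMn ler_wpM2l ?sqr_ge0.
have [yz|/ltW yz] := leP (y ^+ 2) (z ^+ 2).
  by apply: mulr_le0; rewrite subr_le0; [exact: yz|exact: sq].
by apply: mulr_ge0; rewrite subr_ge0; [exact: yz|exact: sq].
Qed.

Ltac bmtac := do !(first [exact: bmg|exact: bmg'|apply: bmN|apply: bmD|apply: bmB|apply: bmX|apply: bmZ|apply: bm_exp|apply: bmM]).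

(** An integration by parts gives [f' t = t * esp U (g' ^ 2 * expR (t * g))], and by [sym] the
    square of [g'] may be replaced by half of [g ^ 2 + g' ^ 2 = rho]. Hence
    [f' <= t * rho / 2 * f]. *)
Lemma unif_exp_moment : esp U (fun x => expR (a * cos x + b * sin x)) <= expR (rho / 4).
Proof.
have bt (s : R) : bm (fun x => expR (s * g x)) by apply: bm_exp; exact: bmZ.
have df_le (t : R) : 0 <= t -> esp U (fun x => g x * expR (t * g x)) <= t * rho / 2 * f t.
  move=> t0.
  have ibp : esp U (fun x => - g x * expR (t * g x) + g' x * (expR (t * g x) * (t * g' x))) = 0.
    apply: (@esp_unif_FTC R _ (fun x => g' x * expR (t * g x))).
    - by bmtac.
    - have ce : continuous (fun x => expR (t * g x)).
        move=> x; apply: (@continuous_comp _ _ _ (fun z => t * g z) expR x); last exact: continuous_expR.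
        by apply: contM => //; exact: cont_cst.
      apply: contD; apply: contM => //.
        have -> : (fun x => - g x) = (fun x => 0 - g x) by apply/funext => x; rewrite sub0r.
        by apply: contB => //; exact: cont_cst.
      by apply: contM => //; apply: contM => //; exact: cont_cst.
    - by move=> x; apply: (drv_eq (drvM (dg' x) (drv_exp (drvZ t (dg x))))); ring.
    - by rewrite /g' /g !mulr_natl cos2pi sin2pi cos0 sin0.
  have h := sym t.
  have b1 : bm (fun x => g x * expR (t * g x)) by exact: bmM.
  have b2 : bm (fun x => g' x ^+ 2 * expR (t * g x)) by apply: bmM => //; exact: bmX.
  have b3 : bm (fun x => (g x ^+ 2 - g' x ^+ 2) * expR (t * g x)).
    by apply: bmM => //; apply: bmB; exact: bmX.
  have e1 : esp U (fun x => g x * expR (t * g x)) = t * esp U (fun x => g' x ^+ 2 * expR (t * g x)).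
    apply/eqP; rewrite -subr_eq0 -espZ// -espB//; last exact: bmZ.
    apply/eqP; rewrite -[RHS]oppr0 -[in RHS]ibp -espN.
      by apply: eq_esp => x; ring.
    by bmtac.
  have e2 : esp U (fun x => (g x ^+ 2 - g' x ^+ 2) * expR (t * g x)) =
      rho * f t - 2 * esp U (fun x => g' x ^+ 2 * expR (t * g x)).
    transitivity (esp U (fun x => rho * expR (t * g x) - 2 * (g' x ^+ 2 * expR (t * g x)))).
      by apply: eq_esp => x; rewrite -(pythagoras x); ring.
    by rewrite espB ?espZ//; bmtac.
  rewrite e1; rewrite e2 in h; move: h.
  move: (esp U _) (f t) => A B h; nra.
have h : f 1 <= expR (rho / 4).
  have d (t : R) : is_derive t 1 (fun s => - (f s * expR (- (rho / 4 * s ^+ 2))))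
    (- ((esp U (fun x => g x * expR (t * g x)) - t * rho / 2 * f t) * expR (- (rho / 4 * t ^+ 2)))).
    apply: (drv_eq (drvN (drvM (drvf t) (drv_exp (drvN (drvZ (rho / 4) (drvX 2 (drv_id t)))))))).
    by rewrite /= expr1; field.
  have := derive_nondecreasing_closed ler01 (fun t _ => d t).
  rewrite expr0n expr1n/= mulr0 oppr0 expR0 !mulr1 => h.
  have f0 : f 0 = 1.
    transitivity (esp U (fun=> 1 : R)); last exact: esp_cst.
    by apply: eq_esp => x; rewrite mul0r expR0.
  have : - f 0 <= - (f 1 * expR (- (rho / 4))).
    apply: h => t /andP[t0 _]; rewrite oppr_ge0 mulr_le0_ge0 ?expR_ge0// subr_le0.
    exact: df_le.
  by rewrite f0 lerN2 expRN ler_pdivrMr ?expR_gt0// mul1r.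
apply: le_trans h; rewrite le_eqVlt; apply/orP; left; apply/eqP.
by apply: eq_esp => x; rewrite mul1r.
Qed.

End uniform_exp_moment.

(** Here [s] is the mean of a linear form and [rho] the squared norm of its coefficients. The
    exponent on the right is [s + B + D], and [D = eta * rho] pays for the term
    [s * (1 - expR (- B))], since [s] is at most [eta] times the square root of [rho] in modulus and
    [1 - expR (- B)] at most that square root. *)
Lemma near_subgaussian_scalar (R : realType) (s eta rho : R) : 0 <= rho -> 0 <= eta -> eta <= 1 ->
  s ^+ 2 <= eta ^+ 2 * rho ->
  1 + s + (1 + eta) * (expR (rho / 4) - 1) <= expR s * expR ((1 + 5 * eta) * rho / 4).
Proof.
move=> rho0 eta0 eta1 hs.
set x := expR (rho / 4); set B := (1 + eta) * rho / 4; set D := eta * rho.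
have D0 : 0 <= D by rewrite mulr_ge0.
have x0 : 0 < x by exact: expR_gt0.
have xB : (1 + eta) * (x - 1) <= expR B - 1.
  have xr : x - 1 <= x * (rho / 4).
    have := ler_wpM2l (ltW x0) (expR_ge1Dx (- (rho / 4))); rewrite expRN -/x divff ?gt_eqF//.
    lra.
  have e : expR B = x * expR (eta * (rho / 4)) by rewrite /x -expRD; congr expR; rewrite /B; ring.
  have := ler_wpM2l (ltW x0) (expR_ge1Dx (eta * (rho / 4))); rewrite -e.
  have := ler_wpM2l eta0 xr.
  move: (expR B) => EB; move: (rho / 4) => r h1 h2.
  have h3 : x * (1 + eta * r) = x + eta * (x * r) by ring.
  by rewrite h3 in h2; lra.
have EB0 : 0 < expR B by exact: expR_gt0.
set c := 1 - (expR B)^-1.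
have B0 : 0 <= B by rewrite /B divr_ge0// mulr_ge0//; lra.
have c0 : 0 <= c by rewrite subr_ge0 invf_le1// -expR0 ler_expR.
have c1 : c <= 1 by rewrite gerBl invr_ge0 ltW.
have cB : c <= rho / 2.
  have : 1 - B <= (expR B)^-1 by rewrite -expRN expR_ge1Dx.
  have : B <= rho / 2 by rewrite /B; nra.
  rewrite /c; lra.
have c2 : c ^+ 2 <= rho.
  have [r1|/ltW r1] := leP 1 rho; first by nra.
  by nra.
have sc : 0 <= D + s * c.
  have h : (s * c) ^+ 2 <= D ^+ 2.
    rewrite exprMn /D exprMn; apply: (@le_trans _ _ (eta ^+ 2 * rho * rho)).
      by rewrite ler_pM ?sqr_ge0.
    by rewrite expr2 mulrA.
  have : `|s * c| <= `|D| by rewrite -ler_sqr ?nnegrE// !real_normK ?num_real.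
  by rewrite (ger0_norm D0) ler_norml => /andP[h1 _]; lra.
have -> : expR s * expR ((1 + 5 * eta) * rho / 4) = expR B * expR (s + D).
  by rewrite -!expRD; congr expR; rewrite /B /D; field.
apply: (@le_trans _ _ (s + expR B)); first lra.
apply: le_trans (ler_wpM2l (ltW EB0) (expR_ge1Dx _)).
have := mulr_ge0 (ltW EB0) sc.
have -> : expR B * (D + s * c) = expR B * D + s * expR B - s.
  by rewrite /c; field; rewrite gt_eqF.
by rewrite mulrDr mulr1 mulrDr => *; lra.
Qed.

(** * Functional inequalities for nearly uniform laws on the circle *)

Section near_uniform.
Variables (R : realType) (m : probability (circle R) R) (eta : R).
Local Notation C := (circle R).
Local Notation U := (@unif R).
Hypotheses (eta0 : 0 < eta) (eta_half : eta <= 1 / 2).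
Hypothesis small : forall K, \sum_(n < K) n.+1%:R *
  (`|esp m (wave1 n.+1%:Z 0)| + `|esp m (wave1 n.+1%:Z (- (pi / 2)))|) <= eta / 2.
Local Notation p := (dens m).
Local Notation p' := (ddens m).
Implicit Types s t : seq (R * int * R).

Definition cev s (x : C) : R := \sum_(w <- s) w.1.1 * wave1 w.1.2 w.2 x.

Lemma cev_pi s x : cev s (\pi_C x) = ev s x.
Proof. by apply: eq_bigr => w _; rewrite wave1_pi. Qed.

Lemma bm_cev s : bm (cev s).
Proof. by apply: bm_sum => w; apply: bmZ; exact: bm_wave1. Qed.

Definition score (x : C) : R := p' (repr x) / p (repr x).

Let pl x : 1 - eta <= p x. Proof. by have := dens_near1 small x; rewrite ler_norml; lra. Qed.
Let pu x : p x <= 1 + eta. Proof. by have := dens_near1 small x; rewrite ler_norml; lra. Qed.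
Let e1 : 0 < 1 - eta. Proof. by have := eta_half; lra. Qed.
Let p0 x : 0 < p x. Proof. exact: lt_le_trans e1 (pl x). Qed.
Let bp := bm_dens small.

Lemma bm_score : bm score.
Proof.
apply: bmM; first exact: bm_ddens_repr.
apply: (bm_inv e1); [by move=> x; exact: pl|exact: (bm_dens_repr small)].
Qed.

Lemma score_bound x : `|score x| <= 2 * eta.
Proof.
have pr := p0 (repr x); rewrite /score normrM normfV (gtr0_norm pr) ler_pdivrMr//.
apply: (le_trans (ddens_small small _)).
have := pl (repr x); have := eta_half; have := eta0; move: (p _) => y; nra.
Qed.

Let score_pi x : score (\pi_C x) = p' x / p x.
Proof. by rewrite /score dens_pi ddens_pi. Qed.

(** The Holley-Stroock perturbation argument: entropy is the minimum over [a] of the mean of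
    [F * ln F - F * ln a - F + a], a nonnegative integrand, which can be compared under [m] and
    [unif] through the bounds on the density. *)
Lemma near_log_sobolev s : ent m (fun x => expR (cev s x)) <=
  2^-1 * ((1 + eta) / (1 - eta)) * esp m (fun x => expR (cev s x) * cev (dl s) x ^+ 2).
Proof.
have bs := bm_cev s; have bds := bm_cev (dl s).
have bF := bm_exp bs.
have bF' : bm (fun x : R => expR (ev s x)) by apply: bm_exp; exact: bm_ev.
set F := fun x => expR (cev s x) in bF *.
set a := esp U (fun x => expR (ev s x)).
set M := nrm s.
have lowU x : expR (- M) <= expR (ev s x).
  by rewrite ler_expR; have := ev_bound s x; rewrite ler_norml => /andP[].
have eM : 0 < expR (- M) by exact: expR_gt0.
have a0 : 0 < a by apply: (esp_gt0 U eM).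
have lowC x : expR (- M) <= F x.
  have -> : F x = expR (ev s (repr x)) by [].
  exact: lowU.
have A0 : 0 < esp m F by exact: (esp_gt0 m eM).
have phi_ge (u : R) : 0 < u -> 0 <= u * ln u - u * ln a - u + a.
  move=> u0; have := ler_wpM2l (ltW u0) (expR_ge1Dx (ln a - ln u)).
  rewrite expRB !lnK ?posrE//.
  have -> : u * (a / u) = a by field; rewrite gt_eqF.
  move: (ln a) (ln u) => la lu; nra.
have bl : bm (fun x => F x * cev s x) by exact: bmM.
have bl' : bm (fun x : R => expR (ev s x) * ev s x) by apply: bmM => //; exact: bm_ev.
pose phi x := F x * cev s x - ln a * F x - F x + a.
pose phi' x := expR (ev s x) * ev s x - ln a * expR (ev s x) - expR (ev s x) + a.
have bphi' : bm phi'.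
  by apply: bmD; [apply: bmB => //; apply: bmB => //; exact: bmZ|exact: bm_cst].
have bphi : bm phi.
  by apply: bmD; [apply: bmB => //; apply: bmB => //; exact: bmZ|exact: bm_cst].
have h1 : ent m F <= esp m phi.
  rewrite /phi espD; [|by apply: bmB => //; apply: bmB => //; exact: bmZ|exact: bm_cst].
  rewrite esp_cst espB//; last by apply: bmB => //; exact: bmZ.
  rewrite espB//; last exact: bmZ.
  rewrite espZ// /ent.
  have -> : esp m (fun x => F x * ln (F x)) = esp m (fun x => F x * cev s x).
    by apply: eq_esp => x; rewrite /F expRK.
  have := phi_ge _ A0; move: (esp m F) (esp m (fun x => F x * cev s x)) => u v.
  move: (u * ln u) => w; rewrite [u * ln a]mulrC; move: (ln a * u) => z; lra.
have [_ h2] := esp_dens small bphi.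
have phi'E x : phi (\pi_C x) = phi' x by rewrite /phi /phi' /F cev_pi.
have {}h2 : esp m phi = esp U (fun x => phi' x * p x).
  by rewrite h2; apply: eq_esp => x; rewrite phi'E.
have phi'0 x : 0 <= phi' x.
  have := phi_ge _ (expR_gt0 (ev s x)); rewrite expRK /phi'.
  by rewrite [expR _ * ln a]mulrC.
have h3 : esp U (fun x => phi' x * p x) <= (1 + eta) * esp U phi'.
  rewrite -espZ//; apply: le_esp => [||x]; [exact: bmM|exact: bmZ|].
  by rewrite mulrC ler_wpM2r.
have h4 : esp U phi' = ent U (fun x => expR (ev s x)).
  rewrite /phi' espD; [|by apply: bmB => //; apply: bmB => //; exact: bmZ|exact: bm_cst].
  rewrite esp_cst espB//; last by apply: bmB => //; exact: bmZ.
  rewrite espB//; last exact: bmZ.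
  rewrite espZ// /ent -/a.
  have -> : esp U (fun x => expR (ev s x) * ln (expR (ev s x))) = esp U (fun x => expR (ev s x) * ev s x).
    by apply: eq_esp => x; rewrite expRK.
  by ring.
have bG : bm (fun x => F x * cev (dl s) x ^+ 2) by apply: bmM => //; exact: bmX.
have bG' : bm (fun x : R => expR (ev s x) * ev (dl s) x ^+ 2).
  by apply: bmM => //; apply: bmX; exact: bm_ev.
have h5 : esp U (fun x => expR (ev s x) * ev (dl s) x ^+ 2) <=
    (1 - eta)^-1 * esp m (fun x => F x * cev (dl s) x ^+ 2).
  have [_ ->] := esp_dens small bG.
  rewrite [leRHS]mulrC ler_pdivlMr// [leLHS]mulrC -espZ//.
  apply: le_esp => [||x]; first exact: bmZ.
    have [b _] := esp_dens small bG; exact: bmM.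
  by rewrite /F !cev_pi [leRHS]mulrC ler_wpM2r// mulr_ge0 ?expR_ge0// sqr_ge0.
have h6 := circle_log_sobolev_exp s.
apply: (@le_trans _ _ (esp m phi)); first exact: h1.
rewrite h2; apply: (le_trans h3); rewrite h4.
apply: (@le_trans _ _ ((1 + eta) * (2^-1 * ((1 - eta)^-1 * esp m (fun x => F x * cev (dl s) x ^+ 2))))).
  rewrite ler_wpM2l//; first by have := eta0; lra.
  by apply: (le_trans h6); rewrite ler_pM2l.
by rewrite le_eqVlt; apply/orP; left; apply/eqP; ring.
Qed.

(** Integration by parts for the product of [expR (cev s)] and [cev t], with [score] the logarithmic
    derivative of the density. *)
Lemma near_ibp s t : esp m (fun x => expR (cev s x) *
  (cev (dl s) x * cev t x + cev (dl t) x + cev t x * score x)) = 0.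
Proof.
have bs := bm_cev s; have bds := bm_cev (dl s); have bt := bm_cev t; have bdt := bm_cev (dl t).
have bsc := bm_score.
have bG : bm (fun x => expR (cev s x) * (cev (dl s) x * cev t x + cev (dl t) x + cev t x * score x)).
  by apply: bmM; [exact: bm_exp|apply: bmD; [apply: bmD => //; exact: bmM|exact: bmM]].
have [_ ->] := esp_dens small bG.
have bev := @bm_ev R.
pose h x := expR (ev s x) * ev t x.
pose h' x := expR (ev s x) * ev (dl s) x * ev t x + expR (ev s x) * ev (dl t) x.
rewrite -[RHS](@dens_ibp R m eta small h h').
- apply: eq_esp => x; rewrite score_pi !cev_pi /h /h'.
  by field; rewrite gt_eqF.
- by apply: bmM => //; exact: bm_exp.
- by apply: bmD; [apply: bmM => //; apply: bmM => //; exact: bm_exp|apply: bmM => //; exact: bm_exp].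
- have ce u : continuous (ev u) := @continuous_ev R u.
  have cx : continuous (fun x => expR (ev s x)).
    by move=> x; apply: (@continuous_comp _ _ _ (ev s) expR x); [exact: ce|exact: continuous_expR].
  by apply: contD; [apply: contM => //; exact: contM|exact: contM].
- by move=> x; apply: (drv_eq (drvM (drv_exp (drv_ev s x)) (drv_ev t x))); rewrite /h'; ring.
- by rewrite /h -[2 * pi]add0r !ev_per.
Qed.

Let A1 := esp m (wave1 1 0).
Let B1 := esp m (wave1 1 (- (pi / 2))).

Lemma near_first_mode : A1 ^+ 2 + B1 ^+ 2 <= eta ^+ 2.
Proof.
have := small 1; rewrite big_ord1 mul1r -/A1 -/B1.
rewrite -(@real_normK _ A1) ?num_real// -(@real_normK _ B1) ?num_real//.
have := eta0; move: `|A1| `|B1| (normr_ge0 A1) (normr_ge0 B1) => x y; nra.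
Qed.

(** The nonnegative function [expR l - 1 - l] is compared under [m] and [unif] through the upper
    bound on the density. Under [unif] the linear form [l] has mean zero, under [m] it has a small
    mean [s]. *)
Lemma near_subgaussian a1 a2 :
  esp m (fun x => expR (a1 * (wave1 1 0 x - A1) + a2 * (wave1 1 (- (pi / 2)) x - B1))) <=
  expR ((1 + 5 * eta) * (a1 ^+ 2 + a2 ^+ 2) / 4).
Proof.
set rho := a1 ^+ 2 + a2 ^+ 2.
pose l := [:: (a1, 1%:Z, 0); (a2, 1%:Z, - (pi / 2))] : seq (R * int * R).
have lE x : cev l x = a1 * wave1 1 0 x + a2 * wave1 1 (- (pi / 2)) x.
  by rewrite /cev big_cons big_seq1.
have bl := bm_cev l; have bel := bm_exp bl.
set s := a1 * A1 + a2 * B1.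
have sE : esp m (cev l) = s.
  rewrite -[cev l]/(fun x => cev l x); transitivity (esp m (fun x => a1 * wave1 1 0 x + a2 * wave1 1 (- (pi / 2)) x)).
    by apply: eq_esp.
  by rewrite espD ?espZ//; (try apply: bmZ); exact: bm_wave1.
pose phi x := expR (cev l x) - 1 - cev l x.
have bphi : bm phi by apply: bmB => //; apply: bmB => //; exact: bm_cst.
pose phi' x := expR (ev l x) - 1 - ev l x.
have bev := @bm_ev R l; have bev' := bm_exp bev.
have bphi' : bm phi' by apply: bmB => //; apply: bmB => //; exact: bm_cst.
have phi'0 x : 0 <= phi' x by rewrite /phi'; have := expR_ge1Dx (ev l x); lra.
have h1 : esp m phi <= (1 + eta) * esp U phi'.
  have [_ ->] := esp_dens small bphi.
  rewrite -espZ//; apply: le_esp => [||x]; last by rewrite /phi cev_pi mulrC ler_wpM2r// phi'0.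
    by have [b _] := esp_dens small bphi; exact: bmM.
  exact: bmZ.
have h2 : esp m phi = esp m (fun x => expR (cev l x)) - 1 - s.
  rewrite /phi espB//; last by apply: bmB => //; exact: bm_cst.
  by rewrite espB//; [rewrite esp_cst sE|exact: bm_cst].
have h3 : esp U phi' = esp U (fun x => expR (ev l x)) - 1.
  rewrite /phi' espB//; last by apply: bmB => //; exact: bm_cst.
  rewrite espB//; last exact: bm_cst.
  rewrite esp_cst; suff -> : esp U (ev l) = 0 by rewrite subr0.
  transitivity (esp U (fun x => a1 * cos (1%:Z%:~R * x + 0) + a2 * cos (1%:Z%:~R * x + - (pi / 2)))).
    by apply: eq_esp => x; rewrite /ev big_cons big_seq1.
  have bc c : bm (fun x : R => cos (1%:Z%:~R * x + c)).
    split; last by exists 1 => x; exact: cos_max.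
    by apply: continuous_measurable_fun; exact: continuous_cos_affine.
  by rewrite espD ?espZ ?esp_unif_wave/= ?mulr0 ?addr0//; (try apply: bmZ); exact: bc.
have h4 : esp U (fun x => expR (ev l x)) <= expR (rho / 4).
  apply: le_trans (unif_exp_moment a1 a2); rewrite le_eqVlt; apply/orP; left; apply/eqP.
  by apply: eq_esp => x; rewrite /ev big_cons big_seq1/= !mul1r addr0 cosBpihalf.
have rho0 : 0 <= rho by rewrite addr_ge0// sqr_ge0.
have hs : s ^+ 2 <= eta ^+ 2 * rho.
  apply: (@le_trans _ _ ((A1 ^+ 2 + B1 ^+ 2) * rho)); last by rewrite ler_wpM2r// near_first_mode.
  rewrite -subr_ge0 [leRHS](_ : _ = (a1 * B1 - a2 * A1) ^+ 2); last by rewrite /s /rho; ring.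
  exact: sqr_ge0.
have eta1 : eta <= 1 by have := eta_half; lra.
have h5 := near_subgaussian_scalar rho0 (ltW eta0) eta1 hs.
have h6 : esp m (fun x => expR (cev l x)) <= expR s * expR ((1 + 5 * eta) * rho / 4).
  apply: le_trans h5.
  have : (1 + eta) * esp U phi' <= (1 + eta) * (expR (rho / 4) - 1).
    rewrite ler_wpM2l//; first by have := eta0; lra.
    by rewrite h3 lerD2r.
  move: h1; rewrite h2; lra.
apply: (@le_trans _ _ (expR (- s) * esp m (fun x => expR (cev l x)))).
  rewrite -espZ// le_eqVlt; apply/orP; left; apply/eqP; apply: eq_esp => x.
  by rewrite -expRD lE /s; congr expR; ring.
by rewrite expRN mulrC ler_pdivrMr ?expR_gt0// mulrC.
Qed.

End near_uniform.

(** * Modified logarithmic Sobolev inequalities on the torus *)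

Section quadratic_moment.
Context d (T : measurableType d) (R : realType) (P : probability T R).
Variables (g1 g2 : T -> R) (kappa lambda : R).
Hypotheses (bg1 : bm g1) (bg2 : bm g2) (kappa0 : 0 <= kappa).
Hypothesis g4 : forall x, g1 x ^+ 2 + g2 x ^+ 2 <= 4.
Hypothesis subg : forall a1 a2 : R,
  esp P (fun x => expR (a1 * g1 x + a2 * g2 x)) <= expR (kappa * (a1 ^+ 2 + a2 ^+ 2) / 4).
Hypotheses (lambda0 : 0 < lambda) (kl : kappa * lambda < 1).

(** Equals [n] times the squared norm of the empirical mean of [(g1, g2)]. *)
Definition quad n (t : n.-tuple T) := n%:R^-1 * (tsum g1 t ^+ 2 + tsum g2 t ^+ 2).

Lemma bm_quad n : bm (@quad n).
Proof. by apply: bmZ; apply: bmD; apply: bmX; exact: bm_tsum. Qed.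

(** The entropy inequality with test function [lambda * quad], whose exponential moment is bounded
    uniformly in [n] by [exp_moment] with [q = lambda / n%:R]. *)
Lemma quad_moment n (F : n.-tuple T -> R) c : (0 < n)%N -> 0 < c -> (forall t, c <= F t) -> bm F ->
  esp (tensor_power P n) (fun t => F t * quad t) <=
  lambda^-1 * ent (tensor_power P n) F + 4 / (1 - kappa * lambda) * esp (tensor_power P n) F.
Proof.
move=> n0 c0 cF bF; set Q := tensor_power P n.
have N0 : 0 < n%:R :> R by rewrite ltr0n.
have bq := @bm_quad n; have F0 := esp_gt0 Q c0 cF bF.
have := gibbs_variational Q c0 cF bF (bmZ lambda bq).
have -> : esp Q (fun t => F t * (lambda * quad t)) = lambda * esp Q (fun t => F t * quad t).
  by rewrite -espZ; [apply: eq_esp => t; ring|exact: bmM].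
set E := esp Q (fun t => expR (lambda * quad t)).
have E1 : E <= expR (4 * lambda / (1 - kappa * lambda)).
  have qn : kappa * (lambda / n%:R) * n%:R < 1 by rewrite mulrA divfK ?gt_eqF.
  have q0 : 0 <= lambda / n%:R by rewrite divr_ge0// ltW.
  have := exp_moment bg1 bg2 kappa0 g4 subg 0 0 q0 qn.
  have -> : kappa * (lambda / n%:R) * n%:R = kappa * lambda by rewrite mulrA divfK ?gt_eqF.
  have -> : lambda / n%:R * (0 ^+ 2 + 0 ^+ 2 + 4 * n%:R) = 4 * lambda by field; rewrite gt_eqF.
  apply: le_trans; apply: eq_ler; apply: eq_esp => t.
  by rewrite !add0r /quad mulrA.
have E0 : 0 < E.
  have [M hM] : exists M, forall t : n.-tuple T, `|lambda * quad t| <= M by have [_ [x hx]] := bmZ lambda bq; exists x.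
  apply: (@esp_gt0 _ _ _ Q _ (expR (- M)) (expR_gt0 _)) => [t|]; last by apply: bm_exp; exact: bmZ.
  by rewrite ler_expR; have := hM t; rewrite ler_norml => /andP[].
have lE : ln E <= 4 * lambda / (1 - kappa * lambda).
  by rewrite -[leRHS]expRK ler_ln ?posrE ?expR_gt0.
move=> h; rewrite -(ler_pM2l lambda0) (le_trans h)// mulrDr mulrA mulfV ?gt_eqF// mul1r lerD2l.
rewrite mulrC mulrA ler_pM2r// (le_trans lE)//.
by apply: eq_ler; ring.
Qed.

End quadratic_moment.

Section tpoly_calculus.
Variables (R : realType) (N : nat).
Local Notation C := (circle R).
Implicit Types (p : tpoly R N) (t : N.-tuple C) (i : 'I_N).

Definition dpart i p : tpoly R N :=
  [seq (w.1.1 * (w.1.2 i)%:~R, w.1.2, w.2 + pi / 2) | w : R * {ffun 'I_N -> int} * R <- p].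

Definition slice i t p : seq (R * int * R) :=
  [seq (w.1.1, w.1.2 i, angle w.1.2 t - (w.1.2 i)%:~R * repr (tnth t i) + w.2)
    | w : R * {ffun 'I_N -> int} * R <- p].

Lemma wave_upd i y t (k : {ffun 'I_N -> int}) b :
  wave k b (upd i y t) = wave1 (k i) (angle k t - (k i)%:~R * repr (tnth t i) + b) y.
Proof.
rewrite /wave /wave1 addrA; congr (cos (_ + _)).
rewrite /angle (bigD1 i)//= [in RHS](bigD1 i)//= addrAC subrr add0r tnth_mktuple eqxx.
by congr (_ + _); apply: eq_bigr => j ji; rewrite tnth_mktuple (negbTE ji).
Qed.

Lemma teval_upd i y t p : teval p (upd i y t) = cev (slice i t p) y.
Proof. by rewrite /teval /cev big_map; apply: eq_bigr => w _; rewrite wave_upd. Qed.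

Lemma dl_slice i t p : dl (slice i t p) = slice i t (dpart i p).
Proof. by rewrite /dl /slice /dpart -!map_comp; apply: eq_map => w /=; rewrite addrA. Qed.

Lemma tsum_upd (g : C -> R) i y t : tsum g (upd i y t) = g y + (tsum g t - g (tnth t i)).
Proof.
rewrite /tsum (bigD1 i)//= [in RHS](bigD1 i)//= addrAC subrr add0r tnth_mktuple eqxx.
by congr (_ + _); apply: eq_bigr => j ji; rewrite tnth_mktuple (negbTE ji).
Qed.

Lemma bm_exp_teval p : bm (fun t => expR (teval p t)).
Proof. by apply: bm_exp; exact: bm_teval. Qed.

Lemma exp_teval_low p : exists c, 0 < c /\ forall t, c <= expR (teval p t).
Proof.
have [_ [M hM]] := bm_teval p; exists (expR (- M)); split; first exact: expR_gt0.
by move=> t; rewrite ler_expR; have := hM t; rewrite ler_norml => /andP[].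
Qed.

End tpoly_calculus.

Section functional_inequality.
Variables (R : realType) (J : R) (m : probability (circle R) R) (N : nat).
Local Notation C := (circle R).
Local Notation co := (@wave1 R 1 0).
Local Notation si := (@wave1 R 1 (- (pi / 2))).
Let A1 := esp m co.
Let B1 := esp m si.
Let g1 x := co x - A1.
Let g2 x := si x - B1.
Local Notation P := (tensor_power m N).

(* [- J * drift_gap i t] is the drift of the i-th particle minus the mean-field drift. *)
Definition drift_gap i (t : N.-tuple C) :=
  N%:R^-1 * (si (tnth t i) * tsum g1 t - co (tnth t i) * tsum g2 t).

(** The inequality is multiplied by the normalising constant of the density [expR (teval p)], which
    avoids quotients. *)
Definition modified_log_sobolev r c := forall p : tpoly R N,
  r * ent P (fun t => expR (teval p t))
    - esp P (fun t => expR (teval p t) * \sum_i teval (dpart i p) t ^+ 2)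
    - J * esp P (fun t => expR (teval p t) * \sum_i drift_gap i t * teval (dpart i p) t)
  <= c * esp P (fun t => expR (teval p t)).

Let bco : bm co. Proof. exact: bm_wave1. Qed.
Let bsi : bm si. Proof. exact: bm_wave1. Qed.
Let bg1 : bm g1. Proof. by apply: bmB => //; exact: bm_cst. Qed.
Let bg2 : bm g2. Proof. by apply: bmB => //; exact: bm_cst. Qed.

Let cs x : co x ^+ 2 + si x ^+ 2 = 1.
Proof. by rewrite /wave1 !mul1r addr0 cosBpihalf cos2Dsin2. Qed.

Let AB1 : A1 ^+ 2 + B1 ^+ 2 <= 1.
Proof.
have h : 0 <= esp m (fun x => (co x - A1) ^+ 2 + (si x - B1) ^+ 2).
  by apply: esp_ge0 => x; rewrite addr_ge0// sqr_ge0.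
suff e : esp m (fun x => (co x - A1) ^+ 2 + (si x - B1) ^+ 2) = 1 - (A1 ^+ 2 + B1 ^+ 2).
  by rewrite e subr_ge0 in h.
transitivity (esp m (fun x => (1 + (A1 ^+ 2 + B1 ^+ 2)) - ((2 * A1) * co x + (2 * B1) * si x))).
  apply: eq_esp => x; have e := cs x.
  have -> : (co x - A1) ^+ 2 + (si x - B1) ^+ 2 = (co x ^+ 2 + si x ^+ 2) +
    (A1 ^+ 2 + B1 ^+ 2) - ((2 * A1) * co x + (2 * B1) * si x) by ring.
  by rewrite e.
rewrite espB; [|exact: bm_cst|by apply: bmD; exact: bmZ].
rewrite esp_cst espD; [|exact: bmZ|exact: bmZ].
by rewrite !espZ// -/A1 -/B1; ring.
Qed.

Let g4 x : g1 x ^+ 2 + g2 x ^+ 2 <= 4.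
Proof.
have h : g1 x ^+ 2 + g2 x ^+ 2 + ((co x + A1) ^+ 2 + (si x + B1) ^+ 2) =
    2 * (co x ^+ 2 + si x ^+ 2) + 2 * (A1 ^+ 2 + B1 ^+ 2) by rewrite /g1 /g2; ring.
rewrite cs in h; have := AB1; have := sqr_ge0 (co x + A1); have := sqr_ge0 (si x + B1).
by move: h; move: (g1 x ^+ 2) (g2 x ^+ 2) ((co x + A1) ^+ 2) ((si x + B1) ^+ 2) (A1 ^+ 2) (B1 ^+ 2) => *; lra.
Qed.

Let g1_0 : esp m g1 = 0.
Proof. by rewrite /g1 espB//; [rewrite esp_cst subrr|exact: bm_cst]. Qed.
Let g2_0 : esp m g2 = 0.
Proof. by rewrite /g2 espB//; [rewrite esp_cst subrr|exact: bm_cst]. Qed.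

Let bm_gap i : bm (drift_gap i).
Proof.
have bt := @bm_tnth _ C R; have bs := @bm_tsum _ C R.
by apply: bmZ; apply: bmB; apply: bmM; [exact: bt|exact: bs|exact: bt|exact: bs].
Qed.

Let bm_grad2 (p : tpoly R N) : bm (fun t => \sum_i teval (dpart i p) t ^+ 2).
Proof. by apply: bm_sum => i; apply: bmX; exact: bm_teval. Qed.

Let bm_fg (p : tpoly R N) : bm (fun t => \sum_i drift_gap i t * teval (dpart i p) t).
Proof. by apply: bm_sum => i; apply: bmM => //; exact: bm_teval. Qed.

Hypothesis N0 : (0 < N)%N.

(** Completing the square leaves [- J ^+ 2 / 4] times the sum of the squared gaps, which is at most
    [quad]. The moment bound with [kappa = 16] and [lambda = 32^-1] costs 32 times the entropy plus
    8 times the mass, whence [8 * J ^+ 2] and [2 * J ^+ 2]. *)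
Lemma modified_log_sobolev_crude : 0 < J -> modified_log_sobolev (- (8 * J ^+ 2)) (2 * J ^+ 2).
Proof.
move=> J0 p; set F := fun t => expR (teval p t).
have bF : bm F by exact: bm_exp_teval.
have [c [c0 cF]] := exp_teval_low p.
have n0 : 0 < N%:R :> R by rewrite ltr0n.
have kl : 16 * 32^-1 < 1 :> R by lra.
have l0 : 0 < 32^-1 :> R by lra.
have h := quad_moment bg1 bg2 (ler0n _ 16) g4 (fun a1 a2 =>
  subgaussian_crude a1 a2 bg1 bg2 g1_0 g2_0 g4) l0 kl N0 c0 cF bF.
rewrite invrK in h; have e8 : 4 / (1 - 16 * 32^-1) = 8 :> R by field.
rewrite e8 in h.
have bq := bm_quad bg1 bg2 N.
have pt t : 0 <= F t * (\sum_i teval (dpart i p) t ^+ 2) + J * (F t * \sum_i drift_gap i t * teval (dpart i p) t)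
    + J ^+ 2 / 4 * (F t * quad g1 g2 t).
  have -> : F t * (\sum_i teval (dpart i p) t ^+ 2) + J * (F t * \sum_i drift_gap i t * teval (dpart i p) t)
    + J ^+ 2 / 4 * (F t * quad g1 g2 t) = F t * (\sum_i teval (dpart i p) t ^+ 2 + J * (\sum_i drift_gap i t * teval (dpart i p) t)
    + J ^+ 2 / 4 * quad g1 g2 t) by ring.
  rewrite mulr_ge0 ?expR_ge0//.
  apply: (@le_trans _ _ (\sum_i (teval (dpart i p) t + J / 2 * drift_gap i t) ^+ 2)).
    by apply: sumr_ge0 => i _; exact: sqr_ge0.
  apply: (@le_trans _ _ (\sum_i teval (dpart i p) t ^+ 2 + J * (\sum_i drift_gap i t * teval (dpart i p) t)
    + J ^+ 2 / 4 * \sum_i drift_gap i t ^+ 2)).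
    by apply: eq_ler; rewrite !mulr_sumr -!big_split/=; apply: eq_bigr => i _; field.
  rewrite lerD2l ler_wpM2l// ?divr_ge0 ?sqr_ge0//.
  apply: (@le_trans _ _ (\sum_(i < N) (N%:R^-1 ^+ 2 * (tsum g1 t ^+ 2 + tsum g2 t ^+ 2)))).
    apply: ler_sum => i _; rewrite /drift_gap exprMn ler_wpM2l ?sqr_ge0//.
    have := cs (tnth t i); move: (co _) (si _) (tsum g1 t) (tsum g2 t) => c' s' u v e.
    have -> : u ^+ 2 + v ^+ 2 = (c' ^+ 2 + s' ^+ 2) * (u ^+ 2 + v ^+ 2) by rewrite e mul1r.
    rewrite -subr_ge0 [leRHS](_ : _ = (s' * v + c' * u) ^+ 2); last by ring.
    exact: sqr_ge0.
  rewrite sumr_const card_ord -[_ *+ _]mulr_natr /quad.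
  by apply: eq_ler; field; rewrite gt_eqF.
have bFq : bm (fun t => F t * quad g1 g2 t) by exact: bmM.
have bFg : bm (fun t => F t * \sum_i teval (dpart i p) t ^+ 2) by apply: bmM.
have bFf : bm (fun t => F t * \sum_i drift_gap i t * teval (dpart i p) t) by apply: bmM.
have := @esp_ge0 _ _ _ P _ pt.
rewrite espD; [|by apply: bmD => //; exact: bmZ|exact: bmZ].
rewrite espD//; last exact: bmZ.
rewrite espZ// espZ//.
have := ler_wpM2l (_ : 0 <= J ^+ 2 / 4) h; rewrite divr_ge0 ?sqr_ge0// => /(_ isT).
set a := esp P (fun t => F t * quad g1 g2 t); set b := esp P (fun t => F t * \sum_i teval (dpart i p) t ^+ 2).
set e := esp P (fun t => F t * \sum_i drift_gap i t * teval (dpart i p) t).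
move: a b e (ent P F) (esp P F) => a b e x y; move: (J ^+ 2) => J2'.
by move: (J * e) => Je; lra.
Qed.

Variable eta : R.
Hypotheses (eta0 : 0 < eta) (eta_half : eta <= 1 / 2).
Hypothesis small : forall K, \sum_(n < K) n.+1%:R *
  (`|esp m (wave1 n.+1%:Z 0)| + `|esp m (wave1 n.+1%:Z (- (pi / 2)))|) <= eta / 2.
Local Notation q := (score m).
Let bq := bm_score eta_half small.
Let bt i (g : C -> R) : bm g -> bm (fun t : N.-tuple C => g (tnth t i)).
Proof. by move=> bg; exact: bm_tnth. Qed.

(** Integration by parts in the [i]-th coordinate along the drift gap. The middle term is the
    derivative of the gap, whose [- 1] comes from the particle's own contribution to the sums; the
    last term is the score of [m]. *)
Lemma drift_gap_ibp i (p : tpoly R N) : esp P (fun t => expR (teval p t) *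
  (drift_gap i t * teval (dpart i p) t
   + N%:R^-1 * (co (tnth t i) * tsum g1 t + si (tnth t i) * tsum g2 t - 1)
   + drift_gap i t * q (tnth t i))) = 0.
Proof.
set G := fun t => _.
have bG : bm G.
  have bs1 := bm_tsum N bg1; have bs2 := bm_tsum N bg2.
  apply: bmM; first exact: bm_exp_teval.
  apply: bmD; last by apply: bmM => //; exact: bt.
  apply: bmD; first by apply: bmM => //; exact: bm_teval.
  apply: bmZ; apply: bmB; last exact: bm_cst.
  by apply: bmD; apply: bmM => //; exact: bt.
rewrite -(esp_upd m i bG); transitivity (esp P (fun=> 0 : R)); last exact: esp_cst.
apply: eq_esp => t.
(* Once the coordinate is resampled to [y], the sums are [co y + c1] and [si y + c2] with [c1] and
   [c2] free of [y]; the products of [co y] and [si y] cancel in the gap, which becomes the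
   trigonometric polynomial [l]. *)
set c1 := tsum g1 t - co (tnth t i); set c2 := tsum g2 t - si (tnth t i).
pose l := [:: (N%:R^-1 * c1, 1%:Z, - (pi / 2)); (- (N%:R^-1 * c2), 1%:Z, 0)] : seq (R * int * R).
rewrite -(near_ibp eta_half small (slice i t p) l); apply: eq_esp => y.
rewrite /G /drift_gap !tsum_upd !teval_upd dl_slice tnth_mktuple eqxx.
rewrite /cev !big_map !big_cons !big_nil/= -/(cev _ _).
rewrite addNr add0r mulr1 !addr0.
have -> : wave1 1 (pi / 2) y = - si y by rewrite /wave1 cosDpihalf cosBpihalf.
rewrite /g1 /g2 -/(g1 _) -/(g2 _).
have -> : co y - A1 + (tsum g1 t - (co (tnth t i) - A1)) = co y + c1 by rewrite /c1; ring.
have -> : si y - B1 + (tsum g2 t - (si (tnth t i) - B1)) = si y + c2 by rewrite /c2; ring.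
have := cs y; move: (co y) (si y) => c s e.
congr (_ * _).
have -> : c * (c + c1) + s * (s + c2) - 1 = c ^+ 2 + s ^+ 2 - 1 + (c * c1 + s * c2) by ring.
by rewrite e subrr add0r; ring.
Qed.

Let bF (p : tpoly R N) := bm_exp_teval p.

Lemma near_tensor_log_sobolev (p : tpoly R N) : ent P (fun t => expR (teval p t)) <=
  2^-1 * ((1 + eta) / (1 - eta)) * esp P (fun t => expR (teval p t) * \sum_i teval (dpart i p) t ^+ 2).
Proof.
have [c [c0 cF]] := exp_teval_low p.
apply: (le_trans (ent_tensor m c0 cF (bF p))).
have bi i : bm (fun t => expR (teval p t) * teval (dpart i p) t ^+ 2).
  by apply: bmM => //; apply: bmX; exact: bm_teval.
have -> : esp P (fun t => expR (teval p t) * \sum_i teval (dpart i p) t ^+ 2) =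
    \sum_i esp P (fun t => expR (teval p t) * teval (dpart i p) t ^+ 2).
  by rewrite -esp_sum//; apply: eq_esp => t; rewrite mulr_sumr.
rewrite mulr_sumr; apply: ler_sum => i _.
rewrite -(esp_upd m i (bi i)) -espZ; last exact: (bm_esp P m (bm_upd i (bi i))).
apply: le_esp => [||t].
- exact: (bm_ent m c0 (fun z => cF _) (bm_upd i (bF p))).
- by apply: bmZ; exact: (bm_esp P m (bm_upd i (bi i))).
have h := near_log_sobolev eta0 eta_half small (slice i t p).
have e1 : (fun y => expR (teval p (upd i y t))) = (fun y => expR (cev (slice i t p) y)).
  by apply/funext => y; rewrite teval_upd.
have e2 : (fun y => expR (teval p (upd i y t)) * teval (dpart i p) (upd i y t) ^+ 2) =
    (fun y => expR (cev (slice i t p) y) * cev (dl (slice i t p)) y ^+ 2).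
  by apply/funext => y; rewrite dl_slice !teval_upd.
by rewrite e1 e2; exact h.
Qed.

(** The score terms left by the integration by parts, centred by [q_wave]. Score and first modes are
    of order [eta], so that division by [2 * eta] gives functions to which the crude sub-Gaussian
    bound applies with constants free of [eta]. *)
Let h1 x := (q x * si x + A1) / (2 * eta).
Let h2 x := (q x * co x - B1) / (2 * eta).
Let bh1 : bm h1.
Proof.
have -> : h1 = fun x => (2 * eta)^-1 * (q x * si x + A1) by apply/funext => x; rewrite mulrC.
by apply: bmZ; apply: bmD; [exact: bmM|exact: bm_cst].
Qed.
Let bh2 : bm h2.
Proof.
have -> : h2 = fun x => (2 * eta)^-1 * (q x * co x - B1) by apply/funext => x; rewrite mulrC.
by apply: bmZ; apply: bmB; [exact: bmM|exact: bm_cst].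
Qed.

Let q_wave b : esp m (fun x => q x * wave1 1 b x) = - esp m (wave1 1 (b + pi / 2)).
Proof.
have bw c := @bm_wave1 R 1 c.
have h := near_ibp eta_half small [::] [:: (1, 1%:Z, b)].
apply/eqP; rewrite -addr_eq0 -espD//; last exact: bmM.
rewrite -[X in _ == X]h; apply/eqP; apply: eq_esp => x.
by rewrite /cev !big_nil !big_seq1/= expR0 !mul1r mul0r add0r addrC [q x * _]mulrC.
Qed.

Let h1_0 : esp m h1 = 0.
Proof.
rewrite espZr; last by apply: bmD; [exact: bmM|exact: bm_cst].
rewrite espD; [|exact: bmM|exact: bm_cst].
by rewrite q_wave addNr esp_cst addNr mul0r.
Qed.

Let h2_0 : esp m h2 = 0.
Proof.
rewrite espZr; last by apply: bmB; [exact: bmM|exact: bm_cst].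
rewrite espB; [|exact: bmM|exact: bm_cst].
rewrite q_wave add0r esp_cst.
have -> : esp m (wave1 1 (pi / 2)) = - B1.
  rewrite /B1 -espN//; apply: eq_esp => x; by rewrite /wave1 cosDpihalf cosBpihalf.
by rewrite opprK subrr mul0r.
Qed.

Let h4 x : h1 x ^+ 2 + h2 x ^+ 2 <= 4.
Proof.
rewrite /h1 /h2; have := score_bound eta0 eta_half small x; have := near_first_mode eta0 small.
rewrite -/A1 -/B1; have := cs x; move: (q x) (co x) (si x) => u c s e ab ub.
have u2 : u ^+ 2 <= 4 * eta ^+ 2.
  rewrite -(@real_normK _ u) ?num_real//.
  have -> : 4 * eta ^+ 2 = (2 * eta) ^+ 2 by ring.
  by rewrite lerXn2r ?nnegrE// mulr_ge0// ltW.
rewrite !expr_div_n -mulrDl ler_pdivrMr; last by rewrite exprn_gt0// mulr_gt0.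
have hh : (u * s + A1) ^+ 2 + (u * c - B1) ^+ 2 + ((u * s - A1) ^+ 2 + (u * c + B1) ^+ 2) =
    2 * (u ^+ 2 * (c ^+ 2 + s ^+ 2)) + 2 * (A1 ^+ 2 + B1 ^+ 2) by ring.
rewrite e mulr1 in hh.
have := sqr_ge0 (u * s - A1); have := sqr_ge0 (u * c + B1); move: hh ab u2.
have -> : 4 * (2 * eta) ^+ 2 = 16 * eta ^+ 2 by ring.
move: ((u * s + A1) ^+ 2) ((u * c - B1) ^+ 2) ((u * s - A1) ^+ 2) ((u * c + B1) ^+ 2) => x1 x2 x3 x4.
have := sqr_ge0 eta; move: (u ^+ 2) (A1 ^+ 2) (B1 ^+ 2) (eta ^+ 2) => x5 x6 x7 x8; lra.
Qed.

(** The summed integration by parts trades the drift term for [quad - 1], whose moment bound with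
    [lambda = (1 + 6 * eta)^-1] costs nearly one entropy. The margin [152 * eta] covers [4 * eta]
    lost in the logarithmic Sobolev constant and [J] times at most [72 * eta] in the interaction. *)
Lemma modified_log_sobolev_near r : 0 < J -> J < 2 -> 0 <= r -> 152 * eta <= 2 - J - r ->
  modified_log_sobolev r (J * ((1 + eta / 2) * (4 * (1 + 6 * eta) / eta) + 16 * eta)).
Proof.
move=> J0 J2 r0 re p; set F := fun t => expR (teval p t).
have [c [c0 cF]] := exp_teval_low p; have bFp : bm F by exact: bF.
have n0 : 0 < N%:R :> R by rewrite ltr0n.
have e1 : 0 < 1 + 6 * eta by have := eta0; lra.
have l0 : 0 < (1 + 6 * eta)^-1 by rewrite invr_gt0.
have k0 : 0 <= 1 + 5 * eta by have := eta0; lra.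
have kl : (1 + 5 * eta) * (1 + 6 * eta)^-1 < 1.
  by rewrite ltr_pdivrMr// mul1r; have := eta0; lra.
have hq := quad_moment bg1 bg2 k0 g4 (near_subgaussian eta0 eta_half small) l0 kl N0 c0 cF bFp.
have kl2 : 16 * 32^-1 < 1 :> R by lra.
have l2 : 0 < 32^-1 :> R by lra.
have hy := quad_moment bh1 bh2 (ler0n _ 16) h4 (fun a1 a2 =>
  subgaussian_crude a1 a2 bh1 bh2 h1_0 h2_0 h4) l2 kl2 N0 c0 cF bFp.
rewrite invrK in hy; have e8 : 4 / (1 - 16 * 32^-1) = 8 :> R by field.
rewrite e8 {e8 kl2 l2} in hy.
have e9 : 4 / (1 - (1 + 5 * eta) * (1 + 6 * eta)^-1) = 4 * (1 + 6 * eta) / eta.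
  by field; rewrite !gt_eqF//; have -> : 1 + 6 * eta - (1 + 5 * eta) = eta by ring.
rewrite invrK e9 {e9 kl l0 k0} in hq.
have hl := near_tensor_log_sobolev p; rewrite -/F in hl.
have bq1 := bm_quad bg1 bg2 N; have bq2 := bm_quad bh1 bh2 N.
pose H t := F t * (\sum_i (drift_gap i t * teval (dpart i p) t
   + N%:R^-1 * (co (tnth t i) * tsum g1 t + si (tnth t i) * tsum g2 t - 1)
   + drift_gap i t * q (tnth t i))).
have bHi i : bm (fun t => F t * (drift_gap i t * teval (dpart i p) t
   + N%:R^-1 * (co (tnth t i) * tsum g1 t + si (tnth t i) * tsum g2 t - 1)
   + drift_gap i t * q (tnth t i))).
  have bs1 := bm_tsum N bg1; have bs2 := bm_tsum N bg2.
  apply: bmM => //; apply: bmD; last by apply: bmM => //; exact: bt.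
  apply: bmD; first by apply: bmM => //; exact: bm_teval.
  apply: bmZ; apply: bmB; last exact: bm_cst.
  by apply: bmD; apply: bmM => //; exact: bt.
have HE t : H t = \sum_i F t * (drift_gap i t * teval (dpart i p) t
   + N%:R^-1 * (co (tnth t i) * tsum g1 t + si (tnth t i) * tsum g2 t - 1)
   + drift_gap i t * q (tnth t i)) by rewrite /H mulr_sumr.
have bH : bm H by have -> : H = _ := funext HE; exact: bm_sum.
have H0 : esp P H = 0.
  transitivity (esp P (fun t => \sum_i F t * (drift_gap i t * teval (dpart i p) t
   + N%:R^-1 * (co (tnth t i) * tsum g1 t + si (tnth t i) * tsum g2 t - 1)
   + drift_gap i t * q (tnth t i)))); first exact: eq_esp.
  by rewrite esp_sum// big1// => i _; exact: drift_gap_ibp.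
(* The means [A1] and [B1] produce linear terms in the derivative part and in the score part, and
   these cancel; what remains beside [quad - 1] is a cross term of order [eta]. *)
have sumE t : \sum_i (drift_gap i t * teval (dpart i p) t
   + N%:R^-1 * (co (tnth t i) * tsum g1 t + si (tnth t i) * tsum g2 t - 1)
   + drift_gap i t * q (tnth t i)) = \sum_i drift_gap i t * teval (dpart i p) t + quad g1 g2 t - 1
   + N%:R^-1 * 2 * eta * (tsum g1 t * tsum h1 t - tsum g2 t * tsum h2 t).
  rewrite !big_split/= -!addrA; congr (_ + _).
  have s1 : tsum g1 t = \sum_i co (tnth t i) - N%:R * A1.
    by rewrite /tsum sumrB sumr_const card_ord mulr_natl.
  have s2 : tsum g2 t = \sum_i si (tnth t i) - N%:R * B1.
    by rewrite /tsum sumrB sumr_const card_ord mulr_natl.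
  have s3 : 2 * eta * tsum h1 t = \sum_i q (tnth t i) * si (tnth t i) + N%:R * A1.
    rewrite /tsum /h1 -mulr_suml mulrCA mulfV ?mulr1; last by rewrite gt_eqF// mulr_gt0.
    by rewrite big_split/= sumr_const card_ord mulr_natl.
  have s4 : 2 * eta * tsum h2 t = \sum_i q (tnth t i) * co (tnth t i) - N%:R * B1.
    rewrite /tsum /h2 -mulr_suml mulrCA mulfV ?mulr1; last by rewrite gt_eqF// mulr_gt0.
    by rewrite sumrB sumr_const card_ord mulr_natl.
  have x1 : \sum_(i < N) N%:R^-1 * (co (tnth t i) * tsum g1 t + si (tnth t i) * tsum g2 t - 1) =
      N%:R^-1 * ((\sum_i co (tnth t i)) * tsum g1 t + (\sum_i si (tnth t i)) * tsum g2 t - N%:R).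
    by rewrite -mulr_sumr sumrB sumr_const card_ord big_split/= -!mulr_suml.
  have x2 : \sum_(i < N) drift_gap i t * q (tnth t i) =
      N%:R^-1 * ((\sum_i q (tnth t i) * si (tnth t i)) * tsum g1 t - (\sum_i q (tnth t i) * co (tnth t i)) * tsum g2 t).
    rewrite !mulr_suml -sumrB mulr_sumr; apply: eq_bigr => i _; rewrite /drift_gap; ring.
  rewrite x1 x2 /quad.
  have -> : N%:R^-1 * 2 * eta * (tsum g1 t * tsum h1 t - tsum g2 t * tsum h2 t) =
    N%:R^-1 * (tsum g1 t * (2 * eta * tsum h1 t) - tsum g2 t * (2 * eta * tsum h2 t)) by ring.
  rewrite s3 s4.
  have -> : \sum_i co (tnth t i) = tsum g1 t + N%:R * A1 by rewrite s1 subrK.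
  have -> : \sum_i si (tnth t i) = tsum g2 t + N%:R * B1 by rewrite s2 subrK.
  by field; rewrite gt_eqF.
have bFq : bm (fun t => F t * quad g1 g2 t) by exact: bmM.
have bFy : bm (fun t => F t * quad h1 h2 t) by exact: bmM.
have bFf : bm (fun t => F t * \sum_i drift_gap i t * teval (dpart i p) t) by apply: bmM.
(* Young's inequality for the cross term, with weights [eta / 2] on [quad g1 g2] and [2 * eta] on
   [quad h1 h2]. *)
have pt t : H t <= F t * (\sum_i drift_gap i t * teval (dpart i p) t)
    + ((1 + eta / 2) * (F t * quad g1 g2 t) + 2 * eta * (F t * quad h1 h2 t)).
  rewrite /H sumE.
  set D := \sum_i drift_gap i t * teval (dpart i p) t.
  have -> : F t * D + ((1 + eta / 2) * (F t * quad g1 g2 t) + 2 * eta * (F t * quad h1 h2 t)) =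
    F t * (D + (1 + eta / 2) * quad g1 g2 t + 2 * eta * quad h1 h2 t) by ring.
  rewrite ler_wpM2l ?expR_ge0// /quad.
  have nn : 0 <= N%:R^-1 :> R by rewrite invr_ge0.
  move: (tsum g1 t) (tsum g2 t) (tsum h1 t) (tsum h2 t) => a b x y.
  have sq : 0 <= N%:R^-1 * (eta / 2 * ((a - 2 * x) ^+ 2 + (b + 2 * y) ^+ 2)).
    by rewrite mulr_ge0// mulr_ge0 ?divr_ge0 ?(ltW eta0)// addr_ge0// sqr_ge0.
  rewrite -subr_ge0 [leRHS](_ : _ = 1 + N%:R^-1 * (eta / 2 * ((a - 2 * x) ^+ 2 + (b + 2 * y) ^+ 2))).
    by rewrite addr_ge0.
  by field; rewrite gt_eqF.
have := le_esp P bH (bmD bFf (bmD (bmZ (1 + eta / 2) bFq) (bmZ (2 * eta) bFy))) pt.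
rewrite H0 espD//; last by apply: bmD; exact: bmZ.
rewrite espD; [|exact: bmZ|exact: bmZ]; rewrite !espZ//.
have en0 : 0 <= ent P F by exact: ent_ge0 c0 cF bFp.
have F0 : 0 <= esp P F by apply: ltW; exact: esp_gt0 c0 cF bFp.
move: hq hy hl.
set a := esp P (fun t => F t * quad g1 g2 t); set b := esp P (fun t => F t * quad h1 h2 t).
set g := esp P (fun t => F t * \sum_i teval (dpart i p) t ^+ 2).
set e := esp P (fun t => F t * \sum_i drift_gap i t * teval (dpart i p) t).
move: (ent P F) (esp P F) en0 F0 => X Y X0 Y0 hq hy hl h.
set K := 4 * (1 + 6 * eta) / eta in hq *.
have ep : 0 < 1 - eta by have := eta_half; lra.
have hX : (2 - 4 * eta) * X <= g.
  have h3 : (2 - 4 * eta) * X <= 2 * (1 - eta) / (1 + eta) * X.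
    rewrite ler_wpM2r// ler_pdivlMr; last by have := eta0; lra.
    by have := eta0; nra.
  apply: (le_trans h3); have pp : 0 < 2 * (1 - eta) / (1 + eta).
    by rewrite divr_gt0 ?mulr_gt0//; have := eta0; lra.
  apply: (le_trans (ler_wpM2l (ltW pp) hl)); apply: eq_ler.
  by field; rewrite !gt_eqF//; have := eta0; lra.
have ha := ler_wpM2l (_ : 0 <= 1 + eta / 2) hq.
have {}ha := ha ltac:(by have := eta0; lra).
have hb := ler_wpM2l (_ : 0 <= 2 * eta) hy.
have {}hb := hb ltac:(by have := eta0; lra).
have hs : - e <= (1 + eta / 2) * ((1 + 6 * eta) * X + K * Y) + 2 * eta * (32 * X + 8 * Y) by lra.
have hJ := ler_wpM2l (ltW J0) hs.
have co : 0 <= (2 - 4 * eta - r - J * ((1 + eta / 2) * (1 + 6 * eta) + 64 * eta)) * X.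
  by rewrite mulr_ge0//; have := eta0; have := eta_half; nra.
have -> : J * ((1 + eta / 2) * K + 16 * eta) * Y =
  J * ((1 + eta / 2) * ((1 + 6 * eta) * X + K * Y) + 2 * eta * (32 * X + 8 * Y))
   - J * ((1 + eta / 2) * (1 + 6 * eta) + 64 * eta) * X by ring.
have e5 : (2 - 4 * eta - r - J * ((1 + eta / 2) * (1 + 6 * eta) + 64 * eta)) * X =
  (2 - 4 * eta) * X - r * X - J * ((1 + eta / 2) * (1 + 6 * eta) + 64 * eta) * X by ring.
rewrite e5 in co; rewrite mulrN in hJ.
move: co hJ hX; move: (J * ((1 + eta / 2) * (1 + 6 * eta) + 64 * eta) * X).
move: (J * ((1 + eta / 2) * ((1 + 6 * eta) * X + K * Y) + 2 * eta * (32 * X + 8 * Y))).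
move: ((2 - 4 * eta) * X) (r * X) (J * e) => u1 u2 u3 u4 u5; lra.
Qed.

End functional_inequality.

(** * Approximate solutions of the backward equation *)

Section galerkin.
Variables (R : realType) (N : nat) (J : R).
Local Notation C := (circle R).
Local Notation freq := {ffun 'I_N -> int}.
Local Notation term := (R * freq * R)%type.
Implicit Types (k l : freq) (p : tpoly R N) (w : term) (b : R).

Definition l1 k : nat := (\sum_i `|k i|)%N.
Definition sqn k : R := \sum_i (k i)%:~R ^+ 2.
Definition shift (i j : 'I_N) : freq := single i 1 - single j 1.
(** A hop raises [l1] by at most 2, hence the weight by a factor at most 4, while the exponential
    weight beats the polynomial growth of the generator in the frequency. *)
Definition wnorm p : R := \sum_(w <- p) `|w.1.1| * 2 ^+ l1 w.1.2.

(* The product formula for cosines turns the interaction part of the generator into hops of the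
   frequency, which leave the phase unchanged. *)
Definition hop w : seq term :=
  [seq (w.1.1 * (J / (2 * N%:R) * (w.1.2 i)%:~R), w.1.2 - shift i j, w.2) | i <- index_enum 'I_N, j <- index_enum 'I_N]
  ++ [seq (- (w.1.1 * (J / (2 * N%:R) * (w.1.2 i)%:~R)), w.1.2 + shift i j, w.2) | i <- index_enum 'I_N, j <- index_enum 'I_N].

Definition Lterm w : seq term := (- (w.1.1 * sqn w.1.2), w.1.2, w.2) :: hop w.
Definition Lgen p : tpoly R N := flatten [seq Lterm w | w <- p].

Lemma teval_flatten (f : term -> seq term) p t :
  teval (flatten [seq f w | w <- p]) t = \sum_(w <- p) teval (f w) t.
Proof.
elim: p => [|w p IH] /=; first by rewrite /teval !big_nil.
by rewrite teval_cat IH big_cons.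
Qed.

Lemma wnorm_cat p q : wnorm (p ++ q) = wnorm p + wnorm q.
Proof. by rewrite /wnorm big_cat. Qed.

Lemma wnorm_flatten (f : term -> seq term) p :
  wnorm (flatten [seq f w | w <- p]) = \sum_(w <- p) wnorm (f w).
Proof.
elim: p => [|w p IH] /=; first by rewrite /wnorm !big_nil.
by rewrite wnorm_cat IH big_cons.
Qed.

Lemma angle_shift i j (t : N.-tuple C) :
  angle (shift i j) t = repr (tnth t i) - repr (tnth t j).
Proof.
have s h : angle (single h 1) t = repr (tnth t h).
  rewrite /angle (bigD1 h)//= ffunE eqxx mul1r big1 ?addr0// => h' /negbTE hh.
  by rewrite ffunE hh mul0r.
by rewrite angleB !s.
Qed.

Lemma teval_hop w t : teval (hop w) t = w.1.1 * (- (J / N%:R) * \sum_(i < N)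
   (\sum_(j < N) sin_diff (tnth t i) (tnth t j)) * ((w.1.2 i)%:~R * wave w.1.2 (w.2 + pi / 2) t)).
Proof.
rewrite /hop teval_cat /teval !big_allpairs_dep -big_split/= mulrA mulr_sumr.
apply: eq_bigr => i _; rewrite -big_split/= mulr_suml mulr_sumr; apply: eq_bigr => j _.
rewrite /wave angleB angleD angle_shift /sin_diff.
set d := repr (tnth t i) - repr (tnth t j); set x := angle w.1.2 t.
have -> : x - d + w.2 = (x + w.2) - d by ring.
have -> : x + d + w.2 = (x + w.2) + d by ring.
rewrite [x + (w.2 + _)]addrA cosDpihalf (cosB (x + w.2) d) (cosD (x + w.2) d).
by rewrite invfM; move: (N%:R^-1) => v; field.
Qed.

Lemma teval_Lterm w t : teval (Lterm w) t = w.1.1 * Lwave J w.1.2 w.2 t.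
Proof.
rewrite /Lterm -cat1s teval_cat teval_hop {1}/teval big_seq1/= /Lwave sumrB mulrBr.
rewrite (_ : \sum_(i < N) - _ ^+ 2 * _ = - sqn w.1.2 * wave w.1.2 w.2 t); last first.
  by rewrite /sqn -sumrN mulr_suml.
rewrite (_ : \sum_(i < N) J / N%:R * _ * _ = J / N%:R * \sum_(i < N)
   (\sum_(j < N) sin_diff (tnth t i) (tnth t j)) * ((w.1.2 i)%:~R * wave w.1.2 (w.2 + pi / 2) t)).
  by ring.
by rewrite mulr_sumr; apply: eq_bigr => i _; rewrite mulrA.
Qed.

Lemma teval_Lgen p t : teval (Lgen p) t = \sum_(w <- p) w.1.1 * Lwave J w.1.2 w.2 t.
Proof. by rewrite teval_flatten; apply: eq_bigr => w _; exact: teval_Lterm. Qed.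

Lemma l1D k l : (l1 (k + l)%R <= l1 k + l1 l)%N.
Proof.
rewrite /l1 -big_split/=; apply: leq_sum => i _; rewrite ffunE.
by rewrite -lez_nat PoszD !abszE ler_normD.
Qed.

Lemma l1_single i (x : int) : l1 (single i x) = `|x|%N.
Proof.
rewrite /l1 (bigD1 i)//= ffunE eqxx big1 ?addn0// => j /negbTE ji.
by rewrite ffunE ji.
Qed.

Lemma l1N k : l1 (- k) = l1 k.
Proof. by apply: eq_bigr => i _; rewrite ffunE abszN. Qed.

Lemma l1_shift i j : (l1 (shift i j) <= 2)%N.
Proof. by rewrite (leq_trans (l1D _ _))// l1N !l1_single. Qed.

Lemma intr_absz (x : int) : `|x%:~R : R| = (`|x|%N)%:R.
Proof. by rewrite -intr_norm -abszE -pmulrn. Qed.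

Lemma l1_real k : (l1 k)%:R = \sum_i `|(k i)%:~R : R|.
Proof. by rewrite /l1 natr_sum; apply: eq_bigr => i _; rewrite intr_absz. Qed.

Lemma sqn_ge0 k : 0 <= sqn k. Proof. by apply: sumr_ge0 => i _; exact: sqr_ge0. Qed.

Lemma sqn_le k : sqn k <= (l1 k)%:R ^+ 2.
Proof.
rewrite l1_real expr2 mulr_suml; apply: ler_sum => i _.
rewrite -(@real_normK _ (k i)%:~R) ?num_real// expr2 ler_wpM2l//.
by rewrite (bigD1 i)//= lerDl sumr_ge0.
Qed.

Hypotheses (J0 : 0 < J) (N0 : (0 < N)%N).
Let n0 : 0 < N%:R :> R. Proof. by rewrite ltr0n. Qed.

Let wnorm_hop_gen (f : 'I_N -> 'I_N -> freq) w (c : 'I_N -> R) (e : R) :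
  (forall i, `|c i| = `|w.1.1| * (J / (2 * N%:R) * `|(w.1.2 i)%:~R|)) ->
  (forall i j, 2 ^+ l1 (f i j) <= e) ->
  wnorm [seq (c i, f i j, w.2) | i <- index_enum 'I_N, j <- index_enum 'I_N] <=
  J / 2 * (l1 w.1.2)%:R * `|w.1.1| * e.
Proof.
move=> hc hf; rewrite /wnorm big_allpairs_dep/=.
apply: (@le_trans _ _ (\sum_(i < N) \sum_(j < N) `|w.1.1| * (J / (2 * N%:R) * `|(w.1.2 i)%:~R|) * e)).
  by apply: ler_sum => i _; apply: ler_sum => j _; rewrite hc ler_wpM2l// !mulr_ge0 ?invr_ge0// ltW.
rewrite l1_real mulr_sumr !mulr_suml; apply: ler_sum => i _.
rewrite sumr_const card_ord -[_ *+ _]mulr_natr; apply: eq_ler.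
by field; rewrite gt_eqF.
Qed.

Lemma wnorm_hop w : wnorm (hop w) <= 4 * J * (l1 w.1.2)%:R * (`|w.1.1| * 2 ^+ l1 w.1.2).
Proof.
rewrite wnorm_cat.
have b1 (i j : 'I_N) : 2 ^+ l1 (w.1.2 - shift i j) <= 4 * 2 ^+ l1 w.1.2 :> R.
  have -> : 4 * 2 ^+ l1 w.1.2 = 2 ^+ (l1 w.1.2 + 2) :> R by rewrite exprD mulrC; congr (_ * _); ring.
  apply: ler_weXn2l; first by rewrite ler1n.
  by rewrite (leq_trans (l1D _ _))// leq_add2l l1N l1_shift.
have b2 (i j : 'I_N) : 2 ^+ l1 (w.1.2 + shift i j) <= 4 * 2 ^+ l1 w.1.2 :> R.
  have -> : 4 * 2 ^+ l1 w.1.2 = 2 ^+ (l1 w.1.2 + 2) :> R by rewrite exprD mulrC; congr (_ * _); ring.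
  apply: ler_weXn2l; first by rewrite ler1n.
  by rewrite (leq_trans (l1D _ _))// leq_add2l l1_shift.
have nc i : `|w.1.1 * (J / (2 * N%:R) * (w.1.2 i)%:~R)| = `|w.1.1| * (J / (2 * N%:R) * `|(w.1.2 i)%:~R|).
  by rewrite !normrM (gtr0_norm J0) normfV normrM !normr_nat.
have h1 := @wnorm_hop_gen (fun i j => w.1.2 - shift i j) w _ _ nc b1.
have nc' i : `|- (w.1.1 * (J / (2 * N%:R) * (w.1.2 i)%:~R))| = `|w.1.1| * (J / (2 * N%:R) * `|(w.1.2 i)%:~R|).
  by rewrite normrN.
have h2 := @wnorm_hop_gen (fun i j => w.1.2 + shift i j) w _ _ nc' b2.
by rewrite (le_trans (lerD h1 h2))//; apply: eq_ler; field.
Qed.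

Lemma teval_le_wnorm p t : `|teval p t| <= wnorm p.
Proof.
rewrite /teval (le_trans (ler_norm_sum _ _ _))// ler_sum// => w _.
rewrite normrM ler_wpM2l// (le_trans (cos_max _))// exprn_ege1// ler1n//.
Qed.

Lemma teval_hop_le w t : `|teval (hop w) t| <= J * (l1 w.1.2)%:R * `|w.1.1|.
Proof.
rewrite /hop teval_cat (le_trans (ler_normD _ _))//.
have gen (f : 'I_N -> 'I_N -> freq) (c : 'I_N -> R) :
    (forall i, `|c i| = `|w.1.1| * (J / (2 * N%:R) * `|(w.1.2 i)%:~R|)) ->
    `|teval [seq (c i, f i j, w.2) | i <- index_enum 'I_N, j <- index_enum 'I_N] t| <=
    J / 2 * (l1 w.1.2)%:R * `|w.1.1|.
  move=> hc; rewrite /teval big_allpairs_dep/=.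
  apply: (@le_trans _ _ (\sum_(i < N) \sum_(j < N) `|w.1.1| * (J / (2 * N%:R) * `|(w.1.2 i)%:~R|))).
    rewrite (le_trans (ler_norm_sum _ _ _))// ler_sum// => i _.
    rewrite (le_trans (ler_norm_sum _ _ _))// ler_sum// => j _.
    by rewrite normrM -hc ler_piMr// cos_max.
  rewrite l1_real mulr_sumr !mulr_suml; apply: ler_sum => i _.
  rewrite sumr_const card_ord -[_ *+ _]mulr_natr; apply: eq_ler.
  by field; rewrite gt_eqF.
have nc i : `|w.1.1 * (J / (2 * N%:R) * (w.1.2 i)%:~R)| = `|w.1.1| * (J / (2 * N%:R) * `|(w.1.2 i)%:~R|).
  by rewrite !normrM (gtr0_norm J0) normfV normrM !normr_nat.
have nc' i : `|- (w.1.1 * (J / (2 * N%:R) * (w.1.2 i)%:~R))| = `|w.1.1| * (J / (2 * N%:R) * `|(w.1.2 i)%:~R|).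
  by rewrite normrN.
apply: (le_trans (lerD (gen (fun i j => w.1.2 - shift i j) _ nc) (gen (fun i j => w.1.2 + shift i j) _ nc'))).
by apply: eq_ler; field.
Qed.

Lemma cube_le_exp2 n : (n ^ 3 <= 8 * 2 ^ n)%N.
Proof.
have [n4|n4] := leqP n 4; first by case: n n4 => [|[|[|[|[|]]]]].
rewrite -(subnK n4); elim: (n - 5)%N => [//|j IH].
rewrite addSn [(2 ^ _.+1)%N]expnS mulnCA; apply: (@leq_trans (2 * (j + 5) ^ 3)%N); last by rewrite leq_mul2l.
have : (5 <= j + 5)%N by rewrite leq_addl.
move: (j + 5)%N => x x5; rewrite -addn1 !expnS expn0 !muln1; nia.
Qed.

Local Notation tdterm := ((R -> R) * (R -> R) * freq * R)%type.

(* A term [(f, f', k, b)] carries a time-dependent coefficient together with its derivative. *)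
Definition at_time (u : seq tdterm) s : tpoly R N := [seq (w.1.1.1 s, w.1.2, w.2) | w : tdterm <- u].
Definition time_drv (u : seq tdterm) s : tpoly R N := [seq (w.1.1.2 s, w.1.2, w.2) | w : tdterm <- u].
Fixpoint td_derivable (u : seq tdterm) : Prop := if u is w :: u' then
  (forall s : R, is_derive s 1 w.1.1.1 (w.1.1.2 s)) /\ td_derivable u' else True.

Lemma td_derivable_cat u v : td_derivable u -> td_derivable v -> td_derivable (u ++ v).
Proof. by elim: u => [//|w u IH] /= [dw du] dv; split=> //; exact: IH. Qed.

(** * Frequency truncation of the generator *)

Section truncation.
Variable K : nat.
Let c : R := K%:R ^+ 2.

(** The operator [c + L] with [L] switched off at frequencies above [K]. The shift by [c = K ^ 2]
    makes the diagonal entries nonnegative, so that the diffusion counts in the norm estimate; the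
    factor [expR (- (c * tau))] in the weights [chi] undoes it. *)
Definition Mterm w : seq term :=
  if (l1 w.1.2 <= K)%N then (w.1.1 * (c - sqn w.1.2), w.1.2, w.2) :: hop w else [:: (c * w.1.1, w.1.2, w.2)].
Definition Mgen p : tpoly R N := flatten [seq Mterm w | w <- p].

Let mu : R := 4 * J ^+ 2 * N%:R.
Let mu0 : 0 <= mu.
Proof. by apply: mulr_ge0 => //; apply: mulr_ge0 => //; exact: sqr_ge0. Qed.
Let c0 : 0 <= c. Proof. exact: sqr_ge0. Qed.

(** In each coordinate [4 * J * y <= y ^+ 2 + 4 * J ^+ 2], so that the diffusion absorbs the hops.
    The excess [mu] over [c] does not depend on [K], and the truncated evolution grows at a rate
    uniform in [K]. *)
Lemma wnorm_Mgen p : wnorm (Mgen p) <= (c + mu) * wnorm p.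
Proof.
rewrite wnorm_flatten {2}/wnorm mulr_sumr; apply: ler_sum => w _.
set x := `|w.1.1| * 2 ^+ l1 w.1.2.
have x0 : 0 <= x by rewrite mulr_ge0// exprn_ge0.
rewrite /Mterm; case: leqP => lK; last first.
  rewrite /wnorm big_seq1/= normrM (ger0_norm c0) -mulrA -/x mulrDl lerDl.
  by rewrite mulr_ge0.
rewrite -cat1s wnorm_cat {1}/wnorm big_seq1/= normrM mulrAC -/x.
have sc : sqn w.1.2 <= c.
  by rewrite (le_trans (sqn_le _))// /c lerXn2r ?nnegrE// ler_nat.
rewrite ger0_norm ?subr_ge0//.
have h := wnorm_hop w; rewrite -/x in h.
apply: (le_trans (lerD (lexx _) h)); rewrite [x * _]mulrC -mulrDl ler_wpM2r//.
rewrite -addrA lerD2l addrC lerBlDr /mu l1_real mulr_sumr /sqn.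
have -> : 4 * J ^+ 2 * N%:R = \sum_(i < N) 4 * J ^+ 2 by rewrite sumr_const card_ord mulr_natr.
rewrite -big_split/=; apply: ler_sum => i _.
rewrite -(@real_normK _ (w.1.2 i)%:~R) ?num_real//; move: `|_| => y.
rewrite -subr_ge0 [leRHS](_ : _ = (2 * J - y) ^+ 2); last by ring.
exact: sqr_ge0.
Qed.

Definition high p : tpoly R N := [seq w : term <- p | (K < l1 w.1.2)%N].

Lemma teval_Mgen p t : teval (Mgen p) t = c * teval p t + teval (Lgen p) t - teval (Lgen (high p)) t.
Proof.
rewrite !teval_flatten; elim: (p : seq term) => [|w q IH]; first by rewrite /teval !big_nil; ring.
rewrite -cat1s teval_cat {1}/high filter_cat !big_cat/= !big_seq1 IH.
have e : teval (Mterm w) t = c * teval [:: w] t + teval (Lterm w) t -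
    \sum_(v <- (if (K < l1 w.1.2)%N then [:: w] else [::])) teval (Lterm v) t.
  rewrite /Mterm; case: leqP => _.
    by rewrite big_nil subr0 /Lterm /teval !big_cons !big_nil/=; ring.
  by rewrite big_seq1 addrK /teval !big_seq1/= mulrA.
by rewrite e /high; ring.
Qed.

(** At frequency [l] the generator costs at most [(1 + J) * l ^ 2], while the norm carries the
    weight [2 ^ l >= l ^ 3 / 8]; the remaining factor [1 / l] is small above the truncation
    level. *)
Lemma boundary_le p t : `|teval (Lgen (high p)) t| <= 8 * (1 + J) / K.+1%:R * wnorm p.
Proof.
rewrite teval_flatten (le_trans (ler_norm_sum _ _ _))// /high big_filter big_mkcond/=.
rewrite /wnorm mulr_sumr; apply: ler_sum => w _.
have e0 : 0 <= 8 * (1 + J) / K.+1%:R :> R by rewrite divr_ge0// mulr_ge0// addr_ge0// ltW.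
case: ifPn => [lK|_]; last by rewrite mulr_ge0// mulr_ge0// exprn_ge0.
set l := l1 w.1.2 in lK *.
have l0 : 0 < l%:R :> R by rewrite ltr0n (leq_trans _ lK).
apply: (@le_trans _ _ (`|w.1.1| * ((1 + J) * l%:R ^+ 2))).
  rewrite /Lterm -cat1s teval_cat (le_trans (ler_normD _ _))//.
  have h := teval_hop_le w t; rewrite -/l in h.
  apply: (le_trans (lerD (lexx _) h)).
  rewrite /teval big_seq1/= normrM normrN normrM (ger0_norm (sqn_ge0 _)).
  have l1' : 1 <= l%:R :> R by rewrite ler1n -(ltr0n R).
  have sq := sqn_le w.1.2; rewrite -/l in sq.
  apply: (@le_trans _ _ (`|w.1.1| * l%:R ^+ 2 + J * l%:R * `|w.1.1|)).
    rewrite lerD2r; apply: (@le_trans _ _ (`|w.1.1| * sqn w.1.2)).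
      by rewrite ler_piMr ?cos_max// mulr_ge0// sqn_ge0.
    by rewrite ler_wpM2l.
  rewrite -subr_ge0 [leRHS](_ : _ = J * `|w.1.1| * (l%:R * (l%:R - 1))); last by ring.
  by rewrite !mulr_ge0// ?subr_ge0// ltW.
rewrite [leRHS]mulrCA ler_wpM2l//.
have cu : l%:R ^+ 3 <= 8 * 2 ^+ l :> R by rewrite -!natrX -natrM ler_nat cube_le_exp2.
have kl : K.+1%:R <= l%:R :> R by rewrite ler_nat.
have -> : 8 * (1 + J) / K.+1%:R * 2 ^+ l = (1 + J) * (8 * 2 ^+ l / K.+1%:R) by ring.
rewrite ler_wpM2l ?addr_ge0 ?(ltW J0)// ler_pdivlMr//.
apply: (le_trans _ cu); rewrite [leRHS]exprSr.
by rewrite ler_wpM2l// exprn_ge0// ltW.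
Qed.

Definition iterM n p := iter n Mgen p.

Lemma wnorm_iterM n p : wnorm (iterM n p) <= (c + mu) ^+ n * wnorm p.
Proof.
elim: n => [|n IH] /=; first by rewrite mul1r.
apply: (le_trans (wnorm_Mgen _)); rewrite exprS -mulrA ler_wpM2l//.
by rewrite addr_ge0.
Qed.

Lemma wnorm_ge0 p : 0 <= wnorm p.
Proof. by apply: sumr_ge0 => w _; rewrite mulr_ge0// exprn_ge0. Qed.

(* [chi n] is the weight of a Poisson variable of parameter [c * tau], up to c^n. *)
Let chi n (tau : R) := expR (- (c * tau)) * (tau ^+ n / n`!%:R).
Let pchi n tau := if n is n'.+1 then chi n' tau else 0.

Lemma drv_chi n (tau : R) : is_derive tau 1 (chi n) (- c * chi n tau + pchi n tau).
Proof.
have h := drvM (drv_exp (drvN (drvZ c (drv_id tau))))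
  (drvM (drvX n (drv_id tau)) (drv_cst n`!%:R^-1 tau)).
apply: (drv_eq h); case: n {h} => [|n] /=.
  by rewrite /chi fact0 expr0; ring.
have f0 : n`!%:R != 0 :> R by rewrite pnatr_eq0 -lt0n fact_gt0.
have m0 : n.+1%:R != 0 :> R by [].
rewrite /pchi /chi factS natrM; move: (n.+1%:R) (n`!%:R) f0 m0 => x y y0 x0.
by field; rewrite x0 y0.
Qed.

(** The derivative of the weights shifts the index, so that the sum telescopes against [Mgen] up to
    its last term. The other error is the part of the generator that was switched off at high
    frequencies. *)
Lemma galerkin_error p m (tau : R) (S : R) t : 0 <= tau -> tau <= S ->
  `|- (\sum_(n < m.+1) (- c * chi n tau + pchi n tau) * teval (iterM n p) t)
    + \sum_(n < m.+1) chi n tau * teval (Lgen (iterM n p)) t| <=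
  (c + mu) * ((S * (c + mu)) ^+ m / m`!%:R) * wnorm p +
  8 * (1 + J) / K.+1%:R * expR (mu * S) * wnorm p.
Proof.
move=> tau0 tS; have W0 := wnorm_ge0 p; have cm0 : 0 <= c + mu by rewrite addr_ge0.
have chi0 n : 0 <= chi n tau by rewrite mulr_ge0 ?expR_ge0// divr_ge0 ?exprn_ge0.
have gen (T : nat -> tpoly R N) : (forall n, T n.+1 = Mgen (T n)) ->
    - (\sum_(n < m.+1) (- c * chi n tau + pchi n tau) * teval (T n) t)
    + \sum_(n < m.+1) chi n tau * teval (Lgen (T n)) t =
    chi m tau * teval (T m.+1) t + \sum_(n < m.+1) chi n tau * teval (Lgen (high (T n))) t.
  move=> TS; elim: m => [|m IH]; first by rewrite !big_ord_recr !big_ord0 /= TS teval_Mgen; ring.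
  rewrite big_ord_recr/= [X in _ + X]big_ord_recr/= [X in _ = _ + X]big_ord_recr/=.
  have {}IH : \sum_(n < m.+1) chi n tau * teval (Lgen (T n)) t =
    chi m tau * teval (T m.+1) t + \sum_(n < m.+1) chi n tau * teval (Lgen (high (T n))) t
     + \sum_(n < m.+1) (- c * chi n tau + pchi n tau) * teval (T n) t by rewrite -IH; ring.
  by rewrite IH [T m.+2]TS teval_Mgen; ring.
have e := gen (iterM ^~ p) (fun n => erefl).
rewrite e (le_trans (ler_normD _ _))// lerD//.
  rewrite normrM ger0_norm//.
  have : `|teval (iterM m.+1 p) t| <= (c + mu) ^+ m.+1 * wnorm p.
    exact: le_trans (teval_le_wnorm _ _) (wnorm_iterM _ _).
  move=> h; apply: (le_trans (ler_wpM2l (chi0 m) h)).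
  have hchi : chi m tau <= S ^+ m / m`!%:R.
    rewrite /chi -[leRHS]mul1r ler_pM ?expR_ge0 ?divr_ge0 ?exprn_ge0//.
      by rewrite expR_le1 oppr_le0 mulr_ge0.
    by rewrite ler_wpM2r ?invr_ge0// lerXn2r ?nnegrE// (le_trans tau0).
  have -> : (c + mu) * ((S * (c + mu)) ^+ m / m`!%:R) * wnorm p =
      S ^+ m / m`!%:R * ((c + mu) ^+ m.+1 * wnorm p) by rewrite exprMn exprS; ring.
  by rewrite ler_wpM2r// mulr_ge0// exprn_ge0.
apply: (@le_trans _ _ (\sum_(n < m.+1) 8 * (1 + J) / K.+1%:R * wnorm p *
    (expR (- (c * tau)) * ((tau * (c + mu)) ^+ n / n`!%:R)))).
  rewrite (le_trans (ler_norm_sum _ _ _))// ler_sum// => n _.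
  rewrite normrM (ger0_norm (chi0 n)).
  apply: (le_trans (ler_wpM2l (chi0 n) (boundary_le _ _))).
  have e0 : 0 <= 8 * (1 + J) / K.+1%:R :> R by rewrite divr_ge0// mulr_ge0// addr_ge0// ltW.
  apply: (le_trans (ler_wpM2l (chi0 n) (ler_wpM2l e0 (wnorm_iterM _ _)))).
  by apply: eq_ler; rewrite /chi exprMn; ring.
rewrite -mulr_sumr -mulr_sumr [leRHS]mulrAC ler_wpM2l//.
  by rewrite mulr_ge0// divr_ge0// mulr_ge0// addr_ge0// ltW.
have := @texp_bound R m.+1 (tau * (c + mu)) (tau * (c + mu)).
rewrite ger0_norm ?mulr_ge0// => /(_ (lexx _)) /(le_trans (ler_norm _)) h.
apply: (le_trans (ler_wpM2l (expR_ge0 _) h)); rewrite -expRD ler_expR.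
have -> : - (c * tau) + tau * (c + mu) = mu * tau by ring.
by rewrite ler_wpM2l.
Qed.


(* [galu p s1 m] is the truncated solution of the backward equation with final value [p] at [s1]. *)
Fixpoint galu p (s1 : R) m : seq tdterm := if m is m'.+1 then galu p s1 m' ++
  [seq ((fun s => chi m' (s1 - s) * w.1.1),
        (fun s => - (- c * chi m' (s1 - s) + pchi m' (s1 - s)) * w.1.1), w.1.2, w.2)
    | w : term <- iterM m' p] else [::].

Lemma galu_derivable p s1 m : td_derivable (galu p s1 m).
Proof.
elim: m => [//|m IH] /=; apply: td_derivable_cat IH _.
elim: (iterM m p : seq term) => [//|w q IHq]; split; last exact: IHq.
move=> s; change (is_derive s 1 (fun s => chi m (s1 - s) * w.1.1)
  (- (- c * chi m (s1 - s) + pchi m (s1 - s)) * w.1.1)).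
have ds : is_derive s 1 (fun y => s1 - y) (-1).
  by apply: (drv_eq (drvB (drv_cst s1 s) (drv_id s))); rewrite sub0r.
apply: (drv_eq (drvM (@drv_comp R (chi m) (fun y => s1 - y) s _ _ (drv_chi m (s1 - s)) ds)
  (drv_cst w.1.1 s))); ring.
Qed.

Lemma galu_at p s1 m s t :
  teval (at_time (galu p s1 m) s) t = \sum_(n < m) chi n (s1 - s) * teval (iterM n p) t.
Proof.
elim: m => [|m IH]; first by rewrite big_ord0 /teval big_nil.
rewrite big_ord_recr/= -IH /at_time map_cat teval_cat; congr (_ + _).
by rewrite -map_comp /teval big_map mulr_sumr; apply: eq_bigr => w _; rewrite /= mulrA.
Qed.

Lemma galu_drv p s1 m s t : teval (time_drv (galu p s1 m) s) t =
  - \sum_(n < m) (- c * chi n (s1 - s) + pchi n (s1 - s)) * teval (iterM n p) t.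
Proof.
elim: m => [|m IH]; first by rewrite big_ord0 oppr0 /teval big_nil.
rewrite big_ord_recr/= opprD -IH /time_drv map_cat teval_cat; congr (_ + _).
rewrite -[RHS]mulNr -map_comp /teval big_map mulr_sumr; apply: eq_bigr => w _ /=.
by rewrite -[LHS]mulrA.
Qed.

Lemma galu_Lgen p s1 m s t : teval (Lgen (at_time (galu p s1 m) s)) t =
  \sum_(n < m) chi n (s1 - s) * teval (Lgen (iterM n p)) t.
Proof.
elim: m => [|m IH]; first by rewrite big_ord0 /teval big_nil.
rewrite big_ord_recr/= -IH !teval_Lgen /at_time map_cat big_cat/=; congr (_ + _).
rewrite big_map big_map mulr_sumr; apply: eq_bigr => w _ /=.
by rewrite -[LHS]mulrA.
Qed.

Lemma galu_final p s1 m t : teval (at_time (galu p s1 m.+1) s1) t = teval p t.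
Proof.
rewrite galu_at subrr big_ord_recl big1 => [|i _].
  by rewrite addr0 /chi mulr0 oppr0 expR0 expr0 fact0 divr1 !mul1r.
by rewrite /chi expr0n/= mul0r mulr0 mul0r.
Qed.

End truncation.

Theorem galerkin (p : tpoly R N) (s0 s1 e : R) : s0 <= s1 -> 0 < e ->
  exists u, [/\ td_derivable u, (forall t, teval (at_time u s1) t = teval p t) &
    forall s t, s0 <= s <= s1 -> `|teval (time_drv u s) t + teval (Lgen (at_time u s)) t| <= e].
Proof.
move=> s01 e0; set S := s1 - s0; set mu := 4 * J ^+ 2 * N%:R; set W := wnorm p.
have W0 : 0 <= W by exact: wnorm_ge0.
have e2 : 0 < e / 2 by rewrite divr_gt0.
set B := 8 * (1 + J) * expR (mu * S) * W.
have B0 : 0 <= B by rewrite !mulr_ge0 ?expR_ge0// addr_ge0// ltW.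
(* [K] is fixed first, by an error bound that is uniform in the length of the series; the length [m]
   may then depend on [K] through [c]. *)
have [K hK] : exists K, B / K.+1%:R <= e / 2.
  exists (Num.truncn (B / (e / 2))); rewrite ler_pdivrMr//.
  have /ltW := truncnS_gt (B / (e / 2)); move: ((Num.truncn _).+1%:R) => x.
  by rewrite ler_pdivrMr// mulrC.
set c : R := K%:R ^+ 2; set x := S * (c + mu).
have [m hm] : exists m, (c + mu) * (x ^+ m / m`!%:R) * W <= e / 2.
  have h0 : exp_coeff x n @[n --> \oo] --> 0 by exact: cvg_exp_coeff.
  have h : (c + mu) * exp_coeff x n * W @[n --> \oo] --> (c + mu) * 0 * W.
    by apply: cvgM; [apply: cvgM => //; exact: cvg_cst|exact: cvg_cst].
  rewrite mulr0 mul0r in h; have /cvgrPdist_le/(_ _ e2)[n _ /(_ n (leqnn n))] := h.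
  rewrite sub0r normrN => hn; exists n; apply: le_trans hn; exact: ler_norm.
exists (galu K p s1 m.+1); split=> [|t|s t /andP[s0s ss1]].
- exact: galu_derivable.
- exact: galu_final.
rewrite galu_drv galu_Lgen.
have t0 : 0 <= s1 - s by rewrite subr_ge0.
have tS : s1 - s <= S by rewrite lerD2l lerN2.
apply: (le_trans (galerkin_error K p m t t0 tS)).
have -> : e = e / 2 + e / 2 by field.
rewrite lerD//; apply: le_trans hK; apply: eq_ler.
by rewrite /B /W -/mu; ring.
Qed.

End galerkin.

(** * Entropy along the flow *)

Section tensor_evolution.
Variables (R : realType) (J : R) (m : R -> probability (circle R) R).
Hypothesis mFP : mean_field_Fokker_Planck J m.
Local Notation C := (circle R).
Local Notation pi2 := (pi / 2).

Let D1 s (k : int) b (x : C) := - k%:~R ^+ 2 * wave1 k b x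
      - J * drift m s x * (k%:~R * wave1 k (b + pi2) x).

Definition Lbarwave n s (k : {ffun 'I_n -> int}) b (t : n.-tuple C) := \sum_(i < n)
  (- (k i)%:~R ^+ 2 * wave k b t
   - J * drift m s (tnth t i) * ((k i)%:~R * wave k (b + pi2) t)).

Lemma bm_drift s : bm (drift m s).
Proof. by apply: bmB; apply: bmZ; exact: bm_wave1. Qed.

Let bm_D1 s k b : bm (D1 s k b).
Proof.
have bw := @bm_wave1 R k; have bd := bm_drift s.
apply: bmB; first exact: bmZ.
by apply: bmM; [exact: bmZ|exact: bmZ].
Qed.

Lemma bm_Lbarwave n s (k : {ffun 'I_n -> int}) b : bm (Lbarwave s k b).
Proof.
apply: bm_sum => i; apply: bmB; first by apply: bmZ; exact: bm_wave.
apply: bmM; first by apply: bmZ; apply: bm_tnth; exact: bm_drift.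
by apply: bmZ; exact: bm_wave.
Qed.

Let tl n (k : {ffun 'I_n.+1 -> int}) : {ffun 'I_n -> int} := [ffun i => k (lift ord0 i)].

Let wave_cons' n (k : {ffun 'I_n.+1 -> int}) b x (t : n.-tuple C) :
  wave k (b + pi2) (cons_pair (x, t)) =
  wave1 (k ord0) b x * wave (tl k) (0 + pi2) t
  + wave1 (k ord0) (b + pi2) x * wave (tl k) (- pi2 + pi2) t.
Proof.
rewrite wave_cons -/(tl k) /wave /wave1 addNr add0r !addr0 !addrA !cosDpihalf cosBpihalf sinDpihalf.
by ring.
Qed.

Let Lbarwave_cons n s (k : {ffun 'I_n.+1 -> int}) b x (t : n.-tuple C) :
  Lbarwave s k b (cons_pair (x, t)) =
  (D1 s (k ord0) b x * wave (tl k) 0 t + D1 s (k ord0) (b + pi2) x * wave (tl k) (- pi2) t)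
  + (wave1 (k ord0) b x * Lbarwave s (tl k) 0 t + wave1 (k ord0) (b + pi2) x * Lbarwave s (tl k) (- pi2) t).
Proof.
rewrite /Lbarwave big_ord_recl; congr (_ + _).
  have -> : tnth (cons_pair (x, t)) ord0 = x by [].
  by rewrite !wave_cons -/(tl k) /D1; ring.
rewrite !mulr_sumr -big_split; apply: eq_bigr => i _ /=.
have -> : tnth [tuple of x :: t] (lift ord0 i) = tnth t i by rewrite !(tnth_nth x).
rewrite wave_cons' wave_cons -/(tl k) ffunE.
by ring.
Qed.

Let esp_two n (s : R) (f g : C -> R) (h l : n.-tuple C -> R) : bm f -> bm g -> bm h -> bm l ->
  esp (m s) (fun x => esp (tensor_power (m s) n) (fun t => f x * h t + g x * l t)) =
  esp (m s) f * esp (tensor_power (m s) n) h + esp (m s) g * esp (tensor_power (m s) n) l.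
Proof.
move=> bf bg bh bl; transitivity (esp (m s) (fun x => f x * esp (tensor_power (m s) n) h +
    g x * esp (tensor_power (m s) n) l)).
  by apply: eq_esp => x; rewrite espD ?espZ//; exact: bmZ.
have bZr (f' : C -> R) c : bm f' -> bm (fun x => f' x * c).
  by move=> b; apply: bmM => //; exact: bm_cst.
by rewrite espD ?espZr//; exact: bZr.
Qed.

Let esp_wave_cons n (s : R) (k : {ffun 'I_n.+1 -> int}) b :
  esp (tensor_power (m s) n.+1) (wave k b) =
  mean m s (k ord0) b * esp (tensor_power (m s) n) (wave (tl k) 0) +
  mean m s (k ord0) (b + pi2) * esp (tensor_power (m s) n) (wave (tl k) (- pi2)).
Proof.
rewrite esp_tensorS; last exact: bm_wave.
rewrite /mean -esp_two; try exact: bm_wave1; try exact: bm_wave.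
by apply: eq_esp => x; apply: eq_esp => t; rewrite wave_cons.
Qed.

(** Induction on the dimension: [wave_cons] writes the expectation as a sum of two products of
    independent factors, to which the Leibniz rule applies. *)
Lemma tensor_wave_derive n (k : {ffun 'I_n -> int}) b (s : R) : 0 < s ->
  is_derive s 1 (fun s => esp (tensor_power (m s) n) (wave k b))
    (esp (tensor_power (m s) n) (Lbarwave s k b)).
Proof.
move=> s0; elim: n k b => [|n IH] k b.
  have -> : (fun s => esp (tensor_power (m s) 0) (wave k b)) = (fun=> wave k b [tuple]).
    by apply/funext => s'; rewrite esp_tensor0//; exact: bm_wave.
  rewrite esp_tensor0; last exact: bm_Lbarwave.
  by rewrite /Lbarwave big_ord0; exact: drv_cst.
have -> : (fun s => esp (tensor_power (m s) n.+1) (wave k b)) = (fun s =>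
    mean m s (k ord0) b * esp (tensor_power (m s) n) (wave (tl k) 0) +
    mean m s (k ord0) (b + pi2) * esp (tensor_power (m s) n) (wave (tl k) (- pi2))).
  by apply/funext => s'; exact: esp_wave_cons.
have h := drvD (drvM (mean_derive mFP (k ord0) b s0) (IH (tl k) 0))
  (drvM (mean_derive mFP (k ord0) (b + pi2) s0) (IH (tl k) (- pi2))).
apply: (drv_eq h).
have bw := @bm_wave R n; have bL := @bm_Lbarwave n s; have bw1 := @bm_wave1 R; have bD := bm_D1 s.
rewrite esp_tensorS; last exact: bm_Lbarwave.
transitivity (esp (m s) (fun x => esp (tensor_power (m s) n) (fun t =>
  D1 s (k ord0) b x * wave (tl k) 0 t + D1 s (k ord0) (b + pi2) x * wave (tl k) (- pi2) t)) +
  esp (m s) (fun x => esp (tensor_power (m s) n) (fun t =>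
  wave1 (k ord0) b x * Lbarwave s (tl k) 0 t + wave1 (k ord0) (b + pi2) x * Lbarwave s (tl k) (- pi2) t))).
  by rewrite !esp_two// /mean -/(D1 s _ _); ring.
pose Q := tensor_power (m s) n.
have eD (f g : C -> R) (h1 h2 : n.-tuple C -> R) x : bm h1 -> bm h2 ->
    esp Q (fun t => f x * h1 t + g x * h2 t) = f x * esp Q h1 + g x * esp Q h2.
  by move=> b1 b2; rewrite espD ?espZ//; exact: bmZ.
have bmr (f : C -> R) e : bm f -> bm (fun x => f x * e) by move=> bf; apply: bmM => //; exact: bm_cst.
have b2 (f g : C -> R) (h1 h2 : n.-tuple C -> R) : bm f -> bm g -> bm h1 -> bm h2 ->
    bm (fun x => esp Q (fun t => f x * h1 t + g x * h2 t)).
  move=> bf bg bh1 bh2; have -> : (fun x => esp Q (fun t => f x * h1 t + g x * h2 t)) =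
    (fun x => f x * esp Q h1 + g x * esp Q h2) by apply/funext => x; exact: eD.
  by apply: bmD; exact: bmr.
rewrite -espD; [|exact: b2|exact: b2].
apply: eq_esp => x; rewrite -espD; [|by apply: bmD; exact: bmZ|by apply: bmD; exact: bmZ].
by apply: eq_esp => t; rewrite Lbarwave_cons.
Qed.

Lemma tensor_wave_cont n (k : {ffun 'I_n -> int}) b s0 s1 : 0 <= s0 ->
  {within `[s0, s1], continuous (fun s => esp (tensor_power (m s) n) (wave k b))}.
Proof.
move=> s00; elim: n k b => [|n IH] k b.
  have -> : (fun s => esp (tensor_power (m s) 0) (wave k b)) = (fun=> wave k b [tuple]).
    by apply/funext => s'; rewrite esp_tensor0//; exact: bm_wave.
  by apply: continuous_subspaceT => x; exact: cst_continuous.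
have -> : (fun s => esp (tensor_power (m s) n.+1) (wave k b)) = (fun s =>
    mean m s (k ord0) b * esp (tensor_power (m s) n) (wave (tl k) 0) +
    mean m s (k ord0) (b + pi2) * esp (tensor_power (m s) n) (wave (tl k) (- pi2))).
  by apply/funext => s'; exact: esp_wave_cons.
have mc c : {within `[s0, s1], continuous (fun s => mean m s (k ord0) c)}.
  have sub : `[s0, s1] `<=` `[0, +oo[.
    by move=> x /=; rewrite !in_itv/= andbT => /andP[x0 _]; rewrite (le_trans s00 x0).
  have h0 := @mean_cont _ _ _ mFP (k ord0) c.
  exact (continuous_subspaceW sub h0).
move=> x; apply: cvgD; apply: cvgM; [exact: mc|exact: IH|exact: mc|exact: IH].
Qed.

End tensor_evolution.

Section teval_derivative.
Variables (R : realType) (N : nat).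
Local Notation C := (circle R).
Implicit Types (p : tpoly R N) (t : N.-tuple C) (i : 'I_N).

Lemma upd_self i t : upd i (tnth t i) t = t.
Proof. by apply: eq_from_tnth => j; rewrite tnth_mktuple; case: eqP => [->|]. Qed.

Lemma drv_teval i p t (x : R) : is_derive x 1 (fun y => teval p (upd i (\pi_C y) t))
  (teval (dpart i p) (upd i (\pi_C x) t)).
Proof.
have -> : (fun y => teval p (upd i (\pi_C y) t)) = ev (slice i t p).
  by apply/funext => y; rewrite teval_upd cev_pi.
by rewrite teval_upd cev_pi -dl_slice; exact: drv_ev.
Qed.

(** Computes a formal derivative from the function it represents, so that truncated exponentials are
    differentiated by the chain rule rather than by expanding lists. *)
Lemma teval_dpart_eq i p (f f' : N.-tuple C -> R) : (forall t, teval p t = f t) ->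
  (forall t (x : R), is_derive x 1 (fun y => f (upd i (\pi_C y) t)) (f' (upd i (\pi_C x) t))) ->
  forall t, teval (dpart i p) t = f' t.
Proof.
move=> pf df t; rewrite -[in LHS](upd_self i t) -[in RHS](upd_self i t) -[tnth t i]reprK.
have h1 := drv_teval i p t (repr (tnth t i)); have h2 := df t (repr (tnth t i)).
have e : (fun y => teval p (upd i (\pi_C y) t)) = (fun y => f (upd i (\pi_C y) t)).
  by apply/funext => y.
by rewrite e in h1; rewrite -(@derive_val _ _ _ _ _ _ _ h1) (@derive_val _ _ _ _ _ _ _ h2).
Qed.

End teval_derivative.

(** * Time-dependent trigonometric polynomials *)

Section time_dependent.
Variables (R : realType) (N : nat).
Local Notation C := (circle R).
Local Notation freq := {ffun 'I_N -> int}.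
Local Notation tdterm := ((R -> R) * (R -> R) * freq * R)%type.
Implicit Types (u v : seq tdterm) (t : N.-tuple C).

Definition tdmul u v : seq tdterm :=
  [seq ((fun s => w.1.1.1 s * z.1.1.1 s / 2),
        (fun s => (w.1.1.2 s * z.1.1.1 s + w.1.1.1 s * z.1.1.2 s) / 2),
        w.1.2 + z.1.2, w.2 + z.2) | w : tdterm <- u, z : tdterm <- v] ++
  [seq ((fun s => w.1.1.1 s * z.1.1.1 s / 2),
        (fun s => (w.1.1.2 s * z.1.1.1 s + w.1.1.1 s * z.1.1.2 s) / 2),
        w.1.2 - z.1.2, w.2 - z.2) | w : tdterm <- u, z : tdterm <- v].

Definition tdscale (a a' : R -> R) u : seq tdterm :=
  [seq ((fun s => a s * w.1.1.1 s), (fun s => a' s * w.1.1.1 s + a s * w.1.1.2 s), w.1.2, w.2)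
    | w : tdterm <- u].

Fixpoint tdpow u n : seq tdterm :=
  if n is n'.+1 then tdmul u (tdpow u n') else [:: ((fun=> 1), (fun=> 0), 0, 0)].

Fixpoint tdtexp u n : seq tdterm :=
  if n is n'.+1 then tdtexp u n' ++ tdscale (fun=> n'`!%:R^-1) (fun=> 0) (tdpow u n') else [::].

Lemma at_time_cat u v s t :
  teval (at_time (u ++ v) s) t = teval (at_time u s) t + teval (at_time v s) t.
Proof. by rewrite /at_time map_cat teval_cat. Qed.

Lemma at_time_mul u v s t :
  teval (at_time (tdmul u v) s) t = teval (at_time u s) t * teval (at_time v s) t.
Proof.
rewrite -tevalM; congr (teval _ t).
by rewrite /at_time /tdmul map_cat !map_allpairs /tmul !allpairs_mapl !allpairs_mapr.
Qed.

Lemma at_time_scale a a' u s t :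
  teval (at_time (tdscale a a' u) s) t = a s * teval (at_time u s) t.
Proof.
rewrite /at_time /tdscale -map_comp /teval !big_map mulr_sumr.
by apply: eq_bigr => w _; rewrite /= mulrA.
Qed.

Lemma time_drv_scale a a' u s t : teval (time_drv (tdscale a a' u) s) t =
  a' s * teval (at_time u s) t + a s * teval (time_drv u s) t.
Proof.
rewrite /at_time /time_drv /tdscale -map_comp /teval !big_map !mulr_sumr -big_split.
by apply: eq_bigr => w _; rewrite /=; ring.
Qed.

Lemma at_time_pow u n s t : teval (at_time (tdpow u n) s) t = teval (at_time u s) t ^+ n.
Proof.
elim: n => [|n IH]; first by rewrite /teval big_seq1/= wave0 cos0 mulr1.
by rewrite /= at_time_mul IH exprS.
Qed.

Lemma at_time_texp u n s t : teval (at_time (tdtexp u n) s) t = texp n (teval (at_time u s) t).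
Proof.
elim: n => [|n IH]; first by rewrite /teval /texp big_nil big_ord0.
by rewrite texpS /= at_time_cat IH at_time_scale at_time_pow mulrC.
Qed.

Let good (w : tdterm) := forall s : R, is_derive s 1 w.1.1.1 (w.1.1.2 s).

Let td_map (f : tdterm -> tdterm) u : (forall w, good w -> good (f w)) ->
  td_derivable u -> td_derivable [seq f w | w <- u].
Proof. by move=> gf; elim: u => [//|w u IH] /= [dw du]; split; [exact: gf|exact: IH]. Qed.

Let td_allpairs (f : tdterm -> tdterm -> tdterm) u v :
  (forall w z, good w -> good z -> good (f w z)) ->
  td_derivable u -> td_derivable v -> td_derivable [seq f w z | w <- u, z <- v].
Proof.
move=> gf; elim: u => [//|w u IH] /= [dw du] dv.
by apply: td_derivable_cat; [apply: td_map dv => z; exact: gf|exact: IH].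
Qed.

Let good_mul w z : good w -> good z -> forall s : R, is_derive s 1
  (fun s => w.1.1.1 s * z.1.1.1 s / 2) ((w.1.1.2 s * z.1.1.1 s + w.1.1.1 s * z.1.1.2 s) / 2).
Proof.
move=> gw gz s; apply: (drv_eq (drvM (drvM (gw s) (gz s)) (drv_cst (2^-1) s))).
by rewrite mulr0 addr0.
Qed.

Lemma td_derivable_mul u v : td_derivable u -> td_derivable v -> td_derivable (tdmul u v).
Proof.
by move=> du dv; apply: td_derivable_cat; apply: td_allpairs => // w z gw gz; exact: good_mul.
Qed.

Lemma td_derivable_scale a a' u : (forall s : R, is_derive s 1 a (a' s)) ->
  td_derivable u -> td_derivable (tdscale a a' u).
Proof. by move=> da; apply: td_map => w gw s; exact: drvM. Qed.

Lemma td_derivable_pow u n : td_derivable u -> td_derivable (tdpow u n).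
Proof.
move=> du; elim: n => [|n IH]; last exact: td_derivable_mul.
by split=> // s; exact: drv_cst.
Qed.

Lemma td_derivable_texp u n : td_derivable u -> td_derivable (tdtexp u n).
Proof.
move=> du; elim: n => [//|n IH] /=; apply: td_derivable_cat => //.
by apply: td_derivable_scale; exact: td_derivable_pow.
Qed.

Lemma drv_at_time u t (s : R) : td_derivable u ->
  is_derive s 1 (fun y => teval (at_time u y) t) (teval (time_drv u s) t).
Proof.
elim: u => [_|w u IH /= [dw /IH du]].
  have -> : (fun y => teval (at_time [::] y) t) = (fun=> 0) by apply/funext => y; rewrite /teval big_nil.
  by rewrite /teval big_nil; exact: drv_cst.
have -> : (fun y => teval (at_time (w :: u) y) t) = (fun y => w.1.1.1 y * wave w.1.2 w.2 t + teval (at_time u y) t).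
  by apply/funext => y; rewrite /teval big_cons.
apply: (drv_eq (drvD (drvM (dw s) (drv_cst _ s)) du)).
by rewrite mulr0 addr0 /teval big_cons.
Qed.

Lemma time_drv_texp u n s t : td_derivable u ->
  teval (time_drv (tdtexp u n.+1) s) t = texp n (teval (at_time u s) t) * teval (time_drv u s) t.
Proof.
move=> du; have h1 := drv_at_time t s (td_derivable_texp n.+1 du).
have h2 := @drv_comp R (texp n.+1) (fun y => teval (at_time u y) t) s _ _
  (drv_texp n (teval (at_time u s) t)) (drv_at_time t s du).
have e : (fun y => teval (at_time (tdtexp u n.+1) y) t) = (fun y => texp n.+1 (teval (at_time u y) t)).
  by apply/funext => y; exact: at_time_texp.
by rewrite e in h1; rewrite -(@derive_val _ _ _ _ _ _ _ h1) (@derive_val _ _ _ _ _ _ _ h2).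
Qed.

Lemma dpart_texp u n i s t : teval (dpart i (at_time (tdtexp u n.+1) s)) t =
  texp n (teval (at_time u s) t) * teval (dpart i (at_time u s)) t.
Proof.
apply: (@teval_dpart_eq R N i _ (fun t => texp n.+1 (teval (at_time u s) t))
  (fun t => texp n (teval (at_time u s) t) * teval (dpart i (at_time u s)) t)) => [t'|t' x].
  exact: at_time_texp.
exact: (@drv_comp R (texp n.+1) (fun y => teval (at_time u s) (upd i (\pi_C y) t')) x _ _
  (drv_texp n _) (drv_teval i (at_time u s) t' x)).
Qed.

Lemma dpart2_texp u n i s t : teval (dpart i (dpart i (at_time (tdtexp u n.+2) s))) t =
  texp n (teval (at_time u s) t) * teval (dpart i (at_time u s)) t ^+ 2 +
  texp n.+1 (teval (at_time u s) t) * teval (dpart i (dpart i (at_time u s))) t.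
Proof.
apply: (@teval_dpart_eq R N i _
  (fun t => texp n.+1 (teval (at_time u s) t) * teval (dpart i (at_time u s)) t)
  (fun t => texp n (teval (at_time u s) t) * teval (dpart i (at_time u s)) t ^+ 2 +
  texp n.+1 (teval (at_time u s) t) * teval (dpart i (dpart i (at_time u s))) t)) => [t'|t' x].
  exact: dpart_texp.
have h := drvM (@drv_comp R (texp n.+1) (fun y => teval (at_time u s) (upd i (\pi_C y) t')) x _ _
  (drv_texp n _) (drv_teval i (at_time u s) t' x)) (drv_teval i (dpart i (at_time u s)) t' x).
by apply: (drv_eq h); rewrite expr2 mulrA.
Qed.

Section curve.
Variables (P : R -> probability (N.-tuple C) R) (Lw : R -> freq -> R -> N.-tuple C -> R).
Hypothesis bLw : forall s k b, bm (Lw s k b).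

(** Stated for an abstract curve [P] with generator [Lw], since it serves for the particle law and
    for the tensor power of the mean-field law. *)
Lemma drv_esp_at_time u (s : R) : td_derivable u ->
  (forall k b, is_derive s 1 (fun y => esp (P y) (wave k b)) (esp (P s) (Lw s k b))) ->
  is_derive s 1 (fun y => esp (P y) (teval (at_time u y))) (esp (P s) (fun t =>
    teval (time_drv u s) t + \sum_(w <- at_time u s) w.1.1 * Lw s w.1.2 w.2 t)).
Proof.
move=> du dw; elim: u du => [_|w u IH /= [dw1 /IH du]].
  have -> : (fun y => esp (P y) (teval (at_time [::] y))) = (fun=> 0).
    apply/funext => y; transitivity (esp (P y) (fun=> 0 : R)); last exact: esp_cst.
    by apply: eq_esp => t; rewrite /teval big_nil.
  apply: (drv_eq (drv_cst (0 : R) s)).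
  transitivity (esp (P s) (fun=> 0 : R)); first by rewrite esp_cst.
  by apply: eq_esp => t; rewrite /teval !big_nil addr0.
have bt p : bm (teval p) := @bm_teval R N p.
have bw := @bm_wave R N w.1.2 w.2.
have -> : (fun y => esp (P y) (teval (at_time (w :: u) y))) =
    (fun y => w.1.1.1 y * esp (P y) (wave w.1.2 w.2) + esp (P y) (teval (at_time u y))).
  apply/funext => y; rewrite -espZ// -espD//; last exact: bmZ.
  by apply: eq_esp => t; rewrite /teval big_cons.
apply: (drv_eq (drvD (drvM (dw1 s) (dw w.1.2 w.2)) du)).
have bs : bm (fun t => \sum_(w0 <- at_time u s) w0.1.1 * Lw s w0.1.2 w0.2 t).
  by apply: bm_sum => w0; apply: bmZ.
rewrite -!espZ// -espD; [|exact: bmZ|exact: bmZ].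
rewrite -espD; [|by apply: bmD; exact: bmZ|exact: bmD].
by apply: eq_esp => t; rewrite /teval /= !big_cons/=; ring.
Qed.

Lemma cont_esp_at_time u s0 s1 : td_derivable u ->
  (forall k b, {within `[s0, s1], continuous (fun y => esp (P y) (wave k b))}) ->
  {within `[s0, s1], continuous (fun y => esp (P y) (teval (at_time u y)))}.
Proof.
move=> du cw; elim: u du => [_|w u IH /= [dw1 /IH cu]].
  have -> : (fun y => esp (P y) (teval (at_time [::] y))) = (fun=> 0).
    apply/funext => y; transitivity (esp (P y) (fun=> 0 : R)); last exact: esp_cst.
    by apply: eq_esp => t; rewrite /teval big_nil.
  by apply: continuous_subspaceT => x; exact: cst_continuous.
have bt p : bm (teval p) := @bm_teval R N p.
have bw := @bm_wave R N w.1.2 w.2.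
have -> : (fun y => esp (P y) (teval (at_time (w :: u) y))) =
    (fun y => w.1.1.1 y * esp (P y) (wave w.1.2 w.2) + esp (P y) (teval (at_time u y))).
  apply/funext => y; rewrite -espZ// -espD//; last exact: bmZ.
  by apply: eq_esp => t; rewrite /teval big_cons.
have c1 : {within `[s0, s1], continuous w.1.1.1}.
  by apply: continuous_subspaceT => x; exact: drv_cont (dw1 x).
by move=> x; apply: cvgD; [apply: cvgM; [exact: c1|exact: cw]|exact: cu].
Qed.

End curve.

Variables (J : R) (m : R -> probability C R).
Hypothesis mFP : mean_field_Fokker_Planck J m.

Lemma Lbar_dpart s (p : tpoly R N) t : \sum_(w <- p) w.1.1 * Lbarwave J m s w.1.2 w.2 t =
  \sum_i (teval (dpart i (dpart i p)) t - J * drift m s (tnth t i) * teval (dpart i p) t).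
Proof.
transitivity (\sum_(i < N) \sum_(w <- p) w.1.1 * (- (w.1.2 i)%:~R ^+ 2 * wave w.1.2 w.2 t
   - J * drift m s (tnth t i) * ((w.1.2 i)%:~R * wave w.1.2 (w.2 + pi / 2) t))).
  by rewrite exchange_big/=; apply: eq_bigr => w _; rewrite mulr_sumr.
apply: eq_bigr => i _; rewrite /teval !big_map/= mulr_sumr -sumrB; apply: eq_bigr => w _ /=.
rewrite [wave w.1.2 (w.2 + pi / 2 + pi / 2) t]/wave !addrA !cosDpihalf sinDpihalf -/(wave _ _ t).
by rewrite /wave !addrA cosDpihalf; ring.
Qed.

(** The chain rule of a diffusion: the first derivative of the truncated exponential multiplies the
    generator, the second one the squared gradient, with the index lowered by one and by two. *)
Lemma Lbar_texp u n s t : \sum_(w <- at_time (tdtexp u n.+2) s) w.1.1 * Lbarwave J m s w.1.2 w.2 t =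
  texp n.+1 (teval (at_time u s) t) * (\sum_(w <- at_time u s) w.1.1 * Lbarwave J m s w.1.2 w.2 t)
  + texp n (teval (at_time u s) t) * \sum_i teval (dpart i (at_time u s)) t ^+ 2.
Proof.
rewrite !Lbar_dpart !mulr_sumr -big_split/=; apply: eq_bigr => i _.
by rewrite dpart2_texp dpart_texp; ring.
Qed.

Lemma Lbar_Lgen s (p : tpoly R N) t : (0 < N)%N ->
  \sum_(w <- p) w.1.1 * Lbarwave J m s w.1.2 w.2 t =
  teval (Lgen J p) t + J * \sum_i drift_gap (m s) i t * teval (dpart i p) t.
Proof.
move=> N0; have n0 : N%:R != 0 :> R by rewrite pnatr_eq0 -lt0n.
have gapE i : drift_gap (m s) i t = N%:R^-1 * (\sum_(j < N) sin_diff (tnth t i) (tnth t j)) - drift m s (tnth t i).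
  have -> : \sum_(j < N) sin_diff (tnth t i) (tnth t j) =
    wave1 1 (- (pi / 2)) (tnth t i) * (\sum_(j < N) wave1 1 0 (tnth t j))
    - wave1 1 0 (tnth t i) * (\sum_(j < N) wave1 1 (- (pi / 2)) (tnth t j)).
    rewrite !mulr_sumr -sumrB; apply: eq_bigr => j _.
    by rewrite /sin_diff /wave1 !mul1r !addr0 !cosBpihalf sinB.
  rewrite /drift_gap /tsum !sumrB !sumr_const card_ord -[esp _ (wave1 1 0) *+ N]mulr_natl
    -[esp _ (wave1 1 (- (pi / 2))) *+ N]mulr_natl /drift /mean.
  by field.
rewrite teval_Lgen.
have -> : \sum_i drift_gap (m s) i t * teval (dpart i p) t =
    \sum_(w <- p) \sum_i drift_gap (m s) i t * (w.1.1 * (w.1.2 i)%:~R * wave w.1.2 (w.2 + pi / 2) t).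
  rewrite exchange_big/=; apply: eq_bigr => i _; rewrite /teval big_map mulr_sumr.
  by apply: eq_bigr.
rewrite mulr_sumr -big_split/=; apply: eq_bigr => w _.
rewrite /Lbarwave /Lwave !mulr_sumr -big_split/=; apply: eq_bigr => i _.
by rewrite gapE; ring.
Qed.

Lemma drv_esp_texp u n (s : R) : (0 < N)%N -> td_derivable u -> 0 < s ->
  is_derive s 1 (fun y => esp (tensor_power (m y) N) (fun t => texp n.+2 (teval (at_time u y) t)))
   (esp (tensor_power (m s) N) (fun t => texp n.+1 (teval (at_time u s) t) *
      (teval (time_drv u s) t + teval (Lgen J (at_time u s)) t
        + J * \sum_i drift_gap (m s) i t * teval (dpart i (at_time u s)) t)
     + texp n (teval (at_time u s) t) * \sum_i teval (dpart i (at_time u s)) t ^+ 2)).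
Proof.
move=> N0 du s0.
have h := drv_esp_at_time (P := fun y => tensor_power (m y) N) (fun s k b => bm_Lbarwave J m s k b)
  (td_derivable_texp n.+2 du) (fun k b => tensor_wave_derive mFP k b s0).
have e : (fun y => esp (tensor_power (m y) N) (teval (at_time (tdtexp u n.+2) y))) =
  (fun y => esp (tensor_power (m y) N) (fun t => texp n.+2 (teval (at_time u y) t))).
  by apply/funext => y; apply: eq_esp => t; exact: at_time_texp.
rewrite e in h; apply: (drv_eq h); apply: eq_esp => t.
by rewrite time_drv_texp// Lbar_texp Lbar_Lgen//; ring.
Qed.

End time_dependent.

(** Here [Z] is a normalising constant, [D] its formal time derivative, and [Zn], [Dn] come from
    truncated exponentials. All errors are relative to [Z], so that the final one is proportional to
    [delta]. *)
Lemma ln_quotient_estimate (R : realType) (r Z D Zn Dn delta K : R) : 0 < Z -> 0 <= delta ->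
  delta <= 1 / 2 -> 0 <= K -> `|Zn - Z| <= delta * Z -> `|D| <= K * Z -> `|Dn - D| <= delta * K * Z ->
  [/\ 0 < Zn, ln Z - 2 * delta <= ln Zn, ln Zn <= ln Z + delta &
   r * ln Z + D / Z - delta * (2 * `|r| + 4 * K) <= r * ln Zn + Dn / Zn].
Proof.
move=> Z0 d0 d12 K0 hZ hD hDn.
have [h1 h2] : Z - delta * Z <= Zn /\ Zn <= Z + delta * Z.
  by move: hZ; rewrite ler_norml => /andP[? ?]; split; lra.
have Zn_half : Z / 2 <= Zn by nra.
have Zn0 : 0 < Zn by apply: lt_le_trans Zn_half; rewrite divr_gt0.
have lnq (x y : R) : 0 < x -> 0 < y -> ln x - ln y <= (x - y) / y.
  move=> x0 y0; have := expR_ge1Dx ((x - y) / y - (ln x - ln y)).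
  have := expR_ge1Dx (ln x - ln y); rewrite expRB !lnK ?posrE// => h _.
  have -> : (x - y) / y = x / y - 1 by field; rewrite gt_eqF.
  lra.
have l2 : ln Zn <= ln Z + delta.
  have := lnq _ _ Zn0 Z0.
  have : (Zn - Z) / Z <= delta by rewrite ler_pdivrMr//; lra.
  lra.
have l1 : ln Z - 2 * delta <= ln Zn.
  have := lnq _ _ Z0 Zn0.
  have : (Z - Zn) / Zn <= 2 * delta by rewrite ler_pdivrMr//; nra.
  lra.
split=> //.
have hr : - (2 * delta * `|r|) <= r * (ln Zn - ln Z).
  have : `|r * (ln Zn - ln Z)| <= `|r| * (2 * delta).
    by rewrite normrM ler_wpM2l// ler_norml; apply/andP; split; lra.
  by rewrite ler_norml => /andP[? _]; lra.
have hq : - (4 * delta * K) <= Dn / Zn - D / Z.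
  have -> : Dn / Zn - D / Z = ((Dn - D) * Z - D * (Zn - Z)) / (Zn * Z).
    by field; rewrite !gt_eqF.
  have ZZ : 0 < Zn * Z by exact: mulr_gt0.
  rewrite ler_pdivlMr//.
  have : `|(Dn - D) * Z - D * (Zn - Z)| <= 2 * (delta * K * Z * Z).
    rewrite (le_trans (ler_normB _ _))// !normrM (gtr0_norm Z0).
    have e1 : `|Dn - D| * Z <= delta * K * Z * Z by rewrite ler_wpM2r// ltW.
    have e2 : `|D| * `|Zn - Z| <= K * Z * (delta * Z) by rewrite ler_pM.
    have -> : 2 * (delta * K * Z * Z) = delta * K * Z * Z + K * Z * (delta * Z) by ring.
    exact: lerD.
  rewrite ler_norml => /andP[h3 _]; apply: le_trans h3.
  have dK : 0 <= delta * K * Z by rewrite !mulr_ge0// ltW.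
  have := ler_wpM2l dK Zn_half.
  have -> : - (4 * delta * K) * (Zn * Z) = - (4 * (delta * K * Z * Zn)) by ring.
  have -> : delta * K * Z * (Z / 2) = delta * K * Z * Z / 2 by ring.
  move: (delta * K * Z * Z) (delta * K * Z * Zn) => u v; lra.
have -> : r * ln Zn = r * ln Z + r * (ln Zn - ln Z) by ring.
move: (r * ln Z) (r * (ln Zn - ln Z)) (Dn / Zn) (D / Z) hr hq => a b x y.
have -> : delta * (2 * `|r| + 4 * K) = 2 * delta * `|r| + 4 * delta * K by ring.
move: (2 * delta * `|r|) (4 * delta * K) => u v; lra.
Qed.

Section flow.
Variables (R : realType) (N : nat) (J : R).
Local Notation C := (circle R).
Local Notation freq := {ffun 'I_N -> int}.
Local Notation tdterm := ((R -> R) * (R -> R) * freq * R)%type.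
Implicit Types (u v : seq tdterm) (t : N.-tuple C).
Variables (mN : R -> probability (N.-tuple C) R) (m : R -> probability C R).
Hypotheses (J0 : 0 < J) (N0 : (0 < N)%N).
Hypotheses (mNFP : particle_Fokker_Planck J mN) (mFP : mean_field_Fokker_Planck J m).

Lemma td_bound u s0 s1 : s0 <= s1 -> td_derivable u -> exists B, 0 <= B /\
  forall s, s0 <= s <= s1 -> \sum_(w <- u) `|w.1.1.1 s| * (1 + (l1 w.1.2)%:R) <= B.
Proof.
move=> s01; elim: u => [_|w u IH /= [dw /IH[B [B0 hB]]]].
  by exists 0; split=> // s _; rewrite big_nil.
have cf : {within `[s0, s1], continuous (fun s => `|w.1.1.1 s|)}.
  by apply: continuous_subspaceT => x; apply: cvg_norm; exact: drv_cont (dw x).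
have [c _ hc] := EVT_max s01 cf.
exists (`|w.1.1.1 c| * (1 + (l1 w.1.2)%:R) + B); split.
  by rewrite addr_ge0// mulr_ge0// addr_ge0.
move=> s ss; rewrite big_cons lerD ?hB// ler_wpM2r ?addr_ge0//.
by apply: hc; rewrite in_itv.
Qed.

Lemma teval_td_le u s t B : \sum_(w <- u) `|w.1.1.1 s| * (1 + (l1 w.1.2)%:R) <= B ->
  `|teval (at_time u s) t| <= B.
Proof.
move=> hB; apply: le_trans hB; rewrite /teval big_map (le_trans (ler_norm_sum _ _ _))//.
apply: ler_sum => w _ /=; rewrite normrM ler_wpM2l// (le_trans (cos_max _))//.
by rewrite lerDl.
Qed.

Lemma teval_dpart_td_le u i s t B : \sum_(w <- u) `|w.1.1.1 s| * (1 + (l1 w.1.2)%:R) <= B ->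
  `|teval (dpart i (at_time u s)) t| <= B.
Proof.
move=> hB; apply: le_trans hB.
rewrite /teval big_map big_map (le_trans (ler_norm_sum _ _ _))//.
apply: ler_sum => w _ /=; rewrite !normrM -mulrA ler_wpM2l//.
apply: (@le_trans _ _ (`|(w.1.2 i)%:~R : R|)); first by rewrite ler_piMr// cos_max.
rewrite l1_real (bigD1 i)//=; set x := \sum_(_ | _) _.
have : 0 <= x by rewrite sumr_ge0.
lra.
Qed.

Lemma drift_gap_le s i t : `|drift_gap (m s) i t| <= 4.
Proof.
have n0 : 0 < N%:R :> R by rewrite ltr0n.
have w1 b x : `|wave1 1 b x| <= 1 :> R by exact: cos_max.
have ts b : `|tsum (fun x => wave1 1 b x - esp (m s) (wave1 1 b)) t| <= 2 * N%:R.
  rewrite /tsum (le_trans (ler_norm_sum _ _ _))//.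
  apply: (@le_trans _ _ (\sum_(j < N) (2 : R))).
    apply: ler_sum => j _; rewrite (le_trans (ler_normB _ _))//.
    have := w1 b (tnth t j); have := @mean_bound _ m s 1 b; rewrite /mean; lra.
  by rewrite sumr_const card_ord mulr_natr.
rewrite /drift_gap normrM (ger0_norm (_ : 0 <= N%:R^-1)) ?invr_ge0// mulrC ler_pdivrMr//.
rewrite (le_trans (ler_normB _ _))//.
have -> : 4 * N%:R = 1 * (2 * N%:R) + 1 * (2 * N%:R) :> R by ring.
by rewrite !normrM lerD// ler_pM.
Qed.

Theorem flow (r c X s0 s1 : R) (phi : tpoly R N) : r != 0 -> 0 <= s0 -> s0 <= s1 ->
  (forall s, s0 < s < s1 -> modified_log_sobolev J (m s) N r c) ->
  (forall psi : N.-tuple C -> R, bm psi ->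
    esp (mN s0) psi - ln (esp (tensor_power (m s0) N) (fun t => expR (psi t))) <= X) ->
  esp (mN s1) (teval phi) - ln (esp (tensor_power (m s1) N) (fun t => expR (teval phi t))) <=
  expR (- r * (s1 - s0)) * X + c / r * (1 - expR (- r * (s1 - s0))).
Proof.
move=> r0 s00 s01 FI HX; apply/ler_addgt0Pr => eps eps0.
set S := s1 - s0; have S0 : 0 <= S by rewrite subr_ge0.
pose alpha s := expR (r * (s1 - s)); pose beta s := expR (- r * (s1 - s)).
set A := expR (`|r| * S).
have A1 : 1 <= A by rewrite -expR0 ler_expR mulr_ge0.
have A0 : 0 < A by exact: expR_gt0.
have ab s : alpha s * beta s = 1 by rewrite -expRD -expR0; congr expR; ring.
have alpha0 s : 0 < alpha s by exact: expR_gt0.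
have beta0 s : 0 < beta s by exact: expR_gt0.
have rS s : s0 <= s <= s1 -> `|r * (s1 - s)| <= `|r| * S.
  by move=> /andP[h1 h2]; rewrite normrM ler_wpM2l// ger0_norm ?subr_ge0// lerD2l lerN2.
have alphaA s : s0 <= s <= s1 -> alpha s <= A.
  by move=> ss; rewrite ler_expR (le_trans (ler_norm _))// rS.
have betaA s : s0 <= s <= s1 -> beta s <= A.
  by move=> ss; rewrite ler_expR mulNr (le_trans (ler_norm _))// normrN rS.
have dalpha (s : R) : is_derive s 1 alpha (- r * alpha s).
  apply: (drv_eq (drv_exp (drvZ r (drvB (drv_cst s1 s) (drv_id s))))).
  by rewrite /alpha; ring.
have dbeta (s : R) : is_derive s 1 beta (r * beta s).
  apply: (drv_eq (drv_exp (drvZ (- r) (drvB (drv_cst s1 s) (drv_id s))))).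
  by rewrite /beta; ring.
(* Half of [eps] is spent on the error of the backward solution, which acts during a time [S] with a
   factor at most [1 + A ^+ 2]; [1 + S] replaces [S], which may vanish. *)
set e := eps / (2 * (1 + A ^+ 2) * (1 + S)).
have S1 : 0 < 1 + S by rewrite ltr_pwDl.
have A2 : 0 < 1 + A ^+ 2 by rewrite ltr_pwDl// sqr_ge0.
have e0 : 0 < e by rewrite divr_gt0// !mulr_gt0.
have [u [du uphi uerr]] := galerkin J0 N0 phi s01 e0.
pose v := tdscale alpha (fun s => - r * alpha s) u.
have dv : td_derivable v by exact: td_derivable_scale.
have [B [B0 hB]] := td_bound s01 dv.
set C1 := `|r| * B + A * e + J * (N%:R * (4 * B)); set C2 := N%:R * B ^+ 2.
set K := C1 + C2.
have C10 : 0 <= C1.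
  apply: addr_ge0; first by apply: addr_ge0; apply: mulr_ge0 => //; exact: ltW.
  by apply: mulr_ge0; [exact: ltW|apply: mulr_ge0 => //; exact: mulr_ge0].
have C20 : 0 <= C2 by rewrite mulr_ge0// sqr_ge0.
have K0 : 0 <= K by exact: addr_ge0.
set kap := 2 * `|r| + 4 * K.
have kap0 : 0 <= kap by rewrite addr_ge0// mulr_ge0.
set q := A * kap * S + 2 * A + 1.
have q0 : 0 < q.
  apply: ltr_wpDl => //; apply: addr_ge0; last by apply: mulr_ge0 => //; exact: ltW.
  by apply: mulr_ge0 => //; apply: mulr_ge0 => //; exact: ltW.
(* The other half goes to the truncation of the exponential: [q] collects its effect on the
   derivative, [A * kap * S], and at the two end points, [2 * A + 1]. The denominator also ensures
   [delta <= 1 / 2]. *)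
set delta := eps / (2 * q + 2 * eps).
have qe : 0 < 2 * q + 2 * eps by lra.
have d0 : 0 < delta by exact: divr_gt0.
have d12 : delta <= 1 / 2 by rewrite ler_pdivrMr//; lra.
have dq : delta * q <= eps / 2.
  rewrite /delta mulrAC ler_pdivrMr//; have := eps0; have := q0; nra.
(* As [V] is bounded by [B], this absolute tolerance is a relative error [delta] on the
   exponential. *)
have tol0 : 0 < delta * expR (- B) by rewrite mulr_gt0// expR_gt0.
have [n hn] := texp_uniform B tol0.
pose V s := teval (at_time v s).
have bV s : bm (V s) by exact: bm_teval.
have Vle s t : s0 <= s <= s1 -> `|V s t| <= B by move=> ss; apply: teval_td_le; exact: hB.
have Fl s t : s0 <= s <= s1 -> expR (- B) <= expR (V s t).
  by move=> ss; rewrite ler_expR; have := Vle s t ss; rewrite ler_norml => /andP[].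
have close n' s t : (n <= n')%N -> s0 <= s <= s1 -> `|texp n' (V s t) - expR (V s t)| <= delta * expR (V s t).
  move=> nn ss; apply: (le_trans (hn n' (V s t) nn (Vle s t ss))).
  by rewrite ler_wpM2l ?(ltW d0)// Fl.
pose P s := tensor_power (m s) N.
pose Sg s t := teval (time_drv v s) t + teval (Lgen J (at_time v s)) t
        + J * \sum_i drift_gap (m s) i t * teval (dpart i (at_time v s)) t.
pose G2 s t := \sum_i teval (dpart i (at_time v s)) t ^+ 2.
pose Er s t := teval (time_drv u s) t + teval (Lgen J (at_time u s)) t.
pose KD s t := \sum_i drift_gap (m s) i t * teval (dpart i (at_time v s)) t.
have bco b : bm (@wave1 R 1 b) by exact: bm_wave1.
have bgap s i : bm (drift_gap (N := N) (m s) i).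
  apply: bmZ; apply: bmB; apply: bmM; try exact: bm_tnth;
    by apply: bm_tsum; apply: bmB => //; exact: bm_cst.
have bKD s : bm (KD s) by apply: bm_sum => i; apply: bmM => //; exact: bm_teval.
have bG2 s : bm (G2 s) by apply: bm_sum => i; apply: bmX; exact: bm_teval.
have bEr s : bm (Er s) by apply: bmD; exact: bm_teval.
have bSg s : bm (Sg s) by apply: bmD; [apply: bmD; exact: bm_teval|apply: bmZ; exact: bKD].
have VE s t : V s t = alpha s * teval (at_time u s) t by exact: at_time_scale.
have SgE s t : Sg s t = - r * V s t + alpha s * Er s t + J * KD s t.
  rewrite /Sg -/(KD s t) time_drv_scale VE /Er !teval_Lgen; congr (_ + _).
  have -> : \sum_(w <- at_time v s) w.1.1 * Lwave J w.1.2 w.2 t =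
      alpha s * \sum_(w <- at_time u s) w.1.1 * Lwave J w.1.2 w.2 t.
    rewrite /at_time /v /tdscale -map_comp !big_map mulr_sumr.
    by apply: eq_bigr => w _; rewrite /= mulrA.
  ring.
have KDle s t : s0 <= s <= s1 -> `|KD s t| <= N%:R * (4 * B).
  move=> ss; rewrite /KD (le_trans (ler_norm_sum _ _ _))//.
  apply: (@le_trans _ _ (\sum_(i < N) 4 * B)).
    apply: ler_sum => i _; rewrite normrM ler_pM ?drift_gap_le//.
    by apply: teval_dpart_td_le; exact: hB.
  by rewrite sumr_const card_ord -[leLHS]mulr_natl.
have Erle s t : s0 <= s <= s1 -> `|Er s t| <= e by exact: uerr.
have Sgle s t : s0 <= s <= s1 -> `|Sg s t| <= C1.
  move=> ss; rewrite SgE (le_trans (ler_normD _ _))// lerD//; last first.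
    by rewrite normrM gtr0_norm// ler_pM2l// KDle.
  rewrite (le_trans (ler_normD _ _))// lerD//.
    by rewrite normrM normrN ler_wpM2l// Vle.
  by rewrite normrM gtr0_norm// ler_pM ?(ltW (alpha0 s)) ?alphaA ?Erle.
have G2le s t : s0 <= s <= s1 -> `|G2 s t| <= C2.
  move=> ss; rewrite /G2 (le_trans (ler_norm_sum _ _ _))//.
  apply: (@le_trans _ _ (\sum_(i < N) B ^+ 2)).
    apply: ler_sum => i _; rewrite normrX lerXn2r ?nnegrE//.
    by apply: teval_dpart_td_le; exact: hB.
  by rewrite sumr_const card_ord -[leLHS]mulr_natl.
(* [Z] is the constant in the functional inequality, while [Zn], built on trigonometric polynomials,
   can be differentiated through the equation, with derivative [Dn]. *)
pose Z s := esp (P s) (fun t => expR (V s t)).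
pose Zn s := esp (P s) (fun t => texp n.+2 (V s t)).
pose D s := esp (P s) (fun t => expR (V s t) * Sg s t + expR (V s t) * G2 s t).
pose Dn s := esp (P s) (fun t => texp n.+1 (V s t) * Sg s t + texp n (V s t) * G2 s t).
have bF s : bm (fun t => expR (V s t)) by exact: bm_exp.
have bT k s : bm (fun t => texp k (V s t)) by exact: bm_texp.
have Z0 s : s0 <= s <= s1 -> 0 < Z s.
  by move=> ss; apply: (@esp_gt0 _ _ _ (P s) _ (expR (- B)) (expR_gt0 _)) => // t; exact: Fl.
have hZ s : s0 <= s <= s1 -> `|Zn s - Z s| <= delta * Z s.
  move=> ss; rewrite -espZ// -espB//.
  have b1 : bm (fun t => texp n.+2 (V s t) - expR (V s t)) by exact: bmB.
  have b2 := bmZ delta (bF s).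
  have cl t := close n.+2 s t (leq_trans (leqnSn _) (leqnSn _)) ss.
  rewrite ler_norml; apply/andP; split; last by apply: le_esp => // t; have := cl t; rewrite ler_norml => /andP[].
  rewrite -espN//; apply: le_esp => // [|t]; first exact: bmN.
  by have := cl t; rewrite ler_norml => /andP[].
have hD s : s0 <= s <= s1 -> `|D s| <= K * Z s.
  move=> ss.
  have b1 : bm (fun t => expR (V s t) * Sg s t + expR (V s t) * G2 s t) by apply: bmD; exact: bmM.
  have b2 := bmZ K (bF s).
  have cl t : `|expR (V s t) * Sg s t + expR (V s t) * G2 s t| <= K * expR (V s t).
    rewrite -mulrDr normrM ger0_norm ?expR_ge0// mulrC ler_wpM2r ?expR_ge0//.
    by rewrite (le_trans (ler_normD _ _))// lerD ?Sgle ?G2le.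
  rewrite -espZ// ler_norml; apply/andP; split; last by apply: le_esp => // t; have := cl t; rewrite ler_norml => /andP[].
  rewrite -espN//; apply: le_esp => // [|t]; first exact: bmN.
  by have := cl t; rewrite ler_norml => /andP[].
have hDn s : s0 <= s <= s1 -> `|Dn s - D s| <= delta * K * Z s.
  move=> ss.
  have b1 : bm (fun t => expR (V s t) * Sg s t + expR (V s t) * G2 s t) by apply: bmD; exact: bmM.
  have b3 : bm (fun t => texp n.+1 (V s t) * Sg s t + texp n (V s t) * G2 s t) by apply: bmD; exact: bmM.
  have b2 := bmZ (delta * K) (bF s).
  have b4 := bmB b3 b1.
  have cl t : `|(texp n.+1 (V s t) * Sg s t + texp n (V s t) * G2 s t)
      - (expR (V s t) * Sg s t + expR (V s t) * G2 s t)| <= delta * K * expR (V s t).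
    have c1 := close n.+1 s t (leqnSn _) ss; have c2 := close n s t (leqnn _) ss.
    have -> : (texp n.+1 (V s t) * Sg s t + texp n (V s t) * G2 s t)
      - (expR (V s t) * Sg s t + expR (V s t) * G2 s t) =
      (texp n.+1 (V s t) - expR (V s t)) * Sg s t + (texp n (V s t) - expR (V s t)) * G2 s t by ring.
    have -> : delta * K * expR (V s t) = delta * expR (V s t) * C1 + delta * expR (V s t) * C2.
      by rewrite /K; ring.
    by rewrite (le_trans (ler_normD _ _))// lerD// normrM ler_pM ?Sgle ?G2le.
  rewrite -espB// -espZ// ler_norml; apply/andP; split; last by apply: le_esp => // t; have := cl t; rewrite ler_norml => /andP[].
  rewrite -espN//; apply: le_esp => // [|t]; first exact: bmN.
  by have := cl t; rewrite ler_norml => /andP[].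
have est s (ss : s0 <= s <= s1) := ln_quotient_estimate r (Z0 s ss) (ltW d0) d12 K0 (hZ s ss) (hD s ss) (hDn s ss).
(* The scaling of [v] contributes [- r] times the mean of [expR V * V] to [D]; added to
   [r * Z * ln Z] this is [- r] times the entropy. What remains is exactly the modified inequality,
   up to the error of the backward solution. *)
have key s : s0 < s < s1 -> - (c + A * e) <= r * ln (Z s) + D s / Z s.
  move=> ss; have ss' : s0 <= s <= s1 by move: ss => /andP[/ltW -> /ltW ->].
  have zp := Z0 s ss'; have fi := FI s ss (at_time v s).
  rewrite -/(V s) in fi.
  have entE : ent (P s) (fun t => expR (V s t)) = esp (P s) (fun t => expR (V s t) * V s t) - Z s * ln (Z s).
    by rewrite /ent -/(Z s); congr (_ - _); apply: eq_esp => t; rewrite expRK.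
  rewrite -/(P s) entE -/(Z s) in fi.
  have bFV : bm (fun t => expR (V s t) * V s t) by exact: bmM.
  have bFE : bm (fun t => expR (V s t) * Er s t) by exact: bmM.
  have bFK : bm (fun t => expR (V s t) * KD s t) by exact: bmM.
  have bFG : bm (fun t => expR (V s t) * G2 s t) by exact: bmM.
  have DE : D s = - r * esp (P s) (fun t => expR (V s t) * V s t) +
     alpha s * esp (P s) (fun t => expR (V s t) * Er s t) + J * esp (P s) (fun t => expR (V s t) * KD s t)
     + esp (P s) (fun t => expR (V s t) * G2 s t).
    rewrite -!espZ// -espD; [|exact: bmZ|exact: bmZ].
    rewrite -espD; [|by apply: bmD; exact: bmZ|exact: bmZ].
    rewrite -espD//; last by apply: bmD; [apply: bmD; exact: bmZ|exact: bmZ].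
    by apply: eq_esp => t; rewrite SgE; ring.
  have errE : - (A * e * Z s) <= alpha s * esp (P s) (fun t => expR (V s t) * Er s t).
    rewrite -!espZ// -espN; last exact: bmZ.
    apply: le_esp => [||t]; [by apply: bmN; exact: bmZ|exact: bmZ|].
    have h1 : `|alpha s * Er s t| <= A * e.
      by rewrite normrM gtr0_norm// ler_pM ?(ltW (alpha0 s)) ?alphaA ?Erle.
    move: h1; rewrite ler_norml => /andP[h1 _].
    rewrite [leLHS](_ : _ = expR (V s t) * - (A * e)); last by ring.
    rewrite [leRHS](_ : _ = expR (V s t) * (alpha s * Er s t)); last by ring.
    by rewrite ler_wpM2l// expR_ge0.
  have hh : - (c + A * e) * Z s <= r * ln (Z s) * Z s + D s.
    rewrite DE; move: fi; rewrite -/(G2 s) -/(KD s).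
    rewrite -[esp (P s) (fun t => expR (V s t) * \sum_i teval (dpart i (at_time v s)) t ^+ 2)]/(esp (P s) (fun t => expR (V s t) * G2 s t)).
    rewrite -[esp (P s) (fun t => expR (V s t) * \sum_i drift_gap (m s) i t * teval (dpart i (at_time v s)) t)]/(esp (P s) (fun t => expR (V s t) * KD s t)).
    move: errE.
    set x := esp (P s) (fun t => expR (V s t) * V s t).
    set z := J * esp (P s) (fun t => expR (V s t) * KD s t).
    set w := esp (P s) (fun t => expR (V s t) * G2 s t).
    set y := alpha s * _.
    rewrite mulrBr => h1 h2.
    have -> : - (c + A * e) * Z s = - (c * Z s) - A * e * Z s by ring.
    have -> : r * ln (Z s) * Z s = r * (Z s * ln (Z s)) by ring.
    rewrite mulNr; move: h1 h2; move: (r * x) (r * (Z s * ln (Z s))) (c * Z s) (A * e * Z s) y z w => a1 a2 a3 a4 a5 a6 a7; lra.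
  have -> : r * ln (Z s) + D s / Z s = (r * ln (Z s) * Z s + D s) / Z s by field; rewrite gt_eqF.
  by rewrite ler_pdivlMr.
set eta := e + A * (A * e + delta * kap).
pose U s := esp (mN s) (teval (at_time u s)).
(* The opposite of the functional, with two compensators: the derivative [c * beta] of
   [c / r * beta] offsets the constant of the inequality and produces the last term of the theorem,
   and [eta * s] offsets the approximation errors. *)
pose Psi s := c / r * beta s + eta * s - (U s - beta s * ln (Zn s)).
pose dPsi s := c * beta s + eta - (esp (mN s) (Er s) - (r * beta s * ln (Zn s) + beta s * (Dn s / Zn s))).
(* Differentiation is done on the open interval and continuity reaches its ends, because [s0 = 0] is
   allowed and the equations hold at positive times. *)
have mono : Psi s0 <= Psi s1.
  apply: (derive_nondecreasing s01 (df := dPsi)) => [s ss||s ss].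
  - have ss' : s0 <= s <= s1 by move: ss => /andP[/ltW -> /ltW ->].
    have sp : 0 < s by move: ss => /andP[h _]; exact: le_lt_trans s00 h.
    have [zn0 _ _ _] := est s ss'.
    have dU : is_derive s 1 U (esp (mN s) (Er s)).
      have bLw (s' : R) k b : bm (Lwave J k b : N.-tuple C -> R).
        have -> : Lwave J k b = (fun t => teval (Lterm J (1, k, b)) t) by apply/funext => t; rewrite teval_Lterm mul1r.
        exact: (bm_teval (Lterm J (1, k, b))).
      have dw k b := particle_wave_derive mNFP k b sp.
      have h := @drv_esp_at_time R N mN (fun _ => @Lwave R N J) bLw u s du dw.
      apply: (drv_eq h).
      by apply: eq_esp => t; rewrite /Er teval_Lgen.
    have dZn : is_derive s 1 Zn (Dn s).
      exact (drv_esp_texp mFP n N0 dv sp).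
    have h := drvB (drvD (drvZ (c / r) (dbeta s)) (drvZ eta (drv_id s)))
      (drvB dU (drvM (dbeta s) (@drv_ln R Zn s _ zn0 dZn))).
    apply: (drv_eq h); rewrite /dPsi mulr1.
    by field; rewrite r0 gt_eqF.
  - have cU : {within `[s0, s1], continuous U}.
      apply: cont_esp_at_time => // k b.
      have sub : `[s0, s1] `<=` `[0, +oo[.
        by move=> x /=; rewrite !in_itv/= andbT => /andP[x0 _]; rewrite (le_trans s00 x0).
      have h0 := @particle_wave_cont R N J mN mNFP k b.
      exact (continuous_subspaceW sub h0).
    have cZn : {within `[s0, s1], continuous Zn}.
      have -> : Zn = (fun y => esp (tensor_power (m y) N) (teval (at_time (tdtexp v n.+2) y))).
        by apply/funext => y; apply: eq_esp => t; rewrite at_time_texp.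
      apply: (@cont_esp_at_time R N (fun y => tensor_power (m y) N)) => [|k b]; first exact: td_derivable_texp.
      exact: tensor_wave_cont mFP _ _ _ _ _ s00.
    have cb : {within `[s0, s1], continuous beta}.
      by apply: continuous_subspaceT => x; exact: drv_cont (dbeta x).
    have cid : {within `[s0, s1], continuous (fun s : R => s)}.
      by apply: continuous_subspaceT => x; exact: cvg_id.
    have cln : {within `[s0, s1], continuous (fun s => ln (Zn s))}.
      apply/subspace_continuousP => s /=; rewrite in_itv/= => ss.
      have [zn0 _ _ _] := est s ss.
      have /subspace_continuousP/(_ s) h := cZn.
      have {}h := h ltac:(by rewrite /= in_itv).
      apply: (cvg_comp _ _ h); exact: continuous_ln.
    move=> x; apply: cvgB.
      apply: cvgD; first by apply: cvgM; [exact: cvg_cst|exact: cb].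
      by apply: cvgM; [exact: cvg_cst|exact: cid].
    by apply: cvgB; [exact: cU|apply: cvgM; [exact: cb|exact: cln]].
  - have ss' : s0 <= s <= s1 by move: ss => /andP[/ltW -> /ltW ->].
    have [_ _ _ h1] := est s ss'; have h2 := key s ss; have h3 := betaA s ss'.
    have h4 : esp (mN s) (Er s) <= e.
      by apply: esp_le => // t; have := Erle s t ss'; rewrite ler_norml => /andP[].
    have h5 : - (c + A * e) - delta * kap <= r * ln (Zn s) + Dn s / Zn s by apply: le_trans h1; rewrite lerD2r.
    have h6 := ler_wpM2l (ltW (beta0 s)) h5.
    have h7 : beta s * (A * e + delta * kap) <= A * (A * e + delta * kap).
      rewrite ler_wpM2r//.
      by apply: addr_ge0; apply: mulr_ge0 => //; exact: ltW.
    rewrite /dPsi /eta.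
    have -> : r * beta s * ln (Zn s) + beta s * (Dn s / Zn s) = beta s * (r * ln (Zn s) + Dn s / Zn s) by ring.
    have e7 : beta s * (- (c + A * e) - delta * kap) = - (c * beta s) - beta s * (A * e + delta * kap) by ring.
    rewrite e7 in h6; move: h4 h6 h7.
    move: (beta s * (r * ln (Zn s) + Dn s / Zn s)) (beta s * (A * e + delta * kap)) (A * (A * e + delta * kap)) (c * beta s) (esp (mN s) (Er s)) => *; lra.
have s0I : s0 <= s0 <= s1 by rewrite lexx.
have s1I : s0 <= s1 <= s1 by rewrite s01 lexx.
have [_ l0 _ _] := est s0 s0I; have [_ _ l1 _] := est s1 s1I.
have a1 : alpha s1 = 1 by rewrite /alpha subrr mulr0 expR0.
have b1 : beta s1 = 1 by rewrite /beta subrr mulr0 expR0.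
have U1 : U s1 = esp (mN s1) (teval phi) by apply: eq_esp => t; exact: uphi.
have Z1 : Z s1 = esp (tensor_power (m s1) N) (fun t => expR (teval phi t)).
  by apply: eq_esp => t; rewrite VE a1 mul1r uphi.
have hX := HX (V s0) (bV s0); rewrite -/(P s0) -/(Z s0) in hX.
(* At the initial time [u] is [beta s0] times [V s0]; multiplying the entropy bound for [V s0] by
   [beta s0 = expR (- r * S)] gives the contraction factor in front of [X]. *)
have UV : U s0 = beta s0 * esp (mN s0) (V s0).
  rewrite -espZ//; apply: eq_esp => t; rewrite VE mulrA [beta s0 * _]mulrC ab mul1r//.
rewrite -Z1 -U1; move: mono; rewrite /Psi b1 UV -/(beta s0).
have hb := betaA s0 s0I; have bb := beta0 s0.
have hX2 := ler_wpM2l (ltW bb) hX.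
have hl := ler_wpM2l (ltW bb) l0.
have hd : beta s0 * (2 * delta) <= A * (2 * delta) by rewrite ler_wpM2r// mulr_ge0// ltW.
have he : eta * S + 2 * A * delta + delta <= eps.
  have -> : eta * S + 2 * A * delta + delta = e * (1 + A ^+ 2) * S + delta * q by rewrite /eta /q; ring.
  have : e * (1 + A ^+ 2) * S <= eps / 2.
    have -> : eps / 2 = e * (1 + A ^+ 2) * (1 + S) by rewrite /e; field; rewrite !gt_eqF.
    by apply: ler_wpM2l; [apply: mulr_ge0; exact: ltW|rewrite lerDr].
  by move: dq; lra.
have hS : eta * s1 = eta * s0 + eta * S by rewrite /S; ring.
rewrite hS.
move: hX2 hl hd he l1.
move: (esp (mN s0) (V s0)) (ln (Z s0)) (ln (Zn s0)) (U s1) (ln (Zn s1)) (ln (Z s1)) => x1 x2 x3 x4 x5 x6.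
rewrite !mul1r !mulr1 !mulrBr.
move: (beta s0) (c / r) (eta * S) (eta * s0) => b k y z hX2 hl hd he l1 mono; lra.
Qed.

End flow.

(** * Propagation of chaos *)

(** Both terms of the functional are continuous under bounded pointwise convergence, so that the
    monotone class theorem applies. *)
Lemma donsker_varadhan_closed (R : realType) (N : nat) (nu mu : probability (N.-tuple (circle R)) R) (B : R) :
  (forall p : tpoly R N, esp nu (teval p) - ln (esp mu (fun t => expR (teval p t))) <= B) ->
  forall f, bm f -> esp nu f - ln (esp mu (fun t => expR (f t))) <= B.
Proof.
move=> hp; suff h f : bm f -> bm f /\ esp nu f - ln (esp mu (fun t => expR (f t))) <= B.
  by move=> f /h [].
apply: (tpoly_bounded_closed (D := fun f => bm f /\ esp nu f - ln (esp mu (fun t => expR (f t))) <= B)).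
  by move=> p; split; [exact: bm_teval|exact: hp].
move=> F {}f M DF FM Ff; have bf : bm f by apply: (bm_lim _ FM Ff) => n; have [[]] := DF n.
split=> //.
have c1 : esp nu (F n) @[n --> \oo] --> esp nu f.
  by apply: (esp_cvg _ FM Ff) => n; have [[]] := DF n.
have c2 : esp mu (fun t => expR (F n t)) @[n --> \oo] --> esp mu (fun t => expR (f t)).
  apply: (@esp_cvg _ _ _ mu (fun n t => expR (F n t)) _ (expR M)) => [n|n x|x].
  - by have [/bm_exp[]] := DF n.
  - by rewrite ger0_norm ?expR_ge0// ler_expR (le_trans (ler_norm _)).
  - apply: (cvg_comp _ _ (Ff x)); exact: continuous_expR.
have e0 : 0 < esp mu (fun t => expR (f t)).
  have [_ [K hK]] := bf; apply: (@esp_gt0 _ _ _ mu _ (expR (- K)) (expR_gt0 _)) => [t|]; last exact: bm_exp.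
  by rewrite ler_expR; have := hK t; rewrite ler_norml => /andP[].
have c3 : ln (esp mu (fun t => expR (F n t))) @[n --> \oo] --> ln (esp mu (fun t => expR (f t))).
  apply: (cvg_comp _ _ c2); exact: continuous_ln.
have c4 : esp nu (F n) - ln (esp mu (fun t => expR (F n t))) @[n --> \oo] -->
    esp nu f - ln (esp mu (fun t => expR (f t))) by apply: cvgB.
apply: (ler_cvg_to c4 (cvg_cst B)); apply: nearW => n; by have [] := DF n.
Qed.

Section entropy_flow.
Variables (R : realType) (N : nat) (J : R).
Local Notation C := (circle R).
Variables (mN : R -> probability (N.-tuple C) R) (m : R -> probability C R).
Hypotheses (J0 : 0 < J) (N0 : (0 < N)%N).
Hypotheses (mNFP : particle_Fokker_Planck J mN) (mFP : mean_field_Fokker_Planck J m).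

(** An entropy bound in variational form, which can be propagated in time without carrying absolute
    continuity or densities along. *)
Definition entropy_below s X := forall psi : N.-tuple C -> R, bm psi ->
  esp (mN s) psi - ln (esp (tensor_power (m s) N) (fun t => expR (psi t))) <= X.

Lemma entropy_below_flow r c X s0 s1 : r != 0 -> 0 <= s0 -> s0 <= s1 ->
  (forall s, s0 < s < s1 -> modified_log_sobolev J (m s) N r c) ->
  entropy_below s0 X ->
  entropy_below s1 (expR (- r * (s1 - s0)) * X + c / r * (1 - expR (- r * (s1 - s0)))).
Proof.
move=> r0 s00 s01 FI HX; apply: donsker_varadhan_closed => p.
exact: (flow J0 N0 mNFP mFP p r0 s00 s01 FI HX).
Qed.

Lemma entropy_below_early T X t : 0 <= X -> 0 <= t -> t <= T -> entropy_below 0 X ->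
  entropy_below t (expR (8 * J ^+ 2 * T) * (X + 1)).
Proof.
move=> X0 t0 tT HX psi bpsi.
have J2 : 0 < J ^+ 2 by exact: exprn_gt0.
have r0 : - (8 * J ^+ 2) != 0 by rewrite oppr_eq0 gt_eqF// mulr_gt0.
have h := entropy_below_flow r0 (lexx 0) t0
  (fun s _ => modified_log_sobolev_crude (m s) N0 J0) HX bpsi.
apply: (le_trans h); rewrite opprK subr0.
(* With the negative rate of the crude inequality the additive term of the flow equals a quarter of
   [expR (8 * J ^+ 2 * t) - 1], which the [+ 1] of the conclusion absorbs. *)
have -> : 2 * J ^+ 2 / - (8 * J ^+ 2) = - 4^-1 by field; rewrite gt_eqF.
have e1 : expR (8 * J ^+ 2 * t) <= expR (8 * J ^+ 2 * T) by rewrite ler_expR ler_wpM2l// mulr_ge0// ltW.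
have e2 : expR (8 * J ^+ 2 * t) * X <= expR (8 * J ^+ 2 * T) * X by rewrite ler_wpM2r.
have e3 := expR_gt0 (8 * J ^+ 2 * t).
rewrite mulrDr mulr1; lra.
Qed.

Lemma entropy_below_late eta r T X t : 0 < eta -> eta <= 1 / 2 -> J < 2 -> 0 < r ->
  152 * eta <= 2 - J - r -> 0 <= T -> T <= t ->
  (forall s, T <= s -> forall K, \sum_(n < K) n.+1%:R *
    (`|mean m s n.+1%:Z 0| + `|mean m s n.+1%:Z (- (pi / 2))|) <= eta / 2) ->
  let c := J * ((1 + eta / 2) * (4 * (1 + 6 * eta) / eta) + 16 * eta) in
  entropy_below T X -> entropy_below t (expR (- r * (t - T)) * X + c / r).
Proof.
move=> eta0 eta_half J2 r0 re T0 Tt small c HX psi bpsi.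
have rn0 : r != 0 by rewrite gt_eqF.
have FI s : T < s < t -> modified_log_sobolev J (m s) N r c.
  move=> /andP[/ltW Ts _].
  exact: (modified_log_sobolev_near N0 eta0 eta_half (small s Ts) J0 J2 (ltW r0) re).
apply: (le_trans (entropy_below_flow rn0 T0 Tt FI HX bpsi)); rewrite lerD2l.
have c0 : 0 <= c / r.
  apply: divr_ge0; last exact: ltW.
  apply: mulr_ge0; first exact: ltW.
  apply: addr_ge0; last by apply: mulr_ge0 => //; exact: ltW.
  apply: mulr_ge0; first by lra.
  by apply: divr_ge0; [lra|exact: ltW].
by rewrite ler_piMr// gerBl expR_ge0.
Qed.

End entropy_flow.

Theorem proposition11 (R : realType) (J : R) (J_gt0 : 0 < J) (J_lt2 : J < 2) :
  let delta := 1 - J / 2 in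
  let rho := expR (- 2 * J) in
  exists C : R, 0 < C /\
    forall (N : nat), (1 <= N)%N ->
    forall (mN : R -> probability (N.-tuple (circle R)) R)
      (m : R -> probability (circle R) R),
    particle_Fokker_Planck J mN ->
    mean_field_Fokker_Planck J m ->
    forall eps : R, 0 < eps -> eps < 1 ->
    forall t : R, 0 <= t ->
    (relative_entropy (mN t) (tensor_power (m t) N) <=
      (C * expR (- 2 * (1 - eps) * delta * rho * t))%R%:E
        * relative_entropy (mN 0%R) (tensor_power (m 0%R) N)
      + (C / ((1 - eps) * eps))%R%:E)%E.
Proof.
move=> delta rho.
have rho0 : 0 < rho by exact: expR_gt0.
have rho1 : rho < 1 by rewrite expR_lt1 mulNr oppr_lt0 mulr_gt0.
set r := 2 * delta * rho.
(* The required rate is [2 - J] times [rho < 1]; the strict inequality opens the gap that [eta] may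
   use. *)
have rE : r = (2 - J) * rho by rewrite /r /delta; field.
have r0 : 0 < r by rewrite rE mulr_gt0// subr_gt0.
have gap : 0 < 2 - J - r by rewrite rE; nra.
set eta := Num.min (1 / 2) ((2 - J - r) / 152).
have eta0 : 0 < eta by rewrite lt_min !divr_gt0.
have eta_half : eta <= 1 / 2 by rewrite ge_min lexx.
have eta152 : 152 * eta <= 2 - J - r.
  by rewrite mulrC -ler_pdivlMr// ge_min lexx orbT.
(* The density is one plus twice the Fourier sum, so that the bound [eta / 2] on the weighted sum
   keeps the density within [eta] of one. *)
have [T [T4 small]] := mean_small J_gt0 J_lt2 (divr_gt0 eta0 (ltr0Sn _ 1)).
have T0 : 0 <= T by lra.
set G := expR (8 * J ^+ 2 * T).
have G0 : 0 < G by exact: expR_gt0.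
set c := J * ((1 + eta / 2) * (4 * (1 + 6 * eta) / eta) + 16 * eta).
have c0 : 0 <= c / r.
  apply: divr_ge0; last exact: ltW.
  apply: mulr_ge0; first exact: ltW.
  apply: addr_ge0; last by apply: mulr_ge0 => //; exact: ltW.
  apply: mulr_ge0; first by lra.
  by apply: divr_ge0; [lra|exact: ltW].
set E := expR (r * T).
have E0 : 0 < E by exact: expR_gt0.
(* [G] is the growth before time [T], and [E = expR (r * T)] compensates for the decay starting only
   at [T]. The second [G] carries the additive constant of the early bound, and [c / r] the constant
   accumulated afterwards. *)
exists (G * E + G + c / r); split; first by rewrite -addrA ltr_wpDr ?mulr_gt0// addr_ge0// ltW.
set C := G * E + G + c / r => N N0 mN m mNFP mFP eps eps0 eps1 t t0.
have C0 : 0 < C by rewrite /C -addrA ltr_wpDr ?mulr_gt0// addr_ge0// ltW.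
set H0 := relative_entropy (mN 0) _.
set a := C * expR _; have a0 : 0 < a by rewrite mulr_gt0// expR_gt0.
have b1 : C <= C / ((1 - eps) * eps).
  rewrite ler_pdivlMr ?mulr_gt0 ?subr_gt0// ler_piMr ?(ltW C0)//; nra.
have H0_ge0 : (0%:E <= H0)%E.
  have := relative_entropy_ge (mN 0) (tensor_power (m 0) N) (bm_cst _ 0).
  by rewrite expR0 !esp_cst ln1 subr0.
(* If the initial entropy is infinite, so is the right-hand side, as its coefficient is positive. *)
case HE : H0 H0_ge0 => [X| |] H0_ge0 //; last first.
  by rewrite mulry gtr0_sg// mul1e addye// leey.
have X0 : 0 <= X by rewrite -lee_fin.
have below0 : entropy_below mN m 0 X.
  by move=> psi bpsi; rewrite -lee_fin -HE; exact: relative_entropy_ge.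
suff below : entropy_below mN m t (a * X + C / ((1 - eps) * eps)).
  by rewrite -EFinM -EFinD; apply: relative_entropy_le => psi bpsi; exact: below.
have expo : expR (- r * t) <= expR (- 2 * (1 - eps) * delta * rho * t).
  rewrite ler_expR.
  have -> : - 2 * (1 - eps) * delta * rho * t = - r * t + eps * (r * t) by rewrite /r; ring.
  by rewrite lerDl; apply: mulr_ge0; [exact: ltW|apply: mulr_ge0 => //; exact: ltW].
have GE : G * E * expR (- r * t) <= a.
  rewrite /a; apply: (@le_trans _ _ (C * expR (- r * t))); last by rewrite ler_pM2l.
  apply: ler_wpM2r; first exact: expR_ge0.
  by rewrite /C -addrA lerDl; apply: addr_ge0 => //; exact: ltW.
have GEX : G * E * expR (- r * t) * X <= a * X by rewrite ler_wpM2r.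
have GC : G + c / r <= C / ((1 - eps) * eps).
  by apply: le_trans b1; rewrite /C -addrA lerDr; apply: mulr_ge0; exact: ltW.
have [tT|Tt] := leP t T.
  move=> psi bpsi.
  apply: (le_trans (entropy_below_early J_gt0 N0 mNFP mFP X0 t0 tT below0 bpsi)).
  rewrite mulrDr mulr1; apply: lerD; last by apply: le_trans GC; rewrite lerDl.
  apply: le_trans GEX; apply: ler_wpM2r => //.
  rewrite -[G * E * _]mulrA ler_peMr ?(ltW G0)// /E -expRD -[leLHS]expR0 ler_expR.
  have -> : r * T + - r * t = r * (T - t) by ring.
  by apply: mulr_ge0; [exact: ltW|rewrite subr_ge0].
move=> psi bpsi.
have HT := entropy_below_early J_gt0 N0 mNFP mFP X0 T0 (lexx T) below0.
have := entropy_below_late J_gt0 N0 mNFP mFP eta0 eta_half J_lt2 r0 eta152 T0 (ltW Tt) (small m mFP) HT bpsi.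
move/le_trans; apply; rewrite -/G -/c.
have e1 : expR (- r * (t - T)) = E * expR (- r * t) by rewrite /E -expRD; congr expR; ring.
have e2 : expR (- r * (t - T)) <= 1.
  by rewrite expR_le1 mulNr oppr_le0; apply: mulr_ge0; [exact: ltW|rewrite subr_ge0 ltW].
have e3 : expR (- r * (t - T)) * G <= G by rewrite ler_piMl// ltW.
have e4 : expR (- r * (t - T)) * (G * (X + 1)) = G * E * expR (- r * t) * X + expR (- r * (t - T)) * G.
  by rewrite e1; ring.
rewrite e4; move: GEX GC e3.
move: (G * E * expR (- r * t) * X) (expR (- r * (t - T)) * G) (a * X) (C / ((1 - eps) * eps)) (c / r).
by move=> x1 x2 x3 x4 x5 *; lra.
Qed.
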